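(* Let $g\in L^2(\mathbb{R}^d)$ be non-zero, and suppose that $g\in M^\infty_{v_s}(\mathbb{R}^d)$ for some $s>2d$ or that $g\in M^1(\mathbb{R}^d)$. Then: (a) $\mathcal{F}_{\mathrm{full}}(g)$ is an open subset of $\{\Lambda:\operatorname{vol}(\Lambda)<1\}$ and contains a neighborhood of $0$, i.e. there is $\delta_0>0$ such that $A\mathbb{Z}^{2d}\in\mathcal{F}_{\mathrm{full}}(g)$ for every invertible real $2d\times2d$ matrix $A$ with $\|A\|_{op}<\delta_0$. (b) $\mathcal{F}(g)$ is an open subset of $\{(\alpha,\beta)\in\mathbb{R}_+^2:\alpha\beta<1\}$ and contains a neighborhood of $(0,0)$ in $\mathbb{R}_+^2$, i.e. there is $\delta_0>0$ such that $(\alpha,\beta)\in\mathcal{F}(g)$ whenever $0<\alpha,\beta<\delta_0$.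
   Context: For $z=(x,\xi)\in\mathbb{R}^{2d}$ the time-frequency shift is $\pi(z)f(t)=e^{2\pi i\xi\cdot t}f(t-x)$, and the short-time Fourier transform is $V_gf(z)=\langle f,\pi(z)g\rangle$. A lattice is $\Lambda=A\mathbb{Z}^{2d}$ with $A\in GL(2d,\mathbb{R})$, and $\operatorname{vol}(\Lambda)=|\det A|$. The set of lattices carries the topology coming from the generating matrices (quotient topology of $GL(2d,\mathbb{R})$ under $A\mapsto A\mathbb{Z}^{2d}$), so a set of lattices is open iff the set of all $A\in GL(2d,\mathbb{R})$ with $A\mathbb{Z}^{2d}$ in it is open. $\mathbb{R}_+=(0,\infty)$. $\mathcal{G}(g,\Lambda)=\{\pi(\lambda)g:\lambda\in\Lambda\}$ is a frame (for $L^2(\mathbb{R}^d)$) if there are $A,B>0$ with $A\|f\|^2\le\sum_{\lambda\in\Lambda}|\langle f,\pi(\lambda)g\rangle|^2\le B\|f\|^2$ for all $f\in L^2(\mathbb{R}^d)$. Frame sets: $\mathcal{F}_{\mathrm{full}}(g)=\{\Lambda\subseteq\mathbb{R}^{2d}\text{ lattice}:\mathcal{G}(g,\Lambda)\text{ is a frame}\}$ and $\mathcal{F}(g)=\{(\alpha,\beta)\in\mathbb{R}_+^2:\mathcal{G}(g,\alpha\mathbb{Z}^d\times\beta\mathbb{Z}^d)\text{ is a frame}\}$. Function classes (as defined here): $g\in L^2(\mathbb{R}^d)$ belongs to $M^\infty_{v_s}(\mathbb{R}^d)$ if there is $C$ with $|V_gg(z)|\le C(1+|z|)^{-s}$ for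 all $z\in\mathbb{R}^{2d}$; $g$ belongs to $M^1(\mathbb{R}^d)$ if $\int_{\mathbb{R}^{2d}}|\langle g,\pi(z)g\rangle|\,dz<\infty$. *)

(* Defs.v *)
From HB Require Import structures.
From mathcomp Require Import all_boot all_order all_algebra.
From mathcomp Require Import complex.
From mathcomp Require Import all_classical all_reals all_analysis.

Set Implicit Arguments.
Unset Strict Implicit.
Unset Printing Implicit Defensive.

Import Order.TTheory GRing.Theory Num.Theory.
Import numFieldNormedType.Exports.
Import Normc.

Local Open Scope classical_set_scope.
Local Open Scope ring_scope.
Local Open Scope complex_scope.

(* Vectors of R^n are columns. They carry the product (= Borel) sigma-algebra,
   generated by the coordinate maps, as for n.-tuple T. *)
Section measurable_column.
Variables (R : realType) (n : nat).

Let coors : 'I_n -> 'cV[R]_n -> measurableTypeR R := fun i x => x i ord0.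

Let column_set0 : g_sigma_preimage coors set0.
Proof. exact: sigma_algebra0. Qed.

Let column_setC A : g_sigma_preimage coors A -> g_sigma_preimage coors (~` A).
Proof. exact: sigma_algebraC. Qed.

Let column_bigcup (F : _^nat) : (forall i, g_sigma_preimage coors (F i)) ->
  g_sigma_preimage coors (\bigcup_i (F i)).
Proof. exact: sigma_algebra_bigcup. Qed.

HB.instance Definition _ :=
  @isMeasurable.Build (measure_tuple_display default_measure_display)
    'cV[R]_n (g_sigma_preimage coors) column_set0 column_setC column_bigcup.

Lemma measurable_coord (i : 'I_n) :
  measurable_fun [set: 'cV[R]_n] (fun x => x i ord0 : measurableTypeR R).
Proof.
move=> _ Y mY; rewrite setTI; apply: sub_sigma_algebra => /=.
rewrite -bigcup_seq/=; exists i => /=; first by rewrite mem_index_enum.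
by exists Y => //; rewrite setTI.
Qed.

Lemma measurable_fun_coordP d (T : measurableType d) (f : T -> 'cV[R]_n) :
  (forall i, measurable_fun [set: T] (fun t => f t i ord0 : measurableTypeR R)) ->
  measurable_fun [set: T] f.
Proof.
move=> mf.
suff H : g_sigma_preimage (fun i => coors i \o f) `<=` measurable.
  move=> _ A mA; apply: H; rewrite g_sigma_preimage_comp.
  by exists A.
apply: smallest_sub; first exact: sigma_algebra_measurable.
rewrite -bigcup_seq => A [/= i _ [B mB <-]].
exact: mf.
Qed.

End measurable_column.

Section column_lebesgue.
Variable R : realType.

Definition cons_col n (p : measurableTypeR R * 'cV[R]_n) : 'cV[R]_n.+1 :=
  col_mx (const_mx p.1 : 'cV_1) p.2.

Lemma cons_col_0 n (p : measurableTypeR R * 'cV[R]_n) :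
  cons_col p ord0 ord0 = p.1.
Proof.
have -> : ord0 = lshift n (ord0 : 'I_1) :> 'I_(1 + n) by apply/val_inj.
by rewrite [LHS]col_mxEu mxE.
Qed.

Lemma cons_col_lift n (p : measurableTypeR R * 'cV[R]_n) (i : 'I_n) :
  cons_col p (lift ord0 i) ord0 = p.2 i ord0.
Proof.
have -> : lift ord0 i = rshift 1 i by apply/val_inj.
by rewrite [LHS]col_mxEd.
Qed.

Lemma measurable_cons_col n : measurable_fun setT (@cons_col n).
Proof.
apply: measurable_fun_coordP => i; case: (unliftP ord0 i) => [j ->|->].
- under eq_fun do rewrite cons_col_lift.
  exact: (measurableT_comp (measurable_coord j) measurable_snd).
- under eq_fun do rewrite cons_col_0.
  exact: measurable_fst.
Qed.

Definition uncons_col n (x : 'cV[R]_n.+1) : measurableTypeR R * 'cV[R]_n :=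
  (x ord0 ord0, \col_(i < n) x (lift ord0 i) ord0).

Lemma measurable_uncons_col n :
  measurable_fun [set: 'cV[R]_n.+1] (@uncons_col n).
Proof.
apply: measurable_fun_pair; first exact: measurable_coord.
apply: measurable_fun_coordP => i.
under eq_fun do rewrite mxE.
exact: measurable_coord.
Qed.

Lemma cons_colK n (p : measurableTypeR R * 'cV[R]_n) :
  uncons_col (cons_col p) = p.
Proof.
rewrite /uncons_col cons_col_0 [RHS]surjective_pairing; congr pair.
by apply/colP => i; rewrite mxE cons_col_lift.
Qed.

Section step.
Variables (n : nat) (mu : {sigma_finite_measure set 'cV[R]_n -> \bar R}).

Definition cons_lebesgue : set 'cV[R]_n.+1 -> \bar R :=
  pushforward (@lebesgue_measure R \x mu)%E (@cons_col n).

Let prod_lebesgue : {measure set (measurableTypeR R * 'cV[R]_n) -> \bar R} :=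
  (@lebesgue_measure R \x mu)%E.

Let cons_lebesgue0 : cons_lebesgue set0 = 0%E.
Proof. exact: (measure0 prod_lebesgue). Qed.

Let cons_lebesgue_ge0 A : (0 <= cons_lebesgue A)%E.
Proof. exact: (measure_ge0 prod_lebesgue). Qed.

Let cons_lebesgue_sigma_additive : semi_sigma_additive cons_lebesgue.
Proof.
exact: (@measure_semi_sigma_additive _ _ _
  (measure_function_pushforward__canonical__measure_function_Measure
    prod_lebesgue (@measurable_cons_col n))).
Qed.

HB.instance Definition _ := isMeasure.Build _ _ _ cons_lebesgue
  cons_lebesgue0 cons_lebesgue_ge0 cons_lebesgue_sigma_additive.

Lemma cons_lebesgue_sigma_finite : sigma_finite setT cons_lebesgue.
Proof.
have /sigma_finiteP[F [TF ndF Foo]] := sigma_finiteT (@lebesgue_measure R).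
have /sigma_finiteP[G [TG ndG Goo]] := sigma_finiteT mu.
exists (fun k => @uncons_col n @^-1` (F k `*` G k)).
  rewrite -preimage_bigcup (_ : \bigcup_k _ = setT) ?preimage_setT//.
  apply/seteqP; split => // -[x y] _.
  have [k _ Fkx] : (\bigcup_k F k) x by rewrite -TF.
  have [l _ Gly] : (\bigcup_k G k) y by rewrite -TG.
  exists (maxn k l) => //; split => /=.
  - by move: x Fkx; exact/subsetPset/ndF/leq_maxl.
  - by move: y Gly; exact/subsetPset/ndG/leq_maxr.
move=> k; have [mF Fk] := Foo k; have [mG Gk] := Goo k; split.
  rewrite -[X in measurable X]setTI.
  by apply: measurable_uncons_col => //; exact: measurableX.
rewrite /cons_lebesgue /pushforward -comp_preimage.
rewrite (_ : _ \o _ = id); last by apply/funext => p /=; exact: cons_colK.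
by rewrite product_measure1E// lte_mul_pinfty// ge0_fin_numE.
Qed.

HB.instance Definition _ :=
  @Measure_isSigmaFinite.Build _ _ _ cons_lebesgue cons_lebesgue_sigma_finite.

End step.

(* Lebesgue measure on R^n: a unit mass at the only point of R^0, and
   lebesgue_measure \x leb n transported to R^(n+1) by cons_col. *)
Fixpoint leb (n : nat) : {sigma_finite_measure set 'cV[R]_n -> \bar R} :=
  match n with
  | 0 => dirac (0 : 'cV[R]_0)
  | m.+1 => cons_lebesgue (leb m)
  end.

Lemma leb_box n (A : 'I_n -> set (measurableTypeR R)) :
  (forall i, measurable (A i)) ->
  leb n [set x | forall i, A i (x i ord0)] =
    (\prod_(i < n) lebesgue_measure (A i))%E.
Proof.
elim: n A => [|n IH] A mA.
  rewrite big_ord0 /= diracE mem_set//; by move=> [].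
rewrite big_ord_recl -IH//= /cons_lebesgue /pushforward.
rewrite (_ : _ @^-1` _ = A ord0 `*`
    [set x : 'cV[R]_n | forall i, A (lift ord0 i) (x i ord0)]); last first.
  apply/seteqP; split => -[a v] /=.
    move=> H; split => [|i]; first by have := H ord0; rewrite cons_col_0.
    by have := H (lift ord0 i); rewrite cons_col_lift.
  move=> [Aa Av] i; case: (unliftP ord0 i) => [j ->|->].
    by rewrite cons_col_lift.
  by rewrite cons_col_0.
rewrite product_measure1E//.
rewrite (_ : [set x | _] = \bigcap_(i in [set: 'I_n])
    ((fun x : 'cV[R]_n => x i ord0 : measurableTypeR R) @^-1` A (lift ord0 i))).
  apply: fin_bigcap_measurable => // i _.
  by rewrite -[X in measurable X]setTI; exact: measurable_coord.
by apply/seteqP; split => x /= H i; [move=> _|]; apply: H.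
Qed.

End column_lebesgue.

Section euclidean.
Variables (R : realType) (n : nat).

Definition dotv (x y : 'cV[R]_n) : R := \sum_i x i ord0 * y i ord0.

(* The library's norm of a matrix is the maximum of its entries. *)
Definition enorm (x : 'cV[R]_n) : R := Num.sqrt (dotv x x).

Definition opnorm (A : 'M[R]_n) : R :=
  sup [set enorm (A *m x) | x in [set x | enorm x <= 1]].

End euclidean.

Section lattices.
Variables (R : realType) (n : nat).

Definition lattice (A : 'M[R]_n) : set 'cV[R]_n :=
  [set A *m map_mx intr k | k in [set: 'cV[int]_n]].

Definition is_lattice (L : set 'cV[R]_n) : Prop :=
  exists2 A : 'M[R]_n, A \in unitmx & L = lattice A.

Definition vol (L : set 'cV[R]_n) : R :=
  xget 0 [set `|\det A| | A in [set A : 'M[R]_n | A \in unitmx /\ L = lattice A]].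

Lemma vol_lattice (A : 'M[R]_n) : A \in unitmx -> vol (lattice A) = `|\det A|.
Proof.
have sub (B C : 'M[R]_n) : lattice B `<=` lattice C ->
    exists K : 'M[int]_n, B = C *m map_mx intr K.
  move=> BC.
  have /choice[f fP] : forall j, exists k : 'cV[int]_n,
      C *m map_mx intr k = col j B.
    move=> j; have [|k _ <-] := BC (col j B); last by exists k.
    exists (col j 1%:M) => //.
    by rewrite map_col map_mx1 !colE mul1mx.
  exists (\matrix_(i, j) f j i ord0); apply/matrixP => i j.
  have /colP/(_ i) := fP j; rewrite [RHS]mxE => <-; rewrite !mxE.
  by apply: eq_bigr => l _; rewrite !mxE.
move=> Au; rewrite /vol; case: xgetP => [_ -> [B [Bu AB] <-]|/(_ `|\det A|) []].
  2: by exists A.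
have [K AK] : exists K : 'M[int]_n, A = B *m map_mx intr K.
  by apply: sub; rewrite AB.
have [K' BK] : exists K : 'M[int]_n, B = A *m map_mx intr K.
  by apply: sub; rewrite -AB.
have dB : \det A != 0 by rewrite -unitfE.
have e1 : \det A = \det B * (\det K)%:~R by rewrite {1}AK det_mulmx det_map_mx.
have e2 : \det B = \det A * (\det K')%:~R by rewrite {1}BK det_mulmx det_map_mx.
have KK : \det K' * \det K = 1.
  apply: (@intr_inj R); rewrite intrM.
  by apply: (mulfI dB); rewrite mulrA -e2 -e1 mulr1.
have /eqP : `|\det K'|%N = 1%N.
  have /(congr1 absz) := KK; rewrite abszM => /eqP.
  by rewrite muln_eq1 => /andP[/eqP].
rewrite e2 normrM -intr_norm -abszE => /eqP ->.
by rewrite mulr1.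
Qed.

(* The quotient topology of GL(n, R), which is open in 'M[R]_n. *)
Definition open_lattices (S : set (set 'cV[R]_n)) : Prop :=
  open [set A : 'M[R]_n | A \in unitmx /\ S (lattice A)].

End lattices.

Section gabor.
Variables (R : realType) (d : nat).
Implicit Types (f g h : 'cV[R]_d -> R[i]) (z : 'cV[R]_(d + d)).

Definition L2norm f : \bar R := ('N[leb R d]_(2%:E) [EFin \o (@normc R \o f)])%E.

(* Square-integrable functions, not their classes modulo a.e. equality. *)
Definition in_L2 f : Prop :=
  [/\ measurable_fun setT (fun t => complex.Re (f t)),
      measurable_fun setT (fun t => complex.Im (f t)) & (L2norm f < +oo)%E].

Definition inner f h : R[i] :=
  (\int[leb R d]_t complex.Re (f t * conjc (h t))) +i*
  (\int[leb R d]_t complex.Im (f t * conjc (h t))).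

(* z = (x, xi) is a column of height d + d, with x on top. *)
Definition tfshift z f : 'cV[R]_d -> R[i] := fun t =>
  let x := usubmx z in let xi := dsubmx z in
  let theta := 2 * pi * dotv xi t in
  (cos theta +i* sin theta) * f (t - x).

Definition stft g f z : R[i] := inner f (tfshift z g).

Definition in_Minfty (s : R) g : Prop :=
  exists C : R, forall z, normc (stft g g z) <= C * (1 + enorm z) `^ (- s).

Definition in_M1 g : Prop :=
  (\int[leb R (d + d)]_z (normc (inner g (tfshift z g)))%:E < +oo)%E.

Definition gabor_frame g (L : set 'cV[R]_(d + d)) : Prop :=
  exists A B : R, [/\ 0 < A, 0 < B & forall f, in_L2 f ->
    (A%:E * L2norm f ^+ 2 <=
       \esum_(z in L) (normc (inner f (tfshift z g)) ^+ 2)%:E <=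
     B%:E * L2norm f ^+ 2)%E].

Definition frame_set_full g : set (set 'cV[R]_(d + d)) :=
  [set L | is_lattice L /\ gabor_frame g L].

Definition separable_lattice (alpha beta : R) : set 'cV[R]_(d + d) :=
  [set z | exists k l : 'cV[int]_d,
    z = col_mx (alpha *: map_mx intr k) (beta *: map_mx intr l)].

Definition frame_set g : set (R * R) :=
  [set p | [/\ 0 < p.1, 0 < p.2 & gabor_frame g (separable_lattice p.1 p.2)]].

End gabor.

(* Main.v *)
Require Import Defs.
From HB Require Import structures.
From mathcomp Require Import all_boot all_order all_algebra.
From mathcomp Require Import complex.
From mathcomp Require Import all_classical all_reals all_analysis.
From mathcomp Require Import measurable_realfun.
From mathcomp Require Import zify ring lra.

Set Implicit Arguments.
Unset Strict Implicit.
Unset Printing Implicit Defensive.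

Import Order.TTheory GRing.Theory Num.Theory.
Import numFieldNormedType.Exports.
Import Normc.

Local Open Scope classical_set_scope.
Local Open Scope ring_scope.
Local Open Scope complex_scope.


(** One property of the window drives everything: the kernel [|<g, pi(z) g>|] is dominated on unit
    cells by a summable sequence ([majorized]). Decay of order [s > 2d] makes the kernel integrable
    ([Minfty_M1]). An integrable kernel [k] is majorized because Moyal's relation yields the
    reproducing inequality [k z * k u <= \int k w * k (w + u - z) dw] ([moyal_le]), which is
    averaged over [u] near 0 ([kernel_majorant]). By the Schur test a majorized window satisfies the
    upper frame inequality for every lattice, so only the lower one is at stake; [lower_frame]
    phrases it with finite sums and [gabor_frameP] ties it to frames.

    Openness ([lower_frame_open]) is delicate because two close lattices drift apart at infinity:
    [A k] and [A' k] differ by an amount proportional to [k]. A vector [f] is first replaced by a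
    nearly exact expansion over a fine cubic lattice ([near_tight], [truncated_close]), and the
    coefficients are multiplied by tents of large scale [rho], which cuts [f] into pieces. The lower
    inequality is invariant under translating the lattice, so for each piece the lattice of [A] is
    moved until it matches that of [A'] near the piece. There the displacement is small and strong
    continuity of the shifts controls the error; far away the tails of the kernel do. The tents
    overlap boundedly and one of them is at least 1/2 at each sample point, so the inequalities for
    the pieces add up to one for [f].

    Near tightness of fine cubic lattices comes from the relation
    [\int |<f, pi(z) g>|^2 dz = |f|^2 |g|^2] ([stft_orthogonality]), whose left side is compared
    with its Riemann sums uniformly in [f] ([difference_bessel], [L2_near_tight]). The relation
    itself is obtained by damping the frequency integral with an exponential weight, whose Fourier
    transform is a Poisson kernel, that is, an approximate identity.

    For small [A], rounding [eps A^-1] to an integer matrix [K] makes [A K] close to [eps I]. The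
    lower inequality holds there by openness and passes from the sublattice to the lattice of [A]
    ([lower_frame_small]).

    For the volume ([lower_frame_det]), if [|det A| >= 1] then openness permits a rational matrix of
    determinant larger than 1. Smith normal form then gives a frame lattice having common periods
    with the integer lattice, along which the shifts of the indicator of the unit cube are
    orthonormal. Periodicity turns the approximation of finitely many of these shifts by finite
    combinations of frame vectors into a uniform one, so that a large box has more orthonormal
    vectors than there are frame vectors nearly spanning them, against [dimension_count].

    Part (b) is the restriction to block-diagonal matrices [sep_mx], whose determinant is
    [(alpha beta)^d]. *)

(** * Modulus of complex numbers *)

Section complex_modulus.
Variable R : realType.
Implicit Types z w : R[i].

Lemma sqr_normcE z : normc z ^+ 2 = complex.Re z ^+ 2 + complex.Im z ^+ 2.
Proof. by case: z => a b /=; rewrite sqr_sqrtr// addr_ge0// sqr_ge0. Qed.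

Lemma normc_ge0 z : 0 <= normc z.
Proof. by case: z => a b; exact: sqrtr_ge0. Qed.

Lemma normc_conj z : normc (conjc z) = normc z.
Proof. by case: z => a b /=; rewrite sqrrN. Qed.

Lemma conjcM z w : conjc (z * w) = conjc z * conjc w.
Proof. exact: rmorphM. Qed.

Lemma mulcJE z : z * conjc z = (normc z ^+ 2)%:C.
Proof.
rewrite sqr_normcE; case: z => a b /=.
by apply/eqP; rewrite eq_complex /=; apply/andP; split; apply/eqP; ring.
Qed.

Lemma normc_real (x : R) : normc x%:C = `|x|.
Proof. by rewrite /= expr0n addr0 sqrtr_sqr. Qed.

Lemma ler_normc_sum I (s : seq I) (F : I -> R[i]) :
  normc (\sum_(i <- s) F i) <= \sum_(i <- s) normc (F i).
Proof.
elim/big_rec2: _ => [|i y x _ h]; first by rewrite normc0.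
by apply: le_trans (le_normcD _ _) _; rewrite lerD2l.
Qed.

Lemma normcB z w : normc (z - w) = normc (w - z).
Proof. by rewrite -normcN opprB. Qed.

Lemma sqr_normc_le2 z w : normc z ^+ 2 <= 2 * normc w ^+ 2 + 2 * normc (z - w) ^+ 2.
Proof.
have : normc z <= normc w + normc (z - w).
  by apply: le_trans (le_normcD _ _); rewrite addrC subrK.
have := normc_ge0 z; have := normc_ge0 w; have := normc_ge0 (z - w).
move: (normc z) (normc w) (normc (z - w)) => a b c c0 b0 a0 abc.
apply: (@le_trans _ _ ((b + c) ^+ 2)); first by rewrite lerXn2r ?nnegrE ?addr_ge0.
by have := sqr_ge0 (b - c); lra.
Qed.

(** The defect of the bound is the square [e^-1 * (e * b - c) ^+ 2]. Unlike the constant 2 of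
    [sqr_normc_le2], the factor [1 + e] of the main term can approach 1, as near tightness
    requires. *)
Lemma sqr_normc_le_eps z w (e : R) : 0 < e ->
  normc z ^+ 2 <= (1 + e) * normc w ^+ 2 + (1 + e^-1) * normc (z - w) ^+ 2.
Proof.
move=> e0.
have : normc z <= normc w + normc (z - w).
  by apply: le_trans (le_normcD _ _); rewrite addrC subrK.
have := normc_ge0 z; have := normc_ge0 w; have := normc_ge0 (z - w).
move: (normc z) (normc w) (normc (z - w)) => a b c c0 b0 a0 abc.
apply: (@le_trans _ _ ((b + c) ^+ 2)); first by rewrite lerXn2r ?nnegrE ?addr_ge0.
rewrite -subr_ge0.
have -> : (1 + e) * b ^+ 2 + (1 + e^-1) * c ^+ 2 - (b + c) ^+ 2 =
   e^-1 * (e * b - c) ^+ 2 by field; rewrite gt_eqF.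
by rewrite mulr_ge0 ?sqr_ge0// invr_ge0 ltW.
Qed.

Lemma Re_mulc z w :
  complex.Re (z * w) = complex.Re z * complex.Re w - complex.Im z * complex.Im w.
Proof. by case: z w => [a b] [a' b']. Qed.

Lemma Im_mulc z w :
  complex.Im (z * w) = complex.Re z * complex.Im w + complex.Im z * complex.Re w.
Proof. by case: z w => [a b] [a' b'] /=; rewrite addrC. Qed.

Lemma Re_conjc z : complex.Re (conjc z) = complex.Re z.
Proof. by case: z. Qed.

Lemma Im_conjc z : complex.Im (conjc z) = - complex.Im z.
Proof. by case: z. Qed.

Lemma ler_Re_normc z : `|complex.Re z| <= normc z.
Proof.
rewrite -(@ler_pXn2r _ 2) ?nnegrE ?normc_ge0// sqr_normcE real_normK ?num_real//.
by rewrite lerDl sqr_ge0.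
Qed.

Lemma ler_Im_normc z : `|complex.Im z| <= normc z.
Proof.
rewrite -(@ler_pXn2r _ 2) ?nnegrE ?normc_ge0// sqr_normcE real_normK ?num_real//.
by rewrite lerDr sqr_ge0.
Qed.

End complex_modulus.

(** * Finite sums *)

Section finite_sums.
Variable R : realType.

Lemma sum_sub_uniq (I : eqType) (s t : seq I) (F : I -> R) :
  uniq s -> {subset s <= t} -> (forall i, 0 <= F i) ->
  \sum_(i <- s) F i <= \sum_(i <- t) F i.
Proof.
move=> us st F0.
apply: (@le_trans _ _ (\sum_(i <- undup t | i \in s) F i)).
  rewrite -[X in _ <= X]big_filter.
  rewrite (perm_big [seq i <- undup t | i \in s])//=.
  apply: uniq_perm => //; first by rewrite filter_uniq// undup_uniq.
  by move=> i; rewrite mem_filter mem_undup; case: (boolP (i \in s)) => // /st ->.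
apply: (@le_trans _ _ (\sum_(i <- undup t) F i)).
  by rewrite big_mkcond /=; apply: ler_sum => i _; case: ifP.
elim: t {st} => [|a t IH] /=; first by rewrite big_nil.
case: ifP => _; rewrite !big_cons; first by apply: le_trans IH _; rewrite lerDr.
by rewrite lerD2l.
Qed.

Lemma sumr_le_size (I : eqType) (s : seq I) (F : I -> R) (c : R) :
  (forall i, i \in s -> F i <= c) -> \sum_(i <- s) F i <= (size s)%:R * c.
Proof.
move=> h; rewrite mulr_natl.
apply: (@le_trans _ _ (\sum_(i <- s) c)).
  by rewrite !big_seq; apply: ler_sum.
by rewrite big_const_seq count_predT iter_addr_0.
Qed.

(** Cauchy-Schwarz for the weights [k], by Lagrange's identity: twice the defect is the double sum
    of [k i * k j * (y i - y j) ^+ 2]. This is the half step of every Schur test below. *)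
Lemma weighted_schur I (s : seq I) (k y : I -> R) : (forall i, 0 <= k i) ->
  (\sum_(i <- s) k i * y i) ^+ 2 <=
  (\sum_(i <- s) k i) * (\sum_(i <- s) k i * y i ^+ 2).
Proof.
move=> k0; have := @sumr_ge0 _ _ s predT
  (fun i => \sum_(j <- s) k i * k j * (y i - y j) ^+ 2).
have -> : \sum_(i <- s) \sum_(j <- s) k i * k j * (y i - y j) ^+ 2 =
  2 * ((\sum_(i <- s) k i) * (\sum_(i <- s) k i * y i ^+ 2)
    - (\sum_(i <- s) k i * y i) ^+ 2).
  set K := \sum_(i <- s) k i; set Q := \sum_(i <- s) k i * y i ^+ 2.
  set L := \sum_(i <- s) k i * y i.
  transitivity (\sum_(i <- s) (k i * y i ^+ 2 * K - 2 * (k i * y i) * L + k i * Q)).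
    apply: eq_bigr => i _; rewrite /K /L /Q !mulr_sumr -sumrB -big_split /=.
    by apply: eq_bigr => j _; ring.
  rewrite big_split /= sumrB -!mulr_suml -mulr_sumr -/K -/L -/Q; ring.
move=> /(_ _); rewrite pmulr_rge0// subr_ge0; apply => i _.
by apply: sumr_ge0 => j _; apply: mulr_ge0; rewrite ?sqr_ge0// mulr_ge0.
Qed.

End finite_sums.

(** * Integer points, unit cells and counting *)

Section integer_columns.
Variables (R : realType) (n : nat).
Implicit Types (k : 'cV[int]_n) (z : 'cV[R]_n).

Definition intv k : 'cV[R]_n := map_mx intr k.

Lemma intvD k l : intv (k + l) = intv k + intv l.
Proof. exact: map_mxD. Qed.

Lemma intvB k l : intv (k - l) = intv k - intv l.
Proof. exact: map_mxB. Qed.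

Lemma intv_inj : injective intv.
Proof.
by move=> k l /colP h; apply/colP => i; have := h i; rewrite !mxE => /intr_inj.
Qed.

Definition flv z : 'cV[int]_n := map_mx Num.floor z.

Lemma ler_cv_norm z (r : R) : 0 <= r ->
  (`|z| <= r) = [forall i, `|z i ord0| <= r].
Proof.
move=> r0; rewrite [`|z|]mx_normrE; apply/bigmax_leP/forallP => [[_ h] i|h].
  exact: (h (i, ord0)).
by split => //= -[i j] _; rewrite (ord1 j).
Qed.

Lemma cv_norm_coord z i : `|z i ord0| <= `|z|.
Proof. by have := lexx `|z|; rewrite ler_cv_norm// => /forallP. Qed.

Lemma cv_norm_le z (r : R) : 0 <= r -> (forall i, `|z i ord0| <= r) -> `|z| <= r.
Proof. by move=> r0 h; rewrite ler_cv_norm//; apply/forallP. Qed.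

Lemma cv_norm_lt z (r : R) : 0 < r -> (forall i, `|z i ord0| < r) -> `|z| < r.
Proof.
move=> r0 h; have [->//|/mx_norm_neq0[[i j] e]] := eqVneq `|z| 0.
by rewrite [`|z|]e /= (ord1 j).
Qed.

Lemma flv_itv z i : 0 <= (z - intv (flv z)) i ord0 < 1.
Proof.
rewrite !mxE subr_ge0 floor_le /= ltrBlDl.
by have := floorD1_gt (z i ord0); rewrite intrD addrC.
Qed.

Lemma flv_dist z : `|z - intv (flv z)| < 1.
Proof.
apply: cv_norm_lt => // i; have /andP[h0 h1] := flv_itv z i.
by rewrite ger0_norm.
Qed.

Lemma flvP k z : (forall i, 0 <= (z - intv k) i ord0 < 1) -> flv z = k.
Proof.
move=> h; apply/colP => i; rewrite mxE; have := h i; rewrite !mxE => /andP[h0 h1].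
by apply: floor_def; rewrite intrD; apply/andP; split; lra.
Qed.

(* The integer columns with entries in [-b, b]. *)
Definition ibox (b : nat) : seq 'cV[int]_n :=
  [seq map_mx (fun i : 'I_b.*2.+1 => (i : nat)%:Z - b%:Z) v | v <- enum {: 'cV['I_b.*2.+1]_n}].

Lemma size_ibox b : size (ibox b) = (b.*2.+1 ^ n)%N.
Proof. by rewrite size_map -cardE card_mx card_ord muln1. Qed.

Lemma mem_ibox b k : (k \in ibox b) = [forall i, `|k i ord0| <= b%:Z].
Proof.
apply/mapP/forallP => [[v _ ->] i|h].
  rewrite mxE; have := ltn_ord (v i ord0); rewrite ltnS => hv.
  move: (nat_of_ord (v i ord0)) hv => x hx.
  by rewrite ler_norml; apply/andP; split; lia.
exists (\col_i inord (absz (k i ord0 + b%:Z))); first by rewrite mem_enum.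
apply/colP => i; rewrite !mxE; have := h i; rewrite ler_norml => /andP[h1 h2].
have e : (absz (k i ord0 + b%:Z))%:Z = k i ord0 + b%:Z by rewrite gez0_abs//; lia.
rewrite inordK; first by rewrite e addrK.
by rewrite -ltz_nat e; lia.
Qed.

Lemma intv_ibox b k : `|intv k| <= b%:R -> k \in ibox b.
Proof.
rewrite ler_cv_norm// mem_ibox => /forallP h; apply/forallP => i.
have := h i; rewrite mxE -intr_norm -(ler_int R).
by rewrite -[b%:R]/((b%:Z)%:~R).
Qed.

Lemma ibox_intv b k : k \in ibox b -> `|intv k| <= b%:R.
Proof.
rewrite mem_ibox => /forallP h; apply: cv_norm_le => // i.
by rewrite mxE -intr_norm -[b%:R]/((b%:Z)%:~R) ler_int.
Qed.

(* At most (2b+1)^n integer points lie within distance b of one of them. *)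
Lemma uniq_size_close b (s : seq 'cV[int]_n) : uniq s ->
  {in s &, forall k l, `|intv k - intv l| <= b%:R} ->
  (size s <= b.*2.+1 ^ n)%N.
Proof.
case: s => // a s us h; rewrite -size_ibox -(size_map (fun k => k - a)).
apply: uniq_leq_size; first by rewrite map_inj_uniq// => x y /addIr.
move=> _ /mapP[k ks ->]; apply: intv_ibox; rewrite intvB.
by apply: h => //; rewrite inE eqxx.
Qed.

(* m majorizes over unit cells; z has at most N points in each of them. *)
Lemma cell_sum (I : eqType) (s : seq I) (z : I -> 'cV[R]_n) (m : 'cV[int]_n -> R)
    (N : nat) : (forall j, 0 <= m j) ->
  (forall j, (count (fun i => flv (z i) == j) s <= N)%N) ->
  \sum_(i <- s) m (flv (z i)) <=
    N%:R * \sum_(j <- undup [seq flv (z i) | i <- s]) m j.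
Proof.
move=> m0 hN; rewrite -(big_map (fun i => flv (z i)) predT m).
rewrite -[X in X <= _](@big_undup_iterop_count _ _ _ _ _ predT) mulr_sumr.
apply: ler_sum => j _.
rewrite Monoid.iteropE iter_addr_0 mulr_natl; apply: ler_wpMn2l => //.
by rewrite count_map; apply: hN.
Qed.

End integer_columns.

Lemma cauchy_schwarz_sum (R : realType) I (s : seq I) (x y : I -> R) :
  (\sum_(i <- s) x i * y i) ^+ 2 <=
  (\sum_(i <- s) x i ^+ 2) * (\sum_(i <- s) y i ^+ 2).
Proof.
have : 0 <= \sum_(i <- s) \sum_(j <- s) (x i * y j - x j * y i) ^+ 2.
  by apply: sumr_ge0 => i _; apply: sumr_ge0 => j _; exact: sqr_ge0.
have -> : \sum_(i <- s) \sum_(j <- s) (x i * y j - x j * y i) ^+ 2 =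
  2 * ((\sum_(i <- s) x i ^+ 2) * (\sum_(i <- s) y i ^+ 2)
    - (\sum_(i <- s) x i * y i) ^+ 2).
  set X := \sum_(i <- s) x i ^+ 2; set Y := \sum_(i <- s) y i ^+ 2.
  set L := \sum_(i <- s) x i * y i.
  transitivity (\sum_(i <- s) (x i ^+ 2 * Y - 2 * (x i * y i) * L + y i ^+ 2 * X)).
    apply: eq_bigr => i _; rewrite /X /L /Y !mulr_sumr -sumrB -big_split /=.
    by apply: eq_bigr => j _; ring.
  rewrite big_split /= sumrB -!mulr_suml -mulr_sumr -/X -/L -/Y; ring.
by rewrite pmulr_rge0// subr_ge0.
Qed.

(* A projective unitary representation of R^n on a semi-inner product space. *)
Record tfsys (R : realType) (n : nat) := Tfsys {
  tfH :> lmodType R[i];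
  ip : tfH -> tfH -> R[i];
  tf : 'cV[R]_n -> tfH -> tfH;
  ipDl : forall f g h, ip (f + g) h = ip f h + ip g h;
  ipZl : forall c f h, ip (c *: f) h = c * ip f h;
  ipJ : forall f h, ip h f = conjc (ip f h);
  ip_ge0 : forall f, 0 <= complex.Re (ip f f);
  tfD : forall z f h, tf z (f + h) = tf z f + tf z h;
  tfZ : forall z c f, tf z (c *: f) = c *: tf z f;
  tf_iso : forall z f h, ip (tf z f) (tf z h) = ip f h;
  tf_comp : forall z w, exists2 c : R[i], normc c = 1 &
    forall f, tf z (tf w f) = c *: tf (z + w) f }.

(** * Bessel bounds and frame notions in a semi-inner product space *)

Section tfsys_theory.
Variables (R : realType) (n : nat) (S : tfsys R n).
Implicit Types (f g h : tfH S) (z w u : 'cV[R]_n).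

Local Notation "<< f , h >>" := (@ip _ _ S f h) (at level 0, f, h at level 99).
Local Notation "z ~> f" := (@tf _ _ S z f) (at level 35, right associativity).

Definition nsq f : R := complex.Re <<f, f>>.

Lemma nsq_ge0 f : 0 <= nsq f.
Proof. exact: ip_ge0. Qed.

Lemma ip0l h : <<0, h>> = 0.
Proof. by rewrite -(scale0r 0) ipZl mul0r. Qed.

Lemma ipNl f h : <<- f, h>> = - <<f, h>>.
Proof. by rewrite -scaleN1r ipZl mulN1r. Qed.

Lemma ipBl f g h : <<f - g, h>> = <<f, h>> - <<g, h>>.
Proof. by rewrite ipDl ipNl. Qed.

Lemma ipDr f g h : <<f, g + h>> = <<f, g>> + <<f, h>>.
Proof. by rewrite ipJ ipDl rmorphD /= -!ipJ. Qed.

Lemma ipZr c f h : <<f, c *: h>> = conjc c * <<f, h>>.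
Proof. by rewrite ipJ ipZl rmorphM /= -ipJ. Qed.

Lemma ipNr f h : <<f, - h>> = - <<f, h>>.
Proof. by rewrite ipJ ipNl rmorphN /= -ipJ. Qed.

Lemma ipBr f g h : <<f, g - h>> = <<f, g>> - <<f, h>>.
Proof. by rewrite ipDr ipNr. Qed.

Lemma ip0r h : <<h, 0>> = 0.
Proof. by rewrite ipJ ip0l rmorph0. Qed.

Lemma ip_suml I (s : seq I) (F : I -> S) h :
  <<\sum_(i <- s) F i, h>> = \sum_(i <- s) <<F i, h>>.
Proof. by elim/big_rec2: _ => [|i y x _ <-]; rewrite ?ip0l// ipDl. Qed.

Lemma ip_sumr I (s : seq I) (F : I -> S) h :
  <<h, \sum_(i <- s) F i>> = \sum_(i <- s) <<h, F i>>.
Proof. by elim/big_rec2: _ => [|i y x _ <-]; rewrite ?ip0r// ipDr. Qed.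

Lemma ipff f : <<f, f>> = (nsq f)%:C.
Proof.
rewrite /nsq; have := ipJ f f; case: <<f, f>> => a b [] /eqP.
by rewrite -subr_eq0 opprK -mulr2n mulrn_eq0 /= => /eqP ->.
Qed.

Lemma normc_ipC f h : normc <<f, h>> = normc <<h, f>>.
Proof. by rewrite ipJ normc_conj. Qed.

Lemma nsqB f h : nsq (f - h) = nsq f - 2 * complex.Re <<f, h>> + nsq h.
Proof.
rewrite /nsq ipBl !ipBr (ipJ f h).
case: <<f, f>> <<f, h>> <<h, h>> => [a b] [c e] [k l] /=; ring.
Qed.

Lemma nsqZ c f : nsq (c *: f) = normc c ^+ 2 * nsq f.
Proof. by rewrite {1}/nsq ipZl ipZr mulrA mulcJE ipff -rmorphM. Qed.

Lemma nsqN f : nsq (- f) = nsq f.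
Proof. by rewrite /nsq ipNl ipNr opprK. Qed.

Lemma nsqD_le f h : nsq (f + h) <= 2 * nsq f + 2 * nsq h.
Proof.
have := nsq_ge0 (f - h); rewrite nsqB.
have -> : nsq (f + h) = nsq f + 2 * complex.Re <<f, h>> + nsq h.
  by rewrite -{1}(opprK h) nsqB nsqN ipNr raddfN /=; ring.
lra.
Qed.

Lemma ip_cauchy_schwarz f h : normc <<f, h>> ^+ 2 <= nsq f * nsq h.
Proof.
set x := normc <<f, h>> ^+ 2.
have x0 : 0 <= x by rewrite sqr_ge0.
(* This is the squared norm of [f - t <f, h> h], for a free real [t]. *)
have key (t : R) : 0 <= nsq f - 2 * t * x + t ^+ 2 * x * nsq h.
  have := nsq_ge0 (f - (t%:C * <<f, h>>) *: h).
  rewrite nsqB nsqZ ipZr normcM normc_real exprMn real_normK ?num_real// -/x.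
  have -> : conjc (t%:C * <<f, h>>) * <<f, h>> = (t * x)%:C.
    by rewrite conjcM -mulrA (mulrC (conjc <<f, h>>)) mulcJE -/x conjc_real -rmorphM.
  by rewrite /= mulrA.
have f0 := nsq_ge0 f; have h0 := nsq_ge0 h.
have [->|xn0] := eqVneq x 0; first by rewrite mulr_ge0.
have {xn0}x0 : 0 < x by rewrite lt_neqAle eq_sym xn0.
(* The form is only semidefinite, so [nsq h = 0] does not mean [h = 0]; the quadratic term then
   disappears and a large [t] contradicts [key]. *)
have [e|hn0] := eqVneq (nsq h) 0.
  have := key ((nsq f + 1) / (2 * x)); rewrite e mulr0 addr0.
  suff -> : 2 * ((nsq f + 1) / (2 * x)) * x = nsq f + 1 by lra.
  by field; rewrite gt_eqF.
have {hn0}h0 : 0 < nsq h by rewrite lt_neqAle eq_sym hn0.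
have := key (nsq h)^-1.
have -> : nsq f - 2 * (nsq h)^-1 * x + (nsq h)^-1 ^+ 2 * x * nsq h =
  nsq f - x / nsq h by field; rewrite gt_eqF.
by rewrite subr_ge0 ler_pdivrMr.
Qed.

Lemma nsq_tf z f : nsq (z ~> f) = nsq f.
Proof. by rewrite /nsq tf_iso. Qed.

Lemma tfN z f : z ~> - f = - (z ~> f).
Proof. by rewrite -scaleN1r tfZ scaleN1r. Qed.

Lemma tfB z f h : z ~> (f - h) = z ~> f - z ~> h.
Proof. by rewrite tfD tfN. Qed.

Lemma tf_normc_comp f z w h :
  normc <<f, z ~> (w ~> h)>> = normc <<f, (z + w) ~> h>>.
Proof.
by have [c c1 ->] := tf_comp S z w; rewrite ipZr normcM normc_conj c1 mul1r.
Qed.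

Lemma tf_normc_shift z f w h :
  normc <<z ~> f, w ~> h>> = normc <<f, (w - z) ~> h>>.
Proof.
rewrite -[in RHS](tf_iso z) tf_normc_comp; congr (normc <<_, _ ~> _>>).
by rewrite addrC subrK.
Qed.

Lemma tf_normc_tf f z w h :
  normc <<(- z) ~> f, w ~> h>> = normc <<f, (w + z) ~> h>>.
Proof. by rewrite tf_normc_shift opprK. Qed.

Section bessel.
Variables (I : Type) (s : seq I) (v : I -> S) (B : R).

(** Schur test for the Gram matrix. Let [g] be the sum of the [<f, v i> v i]. Then [<f, g>] is the
    sum [X] to be bounded, and the row sums give [nsq g <= B * X] by symmetry and
    [2 |a| |b| <= |a|^2 + |b|^2]. Cauchy-Schwarz now reads [X^2 <= nsq f * B * X]. *)
Lemma gram_bessel f : 0 <= B ->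
  (forall i, \sum_(j <- s) normc <<v i, v j>> <= B) ->
  \sum_(i <- s) normc <<f, v i>> ^+ 2 <= B * nsq f.
Proof.
move=> B0 hB; set X := \sum_(i <- s) _.
have X0 : 0 <= X by apply: sumr_ge0 => i _; rewrite sqr_ge0.
pose a i := <<f, v i>>; pose g := \sum_(i <- s) a i *: v i.
have fg : <<f, g>> = X%:C.
  rewrite ip_sumr rmorph_sum; apply: eq_bigr => i _.
  by rewrite ipZr mulrC mulcJE.
have gB : nsq g <= B * X.
  have -> : nsq g = \sum_(i <- s) \sum_(j <- s)
      complex.Re (a i * conjc (a j) * <<v i, v j>>).
    rewrite /nsq {1}/g ip_suml raddf_sum; apply: eq_bigr => i _.
    rewrite ipZl /g ip_sumr mulr_sumr raddf_sum; apply: eq_bigr => j _.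
    by rewrite ipZr mulrA.
  apply: (@le_trans _ _ (\sum_(i <- s) \sum_(j <- s)
    ((normc (a i) ^+ 2 + normc (a j) ^+ 2) / 2 * normc <<v i, v j>>))).
    apply: ler_sum => i _; apply: ler_sum => j _.
    apply: le_trans (ler_norm _) _; apply: le_trans (ler_Re_normc _) _.
    rewrite !normcM normc_conj ler_wpM2r ?normc_ge0//.
    rewrite ler_pdivlMr//; have := sqr_ge0 (normc (a i) - normc (a j)); lra.
  have e : \sum_(i <- s) \sum_(j <- s) (normc (a j) ^+ 2 * normc <<v i, v j>>) =
      \sum_(i <- s) normc (a i) ^+ 2 * \sum_(j <- s) normc <<v i, v j>>.
    rewrite exchange_big /=; apply: eq_bigr => j _; rewrite mulr_sumr.
    by apply: eq_bigr => i _; rewrite normc_ipC.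
  have -> : \sum_(i <- s) \sum_(j <- s)
    ((normc (a i) ^+ 2 + normc (a j) ^+ 2) / 2 * normc <<v i, v j>>) =
      \sum_(i <- s) normc (a i) ^+ 2 * \sum_(j <- s) normc <<v i, v j>>.
    transitivity (2^-1 * (\sum_(i <- s) \sum_(j <- s) (normc (a i) ^+ 2 * normc <<v i, v j>>)
        + \sum_(i <- s) \sum_(j <- s) (normc (a j) ^+ 2 * normc <<v i, v j>>))).
      rewrite -big_split mulr_sumr; apply: eq_bigr => i _ /=.
      rewrite -big_split mulr_sumr; apply: eq_bigr => j _ /=.
      by ring.
    rewrite e; set Y := \sum_(i <- s) _ * _.
    have -> : \sum_(i <- s) \sum_(j <- s) (normc (a i) ^+ 2 * normc <<v i, v j>>) = Y.
      by apply: eq_bigr => i _; rewrite mulr_sumr.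
    by field.
  rewrite mulr_sumr; apply: ler_sum => i _.
  by rewrite mulrC ler_wpM2r ?sqr_ge0.
have := ip_cauchy_schwarz f g; rewrite fg normc_real real_normK ?num_real// => h.
have [->|Xn0] := eqVneq X 0; first by rewrite mulr_ge0 ?nsq_ge0.
have {Xn0}X0 : 0 < X by rewrite lt_neqAle eq_sym Xn0.
rewrite -(ler_pM2r X0) -expr2; apply: le_trans h _.
by rewrite mulrAC mulrC ler_wpM2r ?nsq_ge0.
Qed.

(** Duality with the analysis bound: [nsq g] is the pairing of [b] with the coefficients of [g]
    itself, so its square is at most [Y * (B * nsq g)]. *)
Lemma bessel_synthesis (b : I -> R[i]) : 0 <= B ->
  (forall f, \sum_(i <- s) normc <<f, v i>> ^+ 2 <= B * nsq f) ->
  nsq (\sum_(i <- s) b i *: v i) <= B * \sum_(i <- s) normc (b i) ^+ 2.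
Proof.
move=> B0 hB; set g := \sum_(i <- s) _; set Y := \sum_(i <- s) _.
have Y0 : 0 <= Y by apply: sumr_ge0 => i _; rewrite sqr_ge0.
have N0 := nsq_ge0 g.
have h1 : nsq g <= \sum_(i <- s) normc (b i) * normc <<g, v i>>.
  rewrite {1}/nsq {1}/g ip_suml raddf_sum; apply: ler_sum => i _.
  apply: le_trans (ler_norm _) _; apply: le_trans (ler_Re_normc _) _.
  by rewrite ipZl normcM normc_ipC.
have h2 : nsq g ^+ 2 <= Y * (B * nsq g).
  apply: (@le_trans _ _ ((\sum_(i <- s) normc (b i) * normc <<g, v i>>) ^+ 2)).
    rewrite lerXn2r ?nnegrE//.
    by apply: sumr_ge0 => i _; rewrite mulr_ge0 ?normc_ge0.
  apply: le_trans (cauchy_schwarz_sum _ _ _) _.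
  by rewrite ler_wpM2l.
have [gn0|] := ltP 0 (nsq g).
  by rewrite -(ler_pM2r gn0) -expr2; apply: le_trans h2 _; rewrite mulrA (mulrC Y).
by move=> g0; apply: le_trans g0 _; rewrite mulr_ge0.
Qed.

End bessel.

Definition tf_continuous f := forall e : R, 0 < e -> exists2 dl : R, 0 < dl &
  forall u, `|u| < dl -> nsq (u ~> f - f) < e.

Lemma tf_continuousD f h : tf_continuous f -> tf_continuous h -> tf_continuous (f + h).
Proof.
move=> cf ch e e0; have e4 : 0 < e / 4 by rewrite divr_gt0.
have [d1 d10 h1] := cf _ e4; have [d2 d20 h2] := ch _ e4.
exists (Num.min d1 d2); first by rewrite lt_min d10.
move=> u; rewrite lt_min => /andP[/h1 {}h1 /h2 {}h2].
by rewrite tfD opprD addrACA; apply: le_lt_trans (nsqD_le _ _) _; lra.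
Qed.

Lemma tf_continuousZ c f : tf_continuous f -> tf_continuous (c *: f).
Proof.
move=> cf e e0.
have c1 : 0 < normc c ^+ 2 + 1 by rewrite ltr_wpDl// sqr_ge0.
have [dl dl0 h] := cf _ (divr_gt0 e0 c1).
exists dl => // u /h {}h; rewrite tfZ -scalerBr nsqZ.
move: h; rewrite ltr_pdivlMr// mulrDr mulr1 mulrC; apply: le_lt_trans.
by rewrite lerDl nsq_ge0.
Qed.

(** Three-epsilon argument: the shifts are isometric, so the error of approximating [f] by [h] is
    the same before and after shifting. The fraction [e / 16] absorbs the factors of two uses of
    [nsqD_le]. *)
Lemma tf_continuous_lim f :
  (forall e : R, 0 < e -> exists2 h, tf_continuous h & nsq (f - h) < e) -> tf_continuous f.
Proof.
move=> lim e e0; have e8 : 0 < e / 16 by rewrite divr_gt0.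
have [h ch fh] := lim _ e8; have [dl dl0 hdl] := ch _ e8.
exists dl => // u /hdl hu.
have -> : u ~> f - f = u ~> (f - h) + ((u ~> h - h) - (f - h)).
  by rewrite tfB -!addrA addKr opprB addKr.
apply: le_lt_trans (nsqD_le _ _) _; rewrite nsq_tf.
have := nsqD_le (u ~> h - h) (- (f - h)); rewrite nsqN; lra.
Qed.

(** The finite set depends on [f] but [a] does not. Any constant below a genuine lower frame bound
    has this form for [nsq f > 0], which keeps infinite series out of the perturbation argument. *)
Definition lower_frame g (A : 'M[R]_n) (a : R) := forall f,
  exists2 s : seq 'cV[int]_n, uniq s &
    a * nsq f <= \sum_(k <- s) normc <<f, (A *m intv R k) ~> g>> ^+ 2.

(** The kernel lies in the Wiener amalgam space of local sup and global [l^1] type: [m] bounds it on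
    unit cells, and the bound [M] on all finite sums expresses summability. *)
Definition majorized g (m : 'cV[int]_n -> R) (M : R) :=
  [/\ forall j, 0 <= m j, forall s, uniq s -> \sum_(j <- s) m j <= M &
      forall z, normc <<g, z ~> g>> <= m (flv z)].

(* The frame operator of a fine cubic lattice, normalized by t, is nearly the identity. *)
Definition near_tight g := forall eta : R, 0 < eta -> exists eps t : R,
  [/\ 0 < eps, 0 < t,
    forall f s, uniq s ->
      t * (\sum_(k <- s) normc <<f, (eps%:M *m intv R k) ~> g>> ^+ 2) <= (1 + eta) * nsq f &
    forall f, exists2 s, uniq s &
      (1 - eta) * nsq f <= t * (\sum_(k <- s) normc <<f, (eps%:M *m intv R k) ~> g>> ^+ 2)].

End tfsys_theory.

(** * Separation of lattice points under perturbation of the matrix *)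

Section separation.
Variables (R : realType) (n : nat).
Implicit Types (A : 'M[R]_n) (v : 'cV[R]_n).

(** A quantitative form of invertibility. The constant is a natural number because it becomes a
    count: a unit cell meets the lattice in at most [(2 N + 1)^n] points. *)
Definition spaced A (N : nat) := forall v, `|v| <= N%:R * `|A *m v|.

Lemma spaced_mono A N N' : (N <= N')%N -> spaced A N -> spaced A N'.
Proof. by move=> le h v; apply: le_trans (h v) _; rewrite ler_wpM2r// ler_nat. Qed.

Lemma spacedN A N : spaced A N -> spaced (- A) N.
Proof. by move=> h v; rewrite mulNmx normrN; exact: h. Qed.

Lemma mulmx_norm A v : `|A *m v| <= n%:R * `|A| * `|v|.
Proof.
apply: cv_norm_le => [|i]; first by rewrite !mulr_ge0.
rewrite mxE; apply: le_trans (ler_norm_sum _ _ _) _.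
apply: (@le_trans _ _ (\sum_(j < n) `|A| * `|v|)).
  apply: ler_sum => j _; rewrite normrM ler_pM//; last exact: cv_norm_coord.
  by rewrite [`|A|]mx_normrE (le_bigmax _ (fun ij => `|A ij.1 ij.2|) (i, j)).
by rewrite sumr_const card_ord -[leLHS]mulr_natl mulrA.
Qed.

Lemma spaced_unit A N : spaced A N -> A \in unitmx.
Proof.
move=> h; rewrite -unitmx_tr -row_free_unit -kermx_eq0.
apply/eqP/row_matrixP => i; rewrite row0.
have : row i (kermx A^T) *m A^T = 0 by rewrite -row_mul mulmx_ker row0.
move=> /(congr1 trmx); rewrite trmx_mul trmxK trmx0 => e.
have := h (row i (kermx A^T))^T; rewrite e normr0 mulr0 normr_le0 => /eqP e'.
by apply: trmx_inj; rewrite e' trmx0.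
Qed.

Lemma unit_spaced A : A \in unitmx -> exists2 N, (0 < N)%N & spaced A N.
Proof.
move=> uA; exists (Num.truncn (n%:R * `|invmx A|)).+1 => // v.
rewrite -{1}(mulKmx uA v); apply: le_trans (mulmx_norm _ _) _.
by rewrite ler_wpM2r// ltW// truncnS_gt.
Qed.

(** The error [N n |A' - A| |v|] is at most half of [|v|] and is absorbed on the left, which doubles
    the constant. *)
Lemma spaced_open A N : (0 < N)%N -> spaced A N ->
  forall A', n%:R * `|A' - A| * N%:R <= 2^-1 -> spaced A' (N * 2).
Proof.
move=> N0 h A' close v.
have h1 : `|A *m v| <= `|A' *m v| + n%:R * `|A' - A| * `|v|.
  rewrite -[A in A *m v](subKr A') mulmxBl; apply: le_trans (ler_normB _ _) _.
  by rewrite lerD2l mulmx_norm.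
have h2 := h v.
have h3 : N%:R * `|A *m v| <= N%:R * `|A' *m v| + 2^-1 * `|v|.
  apply: le_trans (ler_wpM2l _ h1) _ => //; rewrite mulrDr lerD2l.
  by rewrite mulrA ler_wpM2r// mulrC.
by rewrite natrM; have := normr_ge0 v; nra.
Qed.

Lemma scalar_spaced (e : R) : 0 < e ->
  exists2 N, (0 < N)%N & spaced e%:M N.
Proof.
move=> e0; apply: unit_spaced.
by rewrite unitmxE det_scalar unitrX// unitfE gt_eqF.
Qed.

End separation.

(** * Sums over lattices, uniformly in the lattice and its translates *)

Section lattice_sums.
Variables (R : realType) (n : nat) (m : 'cV[int]_n -> R) (M : R).
Hypothesis m0 : forall j, 0 <= m j.
Hypothesis mM : forall s, uniq s -> \sum_(j <- s) m j <= M.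

Lemma ibox_sub (s : seq 'cV[int]_n) : exists T, {subset s <= ibox n T}.
Proof.
elim: s => [|k s [T hT]]; first by exists 0%N.
exists (maxn T (\max_i absz (k i ord0))) => j; rewrite inE => /orP[/eqP ->|/hT].
  rewrite mem_ibox; apply/forallP => i.
  have := @leq_bigmax _ (fun i => absz (k i ord0)) i.
  move=> h; rewrite -abszE lez_nat leq_max; apply/orP; right; exact: h.
rewrite !mem_ibox => /forallP h; apply/forallP => i.
by apply: le_trans (h i) _; rewrite lez_nat leq_maxl.
Qed.

(** Some finite sum is within [e] of the supremum; a finite set disjoint from its support can add at
    most [e]. *)
Lemma summable_tail (e : R) : 0 < e -> exists T, forall s, uniq s ->
  {in s, forall j, j \notin ibox n T} -> \sum_(j <- s) m j <= e.
Proof.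
move=> e0; pose E := [set x | exists2 s, uniq s & x = \sum_(j <- s) m j].
have Esup : has_sup E.
  split; first by exists 0; exists [::] => //; rewrite big_nil.
  by exists M => _ [s us ->]; exact: mM.
have [_ [s0 us0 ->] hs0] := sup_adherent e0 Esup.
have [T hT] := ibox_sub s0; exists T => s us out.
have : \sum_(j <- s0 ++ s) m j <= sup E.
  apply: sup_upper_bound => //; exists (s0 ++ s) => //.
  rewrite cat_uniq us0 us andbT /=; apply/hasPn => j js; apply/negP => /hT.
  by apply/negP; exact: out.
by rewrite big_cat /=; lra.
Qed.

Lemma lattice_count (A : 'M[R]_n) N (z0 : 'cV[R]_n) (s : seq 'cV[int]_n) (j : 'cV[int]_n) :
  spaced A N -> uniq s ->
  (count (fun k => flv (z0 + A *m intv R k) == j) s <= N.*2.+1 ^ n)%N.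
Proof.
move=> sA us; rewrite -size_filter.
apply: (@uniq_size_close R); first by rewrite filter_uniq.
move=> k l; rewrite !mem_filter => /andP[/eqP ek _] /andP[/eqP el _].
rewrite -intvB; apply: le_trans (sA _) _;
rewrite -[leRHS]mulr1 ler_wpM2l// intvB mulmxBr.
apply: cv_norm_le => // i.
have := flv_itv (z0 + A *m intv R k) i; have := flv_itv (z0 + A *m intv R l) i.
rewrite ek el !mxE ler_norml.
set x := \sum_j0 _; set y := \sum_j0 _.
move=> /andP[h1 h2] /andP[h3 h4]; apply/andP; split; lra.
Qed.

Lemma lattice_sum (A : 'M[R]_n) N (z0 : 'cV[R]_n) (s : seq 'cV[int]_n) :
  spaced A N -> uniq s ->
  \sum_(k <- s) m (flv (z0 + A *m intv R k)) <= (N.*2.+1 ^ n)%:R * M.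
Proof.
move=> sA us; apply: le_trans (cell_sum m0 (fun j => lattice_count z0 j sA us)) _.
by rewrite ler_wpM2l// mM// undup_uniq.
Qed.

(** The point is the order of quantifiers: the radius [T] depends on [e] alone, neither on the
    matrix nor on the translate [z0]. *)
Lemma lattice_tail (e : R) : 0 < e -> exists T : nat,
  forall (A : 'M[R]_n) N (z0 : 'cV[R]_n) (s : seq 'cV[int]_n),
  spaced A N -> uniq s -> {in s, forall k, T%:R <= `|z0 + A *m intv R k|} ->
  \sum_(k <- s) m (flv (z0 + A *m intv R k)) <= (N.*2.+1 ^ n)%:R * e.
Proof.
(* The extra 1 pays for the passage from a point to the corner of its unit cell. *)
move=> /summable_tail[T hT]; exists T.+1 => A N z0 s sA us far.
apply: le_trans (cell_sum m0 (fun j => lattice_count z0 j sA us)) _.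
rewrite ler_wpM2l// hT ?undup_uniq// => j; rewrite mem_undup => /mapP[k ks ->].
apply/negP => /(ibox_intv R) h; have := far k ks; apply/negP; rewrite -ltNge.
set z := z0 + _ in h *.
rewrite -[z](subrK (intv R (flv z))); apply: le_lt_trans (ler_normD _ _) _.
by rewrite -natr1 addrC ler_ltD// flv_dist.
Qed.

End lattice_sums.

(** * Tent functions of scale [rho] *)

Section tents.
Variables (R : realType) (n : nat) (rho : R).
Hypothesis rho0 : 0 < rho.
Implicit Types (u : 'cV[int]_n) (z w : 'cV[R]_n).

(** A Lipschitz bump of radius [2 rho] around [rho u]. The tents stand in for a partition of unity:
    they overlap boundedly, vary slowly for large [rho], and one of them is at least 1/2 at every
    point. *)
Definition tent u z : R := Num.max 0 (1 - `|rho^-1 *: z - intv R u| / 2).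

Lemma tent_ge0 u z : 0 <= tent u z.
Proof. by rewrite le_max lexx. Qed.

Lemma tent_le1 u z : tent u z <= 1.
Proof. by rewrite ge_max ler01 gerBl divr_ge0. Qed.

Lemma tent_supp u z : tent u z != 0 -> `|rho^-1 *: z - intv R u| < 2.
Proof.
apply: contra_neqT; rewrite -leNgt => h; apply/max_idPl.
by rewrite subr_le0 ler_pdivlMr// mul1r.
Qed.

Lemma tent_dist u z : tent u z != 0 -> `|z - rho *: intv R u| <= rho * 2.
Proof.
move=> /tent_supp h.
have -> : z - rho *: intv R u = rho *: (rho^-1 *: z - intv R u).
  by rewrite scalerBr scalerA divff ?gt_eqF// scale1r.
by rewrite normrZ gtr0_norm// ler_wpM2l ?ltW.
Qed.

Lemma tent_center z : 2^-1 <= tent (flv (rho^-1 *: z)) z.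
Proof. by rewrite le_max; apply/orP; right; have := flv_dist (rho^-1 *: z); lra. Qed.

Lemma tent_lip u z w : `|tent u z - tent u w| <= `|z - w| / rho.
Proof.
have h : `| `|rho^-1 *: z - intv R u| - `|rho^-1 *: w - intv R u| | <= `|z - w| / rho.
  apply: le_trans (ler_dist_dist _ _) _.
  by rewrite opprB addrA subrK -scalerBr normrZ gtr0_norm ?invr_gt0// mulrC.
move: h; have := normr_ge0 (z - w); rewrite /tent.
have : 0 <= rho^-1 by rewrite invr_ge0 ltW.
move: (`|z - w|) (`|rho^-1 *: z - _|) (`|rho^-1 *: w - _|) => d a b.
move=> r0 d0; have := mulr_ge0 d0 r0; move: (d / rho) => D D0.
rewrite !ler_norml => /andP[h1 h2]; case: (leP 0 (1 - a / 2)) => ha; case: (leP 0 (1 - b / 2)) => hb;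
  apply/andP; split; lra.
Qed.

(** Labels of tents that do not vanish at [z] are within distance 4 of one another, so there are at
    most [(2 * 4 + 1)^n] of them. *)
Lemma tent_sum (U : seq 'cV[int]_n) z (F : 'cV[int]_n -> R) (c : R) : uniq U ->
  0 <= c -> (forall u, 0 <= F u <= c) ->
  \sum_(u <- U | tent u z != 0) F u <= (9 ^ n)%:R * c.
Proof.
move=> uU c0 hF; rewrite -big_filter.
apply: le_trans (sumr_le_size _) _.
  by move=> u _; have /andP[_] := hF u; apply.
rewrite ler_wpM2r// ler_nat -[9%N]/(4.*2.+1)%N.
apply: (@uniq_size_close R); first by rewrite filter_uniq.
move=> u v; rewrite !mem_filter => /andP[/tent_supp hu _] /andP[/tent_supp hv _].
rewrite -(subrKA (rho^-1 *: z)); apply: le_trans (ler_normD _ _) _.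
by rewrite -[`|intv R u - _|]normrN opprB (_ : 4%:R = 2 + 2 :> R) ?lerD// ?ltW// -natrD.
Qed.

Lemma tent_sqr_sum (U : seq 'cV[int]_n) z : uniq U ->
  \sum_(u <- U) tent u z ^+ 2 <= (9 ^ n)%:R.
Proof.
move=> uU; rewrite -[leRHS]mulr1.
apply: le_trans (tent_sum z uU ler01 (F := fun u => tent u z ^+ 2) _).
  rewrite [leRHS]big_mkcond /=; apply: ler_sum => u _.
  by case: eqP => [->|_]; rewrite ?expr0n.
by move=> u; rewrite sqr_ge0 expr_le1 ?tent_le1 ?tent_ge0.
Qed.

(** Only tents alive at [z] or at [w] contribute, each at most [c ^+ 2]. The alternative [c = 1]
    serves distant points, where the Lipschitz bound says nothing but tents still lie in
    [[0, 1]]. *)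
Lemma tent_diff_sum (U : seq 'cV[int]_n) z w (c : R) : uniq U -> 0 <= c <= 1 ->
  (`|z - w| / rho <= c \/ c = 1) ->
  \sum_(u <- U) (tent u z - tent u w) ^+ 2 <= 2 * (9 ^ n)%:R * c ^+ 2.
Proof.
move=> uU /andP[c0 c1] hc.
have hF u : 0 <= (tent u z - tent u w) ^+ 2 <= c ^+ 2.
  rewrite sqr_ge0 /= -real_normK ?num_real// lerXn2r ?nnegrE//.
  case: hc => [hc|->]; first by apply: le_trans (tent_lip _ _ _) hc.
  have := tent_ge0 u z; have := tent_le1 u z; have := tent_ge0 u w; have := tent_le1 u w.
  by rewrite ler_norml => *; apply/andP; split; lra.
apply: (@le_trans _ _ (\sum_(u <- U | tent u z != 0) (tent u z - tent u w) ^+ 2 +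
   \sum_(u <- U | tent u w != 0) (tent u z - tent u w) ^+ 2)).
  rewrite [X in _ <= X + _]big_mkcond [X in _ <= _ + X]big_mkcond -big_split /=.
  apply: ler_sum => u _.
  have := hF u; move: (tent u z) (tent u w) => a b /andP[h _].
  case: eqP => [->|_]; case: eqP => [->|_] /=; rewrite ?subr0 ?add0r ?addr0//.
    by rewrite expr0n.
  by rewrite lerDl.
have h := tent_sum _ uU (sqr_ge0 c) hF.
by apply: le_trans (lerD (h z) (h w)) _; rewrite -mulrA mulr2n mulrDl mul1r.
Qed.

End tents.

(** * Truncated and localized frame expansions *)

Section openness.
Variables (R : realType) (n : nat) (S : tfsys R n) (g : S).
Implicit Types (f h : S) (z w : 'cV[R]_n) (A : 'M[R]_n).

Local Notation "<< f , h >>" := (@ip _ _ S f h) (at level 0, f, h at level 99).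
Local Notation "z ~> f" := (@tf _ _ S z f) (at level 35, right associativity).
Local Notation nsq := (@nsq _ _ S).
Local Notation iv := (@intv R n).

Section truncation.
Variables (I : Type) (s : seq I) (v : I -> S) (t eta : R).
Hypotheses (t0 : 0 < t) (eta01 : 0 < eta <= 1).
Hypothesis upper : forall f,
  t * (\sum_(i <- s) normc <<f, v i>> ^+ 2) <= (1 + eta) * nsq f.

Definition truncated f : S := \sum_(i <- s) (t%:C * <<f, v i>>) *: v i.

(** With [X] the normalized frame sum, [<f, truncated f>] has real part [X] and
    [nsq (truncated f) <= (1 + eta) X]. Hence the error is at most [nsq f - (1 - eta) X], and
    [1 - (1 - eta)^2 <= 2 eta]. *)
Lemma truncated_close f :
  (1 - eta) * nsq f <= t * (\sum_(i <- s) normc <<f, v i>> ^+ 2) ->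
  nsq (f - truncated f) <= 2 * eta * nsq f.
Proof.
move=> lower; have [e0 e1] := andP eta01.
set X := t * _ in lower *.
have Re_fJ : complex.Re <<f, truncated f>> = X.
  rewrite /truncated ip_sumr raddf_sum /X mulr_sumr; apply: eq_bigr => i _.
  by rewrite ipZr conjcM conjc_real -mulrA (mulrC (conjc _)) mulcJE -rmorphM.
have nJ : nsq (truncated f) <= (1 + eta) * X.
  have B0 : 0 <= (1 + eta) / t by rewrite divr_ge0 ?addr_ge0 ?ltW.
  apply: le_trans (bessel_synthesis (fun i => t%:C * <<f, v i>>) B0 _) _.
    by move=> h; rewrite mulrAC ler_pdivlMr// mulrC upper.
  under eq_bigr => i _ do rewrite normcM exprMn normc_real real_normK ?num_real//.
  rewrite -mulr_sumr -mulrA ler_wpM2l//; first by rewrite addr_ge0 ?ltW.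
  by rewrite expr2 mulrA mulrA mulVf ?gt_eqF// mul1r.
rewrite nsqB Re_fJ; have := nsq_ge0 f.
move: (nsq f) (nsq _) X lower nJ {Re_fJ} => F J X lower nJ F0.
nra.
Qed.

End truncation.

Section localization.
Variables (I K L : Type) (J : seq I) (U : seq K) (T : seq L).
Variables (x : I -> 'cV[R]_n) (z : L -> 'cV[R]_n) (chi : K -> 'cV[R]_n -> R).
Variables (c : I -> R[i]) (t B0 th : R).
Hypothesis t0 : 0 < t.
Hypothesis hB0 : forall w, \sum_(j <- J) normc <<g, (w - x j) ~> g>> <= B0.

Definition localized (u : K) : S :=
  \sum_(j <- J) (t%:C * ((chi u (x j))%:C * c j)) *: (x j ~> g).

(** A commutator estimate: localizing the coefficients differs from multiplying the transform by
    [chi u] through the kernel [(chi u (x j) - chi u (z k)) <x j ~> g, z k ~> g>]. Schur's test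
    bounds it, with [B0] for one index and the small [th] for the other. *)
Lemma localized_diff :
  (forall j, \sum_(k <- T) (\sum_(u <- U) (chi u (x j) - chi u (z k)) ^+ 2) *
      normc <<g, (z k - x j) ~> g>> <= th) ->
  \sum_(u <- U) \sum_(k <- T)
     normc (<<localized u, z k ~> g>> - (chi u (z k))%:C *
        <<\sum_(j <- J) (t%:C * c j) *: (x j ~> g), z k ~> g>>) ^+ 2 <=
  t ^+ 2 * B0 * th * \sum_(j <- J) normc (c j) ^+ 2.
Proof.
move=> hth.
pose ker j k := normc <<g, (z k - x j) ~> g>>.
pose d u j k := `|chi u (x j) - chi u (z k)|.
have step u k : normc (<<localized u, z k ~> g>> - (chi u (z k))%:C *
    <<\sum_(j <- J) (t%:C * c j) *: (x j ~> g), z k ~> g>>) ^+ 2 <=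
    t ^+ 2 * B0 * \sum_(j <- J) ker j k * (d u j k * normc (c j)) ^+ 2.
  have -> : <<localized u, z k ~> g>> - (chi u (z k))%:C *
      <<\sum_(j <- J) (t%:C * c j) *: (x j ~> g), z k ~> g>> =
      \sum_(j <- J) t%:C * ((chi u (x j) - chi u (z k))%:C * c j * <<x j ~> g, z k ~> g>>).
    rewrite !ip_suml mulr_sumr -sumrB; apply: eq_bigr => j _.
    by rewrite !ipZl rmorphB; ring.
  rewrite -mulr_sumr normcM normc_real exprMn real_normK ?num_real// -mulrA.
  rewrite ler_wpM2l ?sqr_ge0//.
  apply: (@le_trans _ _ ((\sum_(j <- J) ker j k * (d u j k * normc (c j))) ^+ 2)).
    rewrite lerXn2r ?nnegrE ?normc_ge0//.
      by apply: sumr_ge0 => j _; rewrite !mulr_ge0 ?normc_ge0 ?normr_ge0.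
    apply: le_trans (ler_normc_sum _ _) _; apply: ler_sum => j _.
    by rewrite !normcM normc_real tf_normc_shift mulrC.
  apply: le_trans (weighted_schur _ _ _) _ => [j|]; first exact: normc_ge0.
  rewrite ler_wpM2r ?hB0//.
  by apply: sumr_ge0 => j _; rewrite mulr_ge0 ?normc_ge0 ?sqr_ge0.
apply: (@le_trans _ _ (\sum_(u <- U) \sum_(k <- T)
   t ^+ 2 * B0 * \sum_(j <- J) ker j k * (d u j k * normc (c j)) ^+ 2)).
  by apply: ler_sum => u _; apply: ler_sum => k _.
have B00 : 0 <= B0.
  by apply: le_trans (hB0 0); apply: sumr_ge0 => j _; exact: normc_ge0.
have -> : \sum_(u <- U) \sum_(k <- T)
   t ^+ 2 * B0 * \sum_(j <- J) ker j k * (d u j k * normc (c j)) ^+ 2 =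
  t ^+ 2 * B0 * \sum_(j <- J) normc (c j) ^+ 2 *
    \sum_(k <- T) (\sum_(u <- U) (chi u (x j) - chi u (z k)) ^+ 2) * ker j k.
  under eq_bigr => u _ do rewrite -mulr_sumr exchange_big /=.
  rewrite -mulr_sumr exchange_big /=; congr (_ * _); apply: eq_bigr => j _.
  rewrite exchange_big mulr_sumr /=; apply: eq_bigr => k _.
  rewrite mulr_suml mulr_sumr; apply: eq_bigr => u _.
  by rewrite exprMn /d real_normK ?num_real//; ring.
have tB : 0 <= t ^+ 2 * B0 by apply: mulr_ge0 => //; exact: sqr_ge0.
rewrite -[leRHS]mulrA ler_wpM2l//.
rewrite mulr_sumr; apply: ler_sum => j _.
by rewrite mulrC ler_wpM2r ?sqr_ge0.
Qed.

End localization.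
End openness.

(** * Estimates uniform over lattices with a given separation *)

Section lattice_perturbation.
Variables (R : realType) (n : nat) (S : tfsys R n) (g : S).
Variables (m : 'cV[int]_n -> R) (M : R).
Hypothesis gm : majorized g m M.
Hypothesis gc : tf_continuous g.
Implicit Types (f h : S) (z w : 'cV[R]_n) (A : 'M[R]_n).

Local Notation "<< f , h >>" := (@ip _ _ S f h) (at level 0, f, h at level 99).
Local Notation "z ~> f" := (@tf _ _ S z f) (at level 35, right associativity).
Local Notation nsq := (@nsq _ _ S).
Local Notation iv := (@intv R n).

Let m0 j : 0 <= m j. Proof. by have [] := gm. Qed.

Let mM s : uniq s -> \sum_(j <- s) m j <= M. Proof. by have [_ + _] := gm; apply. Qed.

Lemma majorant_ge0 : 0 <= M.
Proof. by have := @mM [::] isT; rewrite big_nil. Qed.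

Lemma kern_sum A N z0 (s : seq 'cV[int]_n) : spaced A N -> uniq s ->
  \sum_(k <- s) normc <<g, (z0 + A *m iv k) ~> g>> <= (N.*2.+1 ^ n)%:R * M.
Proof.
move=> sA us; apply: le_trans (lattice_sum m0 mM z0 sA us).
by apply: ler_sum => k _; have [_ _] := gm; apply.
Qed.

(** The upper frame inequality, from the Schur test on the Gram matrix; the lattice enters only
    through [N]. *)
Lemma lattice_bessel A N (s : seq 'cV[int]_n) f : spaced A N -> uniq s ->
  \sum_(k <- s) normc <<f, (A *m iv k) ~> g>> ^+ 2 <= (N.*2.+1 ^ n)%:R * M * nsq f.
Proof.
move=> sA us.
apply: (@gram_bessel _ _ _ _ s (fun k => (A *m iv k) ~> g)) => [|k].
  by rewrite mulr_ge0// majorant_ge0.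
apply: le_trans (kern_sum (- (A *m iv k)) sA us).
by apply: ler_sum => l _; rewrite tf_normc_shift addrC.
Qed.

(** Close to [x] the tents hardly vary once [rho] is large; far from [x] the tail of the kernel is
    small. The scale [rho] depends on the matrix only through [N]. *)
Lemma tent_localization N (e : R) : 0 < e -> exists2 rho : R, 0 < rho &
  forall A, spaced A N -> forall (U : seq 'cV[int]_n) (x : 'cV[R]_n)
    (T : seq 'cV[int]_n), uniq U -> uniq T ->
  \sum_(k <- T) (\sum_(u <- U) (tent rho u x - tent rho u (A *m iv k)) ^+ 2) *
      normc <<g, (A *m iv k - x) ~> g>> <= e.
Proof.
move=> e0; set D9 : R := (9 ^ n)%:R; set DN : R := (N.*2.+1 ^ n)%:R.
have D90 : 0 < D9 by rewrite ltr0n expn_gt0.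
have DN0 : 0 < DN by rewrite ltr0n expn_gt0.
have M0 := majorant_ge0.
have e1 : 0 < e / (4 * D9 * DN) by rewrite divr_gt0// !mulr_gt0.
have [T0 hT0] := lattice_tail m0 mM e1.
set K := 2 * D9 * DN * M.
have K0 : 0 <= K by rewrite !mulr_ge0// ltW.
(* Since [c <= 1], the near part is at most [K * c ^+ 2 <= K * c <= e / 2]; the other half of [e]
   goes to the far part. *)
pose c := Num.min 1 (e / (2 * (K + 1))).
have K1 : 0 < 2 * (K + 1) by rewrite mulr_gt0// ltr_wpDl.
have c0 : 0 < c by rewrite lt_min ltr01 divr_gt0.
have c1 : c <= 1 by rewrite ge_min lexx.
have cK : 2 * D9 * c ^+ 2 * (DN * M) <= e / 2.
  have h : c * (2 * (K + 1)) <= e by rewrite -ler_pdivlMr// ge_min lexx orbT.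
  have -> : 2 * D9 * c ^+ 2 * (DN * M) = K * c * c by rewrite /K; ring.
  have : K * c * c <= K * c * 1 by rewrite ler_wpM2l ?mulr_ge0// ltW.
  lra.
have D92 : 0 <= 2 * D9 by rewrite mulr_ge0// ltW.
have D9c : 0 <= 2 * D9 * c ^+ 2 by apply: mulr_ge0 => //; exact: sqr_ge0.
(* At distance at most [T0] the Lipschitz bound is then at most [c]; the successor keeps the scale
   positive when [T0] is 0. *)
exists (T0.+1%:R / c); first by rewrite divr_gt0.
move=> A sA U x T uU uT; set rho := _ / c.
have rho0 : 0 < rho by rewrite divr_gt0.
pose far k := T0%:R <= `|- x + A *m iv k|.
pose mk k := m (flv (- x + A *m iv k)).
apply: (@le_trans _ _ (\sum_(k <- T) (2 * D9 * c ^+ 2 * mk k +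
    (if far k then 2 * D9 * mk k else 0)))).
  apply: ler_sum => k _.
  have km : normc <<g, (A *m iv k - x) ~> g>> <= mk k.
    by have [_ _] := gm; rewrite addrC; apply.
  have kp := normc_ge0 <<g, (A *m iv k - x) ~> g>>.
  have [fk|nfk] := boolP (far k).
    apply: (@le_trans _ _ (2 * D9 * mk k)); last first.
      by rewrite lerDr mulr_ge0// m0.
    apply: ler_pM => //; first by apply: sumr_ge0 => u _; rewrite sqr_ge0.
    have h1 : 0 <= (1 : R) <= 1 by rewrite ler01 lexx.
    have := tent_diff_sum rho0 uU h1 (or_intror erefl : `|x - A *m iv k| / rho <= 1 \/ 1 = 1 :> R).
    by rewrite expr1n mulr1.
  rewrite addr0; apply: ler_pM => //; first by apply: sumr_ge0 => u _; rewrite sqr_ge0.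
  apply: tent_diff_sum => //; first by rewrite c1 ltW.
  left; rewrite ler_pdivrMr// /rho mulrCA divff ?gt_eqF// mulr1.
  move: nfk; rewrite -ltNge addrC -normrN opprB => /ltW h.
  by apply: le_trans h _; rewrite ler_nat.
rewrite big_split /= -mulr_sumr.
have -> : e = e / 2 + 2 * D9 * (DN * (e / (4 * D9 * DN))).
  by field; rewrite !gt_eqF.
apply: lerD.
  by apply: le_trans cK; rewrite ler_wpM2l//; exact: lattice_sum.
rewrite -big_mkcond -mulr_sumr /= ler_wpM2l//.
rewrite -big_filter; apply: hT0 => //; first exact: filter_uniq.
by move=> k; rewrite mem_filter => /andP[].
Qed.

(** The displacement between the translated lattice of [A] and that of [A'] may grow linearly away
    from [y]. Close to [y] it is small and strong continuity applies to boundedly many indices; far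
    from [y] both lattice points stay far from [x] and each kernel is in its tail. *)
Lemma phase_localization N (r e : R) : 0 <= r -> 0 < e -> exists2 kappa : R, 0 < kappa &
  forall A A' y c, spaced A N -> spaced A' N ->
  (forall k, `|A *m iv k + c - A' *m iv k| <= kappa * `|A' *m iv k - y|) ->
  forall (x : 'cV[R]_n) (T : seq 'cV[int]_n), `|x - y| <= r -> uniq T ->
  \sum_(k <- T) normc <<x ~> g, (A' *m iv k) ~> ((A *m iv k + c - A' *m iv k) ~> g - g)>>
     <= e.
Proof.
move=> r0 e0; set DN : R := (N.*2.+1 ^ n)%:R.
have DN0 : 0 < DN by rewrite ltr0n expn_gt0.
have e1 : 0 < e / (4 * DN) by rewrite divr_gt0// mulr_gt0.
have [T0 hT0] := lattice_tail m0 mM e1.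
(* Beyond distance [L] from [y], the bound [kappa <= 1 / 2] leaves at least [L / 2 - r = T0] between
   [x] and either lattice point. *)
pose L : R := 2 * (T0%:R + r).
have L0 : 0 <= L by rewrite mulr_ge0// addr_ge0.
(* Indices of points within [L] of [y] differ by at most [2 N L], so [P] counts the near terms. *)
pose b := (Num.truncn (N%:R * (2 * L))).+1.
set P : R := (b.*2.+1 ^ n)%:R.
have P0 : 0 < P by rewrite ltr0n expn_gt0.
have g0 := nsq_ge0 g.
(* Cauchy-Schwarz then bounds each of the at most [P] near terms by [e / (2 P)]. *)
pose e3 := (e / (2 * P)) ^+ 2 / (nsq g + 1).
have e30 : 0 < e3.
  by rewrite divr_gt0 ?ltr_wpDl// exprn_gt0// divr_gt0// mulr_gt0.
have [dl dl0 hdl] := gc e30.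
exists (Num.min 2^-1 (dl / (2 * (L + 1)))).
  by rewrite lt_min invr_gt0 ltr0n /= divr_gt0// mulr_gt0// ltr_wpDl.
set kappa := Num.min _ _.
have k2 : kappa <= 2^-1 by rewrite ge_min lexx.
have kappa0 : 0 < kappa.
  by rewrite lt_min invr_gt0 ltr0n /= divr_gt0// mulr_gt0// ltr_wpDl.
have kL : kappa * L < dl.
  have : kappa * (2 * (L + 1)) <= dl.
    by rewrite -ler_pdivlMr ?ge_min ?lexx ?orbT// mulr_gt0// ltr_wpDl.
  nra.
move=> A A' y c sA sA' hw x T hx uT.
pose w k := A *m iv k + c - A' *m iv k.
pose d k := normc <<x ~> g, (A' *m iv k) ~> (w k ~> g - g)>>.
pose far k := L <= `|A' *m iv k - y|.
pose m1 k := m (flv (- x + A' *m iv k)); pose m2 k := m (flv (c - x + A *m iv k)).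
apply: (@le_trans _ _ (\sum_(k <- T) ((if ~~ far k then e / (2 * P) else 0) +
   (if far k then m1 k + m2 k else 0)))).
  apply: ler_sum => k _; rewrite -/(w k) -/(d k).
  case: (boolP (far k)) => fk /=; rewrite ?addr0 ?add0r.
    rewrite /d tfB ipBr; apply: le_trans (le_normcD _ _) _.
    rewrite normcN addrC; have [_ _ hm] := gm; apply: lerD.
      by rewrite tf_normc_shift addrC; apply: hm.
    rewrite tf_normc_comp tf_normc_shift.
    have -> : A' *m iv k + w k - x = c - x + A *m iv k.
      by apply/colP => i; rewrite /w !mxE; ring.
    exact: hm.
  have wdl : `|w k| < dl.
    apply: le_lt_trans (hw k) _; apply: le_lt_trans kL.
    rewrite ler_wpM2l//; first exact: ltW.
    by move: fk; rewrite /far -ltNge => /ltW.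
  have h := ip_cauchy_schwarz (x ~> g) ((A' *m iv k) ~> (w k ~> g - g)).
  rewrite -(@ler_pXn2r _ 2) ?nnegrE ?normc_ge0//; last by rewrite divr_ge0 ?mulr_ge0 ?(ltW e0) ?(ltW P0).
  apply: le_trans h _; rewrite !nsq_tf.
  apply: (@le_trans _ _ ((nsq g + 1) * e3)).
    apply: ler_pM => //; first exact: nsq_ge0.
      by rewrite lerDl.
    by apply/ltW/hdl.
  by rewrite /e3 mulrCA divff ?mulr1// gt_eqF// ltr_wpDl.
rewrite big_split /=.
have eE : e = P * (e / (2 * P)) + (DN * (e / (4 * DN)) + DN * (e / (4 * DN))).
  by field; rewrite !gt_eqF.
rewrite [leRHS]eE {eE}.
apply: lerD.
  rewrite -big_mkcond -big_filter /=.
  apply: le_trans (@sumr_le_size _ _ _ _ (e / (2 * P)) (fun k _ => lexx _)) _.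
  rewrite ler_wpM2r ?divr_ge0 ?mulr_ge0 ?(ltW e0) ?(ltW P0)// ler_nat.
  apply: (@uniq_size_close R); first exact: filter_uniq.
  move=> k l; rewrite !mem_filter /far -!ltNge => /andP[fk _] /andP[fl _].
  rewrite -intvB; apply: le_trans (sA' _) _.
  apply: (@le_trans _ _ (N%:R * (2 * L))); last by rewrite ltW// truncnS_gt.
  rewrite ler_wpM2l// intvB mulmxBr -(subrKA y); apply: le_trans (ler_normD _ _) _.
  by rewrite -[`|y - _|]normrN opprB mulr2n mulrDl mul1r lerD// ltW.
have far1 k : far k -> T0%:R <= `|- x + A' *m iv k|.
  rewrite /far /L => h.
  have : `|A' *m iv k - y| <= `|- x + A' *m iv k| + `|x - y|.
    apply: le_trans (ler_normD _ _); rewrite le_eqVlt; apply/orP; left; apply/eqP.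
    by congr `|_|; apply/colP => i; rewrite !mxE; ring.
  have : 0 <= T0%:R :> R by []. lra.
have far2 k : far k -> T0%:R <= `|c - x + A *m iv k|.
  rewrite /far /L => h.
  have h2 : `|A' *m iv k - y| <= `|c - x + A *m iv k| + `|w k| + `|x - y|.
    rewrite -[`|w k|]normrN.
    apply: le_trans (lerD (ler_normD _ _) (lexx _)); apply: le_trans (ler_normD _ _).
    by rewrite le_eqVlt; apply/orP; left; apply/eqP; congr `|_|; apply/colP => i; rewrite /w !mxE; ring.
  have := hw k; rewrite -/(w k).
  have : kappa * `|A' *m iv k - y| <= 2^-1 * `|A' *m iv k - y| by rewrite ler_wpM2r.
  lra.
rewrite -big_mkcond -big_filter big_split /=; apply: lerD; apply: hT0 => //;
  rewrite ?filter_uniq// => k; rewrite mem_filter => /andP[fk _].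
- exact: far1.
- exact: far2.
Qed.

End lattice_perturbation.

(** * Openness of the lower frame inequality *)

Section openness.
Variables (R : realType) (n : nat) (S : tfsys R n) (g : S).
Variables (m : 'cV[int]_n -> R) (M : R).
Hypothesis gm : majorized g m M.
Hypothesis gc : tf_continuous g.
Hypothesis gt : near_tight g.
Implicit Types (f h : S) (z w : 'cV[R]_n) (A : 'M[R]_n).

Local Notation "<< f , h >>" := (@ip _ _ S f h) (at level 0, f, h at level 99).
Local Notation "z ~> f" := (@tf _ _ S z f) (at level 35, right associativity).
Local Notation nsq := (@nsq _ _ S).
Local Notation iv := (@intv R n).

Lemma sum_sqr_normc_le2 I (s : seq I) (a b : I -> R[i]) :
  \sum_(i <- s) normc (a i) ^+ 2 <=
  2 * \sum_(i <- s) normc (b i) ^+ 2 + 2 * \sum_(i <- s) normc (a i - b i) ^+ 2.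
Proof.
rewrite !mulr_sumr -big_split /=; apply: ler_sum => i _; exact: sqr_normc_le2.
Qed.

Lemma small_coeff (K e : R) : 0 <= K -> 0 < e -> exists2 x : R, 0 < x & x * K <= e.
Proof.
move=> K0 e0; exists (e / (K + 1)); first by rewrite divr_gt0// ltr_wpDl.
by rewrite mulrAC ler_pdivrMr ?ltr_wpDl// ler_wpM2l ?(ltW e0)// lerDl.
Qed.

(** * The perturbation argument for a single vector [f] *)

Section assembly.
Variables (A A' : 'M[R]_n) (a : R) (eps t rho eta th al B' B0 D : R).
Variables (f : S) (J : seq 'cV[int]_n).
Hypotheses (a0 : 0 < a) (t0 : 0 < t) (eta0 : 0 < eta) (eta1 : 100 * eta <= 1).
Let v j := (eps%:M *m iv j) ~> g.
Let c j := <<f, v j>>.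
Let X := t * \sum_(j <- J) normc (c j) ^+ 2.
Let nu := nsq f.
Let fJ := truncated J v t f.
Let x j := eps%:M *m iv j.
Let U := undup [seq flv (rho^-1 *: x j) | j <- J].
Let fu := localized g J x (tent rho) c t.
Hypotheses (uJ : uniq J) (D0 : 0 < D) (th0 : 0 <= th) (al0 : 0 <= al) (B00 : 0 <= B0)
  (B'0 : 0 <= B').
Hypothesis D9 : forall z, \sum_(u <- U) tent rho u z ^+ 2 <= D.
Hypothesis upper : forall h, t * (\sum_(j <- J) normc <<h, v j>> ^+ 2) <= (1 + eta) * nsq h.
Hypothesis lower : (1 - eta) * nu <= X.
Hypothesis hB0 : forall w, \sum_(j <- J) normc <<g, (w - x j) ~> g>> <= B0.
Hypothesis loc : forall j (T : seq 'cV[int]_n), uniq T ->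
  \sum_(k <- T) (\sum_(u <- U) (tent rho u (x j) - tent rho u (x k)) ^+ 2) *
      normc <<g, (x k - x j) ~> g>> <= th.
Hypothesis loc' : forall j (T : seq 'cV[int]_n), uniq T ->
  \sum_(k <- T) (\sum_(u <- U) (tent rho u (x j) - tent rho u (A' *m iv k)) ^+ 2) *
      normc <<g, (A' *m iv k - x j) ~> g>> <= th.
Hypothesis bessel' : forall h (T : seq 'cV[int]_n), uniq T ->
  \sum_(k <- T) normc <<h, (A' *m iv k) ~> g>> ^+ 2 <= B' * nsq h.
Variable cu : 'cV[int]_n -> 'cV[R]_n.
(** What remains of the difference between the two lattices after translating the first by [cu u];
    the translation is meant to make it small near the centre [rho u] of the piece [fu u]. *)
Let w u k := A *m iv k + cu u - A' *m iv k.
Hypothesis phase : forall u j (T : seq 'cV[int]_n), tent rho u (x j) != 0 -> uniq T ->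
  \sum_(k <- T) normc <<x j ~> g, (A' *m iv k) ~> (w u k ~> g - g)>> <= al.
Hypothesis kern' : forall u k,
  \sum_(j <- J) normc <<x j ~> g, (A' *m iv k) ~> (w u k ~> g - g)>> <= 2 * B0.
Hypothesis frameA : lower_frame g A a.
Hypotheses (small_eta : 16 * D * B' * eta <= a / 100)
  (small_th : 40 * (40 * (t * t * B0 * th)) <= 1) (small_th' : 8 * t * B0 * th <= a / 100)
  (small_al : 8 * t * B0 * al * D <= a / 100).

Let eta01 : 0 < eta <= 1.
Proof. by rewrite eta0 /=; move: eta0 eta1; lra. Qed.

Let nu0 : 0 <= nu. Proof. exact: nsq_ge0. Qed.

Let X_le : X <= (1 + eta) * nu. Proof. exact: upper. Qed.

Let fJ_close : nsq (f - fJ) <= 2 * eta * nu.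
Proof. exact: truncated_close. Qed.

Let uU : uniq U. Proof. exact: undup_uniq. Qed.

(** The lower half of the almost-partition of unity: each [x k] with [k] in [J] has a tent of value
    at least 1/2 in [U], which costs the factor 4 in [h3]. The other losses are the truncation error
    ([eta]) and the commutator error ([th]). *)
Let localized_norms : nu <= 20 * \sum_(u <- U) nsq (fu u).
Proof.
set Y := \sum_(u <- U) _.
have Y0 : 0 <= Y by apply: sumr_ge0 => u _; exact: nsq_ge0.
pose P := \sum_(k <- J) normc <<fJ, v k>> ^+ 2.
have h1 : \sum_(j <- J) normc (c j) ^+ 2 <= 2 * P +
    2 * \sum_(k <- J) normc <<f - fJ, v k>> ^+ 2.
  apply: le_trans (sum_sqr_normc_le2 _ _ (fun k => <<fJ, v k>>)) _.
  by under [X in _ + 2 * X]eq_bigr => k _ do rewrite -ipBl.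
have h2 : t * \sum_(k <- J) normc <<f - fJ, v k>> ^+ 2 <= (1 + eta) * (2 * eta * nu).
  apply: le_trans (upper _) _; rewrite ler_wpM2l//.
  by rewrite addr_ge0// ltW.
pose Q := \sum_(u <- U) \sum_(k <- J) normc ((tent rho u (x k))%:C * <<fJ, v k>>) ^+ 2.
have h3 : P <= 4 * Q.
  rewrite /P /Q exchange_big mulr_sumr /= big_seq [leRHS]big_seq.
  apply: ler_sum => k kJ.
  have ku : flv (rho^-1 *: x k) \in U by rewrite mem_undup; apply: map_f.
  rewrite (bigD1_seq _ ku uU) /= mulrDr.
  apply: (@le_trans _ _ (4 * normc ((tent rho (flv (rho^-1 *: x k)) (x k))%:C * <<fJ, v k>>) ^+ 2)).
    rewrite normcM normc_real exprMn real_normK ?num_real// mulrA.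
    rewrite ler_peMl ?sqr_ge0//.
    have := tent_center rho (x k); move: (tent _ _ _) => y hy; nra.
  by rewrite lerDl mulr_ge0// sumr_ge0// => u _; rewrite sqr_ge0.
have h4 : Q <= 2 * (\sum_(u <- U) \sum_(k <- J) normc <<fu u, v k>> ^+ 2) +
   2 * (t ^+ 2 * B0 * th * \sum_(j <- J) normc (c j) ^+ 2).
  apply: (@le_trans _ _ (2 * (\sum_(u <- U) \sum_(k <- J) normc <<fu u, v k>> ^+ 2) +
    2 * \sum_(u <- U) \sum_(k <- J) normc (<<fu u, v k>> - (tent rho u (x k))%:C * <<fJ, v k>>) ^+ 2)).
    rewrite /Q !mulr_sumr -big_split /=; apply: ler_sum => u _.
    apply: le_trans (sum_sqr_normc_le2 _ _ (fun k => <<fu u, v k>>)) _.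
    by under [X in _ + 2 * X <= _]eq_bigr => k _ do rewrite normcB.
  rewrite lerD2l ler_wpM2l//.
  by apply: localized_diff => // j; apply: loc.
have h5 : t * \sum_(u <- U) \sum_(k <- J) normc <<fu u, v k>> ^+ 2 <= (1 + eta) * Y.
  rewrite /Y !mulr_sumr; apply: ler_sum => u _; exact: upper.
have h6 : X <= 2 * (t * P) + 2 * ((1 + eta) * (2 * eta * nu)).
  apply: le_trans (ler_wpM2l (ltW t0) h1) _.
  by rewrite mulrDr !(mulrCA t) lerD2l ler_wpM2l.
have h7 : t * P <= 4 * (2 * ((1 + eta) * Y) + 2 * (t * t * B0 * th * X)).
  apply: le_trans (ler_wpM2l (ltW t0) h3) _; rewrite mulrCA ler_wpM2l//.
  apply: le_trans (ler_wpM2l (ltW t0) h4) _.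
  rewrite mulrDr; apply: lerD; first by rewrite mulrCA ler_wpM2l.
  by rewrite /X le_eqVlt; apply/orP; left; apply/eqP; ring.
have e1 : (1 + eta) * Y <= 101 / 100 * Y by rewrite ler_wpM2r//; move: eta1; lra.
have e2 : (1 + eta) * (2 * eta * nu) <= 3 / 100 * nu.
  by rewrite mulrA ler_wpM2r//; move: eta0 eta1; nra.
have X0 : 0 <= X.
  by rewrite /X mulr_ge0 ?(ltW t0)// sumr_ge0// => j _; rewrite sqr_ge0.
have e3 : t * t * B0 * th * X <= 1 / 1600 * X by rewrite ler_wpM2r//; move: small_th; lra.
have e4 : 99 / 100 * nu <= X by apply: le_trans lower; rewrite ler_wpM2r//; move: eta1; lra.
lra.
Qed.

(** Schur's test with the sums [kern'] and [phase]. The latter holds only near [rho u], which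
    suffices because the coefficients of [fu u] carry the tent as a factor. *)
Let phase_diff (T : seq 'cV[int]_n) : uniq T ->
  \sum_(u <- U) \sum_(k <- T) normc <<fu u, (A' *m iv k) ~> (w u k ~> g - g)>> ^+ 2 <=
    t * (2 * B0) * al * D * X.
Proof.
move=> uT.
pose d u j k := normc <<x j ~> g, (A' *m iv k) ~> (w u k ~> g - g)>>.
have step u : \sum_(k <- T) normc <<fu u, (A' *m iv k) ~> (w u k ~> g - g)>> ^+ 2 <=
    t ^+ 2 * (2 * B0) * al * \sum_(j <- J) (tent rho u (x j) * normc (c j)) ^+ 2.
  apply: (@le_trans _ _ (\sum_(k <- T) t ^+ 2 * (2 * B0) *
      \sum_(j <- J) d u j k * (tent rho u (x j) * normc (c j)) ^+ 2)).
    apply: ler_sum => k _.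
    apply: (@le_trans _ _ ((t * \sum_(j <- J) d u j k * (tent rho u (x j) * normc (c j))) ^+ 2)).
      rewrite lerXn2r ?nnegrE ?normc_ge0//.
        apply: mulr_ge0; first exact: ltW.
        by apply: sumr_ge0 => j _; rewrite !mulr_ge0 ?normc_ge0 ?tent_ge0.
      rewrite /fu /localized ip_suml; apply: le_trans (ler_normc_sum _ _) _.
      rewrite mulr_sumr; apply: ler_sum => j _.
      rewrite ipZl !normcM !normc_real (gtr0_norm t0) (ger0_norm (tent_ge0 _ _ _)).
      by rewrite /d -mulrA [X in t * X]mulrC.
    rewrite exprMn -mulrA ler_wpM2l ?sqr_ge0//.
    apply: le_trans (weighted_schur _ _ _) _ => [j|]; first exact: normc_ge0.
    rewrite ler_wpM2r ?kern'//.
    by apply: sumr_ge0 => j _; rewrite mulr_ge0 ?normc_ge0 ?sqr_ge0.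
  rewrite -mulr_sumr exchange_big /= -[leRHS]mulrA ler_wpM2l//.
    by apply: mulr_ge0; [exact: sqr_ge0|rewrite mulr_ge0].
  rewrite mulr_sumr; apply: ler_sum => j _; rewrite -mulr_suml.
  have [->|tn0] := eqVneq (tent rho u (x j)) 0; first by rewrite mul0r expr0n !mulr0.
  by rewrite ler_wpM2r ?sqr_ge0// phase.
apply: (le_trans (ler_sum _ (fun u _ => step u))).
rewrite -mulr_sumr exchange_big /=.
have h : \sum_(j <- J) \sum_(u <- U) (tent rho u (x j) * normc (c j)) ^+ 2 <=
    D * \sum_(j <- J) normc (c j) ^+ 2.
  rewrite mulr_sumr; apply: ler_sum => j _.
  under eq_bigr => u _ do rewrite exprMn.
  by rewrite -mulr_suml ler_wpM2r ?sqr_ge0.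
apply: le_trans (ler_wpM2l _ h) _.
  by rewrite !mulr_ge0// ltW.
by rewrite /X le_eqVlt; apply/orP; left; apply/eqP; ring.
Qed.

(** The inequality for [A] is applied to each piece. Replacing the translated points by those of
    [A'] costs the phase error, pulling the tents out of the transform costs the commutator error,
    and returning from [fJ] to [f] costs the truncation error. Each is a small multiple of [a * nu],
    while the main term is at least [a * nu / 20]. *)
Lemma lower_bound_assembly : exists2 T : seq 'cV[int]_n, uniq T &
  a / (20 * (20 * D)) * nsq f <= \sum_(k <- T) normc <<f, (A' *m iv k) ~> g>> ^+ 2.
Proof.
(* Shifting the piece by [- cu u] before applying [frameA] amounts to shifting the lattice by
   [cu u]. *)
have /choice[s_ sP] : forall u, exists s : seq 'cV[int]_n, uniq s /\
    a * nsq (fu u) <= \sum_(k <- s) normc <<fu u, (A *m iv k + cu u) ~> g>> ^+ 2.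
  move=> u; have [s us hs] := frameA ((- cu u) ~> fu u); exists s; split => //.
  rewrite nsq_tf in hs; apply: le_trans hs _; apply: ler_sum => k _.
  by rewrite tf_normc_tf.
(* One finite set for all pieces; the error bounds hold for every finite set, so enlarging is
   harmless. *)
pose T := undup (flatten [seq s_ u | u <- U]).
have uT : uniq T by exact: undup_uniq.
exists T => //; set F := \sum_(k <- T) _.
have F0 : 0 <= F by apply: sumr_ge0 => k _; rewrite sqr_ge0.
set Y := \sum_(u <- U) nsq (fu u).
have h1 : a * Y <= \sum_(u <- U) \sum_(k <- T) normc <<fu u, (A *m iv k + cu u) ~> g>> ^+ 2.
  rewrite /Y mulr_sumr big_seq [leRHS]big_seq; apply: ler_sum => u uU'.
  have [us hs] := sP u; apply: le_trans hs _; apply: sum_sub_uniq => //.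
    move=> k ks; rewrite mem_undup; apply/flattenP; exists (s_ u) => //.
    exact: map_f.
  by move=> k; rewrite sqr_ge0.
have h2 : \sum_(u <- U) \sum_(k <- T) normc <<fu u, (A *m iv k + cu u) ~> g>> ^+ 2 <=
    2 * (\sum_(u <- U) \sum_(k <- T) normc <<fu u, (A' *m iv k) ~> g>> ^+ 2) +
    2 * (t * (2 * B0) * al * D * X).
  apply: (@le_trans _ _ (2 * (\sum_(u <- U) \sum_(k <- T) normc <<fu u, (A' *m iv k) ~> g>> ^+ 2) +
    2 * (\sum_(u <- U) \sum_(k <- T) normc <<fu u, (A' *m iv k) ~> (w u k ~> g - g)>> ^+ 2))); last first.
    by rewrite lerD2l ler_wpM2l// phase_diff.
  rewrite !mulr_sumr -big_split /=; apply: ler_sum => u _.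
  rewrite !mulr_sumr -big_split /=; apply: ler_sum => k _.
  have -> : normc <<fu u, (A *m iv k + cu u) ~> g>> =
      normc <<fu u, (A' *m iv k) ~> (w u k ~> g)>>.
    by rewrite tf_normc_comp /w subrKC.
  by apply: le_trans (sqr_normc_le2 _ <<fu u, (A' *m iv k) ~> g>>) _; rewrite -ipBr -tfB.
pose Q := \sum_(u <- U) \sum_(k <- T) normc ((tent rho u (A' *m iv k))%:C * <<fJ, (A' *m iv k) ~> g>>) ^+ 2.
have h3 : \sum_(u <- U) \sum_(k <- T) normc <<fu u, (A' *m iv k) ~> g>> ^+ 2 <=
    2 * Q + 2 * (t ^+ 2 * B0 * th * \sum_(j <- J) normc (c j) ^+ 2).
  apply: (@le_trans _ _ (2 * Q + 2 * \sum_(u <- U) \sum_(k <- T)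
      normc (<<fu u, (A' *m iv k) ~> g>> - (tent rho u (A' *m iv k))%:C * <<fJ, (A' *m iv k) ~> g>>) ^+ 2)).
    rewrite /Q !mulr_sumr -big_split /=; apply: ler_sum => u _.
    exact: sum_sqr_normc_le2.
  rewrite lerD2l ler_wpM2l//.
  by apply: localized_diff => // j; apply: loc'.
have h4 : Q <= D * \sum_(k <- T) normc <<fJ, (A' *m iv k) ~> g>> ^+ 2.
  rewrite /Q exchange_big mulr_sumr /=; apply: ler_sum => k _.
  under eq_bigr => u _ do rewrite normcM normc_real exprMn real_normK ?num_real//.
  by rewrite -mulr_suml ler_wpM2r ?sqr_ge0.
have h5 : \sum_(k <- T) normc <<fJ, (A' *m iv k) ~> g>> ^+ 2 <=
    2 * F + 2 * (B' * (2 * eta * nu)).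
  apply: le_trans (sum_sqr_normc_le2 _ _ (fun k => <<f, (A' *m iv k) ~> g>>)) _.
  rewrite lerD2l ler_wpM2l//.
  under eq_bigr => k _ do rewrite normcB -ipBl.
  by apply: le_trans (bessel' _ uT) _; rewrite ler_wpM2l.
have h6 : t ^+ 2 * B0 * th * \sum_(j <- J) normc (c j) ^+ 2 = t * B0 * th * X.
  by rewrite /X; ring.
have Xnu : X <= 2 * nu.
  by apply: le_trans X_le _; rewrite ler_wpM2r//; move: eta1; lra.
have e1 : 8 * t * B0 * th * X <= a / 100 * (2 * nu).
  by apply: ler_pM => //; rewrite ?mulr_ge0 ?(ltW t0)// sumr_ge0// => j _; rewrite sqr_ge0.
have e2 : 8 * t * B0 * al * D * X <= a / 100 * (2 * nu).
  by apply: ler_pM => //; rewrite ?mulr_ge0 ?(ltW t0) ?(ltW D0)// sumr_ge0// => j _; rewrite sqr_ge0.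
have e3 : 16 * D * B' * eta * nu <= a / 100 * nu by rewrite ler_wpM2r.
have e4 : a * nu <= 20 * (a * Y) by rewrite mulrCA ler_wpM2l// ltW.
have h7 : Q <= D * (2 * F + 2 * (B' * (2 * eta * nu))).
  by apply: le_trans h4 _; rewrite ler_wpM2l// ltW.
rewrite mulrAC ler_pdivrMr; last by rewrite !mulr_gt0.
have -> : F * (20 * (20 * D)) = 400 * (D * F) by ring.
have h8 : Q <= 2 * (D * F) + 4 * (D * B' * eta * nu).
  by apply: le_trans h7 _; rewrite le_eqVlt; apply/orP; left; apply/eqP; ring.
have e3' : 16 * (D * B' * eta * nu) <= a / 100 * nu by apply: le_trans e3; rewrite !mulrA.
have e1' : 8 * (t * B0 * th * X) <= a / 100 * (2 * nu) by apply: le_trans e1; rewrite !mulrA.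
have e2' : 4 * (t * (2 * B0) * al * D * X) <= a / 100 * (2 * nu).
  by apply: le_trans e2; rewrite le_eqVlt; apply/orP; left; apply/eqP; ring.
rewrite h6 in h3.
have aN : a / 100 * nu = 1 / 100 * (a * nu) by ring.
have aN2 : a / 100 * (2 * nu) = 1 / 50 * (a * nu) by field.
rewrite aN in e3'; rewrite aN2 in e1' e2'.
have : 0 <= a * nu by rewrite mulr_ge0// ltW.
have : 0 <= D * F by rewrite mulr_ge0// ltW.
rewrite -/nu; lra.
Qed.

End assembly.

(** Constants are chosen in the order [eta], ([eps], [t]), [th], [rho], [al], [kappa], [dl], each
    from the preceding ones and none from [A'] or [f]. Only the finite sets depend on [f], so the
    new bound is uniform. *)
Lemma lower_frame_open A (a : R) : A \in unitmx -> 0 < a -> lower_frame g A a ->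
  exists2 dl : R, 0 < dl & forall A', `|A' - A| < dl ->
    A' \in unitmx /\ exists2 a' : R, 0 < a' & lower_frame g A' a'.
Proof.
move=> uA a0 frameA; have [N1 N10 sA1] := unit_spaced uA.
(* A separation constant shared by [A] and all its close perturbations (see [spaced_open]). *)
pose N := (N1 * 2)%N; have sA : spaced A N by apply: spaced_mono sA1; rewrite leq_pmulr.
have M0 := majorant_ge0 gm.
pose D : R := (9 ^ n)%:R; have D0 : 0 < D by rewrite ltr0n expn_gt0.
pose B' : R := (N.*2.+1 ^ n)%:R * M; have B'0 : 0 <= B' by rewrite mulr_ge0.
have a100 : 0 < a / 100 by rewrite divr_gt0.
have [eta1 eta10 heta1] : exists2 x : R, 0 < x & x * (16 * D * B') <= a / 100.
  by apply: small_coeff => //; rewrite !mulr_ge0// ltW.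
pose eta := Num.min eta1 (1 / 100).
have eta0 : 0 < eta by rewrite lt_min eta10 divr_gt0.
have eta_le1 : 100 * eta <= 1.
  have : eta <= 1 / 100 by rewrite ge_min lexx orbT.
  lra.
have small_eta : 16 * D * B' * eta <= a / 100.
  apply: le_trans heta1; rewrite mulrC ler_wpM2r//; last by rewrite ge_min lexx.
  by rewrite !mulr_ge0// ltW.
have [eps [t [eps0 t0 upper lower]]] := gt eta0.
have [N0 N00 s0] := scalar_spaced n eps0.
pose B0 : R := (N0.*2.+1 ^ n)%:R * M; have B00 : 0 <= B0 by rewrite mulr_ge0.
have tt0 : 0 <= t by exact: ltW.
have [th1 th10 hth1] : exists2 x : R, 0 < x & x * (40 * (40 * (t * t * B0))) <= 1.
  by apply: small_coeff => //; rewrite !mulr_ge0.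
have [th2 th20 hth2] : exists2 x : R, 0 < x & x * (8 * t * B0) <= a / 100.
  by apply: small_coeff => //; rewrite !mulr_ge0.
pose th := Num.min th1 th2.
have th0 : 0 < th by rewrite lt_min th10.
have small_th : 40 * (40 * (t * t * B0 * th)) <= 1.
  have -> : 40 * (40 * (t * t * B0 * th)) = th * (40 * (40 * (t * t * B0))) by ring.
  apply: le_trans hth1; rewrite ler_wpM2r ?ge_min ?lexx//.
  by rewrite !mulr_ge0.
have small_th' : 8 * t * B0 * th <= a / 100.
  rewrite mulrC; apply: le_trans hth2; rewrite ler_wpM2r ?ge_min ?lexx ?orbT//.
  by rewrite !mulr_ge0.
have [rho rho0 hrho] := tent_localization gm (maxn N N0) th0.
have [al al0 hal] : exists2 x : R, 0 < x & x * (8 * t * B0 * D) <= a / 100.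
  by apply: small_coeff => //; rewrite !mulr_ge0// ltW.
have small_al : 8 * t * B0 * al * D <= a / 100 by apply: le_trans hal; rewrite mulrC; lra.
have r0 : 0 <= rho * 2 by rewrite mulr_ge0// ltW.
have [kappa kappa0 hkappa] := phase_localization gm gc N r0 al0.
have [dl dl0 hdl] : exists2 x : R, 0 < x & x * (n%:R * N%:R) <= Num.min kappa 2^-1.
  by apply: small_coeff; rewrite ?mulr_ge0// lt_min kappa0 invr_gt0 ltr0n.
move: hdl; rewrite le_min => /andP[hdl1 hdl2].
exists dl => // A' close.
have sA' : spaced A' N.
  apply: (spaced_open N10 sA1); apply: le_trans hdl2.
  rewrite -mulrA mulrCA; apply: ler_pM => //; first exact: ltW.
  by rewrite ler_wpM2l// ler_nat leq_pmulr.
have uA' := spaced_unit sA'.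
split=> //; exists (a / (20 * (20 * D))); first by rewrite divr_gt0 ?mulr_gt0.
move=> f; have [J uJ hJ] := lower f.
(* With this translation the displacement is [(A - A') (k - A'^-1 (rho u))]: zero where [A' k] would
   equal [rho u], and linear in the distance from there. *)
pose cu (u : 'cV[int]_n) := (A' - A) *m (invmx A' *m (rho *: iv u)).
have hw u k : `|A *m iv k + cu u - A' *m iv k| <= kappa * `|A' *m iv k - rho *: iv u|.
  have -> : A *m iv k + cu u - A' *m iv k = (A - A') *m (iv k - invmx A' *m (rho *: iv u)).
    by rewrite mulmxBr !mulmxBl /cu mulmxBl; apply/colP => i; rewrite !mxE; ring.
  apply: le_trans (mulmx_norm _ _) _.
  have h := sA' (iv k - invmx A' *m (rho *: iv u)).
  rewrite mulmxBr mulKVmx// in h.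
  apply: (@le_trans _ _ (n%:R * dl * (N%:R * `|A' *m iv k - rho *: iv u|))).
    by apply: ler_pM => //; rewrite ?mulr_ge0// ler_wpM2l// distrC ltW.
  by rewrite mulrA ler_wpM2r// -mulrA mulrCA.
have loc A1 N2 : (N2 <= maxn N N0)%N -> spaced A1 N2 -> forall U x T, uniq U -> uniq T ->
  \sum_(k <- T) (\sum_(u <- U) (tent rho u x - tent rho u (A1 *m iv k)) ^+ 2) *
      normc <<g, (A1 *m iv k - x) ~> g>> <= th.
  by move=> le sA2 U x T; apply: hrho; apply: spaced_mono sA2.
have hB0 w : \sum_(j <- J) normc <<g, (w - eps%:M *m iv j) ~> g>> <= B0.
  apply: le_trans (kern_sum gm w (spacedN s0) uJ).
  by apply: ler_sum => j _; rewrite mulNmx.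
apply: (@lower_bound_assembly A A' a eps t rho eta th al B' B0 D f J _ _ _ _ _ _ _ _ _ _ _ _ _ _ _ _ _ cu) => //.
all: try by exact: ltW.
- by move=> z; apply: tent_sqr_sum => //; exact: undup_uniq.
- by move=> h; exact: upper.
- by move=> j T uT; apply: (loc _ N0) => //; rewrite ?leq_maxr ?undup_uniq.
- by move=> j T uT; apply: (loc _ N) => //; rewrite ?leq_maxl ?undup_uniq.
- by move=> h T uT; exact: (lattice_bessel gm h sA' uT).
- move=> u j T tn0 uT; apply: (hkappa A A' (rho *: iv u) (cu u)) => //.
  exact: tent_dist.
- move=> u k; rewrite mulr2n mulrDl mul1r.
  apply: le_trans (lerD (hB0 (A *m iv k + cu u)) (hB0 (A' *m iv k))).
  rewrite -big_split /=; apply: ler_sum => j _.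
  rewrite tfB ipBr; apply: le_trans (le_normcD _ _) _; rewrite normcN; apply: lerD.
    by rewrite tf_normc_comp tf_normc_shift subrKC.
  by rewrite tf_normc_shift.
Qed.

End openness.

(** * Small lattices, and counting nearly spanned orthonormal vectors *)

Section density.
Variables (R : realType) (n : nat) (S : tfsys R n) (g : S).
Variables (m : 'cV[int]_n -> R) (M : R).
Hypothesis gm : majorized g m M.
Hypothesis gc : tf_continuous g.
Hypothesis gt : near_tight g.
Implicit Types (f h : S) (z w : 'cV[R]_n) (A : 'M[R]_n).

Local Notation "<< f , h >>" := (@ip _ _ S f h) (at level 0, f, h at level 99).
Local Notation "z ~> f" := (@tf _ _ S z f) (at level 35, right associativity).
Local Notation nsq := (@nsq _ _ S).
Local Notation iv := (@intv R n).

Lemma intv_mulmx (K : 'M[int]_n) (k : 'cV[int]_n) :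
  iv (K *m k) = map_mx intr K *m iv k.
Proof. exact: map_mxM. Qed.

(** Points of the sublattice are points of the lattice under the injective index map [k -> K k], so
    the finite sums carry over. *)
Lemma lower_frame_sub A (K : 'M[int]_n) (a : R) :
  A *m map_mx intr K \in unitmx -> lower_frame g (A *m map_mx intr K) a ->
  lower_frame g A a.
Proof.
move=> uAK frameAK f; have [s us hs] := frameAK f.
exists [seq K *m k | k <- s].
  rewrite map_inj_in_uniq// => k l _ _ e; apply: (@intv_inj R).
  rewrite -(mulKmx uAK (iv k)) -(mulKmx uAK (iv l)); congr (_ *m _).
  by rewrite -!mulmxA -!intv_mulmx e.
apply: le_trans hs _; rewrite big_map.
by apply: ler_sum => k _; rewrite intv_mulmx mulmxA.
Qed.

(** A lattice with small generators contains a sublattice close to a fixed fine cubic one; openness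
    at [eps%:M] and [lower_frame_sub] finish. *)
Lemma lower_frame_small : exists2 dl : R, 0 < dl &
  forall A, A \in unitmx -> `|A| < dl -> exists2 a : R, 0 < a & lower_frame g A a.
Proof.
have half0 : 0 < 2^-1 :> R by rewrite invr_gt0.
have [eps [t [eps0 t0 _ lower]]] := gt half0.
have frame0 : lower_frame g eps%:M (2^-1 / t).
  move=> f; have [s us hs] := lower f; exists s => //.
  rewrite mulrAC ler_pdivrMr// [leRHS]mulrC; apply: le_trans hs.
  by rewrite ler_wpM2r ?nsq_ge0//; lra.
have [|dl dl0 hdl] := lower_frame_open gm gc gt _ (divr_gt0 half0 t0) frame0.
  by rewrite unitmxE det_scalar unitrX// unitfE gt_eqF.
have [d0 d00 hd0] : exists2 x : R, 0 < x & x * (n%:R * n%:R) <= dl / 2.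
  by apply: small_coeff => //; rewrite divr_gt0.
exists d0 => [//|A uA Asmall].
(* Then [eps I - A K] is [A] times a matrix with entries in [[0, 1)], hence of size at most
   [n |A|]. *)
pose K : 'M[int]_n := map_mx Num.floor (eps *: invmx A).
have close : `|A *m map_mx intr K - eps%:M| < dl.
  have -> : A *m map_mx intr K - eps%:M = - (A *m (eps *: invmx A - map_mx intr K)).
    by rewrite mulmxBr -scalemxAr mulmxV// opprB scalemx1.
  rewrite normrN; apply: (@le_lt_trans _ _ (dl / 2)); last by rewrite ltr_pdivrMr// ltr_pMr// ltr1n.
  apply: le_trans hd0; rewrite [`|_|]mx_normrE; apply/bigmax_leP; split.
    by rewrite !mulr_ge0// ltW.
  move=> [i j] _ /=; rewrite mxE.
  apply: le_trans (ler_norm_sum _ _ _) _.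
  apply: (@le_trans _ _ (\sum_(l < n) d0)).
    apply: ler_sum => l _; rewrite normrM -[leRHS]mulr1; apply: ler_pM => //.
      apply: le_trans (ltW Asmall).
      by rewrite [`|A|]mx_normrE (le_bigmax _ (fun ij => `|A ij.1 ij.2|) (i, l)).
    rewrite !mxE; set x := eps * _.
    by rewrite ger0_norm ?subr_ge0 ?floor_le// lerBlDl; have := floorD1_gt x; rewrite intrD => /ltW.
  rewrite sumr_const card_ord -[leLHS]mulr_natl mulrC ler_wpM2l ?(ltW d00)//.
  rewrite -natrM ler_nat leq_pmulr//; exact: leq_ltn_trans (ltn_ord i).
have [uAK [a a0 frameAK]] := hdl _ close.
by exists a => //; exact: lower_frame_sub frameAK.
Qed.

Section dimension_count.
Variables (P N : nat) (v : 'I_P -> S) (u : 'I_N -> S) (C : 'M[R[i]]_(P, N)) (e : R).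
Hypothesis v_on : forall p q, <<v p, v q>> = (p == q)%:R.
Hypothesis close : forall p, nsq (v p - \sum_k C p k *: u k) <= e.

(** The left kernel of [C] has dimension at least [P - N]. An orthonormal basis of it gives
    orthonormal combinations [x l] of the [v p] in which the [u k] cancel, so each [x l] is a
    combination of residuals and its squared coefficients against the residuals sum to at least 1.
    Bessel's inequality bounds the sum over all [l] by [P * e], so the kernel has dimension at most
    [P * e]. *)
Lemma dimension_count : P%:R * (1 - e) <= N%:R :> R.
Proof.
pose E := schmidt (row_base (kermx C)); set r := \rank (kermx C) in E.
have EE : E *m (map_mx Num.conj E^T) = 1%:M.
  by apply/unitarymxP/schmidt_unitarymx; exact: rank_leq_col.
have EC : E *m C = 0.
  apply/eqP; rewrite -sub_kermx.
  by rewrite (eqmx_schmidt_free (row_base_free _)) eq_row_base.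
pose res p := v p - \sum_k C p k *: u k.
pose x l := \sum_p E l p *: v p.
have xE l : x l = \sum_p E l p *: res p.
  under [RHS]eq_bigr => p _ do rewrite scalerBr.
  rewrite sumrB [X in _ - X](_ : _ = 0) ?subr0//.
  under eq_bigr => p _ do rewrite scaler_sumr.
  rewrite exchange_big big1//= => k _.
  transitivity ((E *m C) l k *: u k); last by rewrite EC mxE scale0r.
  by rewrite mxE scaler_suml; apply: eq_bigr => p _; rewrite scalerA.
have x_on l l' : <<x l, x l'>> = (l == l')%:R.
  have -> : <<x l, x l'>> = (E *m (map_mx Num.conj E^T)) l l'.
    rewrite ip_suml mxE; apply: eq_bigr => p _.
    rewrite ipZl ip_sumr (bigD1 p)//= ipZr v_on eqxx mulr1 big1 ?addr0.
      by rewrite !mxE.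
    by move=> q qp; rewrite ipZr v_on eq_sym (negPf qp) mulr0.
  by rewrite EE mxE.
have E1 l : \sum_p normc (E l p) ^+ 2 = 1.
  apply: complexI; rewrite rmorph_sum rmorph1 /=.
  have /matrixP/(_ l l) := EE; rewrite !mxE eqxx => e1.
  rewrite -[RHS]/(true%:R) -e1.
  by apply: eq_bigr => p _; rewrite -mulcJE !mxE.
have resx l : \sum_p normc (E l p) * normc <<x l, res p>> >= 1.
  have : <<x l, x l>> = 1 by rewrite x_on eqxx.
  rewrite {2}xE ip_sumr => /(congr1 (@normc R)); rewrite normc1 => <-.
  apply: le_trans (ler_normc_sum _ _) _; apply: ler_sum => p _.
  by rewrite ipZr normcM normc_conj.
have key : r%:R <= P%:R * e :> R.
  pose F : R := \sum_l \sum_p normc <<x l, res p>> ^+ 2.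
  have F_le : F <= P%:R * e.
    rewrite /F exchange_big /=; apply: (@le_trans _ _ (\sum_(p < P) e)).
      apply: ler_sum => p _; under eq_bigr => l _ do rewrite normc_ipC.
      apply: le_trans (close p); rewrite -[leRHS]mul1r.
      apply: gram_bessel => // l; rewrite (bigD1 l)//= x_on eqxx normc1 big1 ?addr0//.
      by move=> l' ll'; rewrite x_on eq_sym (negPf ll') normc0.
    by rewrite sumr_const card_ord -[leLHS]mulr_natl.
  have h l : 2 <= 1 + \sum_p normc <<x l, res p>> ^+ 2.
    rewrite -[X in _ <= X + _](E1 l) -big_split /=; apply: (@le_trans _ _ (2 * 1)); first by rewrite mulr1.
    apply: le_trans (ler_wpM2l _ (resx l)) _ => //.
    rewrite mulr_sumr; apply: ler_sum => p _.
    by have := sqr_ge0 (normc (E l p) - normc <<x l, res p>>); lra.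
  apply: le_trans F_le; rewrite /F.
  apply: (@le_trans _ _ (\sum_(l < r) 1)); first by rewrite sumr_const card_ord.
  by apply: ler_sum => l _; have := h l; lra.
have : (P <= r + N)%N.
  by rewrite /r mxrank_ker; have := rank_leq_col C; lia.
rewrite -(ler_nat R) natrD; lra.
Qed.

End dimension_count.
End density.

(** * Approximation by finite combinations of frame vectors *)

Section span.
Variables (R : realType) (n : nat) (S : tfsys R n) (g : S).
Variables (m : 'cV[int]_n -> R) (M : R).
Hypothesis gm : majorized g m M.
Implicit Types (f h : S) (z w : 'cV[R]_n) (A : 'M[R]_n).

Local Notation "<< f , h >>" := (@ip _ _ S f h) (at level 0, f, h at level 99).
Local Notation "z ~> f" := (@tf _ _ S z f) (at level 35, right associativity).
Local Notation nsq := (@nsq _ _ S).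
Local Notation iv := (@intv R n).

Definition combination A (s : seq ('cV[int]_n * R[i])) : S :=
  \sum_(x <- s) x.2 *: ((A *m iv x.1) ~> g).

(** One step of the frame algorithm with relaxation [1 / B]: subtracting the normalized partial
    frame operator lowers the squared norm by at least [X / B], where [X >= a * nsq f]. *)
Lemma combination_step A (a B : R) f : 0 < a -> a < B -> lower_frame g A a ->
  (forall h s, uniq s -> \sum_(k <- s) normc <<h, (A *m iv k) ~> g>> ^+ 2 <= B * nsq h) ->
  exists s, nsq (f - combination A s) <= (1 - a / B) * nsq f.
Proof.
move=> a0 aB frameA bessel; have B0 : 0 < B by exact: lt_trans aB.
have [s us hs] := frameA f.
pose v k := (A *m iv k) ~> g.
exists [seq (k, B^-1%:C * <<f, v k>>) | k <- s].
rewrite /combination big_map /=.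
set X := \sum_(k <- s) _ in hs.
set p := \sum_(k <- s) _.
have Re_p : complex.Re <<f, p>> = B^-1 * X.
  rewrite /p ip_sumr raddf_sum /X mulr_sumr; apply: eq_bigr => i _.
  by rewrite ipZr conjcM conjc_real -mulrA (mulrC (conjc _)) mulcJE -rmorphM.
have np : nsq p <= B^-1 * X.
  apply: le_trans (bessel_synthesis (fun k => B^-1%:C * <<f, v k>>) (ltW B0) _) _.
    by move=> h; exact: bessel.
  under eq_bigr => i _ do rewrite normcM exprMn normc_real real_normK ?num_real//.
  rewrite -mulr_sumr expr2 !mulrA divff ?gt_eqF// mul1r.
  exact: lexx.
rewrite nsqB Re_p.
have : B^-1 * (a * nsq f) <= B^-1 * X by rewrite ler_wpM2l// invr_ge0 ltW.
have -> : (1 - a / B) * nsq f = nsq f - B^-1 * (a * nsq f) by ring.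
lra.
Qed.

Lemma combination_cat A s s' :
  combination A (s ++ s') = combination A s + combination A s'.
Proof. by rewrite /combination big_cat. Qed.

(** Iterating [combination_step] on the residual gives geometric decay of ratio [1 - a / B], each
    iterate being a finite combination. *)
Lemma combination_approx A (a B : R) f (e : R) : 0 < a -> a < B -> 0 < e ->
  lower_frame g A a ->
  (forall h s, uniq s -> \sum_(k <- s) normc <<h, (A *m iv k) ~> g>> ^+ 2 <= B * nsq h) ->
  exists s, nsq (f - combination A s) <= e.
Proof.
move=> a0 aB e0 frameA bessel; have B0 : 0 < B by exact: lt_trans aB.
pose q := 1 - a / B.
have q0 : 0 <= q by rewrite subr_ge0 ler_pdivrMr// mul1r ltW.
have q1 : q < 1 by rewrite ltrBlDr ltrDl divr_gt0.
have iter N : exists s, nsq (f - combination A s) <= q ^+ N * nsq f.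
  elim: N => [|N [s hs]].
    by exists [::]; rewrite /combination big_nil subr0 expr0 mul1r.
  have [s' hs'] := combination_step (f - combination A s) a0 aB frameA bessel.
  exists (s ++ s'); rewrite combination_cat opprD addrA.
  by apply: le_trans hs' _; rewrite exprS -mulrA ler_wpM2l.
have : (fun N => q ^+ N * nsq f) @ \oo --> (0 * nsq f : R).
  apply: cvgMl; apply: cvg_expr; by rewrite ger0_norm.
rewrite mul0r => /cvgrPdist_lt/(_ _ e0)[N _ /(_ N (leqnn N))].
rewrite sub0r normrN ger0_norm; last by rewrite mulr_ge0 ?exprn_ge0 ?nsq_ge0.
move=> /ltW h; have [s hs] := iter N; exists s; exact: le_trans hs h.
Qed.

End span.

(** * Rational approximation of matrices *)

Section determinant.
Variables (R : realType) (n : nat).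
Implicit Types (A : 'M[R]_n).

Lemma det_continuous : continuous (fun A : 'M[R]_n => \det A).
Proof.
have cD : continuous (fun x : R^o * R^o => x.1 + x.2).
  by move=> x; apply: cvgD; [exact: cvg_fst|exact: cvg_snd].
have cM : continuous (fun x : R^o * R^o => x.1 * x.2 : R^o).
  by move=> x; apply: cvgM; [exact: cvg_fst|exact: cvg_snd].
move=> A; rewrite /determinant.
apply: (@cvg_big _ _ _ _ _ cD _ (nbhs A)) => s _.
apply: (@cvgM _ _ (nbhs A)); first exact: (@cvg_cst R^o).
by apply: (@cvg_big _ _ _ _ _ cM _ (nbhs A)) => i _; exact: coord_continuous.
Qed.

(* Integer approximation of q A determines a rational matrix close to A. *)
Lemma rational_approx A (dl : R) : 1 < `|\det A| -> 0 < dl ->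
  exists (q : nat) (K : 'M[int]_n), [/\ (0 < q)%N,
    `|q%:R^-1 *: map_mx intr K - A| < dl & (q ^ n < absz (\det K))%N].
Proof.
move=> dA dl0.
have := @det_continuous A; move=> /cvgrPdist_lt/(_ (`|\det A| - 1)).
rewrite subr_gt0 => /(_ dA); rewrite -nbhs_ballE => -[d d0 hd].
pose e := Num.min (dl / 2) (d / 2).
have e0 : 0 < e by rewrite lt_min !divr_gt0.
pose q := (Num.truncn e^-1).+1.
have q0 : 0 < q%:R :> R by [].
have qe : q%:R^-1 <= e.
  by rewrite invf_ple ?posrE// ltW// truncnS_gt.
pose K : 'M[int]_n := map_mx Num.floor (q%:R *: A).
have close i j : `|(q%:R^-1 *: map_mx intr K - A) i j| <= e.
  apply: le_trans qe; rewrite !mxE.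
  have -> : q%:R^-1 * (Num.floor (q%:R * A i j))%:~R - A i j =
     - (q%:R^-1 * (q%:R * A i j - (Num.floor (q%:R * A i j))%:~R)).
    by field; rewrite gt_eqF.
  set x := q%:R * _; rewrite normrN normrM gtr0_norm ?invr_gt0// ler_piMr ?invr_ge0//.
  by rewrite ger0_norm ?subr_ge0 ?floor_le// lerBlDl; have := floorD1_gt x; rewrite intrD => /ltW.
exists q, K; split => //.
  apply: (@le_lt_trans _ _ e).
    by rewrite [`|_|]mx_normrE; apply/bigmax_leP; split => [|[i j] _]; rewrite ?(ltW e0)//.
  have : e <= dl / 2 by rewrite ge_min lexx.
  lra.
have {}hd : `|\det A - \det (q%:R^-1 *: map_mx intr K)| < `|\det A| - 1.
  apply: hd; split => // i j; rewrite /ball /= distrC.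
  have := close i j; rewrite mxE [X in _ + X]mxE => h; apply: le_lt_trans h _.
  have : e <= d / 2 by rewrite ge_min lexx orbT.
  move: d0 => /=; lra.
have : 1 < `|\det (q%:R^-1 *: map_mx intr K : 'M[R]_n)|.
  have := lerB_dist (\det A) (\det (q%:R^-1 *: map_mx intr K)); lra.
rewrite detZ det_map_mx normrM normrX gtr0_norm ?invr_gt0// exprVn.
rewrite ltr_pdivlMl ?exprn_gt0// mulr1 -intr_norm -abszE.
by rewrite -natrX -[(absz _)%:~R]/((absz (\det K))%:R) ltr_nat.
Qed.

End determinant.

(** * The volume of a frame lattice is less than one *)

Section density.
Variables (R : realType) (n : nat) (S : tfsys R n) (g e : S).
Variables (m : 'cV[int]_n -> R) (M : R).
Hypothesis gm : majorized g m M.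
Hypothesis gc : tf_continuous g.
Implicit Types (f h : S) (z w : 'cV[R]_n) (A : 'M[R]_n).

Local Notation "<< f , h >>" := (@ip _ _ S f h) (at level 0, f, h at level 99).
Local Notation "z ~> f" := (@tf _ _ S z f) (at level 35, right associativity).
Local Notation nsq := (@nsq _ _ S).
Local Notation iv := (@intv R n).

Hypothesis e_on : forall p q, <<iv p ~> e, iv q ~> e>> = (p == q)%:R.

Lemma tf_sum I (s : seq I) z (F : I -> S) :
  z ~> \sum_(i <- s) F i = \sum_(i <- s) z ~> F i.
Proof.
elim/big_rec2: _ => [|i y x _ <-]; last by rewrite tfD.
by rewrite -(scale0r 0) tfZ !scale0r.
Qed.

Section rational.
Variables (L : 'M[int]_n) (dd : 'I_n -> nat) (q : nat) (a : R).
Hypotheses (uL : L \in unitmx) (dd0 : forall i, (0 < dd i)%N) (q0 : (0 < q)%N).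
Let A : 'M[R]_n := q%:R^-1 *: map_mx intr (L *m diag_mx (\row_i (dd i)%:Z)).
Hypotheses (a0 : 0 < a) (frameA : lower_frame g A a) (uA : A \in unitmx).
Let mm := (\prod_i dd i)%N.
(** The period in direction [i]: since [b i * dd i = q * mm], taking [b i] steps of [A] gives the
    integer vector [mm] times column [i] of [L]. *)
Let b i := (q * (mm %/ dd i))%N.

Let mm0 : (0 < mm)%N. Proof. by rewrite prodn_gt0. Qed.

Let dd_mm i : (dd i * (mm %/ dd i) = mm)%N.
Proof. by rewrite mulnC divnK// /mm (bigD1 i)//= dvdn_mulr. Qed.

Let b0 i : (0 < b i)%N.
Proof. by rewrite muln_gt0 q0 divn_gt0// -{1}(dd_mm i) leq_pmulr// -(ltn_pmul2l (dd0 i)) muln0 dd_mm. Qed.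

Let prod_b : (\prod_i b i * mm = q ^ n * mm ^ n)%N.
Proof.
transitivity (\prod_(i < n) (b i * dd i))%N; first by rewrite /mm -big_split.
rewrite -expnMn; transitivity (\prod_(i < n) (q * mm))%N; last first.
  by rewrite prod_nat_const card_ord.
by apply: eq_bigr => i _; rewrite /b -mulnA (mulnC _ (dd i)) dd_mm.
Qed.

Definition int_col N (p : 'cV['I_N]_n) : 'cV[int]_n := map_mx (fun i : 'I_N => (i : nat)%:Z) p.

Let shift_vec (y : 'I_n -> nat) : 'cV[int]_n := \col_i (b i * y i)%:Z.

(** The common periods of the frame lattice and the integer lattice. *)
Let shift_vecE y : A *m iv (shift_vec y) = iv (L *m (\col_i (mm * y i)%:Z)).
Proof.
rewrite /A -scalemxAl -intv_mulmx -mulmxA.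
have -> : diag_mx (\row_i (dd i)%:Z) *m shift_vec y = q%:Z *: \col_i (mm * y i)%:Z.
  apply/colP => i; rewrite mul_diag_mx !mxE /b -{2}(dd_mm i) !PoszM; ring.
rewrite -scalemxAr; apply/colP => i; rewrite !mxE intrM mulrA mulVf ?mul1r ?mxE//.
by rewrite pnatr_eq0 -lt0n.
Qed.

Section box.
Variables (T rho : nat) (e0 : R) (s_ : 'cV['I_mm]_n -> seq ('cV[int]_n * R[i])).
Hypothesis rho0 : (0 < rho)%N.
Hypothesis s_close : forall r, nsq (iv (L *m int_col r) ~> e - combination g A (s_ r)) <= e0.
Hypothesis s_box : forall r x, x \in s_ r -> x.1 \in ibox n T.

(** A box of lattice indices: [rho] periods in each direction, with a margin [T] at both ends for
    the combinations [s_]. *)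
Let K := {dffun forall i : 'I_n, 'I_(b i * rho + T.*2)}.
Let kvec (ka : K) : 'cV[int]_n := \col_i ((ka i : nat)%:Z - T%:Z).
Let u (ka : K) : S := (A *m iv (kvec ka)) ~> g.

Let inspan (x : S) := exists C : K -> R[i], x = \sum_ka C ka *: u ka.

Let inspan_u (k : 'cV[int]_n) : (forall i, - T%:Z <= k i ord0 < (b i * rho + T)%:Z) ->
  inspan ((A *m iv k) ~> g).
Proof.
move=> hk.
have lt i : (absz (k i ord0 + T%:Z)%R < b i * rho + T.*2)%N 
    by move: (hk i); move: (k i ord0) (b i * rho)%N => x y /andP[h1 h2]; lia.
pose ka : K := [ffun i => Ordinal (lt i)].
exists (fun l => (l == ka)%:R); rewrite (bigD1 ka)//= eqxx scale1r big1 ?addr0.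
  congr (_ ~> _); congr (_ *m intv _ _); apply/colP => i; rewrite mxE ffunE /=.
  by move: (hk i); move: (k i ord0) (b i * rho)%N => x y /andP[h1 h2]; lia.
by move=> l /negPf ->; rewrite scale0r.
Qed.

Let inspanD x y : inspan x -> inspan y -> inspan (x + y).
Proof.
move=> [C ->] [C' ->]; exists (fun k => C k + C' k); rewrite -big_split.
by apply: eq_bigr => k _; rewrite scalerDl.
Qed.

Let inspanZ c x : inspan x -> inspan (c *: x).
Proof.
move=> [C ->]; exists (fun k => c * C k); rewrite scaler_sumr.
by apply: eq_bigr => k _; rewrite scalerA.
Qed.

Let inspan0 : inspan 0.
Proof. by exists (fun _ => 0); rewrite big1// => k _; rewrite scale0r. Qed.

(** Euclidean division writes [p] as [mm y + r]. Shifting by the common period of [y] carries the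
    approximation of the vector of [r] to that of [p] with the same error, and its indices stay
    inside the box. *)
Let approx (p : 'cV['I_(rho * mm)]_n) : exists C : K -> R[i],
  nsq (iv (L *m int_col p) ~> e - \sum_ka C ka *: u ka) <= e0.
Proof.
pose y i := (p i ord0 %/ mm)%N.
have yrho i : (y i < rho)%N by rewrite ltn_divLR// ltn_ord.
have rlt i : (p i ord0 %% mm < mm)%N by rewrite ltn_pmod.
pose r : 'cV['I_mm]_n := \col_i Ordinal (rlt i).
have pE : int_col p = (\col_i (mm * y i)%:Z) + int_col r.
  apply/colP => i; rewrite !mxE /= -PoszD; congr Posz.
  by rewrite [(mm * _)%N]mulnC; exact: divn_eq.
have [c c1 hc] := tf_comp S (A *m iv (shift_vec y)) (iv (L *m int_col r)).
have c_neq0 : c != 0 by apply: contra_eq_neq c1 => ->; rewrite normc0 eq_sym oner_eq0.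
have sp : inspan (c^-1 *: ((A *m iv (shift_vec y)) ~> combination g A (s_ r))).
  apply: inspanZ; rewrite /combination tf_sum big_seq.
  apply: big_ind => // x xs; rewrite tfZ; apply: inspanZ.
  have [c' _ ->] := tf_comp S (A *m iv (shift_vec y)) (A *m iv x.1).
  apply: inspanZ; rewrite -mulmxDr -intvD; apply: inspan_u => i; rewrite !mxE.
  have := s_box xs; rewrite mem_ibox => /forallP/(_ i); rewrite ler_norml => /andP[h1 h2].
  have : (b i * y i + b i <= b i * rho)%N by rewrite -mulnSr leq_mul2l yrho orbT.
  move: (b0 i) h1 h2; move: (x.1 i ord0) (b i * y i)%N (b i * rho)%N (b i) => z v w t.
  by move=> *; apply/andP; split; lia.
have [C hC] := sp; exists C; rewrite -hC.
have -> : iv (L *m int_col p) ~> e =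
    c^-1 *: ((A *m iv (shift_vec y)) ~> (iv (L *m int_col r) ~> e)).
  by rewrite hc scalerA mulVf// scale1r pE mulmxDr intvD shift_vecE.
by rewrite -scalerBr -tfB nsqZ normcV c1 invr1 expr1n mul1r nsq_tf.
Qed.

Lemma box_dimension_count :
  ((rho * mm) ^ n)%:R * (1 - e0) <= (\prod_i (b i * rho + T.*2))%:R :> R.
Proof.
pose P := #|{: 'cV['I_(rho * mm)]_n}|; pose N := #|{: K}|.
have /choice[C hC] := approx.
have key : P%:R * (1 - e0) <= N%:R :> R.
  apply: (@dimension_count R n S P N
    (fun i => iv (L *m int_col (enum_val i)) ~> e) (fun k => u (enum_val k))
    (\matrix_(i, k) C (enum_val i) (enum_val k)) e0) => [p r|p].
    rewrite e_on; congr (nat_of_bool _)%:R; apply/eqP/eqP => [h|->//].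
    apply: enum_val_inj; apply/matrixP => i j; apply/val_inj.
    have /matrixP/(_ i j) : int_col (enum_val p) = int_col (enum_val r).
      by rewrite -(mulKmx uL (int_col _)) h mulKmx.
    by rewrite !mxE => -[].
  apply: le_trans (hC (enum_val p)).
  rewrite le_eqVlt; apply/orP; left; apply/eqP; congr (nsq (_ - _)).
  rewrite [RHS](reindex_onto (@enum_val _ {: K}) enum_rank) /=; last by move=> k _; rewrite enum_rankK.
  under [LHS]eq_bigr => k _ do rewrite mxE.
  by apply: eq_bigl => k; rewrite enum_valK eqxx.
move: key; have -> : P = ((rho * mm) ^ n)%N by rewrite /P card_mx card_ord muln1.
have -> // : N = (\prod_i (b i * rho + T.*2))%N.
rewrite /N card_dep_ffun foldrE big_map big_enum /=.
by apply: eq_bigr => i _; rewrite card_ord.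
Qed.

End box.

Lemma expr_add1_le (x : R) k : 0 <= x <= 1 -> (1 + x) ^+ k <= 1 + 3 ^+ k * x.
Proof.
move=> /andP[x0 x1]; elim: k => [|k IH]; first by rewrite !expr0 mul1r lerDl.
rewrite exprS [in leRHS]exprS.
apply: le_trans (ler_wpM2l _ IH) _; first by rewrite addr_ge0.
have : 1 <= 3 ^+ k :> R by apply: exprn_ege1; rewrite ler1n.
move: (3 ^+ k) => c c1.
have : c * x * x <= c * x by rewrite ler_piMr// mulr_ge0//; lra.
have : x <= c * x by rewrite ler_peMl.
lra.
Qed.

(** If [mm > q ^ n], then [prod_b] forces the product of the [b i] below [mm ^ n], by at least 1 as
    these are integers. But [box_dimension_count], divided by [rho ^ n], says in the limit that this
    product is at least [mm ^ n * (1 - e0)]. *)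
Lemma rational_density : (mm <= q ^ n)%N.
Proof.
rewrite leqNgt; apply/negP => qmm.
have bQ : (\prod_i b i < mm ^ n)%N.
  by rewrite -(ltn_pmul2r mm0) prod_b mulnC ltn_pmul2l// expn_gt0 mm0.
pose Q := (mm ^ n)%N; have Q0 : (0 < Q)%N by rewrite expn_gt0 mm0.
(* So [Q * e0] is 1/2, half of the integer gap. *)
pose e0 : R := (2 * Q%:R)^-1.
have QR0 : 0 < Q%:R :> R by rewrite ltr0n.
have e00 : 0 < e0 by rewrite invr_gt0 mulr_gt0.
have [N _ sA] := unit_spaced uA.
pose B := (N.*2.+1 ^ n)%:R * M + a + 1.
have M0 := majorant_ge0 gm.
have aB : a < B.
  by rewrite /B -addrA ltr_wpDl ?mulr_ge0// ltrDl.
have /choice[s_ hs] : forall r : 'cV['I_mm]_n, exists s,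
    nsq (iv (L *m int_col r) ~> e - combination g A s) <= e0.
  move=> r; apply: (combination_approx _ a0 aB e00 frameA) => h s us.
  apply: le_trans (lattice_bessel gm h sA us) _.
  by rewrite ler_wpM2r ?nsq_ge0// /B -addrA lerDl addr_ge0// ltW.
have [T hT] := ibox_sub (flatten [seq [seq x.1 | x <- s_ r] | r <- enum {: 'cV['I_mm]_n}]).
have s_box r x : x \in s_ r -> x.1 \in ibox n T.
  move=> xs; apply: hT; apply/flattenP; exists [seq x.1 | x <- s_ r]; last exact: map_f.
  by apply: (map_f (fun r => [seq x.1 | x <- s_ r])); rewrite mem_enum.
(* Large enough for the margins to be a fraction [x] of [rho], with [(1 + x) ^+ n <= 1 + 1 / (4 Q)];
   this uses up at most 1/4 of the gap. *)
pose rho := (T.*2 * (4 * Q * 3 ^ n)).+1.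
have := @box_dimension_count T rho e0 s_ isT hs s_box.
apply/negP; rewrite -ltNge.
pose x : R := (4 * Q * 3 ^ n)%:R^-1.
have X0 : 0 < (4 * Q * 3 ^ n)%:R :> R by rewrite ltr0n !muln_gt0 Q0 expn_gt0.
have x0 : 0 < x by rewrite invr_gt0.
have x1 : x <= 1 by rewrite invf_le1// ler1n -(ltr0n R).
have rho0 : 0 < rho%:R :> R by [].
have Tx : T.*2%:R <= rho%:R * x.
  by rewrite ler_pdivlMr// -natrM ler_nat /rho leqnSn.
have h1 : (\prod_i (b i * rho + T.*2))%:R <= (\prod_i b i)%:R * (rho%:R ^+ n * (1 + x) ^+ n) :> R.
  rewrite -exprMn mulrDr mulr1 -[X in _ ^+ X](card_ord n) -prodr_const !natr_prod -big_split /=.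
  apply: ler_prod => i _; rewrite ler0n natrD natrM mulrDr lerD2l /=.
  by apply: le_trans Tx _; rewrite ler_peMl ?ler1n ?b0// mulr_ge0// ltW.
apply: le_lt_trans h1 _.
have h2 : (\prod_i b i)%:R <= Q%:R - 1 :> R.
  by rewrite lerBrDr natr1 ler_nat.
have h3 : (1 + x) ^+ n <= 1 + 4^-1 / Q%:R.
  apply: le_trans (expr_add1_le _ _) _; first by rewrite x1 ltW.
  rewrite lerD2l /x !natrM natrX; rewrite le_eqVlt; apply/orP; left; apply/eqP.
  by field; rewrite gt_eqF//= expf_neq0// pnatr_eq0.
have rn0 : 0 < rho%:R ^+ n :> R by rewrite exprn_gt0.
have -> : ((rho * mm) ^ n)%:R = rho%:R ^+ n * Q%:R :> R by rewrite expnMn natrM natrX.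
rewrite mulrCA -mulrA ltr_pM2l//.
apply: le_lt_trans (ler_pM _ _ h2 h3) _ => //.
  by rewrite exprn_ge0// addr_ge0// ltW.
have -> : Q%:R * (1 - e0) = Q%:R - 2^-1 by rewrite /e0; field; rewrite gt_eqF.
have -> : (Q%:R - 1) * (1 + 4^-1 / Q%:R) = Q%:R - 1 + 4^-1 - 4^-1 / Q%:R :> R.
  by field; rewrite gt_eqF.
have : 0 <= 4^-1 / Q%:R :> R by rewrite divr_ge0.
lra.
Qed.

End rational.

Hypothesis gt : near_tight g.

(** Openness does two things: it excludes [|det A| = 1], because a slight dilation would exceed 1,
    and it makes the matrix rational. Smith normal form then replaces the lattice by a superlattice
    to which [rational_density] applies. *)
Lemma lower_frame_det A (a : R) : (0 < n)%N -> A \in unitmx -> 0 < a ->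
  lower_frame g A a -> `|\det A| < 1.
Proof.
move=> n0 uA a0 frameA; rewrite ltNge; apply/negP => dA.
have [dl dl0 hdl] := lower_frame_open gm gc gt uA a0 frameA.
have [t t0 ht] : exists2 t : R, 0 < t & t * `|A| <= dl / 2.
  by apply: small_coeff => //; rewrite divr_gt0.
have dA1 : 1 < `|\det ((1 + t) *: A)|.
  have t1 : 1 < 1 + t by rewrite ltrDl.
  rewrite detZ normrM normrX gtr0_norm; last by rewrite (lt_trans _ t1).
  have h : 1 < (1 + t) ^+ n by rewrite exprn_egt1// -lt0n.
  by apply: lt_le_trans h _; rewrite ler_peMr// exprn_ge0// ltW// (lt_trans _ t1).
have [q [K [q0 close detK]]] := rational_approx dA1 (divr_gt0 dl0 (ltr0Sn R 1)).
have {}close : `|q%:R^-1 *: map_mx intr K - A| < dl.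
  rewrite -(subrKA ((1 + t) *: A)); apply: le_lt_trans (ler_normD _ _) _.
  rewrite scalerDl scale1r.
  have -> : A + t *: A - A = t *: A by rewrite addrAC subrr add0r.
  by rewrite normrZ gtr0_norm//; move: close; rewrite scalerDl scale1r; lra.
have [uK [a' a'0 frameK]] := hdl _ close.
have [L uL [Rm uR [d _ KE]]] := int_Smith_normal_form K.
pose dd (i : 'I_n) := absz d`_i.
(* Signs and the right unimodular factor are moved into [Sg], so that the diagonal part has natural
   entries. *)
pose Sg : 'M[int]_n := diag_mx (\row_i sgz d`_i) *m Rm.
have KE' : K = L *m diag_mx (\row_i (dd i)%:Z) *m Sg.
  rewrite KE /Sg mulmxA; congr (_ *m _); rewrite -mulmxA; congr (_ *m _).
  apply/matrixP => i j; rewrite mul_diag_mx !mxE /dd.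
  have [->|ij] := eqVneq i j; last by rewrite val_eqE (negPf ij) !mulr0n mulr0.
  by rewrite eqxx !mulr1n mulrC -intEsg.
have AE : q%:R^-1 *: map_mx intr K =
    (q%:R^-1 *: map_mx intr (L *m diag_mx (\row_i (dd i)%:Z))) *m map_mx intr Sg :> 'M[R]_n.
  by rewrite KE' map_mxM scalemxAl.
have unit_abs (X : 'M[int]_n) : X \in unitmx -> absz (\det X) = 1%N.
  by rewrite unitmxE => /orP[] /eqP ->.
(* Stated as an inequality, a sign being possibly 0 at this stage; positivity of all [dd i] then
   follows from [q ^ n < |det K|]. *)
have detKle : (absz (\det K) <= \prod_i dd i)%N.
  rewrite KE' /Sg !det_mulmx !abszM (unit_abs _ uL) (unit_abs _ uR) mul1n muln1.
  rewrite !det_diag !(big_morph absz abszM (erefl _ : absz 1 = 1%N)).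
  under eq_bigr => i _ do rewrite mxE absz_nat.
  rewrite -[leqRHS]muln1 leq_mul2l; apply/orP; right.
  apply: (big_ind (fun x => (x <= 1)%N)) => // [x y hx hy|i _].
    by rewrite -[1%N]/(1 * 1)%N leq_mul.
  by rewrite mxE; case: sgzP.
have dd0 i : (0 < dd i)%N.
  have : (0 < \prod_i dd i)%N by apply: leq_trans detKle; apply: leq_ltn_trans detK.
  by rewrite (bigD1 i)//= muln_gt0 => /andP[].
rewrite AE in uK frameK.
have uA3 := uK; rewrite unitmx_mul in uA3; have /andP[{}uA3 _] := uA3.
have := rational_density uL dd0 q0 a'0 (lower_frame_sub uK frameK) uA3.
by rewrite leqNgt => /negP; apply; apply: leq_trans detK detKle.
Qed.

End density.

(** * Measurability of operations on columns *)

Section column_measurability.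
Variable R : realType.
Implicit Types n : nat.

Lemma measurable_comp_coord d (T : measurableType d) n (f : T -> 'cV[R]_n) i :
  measurable_fun setT f -> measurable_fun setT (fun t => f t i ord0 : measurableTypeR R).
Proof. by move=> mf; exact: (measurableT_comp (measurable_coord i) mf). Qed.

Lemma measurable_addv d (T : measurableType d) n (f h : T -> 'cV[R]_n) :
  measurable_fun setT f -> measurable_fun setT h ->
  measurable_fun setT (fun t => f t + h t).
Proof.
move=> mf mh; apply: measurable_fun_coordP => i; under eq_fun do rewrite mxE.
by apply: measurable_funD; exact: measurable_comp_coord.
Qed.

Lemma measurable_oppv d (T : measurableType d) n (f : T -> 'cV[R]_n) :
  measurable_fun setT f -> measurable_fun setT (fun t => - f t).
Proof.
move=> mf; apply: measurable_fun_coordP => i; under eq_fun do rewrite mxE.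
by apply: measurableT_comp => //; exact: measurable_comp_coord.
Qed.

Lemma measurable_subv d (T : measurableType d) n (f h : T -> 'cV[R]_n) :
  measurable_fun setT f -> measurable_fun setT h ->
  measurable_fun setT (fun t => f t - h t).
Proof. by move=> mf mh; apply: measurable_addv => //; exact: measurable_oppv. Qed.

Lemma measurable_dotv d (T : measurableType d) n (f h : T -> 'cV[R]_n) :
  measurable_fun setT f -> measurable_fun setT h ->
  measurable_fun setT (fun t => dotv (f t) (h t)).
Proof.
move=> mf mh; rewrite /dotv; apply: measurable_sum => i.
by apply: measurable_funM; exact: measurable_comp_coord.
Qed.

Lemma measurable_col_mx d (T : measurableType d) m n (f : T -> 'cV[R]_m) (h : T -> 'cV[R]_n) :
  measurable_fun setT f -> measurable_fun setT h ->
  measurable_fun setT (fun t => col_mx (f t) (h t)).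
Proof.
move=> mf mh; apply: measurable_fun_coordP => i; case: (split_ordP i) => j ->.
- under eq_fun do rewrite col_mxEu; exact: measurable_comp_coord.
- under eq_fun do rewrite col_mxEd; exact: measurable_comp_coord.
Qed.

Lemma measurable_usubmx d (T : measurableType d) m n (f : T -> 'cV[R]_(m + n)) :
  measurable_fun setT f -> measurable_fun setT (fun t => usubmx (f t)).
Proof.
move=> mf; apply: measurable_fun_coordP => i; under eq_fun do rewrite mxE.
exact: measurable_comp_coord.
Qed.

Lemma measurable_dsubmx d (T : measurableType d) m n (f : T -> 'cV[R]_(m + n)) :
  measurable_fun setT f -> measurable_fun setT (fun t => dsubmx (f t)).
Proof.
move=> mf; apply: measurable_fun_coordP => i; under eq_fun do rewrite mxE.
exact: measurable_comp_coord.
Qed.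

End column_measurability.

(** * Measure-preserving changes of variables *)

Section transport.
Local Open Scope ereal_scope.
Context d1 d2 (X : measurableType d1) (Y : measurableType d2) (R : realType).
Variables (mu : {measure set X -> \bar R}) (nu : {measure set Y -> \bar R}).
Variable phi : X -> Y.

(** Says that [phi] carries [mu] to [nu], in the form in which it is used; signed and complex
    integrals follow by splitting. *)
Definition transports := forall f : Y -> \bar R, measurable_fun setT f ->
  (forall y, 0 <= f y) -> \int[mu]_x f (phi x) = \int[nu]_y f y.

Lemma transports_integral (f : Y -> \bar R) : transports -> measurable_fun setT f ->
  \int[mu]_x f (phi x) = \int[nu]_y f y.
Proof.
move=> tr mf; rewrite integralE [RHS]integralE; congr (_ - _).
- rewrite -tr//; last exact: measurable_funepos.
  by apply: eq_integral => x _; rewrite !funeposE.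
- rewrite -tr//; last exact: measurable_funeneg.
  by apply: eq_integral => x _; rewrite !funenegE.
Qed.

Lemma pushforward_transports : measurable_fun setT phi ->
  (forall A, measurable A -> pushforward mu phi A = nu A) -> transports.
Proof.
move=> mphi e f mf f0.
transitivity (\int[pushforward mu phi]_y f y); first by rewrite (ge0_integral_pushforward mphi).
pose m : {measure set Y -> \bar R} :=
  measure_function_pushforward__canonical__measure_function_Measure mu mphi.
by rewrite -[LHS]/(\int[m]_y f y); apply: eq_measure_integral => A mA _; exact: e.
Qed.

End transport.

(** * Invariance of Lebesgue measure on columns, and Tonelli *)

Section lebesgue_columns.
Variable R : realType.
Local Open Scope ereal_scope.
Local Notation leb1 := (@lebesgue_measure R).
Local Notation lebn := (leb R).

Lemma transports_shift1 (a : R) : transports leb1 leb1 (fun x => (x + a)%R).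
Proof.
have ma : measurable_fun setT ((fun x => x + a)%R : measurableTypeR R -> measurableTypeR R).
  exact: measurable_funD.
apply: pushforward_transports => // A mA.
apply/esym/lebesgue_measure_unique => //= _ [[x y]] _ <-.
rewrite /pushforward (_ : _ @^-1` _ = `](x - a)%R, (y - a)%R]%classic); last first.
  by apply/seteqP; split => z /=; rewrite !in_itv /= ltrBlDr lerBrDr.
by rewrite !lebesgue_measure_itv/= !lte_fin ltrD2r -!EFinB opprB addrA subrK.
Qed.

Lemma transports_opp1 : transports leb1 leb1 (fun x => (- x)%R).
Proof.
have ma : measurable_fun setT (-%R : measurableTypeR R -> measurableTypeR R).
  exact: oppr_measurable.
by apply: pushforward_transports => // A mA; exact: lebesgue_measureN.
Qed.

Lemma ge0_integral_lebS n (f : 'cV[R]_n.+1 -> \bar R) :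
  measurable_fun setT f -> (forall y, 0 <= f y) ->
  \int[lebn n.+1]_x f x = \int[leb1]_a \int[lebn n]_v f (cons_col (a, v)).
Proof.
move=> mf f0.
have mfc : measurable_fun setT (fun p => f (cons_col p)).
  exact: (measurableT_comp mf (@measurable_cons_col R n)).
rewrite -[LHS]/(\int[pushforward (leb1 \x lebn n) (@cons_col R n)]_x f x).
rewrite (ge0_integral_pushforward (@measurable_cons_col R n))//.
by rewrite (fubini_tonelli1 (fun p => f (cons_col p))).
Qed.


Lemma measurable_lebS_inner n (f : 'cV[R]_n.+1 -> \bar R) :
  measurable_fun setT f -> (forall y, 0 <= f y) ->
  measurable_fun setT (fun a => \int[lebn n]_v f (cons_col (a, v))).
Proof.
move=> mf f0.
have mfc : measurable_fun setT (fun p => f (cons_col p)).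
  exact: (measurableT_comp mf (@measurable_cons_col R n)).
exact: (measurable_fun_fubini_tonelli_F (fun p => f (cons_col p))).
Qed.

Lemma transports_lebS n (p : R -> R) (q : 'cV[R]_n -> 'cV[R]_n) :
  transports leb1 leb1 p -> transports (lebn n) (lebn n) q ->
  measurable_fun setT (p : measurableTypeR R -> measurableTypeR R) -> measurable_fun setT q ->
  transports (lebn n.+1) (lebn n.+1)
    (fun x => cons_col (p (uncons_col x).1, q (uncons_col x).2)).
Proof.
move=> tp tq mp mq f mf f0.
have mphi : measurable_fun setT
    (fun x : 'cV[R]_n.+1 => cons_col (p (uncons_col x).1, q (uncons_col x).2)).
  apply: (measurableT_comp (@measurable_cons_col R n)); apply: measurable_fun_pair.
    apply: (measurableT_comp mp); apply: (measurableT_comp measurable_fst).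
    exact: measurable_uncons_col.
  apply: (measurableT_comp mq); apply: (measurableT_comp measurable_snd).
  exact: measurable_uncons_col.
rewrite ge0_integral_lebS//; last exact: (measurableT_comp mf mphi).
rewrite [RHS]ge0_integral_lebS//.
pose F a := \int[lebn n]_v f (cons_col (a, v)).
rewrite -[RHS](tp F); last 2 first.
- exact: measurable_lebS_inner.
- by move=> a; apply: integral_ge0.
apply: eq_integral => a _; rewrite /F.
under eq_integral do rewrite cons_colK.
rewrite (tq (fun v => f (cons_col (p a, v))))//.
apply: (measurableT_comp mf); apply: (measurableT_comp (@measurable_cons_col R n)).
exact: measurable_fun_pair.
Qed.

Lemma ge0_integral_leb0 (f : 'cV[R]_0 -> \bar R) :
  measurable_fun setT f -> \int[lebn 0]_x f x = f 0%R.
Proof. by move=> mf; rewrite /= integral_dirac// diracE mem_set// mul1e. Qed.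

Lemma transports_shift n (a : 'cV[R]_n) : transports (lebn n) (lebn n) (fun x => (x + a)%R).
Proof.
elim: n a => [|n IH] a.
  move=> f mf f0; rewrite !ge0_integral_leb0//; last first.
    by apply: (measurableT_comp mf); apply: measurable_addv.
  by congr f; apply/colP => -[].
have -> : (fun x => x + a)%R = (fun x : 'cV[R]_n.+1 =>
    cons_col (((uncons_col x).1 + (uncons_col a).1)%R, ((uncons_col x).2 + (uncons_col a).2)%R)).
  apply/funext => x; apply/colP => i.
  case: (unliftP ord0 i) => [j ->|->]; rewrite ?cons_col_lift ?cons_col_0 !mxE//=.
apply: (transports_lebS (p := (fun x => x + (uncons_col a).1)%R) (q := (fun v => v + (uncons_col a).2)%R)).
- exact: transports_shift1.
- exact: IH.
- exact: measurable_funD.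
- exact: measurable_addv.
Qed.

Lemma transports_opp n : transports (lebn n) (lebn n) (fun x => (- x)%R).
Proof.
elim: n => [|n IH].
  move=> f mf f0; rewrite !ge0_integral_leb0//; last first.
    by apply: (measurableT_comp mf); apply: measurable_oppv.
  by congr f; apply/colP => -[].
have -> : (fun x => - x)%R = (fun x : 'cV[R]_n.+1 =>
    cons_col ((- (uncons_col x).1)%R, (- (uncons_col x).2)%R)).
  apply/funext => x; apply/colP => i.
  case: (unliftP ord0 i) => [j ->|->]; rewrite ?cons_col_lift ?cons_col_0 !mxE//=.
apply: (transports_lebS (p := -%R) (q := -%R)).
- exact: transports_opp1.
- exact: IH.
- exact: oppr_measurable.
- exact: measurable_oppv.
Qed.

Lemma cons_col_mx m n a (x : 'cV[R]_m) (y : 'cV[R]_n) :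
  cons_col (a, col_mx x y) = col_mx (cons_col (a, x)) y :> 'cV[R]_(m + n).+1.
Proof.
apply/colP => i; case: (unliftP ord0 i) => [j ->|->].
  rewrite cons_col_lift /=; case: (split_ordP j) => k ->.
    rewrite col_mxEu; have -> : lift ord0 (lshift n k) = lshift n (lift ord0 k).
      exact/val_inj.
    by rewrite [RHS](@col_mxEu _ m.+1) cons_col_lift.
  rewrite col_mxEd; have -> : lift ord0 (rshift m k) = rshift m.+1 k by exact/val_inj.
  by rewrite [RHS](@col_mxEd _ m.+1).
rewrite cons_col_0; have -> : ord0 = lshift n ord0 :> 'I_(m.+1 + n) by exact/val_inj.
by rewrite [RHS](@col_mxEu _ m.+1) cons_col_0.
Qed.

Lemma measurable_col_mx_inner m n (f : 'cV[R]_(m + n) -> \bar R) :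
  measurable_fun setT f -> (forall y, 0 <= f y) ->
  measurable_fun setT (fun x => \int[lebn n]_y f (col_mx x y)).
Proof.
move=> mf f0; apply: (measurable_fun_fubini_tonelli_F (fun p => f (col_mx p.1 p.2))) => //.
by apply: (measurableT_comp mf); apply: measurable_col_mx.
Qed.

Lemma ge0_integral_col_mx m n (f : 'cV[R]_(m + n) -> \bar R) :
  measurable_fun setT f -> (forall y, 0 <= f y) ->
  \int[lebn (m + n)]_z f z = \int[lebn m]_x \int[lebn n]_y f (col_mx x y).
Proof.
elim: m f => [|m IH] f mf f0.
  rewrite ge0_integral_leb0; last exact: measurable_col_mx_inner.
  apply: eq_integral => y _; congr f; apply/colP => i; case: (split_ordP i) => j ->.
    by case: j.
  by rewrite col_mxEd; congr (y _ _); exact/val_inj.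
have mfc : measurable_fun setT (fun p => f (cons_col p)).
  exact: (measurableT_comp mf (@measurable_cons_col R (m + n))).
rewrite (ge0_integral_lebS (n := m + n))// ge0_integral_lebS//; last 2 first.
- exact: measurable_col_mx_inner.
- by move=> y; apply: integral_ge0.
apply: eq_integral => a _; rewrite IH//; last first.
  apply: (measurableT_comp mf); apply: (measurableT_comp (@measurable_cons_col R (m + n))).
  exact: measurable_fun_pair.
by under eq_integral => x _ do under eq_integral => y _ do rewrite cons_col_mx.
Qed.

Lemma transports_col_mx m n : transports (lebn m \x lebn n) (lebn (m + n))
  (fun p => col_mx p.1 p.2).
Proof.
move=> f mf f0; rewrite (fubini_tonelli1 (fun p => f (col_mx p.1 p.2)))//.
  by rewrite ge0_integral_col_mx.
by apply: (measurableT_comp mf); apply: measurable_col_mx.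
Qed.

Lemma ge0_integral_prod n (w : 'I_n -> R -> R) :
  (forall i, measurable_fun setT (w i)) -> (forall i x, (0 <= w i x)%R) ->
  \int[lebn n]_x (\prod_i w i (x i ord0))%:E =
    \prod_i \int[leb1]_x (w i x)%:E.
Proof.
elim: n w => [|n IH] w mw w0.
  under eq_integral do rewrite big_ord0.
  by rewrite big_ord0 ge0_integral_leb0.
have mprod k (v : 'I_k -> R -> R) : (forall i, measurable_fun setT (v i)) ->
    measurable_fun setT (fun x : 'cV[R]_k => (\prod_i v i (x i ord0))%:E).
  move=> mv; apply/measurable_EFinP; apply: measurable_prod => i _.
  exact: (measurableT_comp (mv i) (measurable_coord i)).
rewrite ge0_integral_lebS//; last 2 first.
- exact: mprod.
- by move=> y; rewrite lee_fin prodr_ge0.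
rewrite big_ord_recl -IH//.
have I0 : 0 <= \int[lebn n]_x (\prod_(i < n) w (lift ord0 i) (x i ord0))%:E.
  by apply: integral_ge0 => x _; rewrite lee_fin prodr_ge0.
transitivity (\int[leb1]_a ((w ord0 a)%:E *
    \int[lebn n]_x (\prod_(i < n) w (lift ord0 i) (x i ord0))%:E)); last first.
  rewrite ge0_integralZr//; first by apply/measurable_EFinP; exact: mw.
  by move=> x _; rewrite lee_fin; exact: w0.
apply: eq_integral => a _.
transitivity (\int[lebn n]_x ((w ord0 a)%:E * (\prod_(i < n) w (lift ord0 i) (x i ord0))%:E)).
  apply: eq_integral => x _; rewrite big_ord_recl cons_col_0 EFinM.
  by under eq_bigr do rewrite cons_col_lift.
rewrite ge0_integralZl//; first by apply: (mprod _ (fun i => w (lift ord0 i))) => i; exact: mw.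
  by move=> x _; rewrite lee_fin prodr_ge0.
by rewrite lee_fin.
Qed.

End lebesgue_columns.

(** * Tiling of space by cubes *)

Section cells.
Variables (R : realType) (n : nat) (eps : R).
Hypothesis eps0 : 0 < eps.
Local Open Scope ereal_scope.
Local Notation lebn := (leb R n).

Definition cube : set 'cV[R]_n := [set x | forall i, (0 <= x i ord0 < eps)%R].

Definition cell (k : 'cV[int]_n) : set 'cV[R]_n := [set x | cube (x - eps *: intv R k)%R].

Lemma cellP k x : cell k x <-> flv (eps^-1 *: x)%R = k.
Proof.
split=> [h|<-].
  apply: flvP => i; have := h i; rewrite !mxE => /andP[h1 h2].
  have -> : (eps^-1 * x i ord0 - (k i ord0)%:~R = eps^-1 * (x i ord0 - eps * (k i ord0)%:~R))%R.
    by rewrite mulrBr mulrA mulVf ?gt_eqF// mul1r.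
  by rewrite mulr_ge0 ?invr_ge0 ?(ltW eps0)//= ltr_pdivrMl// mulr1.
move=> i; have := flv_itv (eps^-1 *: x)%R i; rewrite !mxE => /andP[].
set z := Num.floor _; move=> h1 h2.
have -> : (x i ord0 - eps * z%:~R = eps * (eps^-1 * x i ord0 - z%:~R))%R.
  by rewrite mulrBr mulrA divff ?gt_eqF// mul1r.
by rewrite mulr_ge0 ?(ltW eps0)//= gtr_pMr.
Qed.

Lemma measurable_box (A : 'I_n -> set (measurableTypeR R)) :
  (forall i, measurable (A i)) -> measurable [set x : 'cV[R]_n | forall i, A i (x i ord0)].
Proof.
move=> mA.
rewrite (_ : [set x | _] = \bigcap_(i in [set: 'I_n])
    ((fun x : 'cV[R]_n => x i ord0 : measurableTypeR R) @^-1` A i)).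
  apply: fin_bigcap_measurable => // i _.
  by rewrite -[X in measurable X]setTI; exact: measurable_coord.
by apply/seteqP; split => x /= H i; [move=> _|]; apply: H.
Qed.

Lemma measurable_cube : measurable cube.
Proof.
have := @measurable_box (fun _ => `[0%R, eps[%classic) (fun _ => measurable_itv _).
by congr measurable; apply/seteqP; split => x /= h i; have := h i; rewrite in_itv.
Qed.

Lemma measurable_cell k : measurable (cell k).
Proof.
rewrite -[cell k](setTI) -[X in measurable X]/(setT `&` (fun x => x - eps *: intv R k)%R @^-1` cube).
by apply: measurable_subv => //; exact: measurable_cube.
Qed.

Lemma leb_cube : lebn cube = (eps ^+ n)%:E.
Proof.
transitivity (\prod_(i < n) lebesgue_measure (`[0%R, eps[%classic : set (measurableTypeR R))).
  by rewrite -leb_box.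
under eq_bigr do rewrite lebesgue_measure_itv /= lte_fin eps0 sube0.
by rewrite prodEFin prodr_const card_ord.
Qed.

Lemma ge0_integral_cell (f : 'cV[R]_n -> \bar R) k :
  measurable_fun setT f -> (forall x, 0 <= f x) ->
  \int[lebn]_(x in cell k) f x = \int[lebn]_(x in cube) f (x + eps *: intv R k)%R.
Proof.
move=> mf f0; rewrite integral_mkcond [RHS]integral_mkcond.
rewrite -(transports_shift (eps *: intv R k)).
- apply: eq_integral => x _; rewrite !patchE.
  suff -> : ((x + eps *: intv R k)%R \in cell k) = (x \in cube) by [].
  by apply/idP/idP; rewrite !inE /cell /= addrK.
- by apply/(measurable_restrictT _ _).1 => //; [exact: measurable_cell|exact: measurable_funTS].
- by move=> x; rewrite patchE; case: ifP.
Qed.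

Lemma cell_sumE (f : 'cV[R]_n -> \bar R) (s : seq 'cV[int]_n) :
  measurable_fun setT f -> (forall x, 0 <= f x) -> uniq s ->
  \sum_(k <- s) \int[lebn]_(x in cube) f (x + eps *: intv R k)%R =
  \int[lebn]_x (if flv (eps^-1 *: x)%R \in s then f x else 0).
Proof.
move=> mf f0 us.
under eq_bigr => k _ do rewrite -ge0_integral_cell// integral_mkcond.
rewrite -ge0_integral_sum//.
- apply: eq_integral => x _; case: ifPn => xs.
    rewrite (bigD1_seq _ xs us) /= patchE mem_set; last by apply/cellP.
    rewrite big1 ?adde0// => k kx; rewrite patchE memNset// => /cellP e.
    by rewrite e eqxx in kx.
  rewrite big_seq big1// => k ks; rewrite patchE memNset// => /cellP e.
  by rewrite e ks in xs.
- by move=> k; apply/(measurable_restrictT _ _).1 => //; [exact: measurable_cell|exact: measurable_funTS].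
- by move=> k x _; rewrite patchE; case: ifP.
Qed.

Lemma measurable_cells (f : 'cV[R]_n -> \bar R) (s : seq 'cV[int]_n) :
  measurable_fun setT f ->
  measurable_fun setT (fun x : 'cV[R]_n => if flv (eps^-1 *: x)%R \in s then f x else 0).
Proof.
move=> mf; apply: measurable_fun_ifT => //.
apply: (measurable_fun_bool true) => /=; rewrite setTI.
rewrite (_ : _ @^-1` _ = \bigcup_(k in [set k | k \in s]) cell k).
  by apply: fin_bigcup_measurable => [|k _]; [exact: finite_seq|exact: measurable_cell].
apply/seteqP; split => x /=.
  by move=> xs; exists (flv (eps^-1 *: x)%R) => //; apply/cellP.
by move=> [k ks /cellP ->].
Qed.

Lemma cell_sum_le (f : 'cV[R]_n -> \bar R) (s : seq 'cV[int]_n) :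
  measurable_fun setT f -> (forall x, 0 <= f x) -> uniq s ->
  \sum_(k <- s) \int[lebn]_(x in cube) f (x + eps *: intv R k)%R <= \int[lebn]_x f x.
Proof.
move=> mf f0 us; rewrite cell_sumE//; apply: ge0_le_integral => //.
- by move=> x _; case: ifP.
- exact: measurable_cells.
- by move=> x _; case: ifP.
Qed.

(** The finite unions of cells labelled by [ibox n N] exhaust space, and monotone convergence passes
    to the limit. *)
Lemma le_cell_sum (f : 'cV[R]_n -> \bar R) (c : \bar R) :
  measurable_fun setT f -> (forall x, 0 <= f x) ->
  (forall s, uniq s -> \sum_(k <- s) \int[lebn]_(x in cube) f (x + eps *: intv R k)%R <= c) ->
  \int[lebn]_x f x <= c.
Proof.
move=> mf f0 h.
pose F N x := if flv (eps^-1 *: x)%R \in undup (ibox n N) then f x else 0.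
have F0 N x : 0 <= F N x by rewrite /F; case: ifP.
have mF N : measurable_fun setT (F N) by exact: measurable_cells.
have ndF x : {homo (fun N => F N x) : N M / (N <= M)%N >-> N <= M}.
  move=> N M NM; rewrite /F !mem_undup; case: ifP => [xN|_]; last by case: ifP.
  rewrite ifT//; move: xN; rewrite !mem_ibox => /forallP h'; apply/forallP => i.
  by apply: le_trans (h' i) _; rewrite lez_nat.
have limF x : limn (F^~ x) = f x.
  apply/cvg_lim => //.
  have [T hT] := ibox_sub [:: flv (eps^-1 *: x)%R].
  apply: cvg_near_cst; exists T => // N /= TN; rewrite /F mem_undup ifT//.
  have := hT _ (mem_head _ _); rewrite !mem_ibox => /forallP h'; apply/forallP => i.
  by apply: le_trans (h' i) _; rewrite lez_nat.
under eq_integral => x _ do rewrite -limF.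
rewrite monotone_convergence//.
apply: lime_le.
  by apply: ereal_nondecreasing_is_cvgn => N M NM; apply: ge0_le_integral => // x _; exact: ndF.
by apply: nearW => N; rewrite -cell_sumE ?undup_uniq// h// undup_uniq.
Qed.

End cells.

(** * Integration of complex functions *)

Section complex_integral.
Context d (T : measurableType d) (R : realType).
Variable mu : {measure set T -> \bar R}.
Implicit Types f h : T -> R[i].

Definition cmeas f := measurable_fun setT (fun x => complex.Re (f x)) /\
  measurable_fun setT (fun x => complex.Im (f x)).

Definition cint f : R[i] :=
  (\int[mu]_x complex.Re (f x)) +i* (\int[mu]_x complex.Im (f x)).

Definition cintegrable f := cmeas f /\ (\int[mu]_x (normc (f x))%:E < +oo)%E.

Lemma cmeas_cst c : cmeas (fun _ => c).
Proof. by split; exact: measurable_cst. Qed.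

Lemma cmeasD f h : cmeas f -> cmeas h -> cmeas (fun x => f x + h x).
Proof.
move=> [f1 f2] [h1 h2]; split.
- under eq_fun do rewrite raddfD; exact: measurable_funD.
- under eq_fun do rewrite raddfD; exact: measurable_funD.
Qed.

Lemma cmeasM f h : cmeas f -> cmeas h -> cmeas (fun x => f x * h x).
Proof.
move=> [f1 f2] [h1 h2]; split.
- under eq_fun do rewrite Re_mulc; apply: measurable_funB; exact: measurable_funM.
- under eq_fun do rewrite Im_mulc; apply: measurable_funD; exact: measurable_funM.
Qed.

Lemma cmeas_conj f : cmeas f -> cmeas (fun x => conjc (f x)).
Proof.
move=> [f1 f2]; split.
- by under eq_fun do rewrite Re_conjc.
- by under eq_fun do rewrite Im_conjc; exact: measurable_funN.
Qed.

Lemma cmeas_real (u : T -> R) : measurable_fun setT u -> cmeas (fun x => (u x)%:C).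
Proof. by move=> mu'; split => //=; exact: measurable_cst. Qed.

Lemma cmeas_cis (u : T -> R) : measurable_fun setT u ->
  cmeas (fun x => cos (u x) +i* sin (u x)).
Proof.
move=> mu'; split => /=.
- by apply: measurableT_comp mu'; apply: continuous_measurable_fun; exact: continuous_cos.
- by apply: measurableT_comp mu'; apply: continuous_measurable_fun; exact: continuous_sin.
Qed.

Lemma measurable_normc f : cmeas f -> measurable_fun setT (fun x => normc (f x)).
Proof.
move=> [f1 f2].
have -> : (fun x => normc (f x)) =
    (fun x => Num.sqrt (complex.Re (f x) ^+ 2 + complex.Im (f x) ^+ 2)).
  by apply/funext => x; case: (f x).
apply: (@measurableT_comp _ _ _ _ _ _ (@Num.sqrt R)).
  by apply: continuous_measurable_fun; exact: sqrt_continuous.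
by apply: measurable_funD; exact: measurable_funX.
Qed.

Lemma measurable_normcE f : cmeas f -> measurable_fun setT (fun x => (normc (f x))%:E).
Proof. by move=> mf; apply/measurable_EFinP; exact: measurable_normc. Qed.

Lemma cintegrable_Re f : cintegrable f -> mu.-integrable setT (fun x => (complex.Re (f x))%:E).
Proof.
move=> [[f1 f2] foo]; apply/integrableP; split; first exact/measurable_EFinP.
apply: le_lt_trans foo; apply: ge0_le_integral => //.
- by apply: measurableT_comp => //; exact/measurable_EFinP.
- exact: measurable_normcE.
- by move=> x _; rewrite lee_fin ler_Re_normc.
Qed.

Lemma cintegrable_Im f : cintegrable f -> mu.-integrable setT (fun x => (complex.Im (f x))%:E).
Proof.
move=> [[f1 f2] foo]; apply/integrableP; split; first exact/measurable_EFinP.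
apply: le_lt_trans foo; apply: ge0_le_integral => //.
- by apply: measurableT_comp => //; exact/measurable_EFinP.
- exact: measurable_normcE.
- by move=> x _; rewrite lee_fin ler_Im_normc.
Qed.

Lemma le_cintegrable f (b : T -> \bar R) : cmeas f -> measurable_fun setT b ->
  (forall x, ((normc (f x))%:E <= b x)%E) -> (\int[mu]_x b x < +oo)%E -> cintegrable f.
Proof.
move=> mf mb fb boo; split=> //; apply: le_lt_trans boo; apply: ge0_le_integral => //.
- by move=> x _; rewrite lee_fin normc_ge0.
- exact: measurable_normcE.
Qed.

Lemma cintegrableZ c f : cintegrable f -> cintegrable (fun x => c * f x).
Proof.
move=> [mf foo].
apply: (@le_cintegrable _ (fun x => (normc c)%:E * (normc (f x))%:E)%E).
- by apply: cmeasM => //; exact: cmeas_cst.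
- by apply: emeasurable_funM; [exact: measurable_cst|exact: measurable_normcE].
- by move=> x; rewrite -EFinM lee_fin normcM.
rewrite ge0_integralZl//; first by rewrite lte_mul_pinfty// ?lee_fin ?normc_ge0.
all: first [exact: measurable_normcE|by move=> x _; rewrite lee_fin normc_ge0|by rewrite lee_fin normc_ge0].
Qed.

Lemma cintD f h : cintegrable f -> cintegrable h ->
  cint (fun x => f x + h x) = cint f + cint h.
Proof.
move=> fi hi; rewrite /cint; congr (_ +i* _).
- under eq_Rintegral do rewrite raddfD.
  by rewrite RintegralD//; exact: cintegrable_Re.
- under eq_Rintegral do rewrite raddfD.
  by rewrite RintegralD//; exact: cintegrable_Im.
Qed.

Lemma cintZ c f : cintegrable f -> cint (fun x => c * f x) = c * cint f.
Proof.
move=> fi; have [fR fI] := (cintegrable_Re fi, cintegrable_Im fi).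
have ZR (r : R) : mu.-integrable setT (fun x => (r * complex.Re (f x))%:E).
  by under eq_fun do rewrite EFinM; exact: integrableZl.
have ZI (r : R) : mu.-integrable setT (fun x => (r * complex.Im (f x))%:E).
  by under eq_fun do rewrite EFinM; exact: integrableZl.
apply/eqP; rewrite eq_complex /=; apply/andP; split; apply/eqP.
- under eq_Rintegral do rewrite Re_mulc.
  rewrite RintegralB//; [|exact: ZR|exact: ZI].
  by rewrite !RintegralZl//; case: (c).
- under eq_Rintegral do rewrite Im_mulc.
  rewrite RintegralD//; [|exact: ZI|exact: ZR].
  by rewrite !RintegralZl//; case: (c) => a b /=; rewrite addrC.
Qed.

Lemma cint_conj f : cintegrable f -> cint (fun x => conjc (f x)) = conjc (cint f).
Proof.
move=> fi; rewrite /cint; congr (_ +i* _).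
  by apply: eq_Rintegral => x _; case: (f x).
under eq_Rintegral do rewrite Im_conjc -mulN1r.
by rewrite RintegralZl ?mulN1r//; exact: cintegrable_Im.
Qed.

(** A unimodular constant [c] rotates the integral onto the positive axis, where it is the integral
    of the real part of [c * f]. *)
Lemma normc_cint_le f : cintegrable f -> ((normc (cint f))%:E <= \int[mu]_x (normc (f x))%:E)%E.
Proof.
move=> fi; have [mf foo] := fi.
have [->|z0] := eqVneq (cint f) 0.
  by rewrite normc0; apply: integral_ge0 => x _; rewrite lee_fin normc_ge0.
set z := cint f in z0 *.
have nz0 : normc z != 0 by apply: contra_neq z0; exact: eq0_normc.
pose c := conjc z * (normc z)^-1%:C.
have c1 : normc c = 1.
  by rewrite normcM normc_conj normc_real ger0_norm ?invr_ge0 ?normc_ge0// divff.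
have cz : cint (fun x => c * f x) = (normc z)%:C.
  rewrite cintZ// -/z /c mulrAC (mulrC (conjc z)) mulcJE -rmorphM /=.
  by rewrite expr2 -mulrA divff ?mulr1.
have gi := cintegrableZ c fi.
have e : (normc z)%:E = (\int[mu]_x (complex.Re (c * f x))%:E)%E.
  have /(congr1 (@complex.Re R)) := cz; rewrite /= => <-.
  rewrite /Rintegral fineK//; apply: integrable_fin_num => //; exact: cintegrable_Re gi.
rewrite e; apply: le_trans (lee_abs _) _.
apply: le_trans (le_abse_integral _ _ _) _ => //.
  by have [[m1 _] _] := gi; exact/measurable_EFinP.
apply: ge0_le_integral => //.
- by apply: measurableT_comp => //; have [[m1 _] _] := gi; exact/measurable_EFinP.
- exact: measurable_normcE.
- by move=> x _; rewrite lee_fin; apply: le_trans (ler_Re_normc _) _; rewrite normcM c1 mul1r.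
Qed.

End complex_integral.

Section complex_transport.
Context d1 d2 (X : measurableType d1) (Y : measurableType d2) (R : realType).
Variables (mu : {measure set X -> \bar R}) (nu : {measure set Y -> \bar R}).
Variable phi : X -> Y.
Hypotheses (mphi : measurable_fun setT phi) (tphi : transports mu nu phi).

Lemma cmeas_comp (f : Y -> R[i]) : cmeas f -> cmeas (fun x => f (phi x)).
Proof.
by move=> [f1 f2]; split; [exact: (measurableT_comp f1 mphi)|exact: (measurableT_comp f2 mphi)].
Qed.

Lemma cintegrable_transport (f : Y -> R[i]) : cintegrable nu f -> cintegrable mu (fun x => f (phi x)).
Proof.
move=> [mf foo]; split; first exact: cmeas_comp.
rewrite (tphi (f := fun y => (normc (f y))%:E))//; first exact: measurable_normcE.
by move=> y; rewrite lee_fin normc_ge0.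
Qed.

Lemma cint_transport (f : Y -> R[i]) : cmeas f -> cint mu (fun x => f (phi x)) = cint nu f.
Proof.
move=> [f1 f2]; rewrite /cint /Rintegral; congr (fine _ +i* fine _).
- by rewrite -(transports_integral (f := fun y => (complex.Re (f y))%:E) tphi)//; exact/measurable_EFinP.
- by rewrite -(transports_integral (f := fun y => (complex.Im (f y))%:E) tphi)//; exact/measurable_EFinP.
Qed.

End complex_transport.

(** * Fubini for complex functions *)

Section complex_fubini.
Context d1 d2 (T1 : measurableType d1) (T2 : measurableType d2) (R : realType).
Variables (m1 : {sigma_finite_measure set T1 -> \bar R}).
Variables (m2 : {sigma_finite_measure set T2 -> \bar R}).

Lemma normc_cint_leT d (T : measurableType d) (mu : {measure set T -> \bar R}) (f : T -> R[i]) :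
  cmeas f -> ((normc (cint mu f))%:E <= \int[mu]_x (normc (f x))%:E)%E.
Proof.
move=> mf; have [foo|] := boolP (\int[mu]_x (normc (f x))%:E < +oo)%E.
  exact: normc_cint_le.
by rewrite -leNgt leye_eq => /eqP ->; rewrite leey.
Qed.

Lemma measurable_Rint (f : T1 * T2 -> R) : measurable_fun setT f ->
  measurable_fun setT (fun x => \int[m2]_y f (x, y)).
Proof.
move=> mf; apply: measurableT_comp => //.
have mE : measurable_fun setT (EFin \o f) by exact/measurable_EFinP.
have -> : (fun x => \int[m2]_y (f (x, y))%:E)%E = (fun x =>
    \int[m2]_y (EFin \o f)^\+ (x, y) - \int[m2]_y (EFin \o f)^\- (x, y))%E.
  apply/funext => x; rewrite integralE; congr (_ - _)%E; apply: eq_integral => y _.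
    by rewrite !funeposE.
  by rewrite !funenegE.
apply: emeasurable_funB.
- apply: (measurable_fun_fubini_tonelli_F (EFin \o f)^\+%E) => //.
  exact: measurable_funepos.
- apply: (measurable_fun_fubini_tonelli_F (EFin \o f)^\-%E) => //.
  exact: measurable_funeneg.
Qed.

Lemma cmeas_cint (F : T1 * T2 -> R[i]) : cmeas F ->
  cmeas (fun x => cint m2 (fun y => F (x, y))).
Proof.
move=> [F1 F2]; split => /=.
- exact: (measurable_Rint (f := fun z => complex.Re (F z))).
- exact: (measurable_Rint (f := fun z => complex.Im (F z))).
Qed.

(** The inner real integral is the [fine] of an extended one, which is finite only almost
    everywhere; hence the comparison through [ae_eq_integral]. *)
Lemma Rint_prod1 (f : T1 * T2 -> R) : (m1 \x m2)%E.-integrable setT (EFin \o f) ->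
  \int[m1]_x \int[m2]_y f (x, y) = fine (\int[(m1 \x m2)%E]_z (f z)%:E)%E.
Proof.
move=> fi; rewrite -(integral12_prod_meas1 fi) /Rintegral; congr fine.
have Fi := integrable_fubini_F fi.
apply: ae_eq_integral => //.
- have mf := measurable_int _ fi.
  apply/measurable_EFinP; apply: (measurable_Rint (f := f)); exact/measurable_EFinP.
- exact: measurable_int Fi.
apply: filterS (integrable_ae measurableT Fi) => x /= h _.
by rewrite fineK// h.
Qed.

Lemma Rint_prod2 (f : T1 * T2 -> R) : (m1 \x m2)%E.-integrable setT (EFin \o f) ->
  measurable_fun setT (fun y => \int[m1]_x f (x, y)) ->
  \int[m2]_y \int[m1]_x f (x, y) = fine (\int[(m1 \x m2)%E]_z (f z)%:E)%E.
Proof.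
move=> fi mg; rewrite -(integral21_prod_meas1 fi) /Rintegral; congr fine.
have mf := measurable_int _ fi.
have Fi : m2.-integrable setT (fun y => \int[m1]_x (f (x, y))%:E)%E.
  apply/integrableP; split; first exact: (measurable_fubini_G fi).
  apply: le_lt_trans ((integrable21ltyP m1 m2 mf).1 fi).
  apply: ge0_le_integral => //.
  - by apply: measurableT_comp => //; exact: (measurable_fubini_G fi).
  - apply: (measurable_fun_fubini_tonelli_G (fun z => `|(f z)%:E|)%E) => //.
    by apply: measurableT_comp.
  - move=> y _; apply: le_abse_integral => //.
    by apply: (measurableT_comp mf); exact: measurable_fun_pair.
apply: ae_eq_integral => //.
- exact/measurable_EFinP.
- exact: measurable_int Fi.
apply: filterS (integrable_ae measurableT Fi) => x /= h _.
by rewrite fineK// h.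
Qed.

Lemma cintegrable_prodP (F : T1 * T2 -> R[i]) : cmeas F ->
  (\int[m1]_x \int[m2]_y (normc (F (x, y)))%:E < +oo)%E -> cintegrable (m1 \x m2)%E F.
Proof.
move=> mF Foo; split=> //; rewrite (fubini_tonelli1 (fun z => (normc (F z))%:E))//.
- exact: measurable_normcE.
- by move=> z; rewrite lee_fin normc_ge0.
Qed.

End complex_fubini.

Section complex_fubini_swap.
Context d1 d2 (T1 : measurableType d1) (T2 : measurableType d2) (R : realType).
Variables (m1 : {sigma_finite_measure set T1 -> \bar R}).
Variables (m2 : {sigma_finite_measure set T2 -> \bar R}).

Lemma measurable_Rint2 (f : T1 * T2 -> R) : measurable_fun setT f ->
  measurable_fun setT (fun y => \int[m1]_x f (x, y)).
Proof.
move=> mf; apply: (measurable_Rint m1 (f := fun z => f (z.2, z.1))).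
by apply: (measurableT_comp mf); exact: measurable_fun_pair.
Qed.

Lemma cint_fubini (F : T1 * T2 -> R[i]) : cmeas F ->
  (\int[m1]_x \int[m2]_y (normc (F (x, y)))%:E < +oo)%E ->
  cint m1 (fun x => cint m2 (fun y => F (x, y))) =
  cint m2 (fun y => cint m1 (fun x => F (x, y))).
Proof.
move=> mF Foo; have Fi := cintegrable_prodP mF Foo; have [F1 F2] := mF.
rewrite {1 3}/cint /=; congr (_ +i* _).
- have h := cintegrable_Re Fi.
  rewrite (Rint_prod1 (f := fun z => complex.Re (F z)) h).
  by rewrite (Rint_prod2 (f := fun z => complex.Re (F z)) h)//; exact: (measurable_Rint2 (f := fun z => complex.Re (F z))).
- have h := cintegrable_Im Fi.
  rewrite (Rint_prod1 (f := fun z => complex.Im (F z)) h).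
  by rewrite (Rint_prod2 (f := fun z => complex.Im (F z)) h)//; exact: (measurable_Rint2 (f := fun z => complex.Im (F z))).
Qed.

Lemma cintegrable_cint (F : T1 * T2 -> R[i]) : cmeas F ->
  (\int[m1]_x \int[m2]_y (normc (F (x, y)))%:E < +oo)%E ->
  cintegrable m1 (fun x => cint m2 (fun y => F (x, y))).
Proof.
move=> mF Foo; apply: le_cintegrable Foo.
- exact: cmeas_cint.
- apply: (measurable_fun_fubini_tonelli_F (fun z => (normc (F z))%:E)) => //.
    exact: measurable_normcE.
  by move=> z; rewrite lee_fin normc_ge0.
- move=> x; apply: normc_cint_leT.
  by apply: (cmeas_comp (phi := fun y => (x, y))) => //; exact: measurable_fun_pair.
Qed.

End complex_fubini_swap.

(** * Unimodular phases and dot products *)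

Section cis.
Variable R : realType.

Definition cis (a : R) : R[i] := cos a +i* sin a.

Lemma cisD a b : cis (a + b) = cis a * cis b.
Proof.
rewrite /cis cosD sinD; apply/eqP; rewrite eq_complex /=.
by apply/andP; split; apply/eqP; ring.
Qed.

Lemma cis0 : cis 0 = 1.
Proof. by rewrite /cis cos0 sin0. Qed.

Lemma conjc_cis a : conjc (cis a) = cis (- a).
Proof. by rewrite /cis cosN sinN. Qed.

Lemma normc_cis a : normc (cis a) = 1.
Proof. by rewrite /= cos2Dsin2 sqrtr1. Qed.

End cis.

Section dot.
Variables (R : realType) (n : nat).
Implicit Types x y z : 'cV[R]_n.

Lemma dotvDl x y z : dotv (x + y) z = dotv x z + dotv y z.
Proof. by rewrite /dotv -big_split; apply: eq_bigr => i _; rewrite mxE mulrDl. Qed.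

Lemma dotvDr x y z : dotv z (x + y) = dotv z x + dotv z y.
Proof. by rewrite /dotv -big_split; apply: eq_bigr => i _; rewrite mxE mulrDr. Qed.

Lemma dotvNr x y : dotv x (- y) = - dotv x y.
Proof. by rewrite /dotv -sumrN; apply: eq_bigr => i _; rewrite mxE mulrN. Qed.

Lemma dotv0l x : dotv 0 x = 0.
Proof. by rewrite /dotv big1// => i _; rewrite mxE mul0r. Qed.

Lemma dotv_le x y : `|dotv x y| <= n%:R * (`|x| * `|y|).
Proof.
apply: le_trans (ler_norm_sum _ _ _) _.
apply: (@le_trans _ _ (\sum_(i < n) `|x| * `|y|)).
  by apply: ler_sum => i _; rewrite normrM ler_pM// cv_norm_coord.
by rewrite sumr_const card_ord -[leLHS]mulr_natl.
Qed.

End dot.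

(** * Square-integrable functions as a system of time-frequency shifts *)

Section L2_space.
Variables (R : realType) (d : nat).
Local Notation V := ('cV[R]_d -> R[i]).
Local Notation lebd := (leb R d).
Implicit Types f h : V.

Lemma sqr_L2norm f : (L2norm f ^+ 2 = \int[lebd]_t ((normc (f t)) ^+ 2)%:E)%E.
Proof.
rewrite /L2norm unlock.
have -> : (\int[lebd]_t (`|(EFin \o (@normc R \o f)) t| `^ 2))%E =
    (\int[lebd]_t ((normc (f t)) ^+ 2)%:E)%E.
  by apply: eq_integral => t _ /=; rewrite ger0_norm ?normc_ge0// powR_mulrn ?normc_ge0.
have : (0 <= \int[lebd]_t ((normc (f t)) ^+ 2)%:E)%E.
  by apply: integral_ge0 => t _; rewrite lee_fin sqr_ge0.
case: (\int[lebd]_t _)%E => [r r0| _|//].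
- by rewrite poweR_EFin powR12_sqrt// -EFin_expe sqr_sqrtr.
- by rewrite poweRyr ?invr_neq0// expe2 mulyy.
Qed.

Lemma in_L2P f : in_L2 f <-> cmeas f /\ (\int[lebd]_t ((normc (f t)) ^+ 2)%:E < +oo)%E.
Proof.
have n0 : (0 <= L2norm f)%E by exact: Lnorm_ge0.
rewrite -sqr_L2norm; split=> [[f1 f2 f3]|[[f1 f2] f3]]; split => //.
  by rewrite expe2 lte_mul_pinfty// ge0_fin_numE.
by rewrite ltey; apply/eqP => e; move: f3; rewrite e expe2 mulyy ltxx.
Qed.

Definition sqL2 f : \bar R := (\int[lebd]_t ((normc (f t)) ^+ 2)%:E)%E.

Lemma measurable_sqr_normc d' (T : measurableType d') (f : T -> R[i]) : cmeas f ->
  measurable_fun setT (fun t => ((normc (f t)) ^+ 2)%:E).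
Proof. by move=> mf; apply/measurable_EFinP; apply: measurable_funX; exact: measurable_normc. Qed.

Lemma in_L2_le f (b : 'cV[R]_d -> \bar R) : cmeas f -> measurable_fun setT b ->
  (forall t, (((normc (f t)) ^+ 2)%:E <= b t)%E) -> (\int[lebd]_t b t < +oo)%E -> in_L2 f.
Proof.
move=> mf mb fb boo; apply/in_L2P; split=> //; apply: le_lt_trans boo.
apply: ge0_le_integral => //.
- by move=> t _; rewrite lee_fin sqr_ge0.
- exact: measurable_sqr_normc.
Qed.

Lemma in_L2D f h : in_L2 f -> in_L2 h -> in_L2 (fun t => f t + h t).
Proof.
move=> /in_L2P[mf foo] /in_L2P[mh hoo].
apply: (@in_L2_le _ (fun t => 2%:E * ((normc (f t)) ^+ 2)%:E + 2%:E * ((normc (h t)) ^+ 2)%:E)%E).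
- exact: cmeasD.
- by apply: emeasurable_funD; apply: emeasurable_funM => //; exact: measurable_sqr_normc.
- move=> t; rewrite -!EFinM -EFinD lee_fin.
  by apply: le_trans (sqr_normc_le2 _ (f t)) _; rewrite addrAC subrr add0r.
have p2 k : cmeas k -> (\int[lebd]_t ((normc (k t)) ^+ 2)%:E < +oo)%E ->
    (\int[lebd]_t (2%:E * ((normc (k t)) ^+ 2)%:E) < +oo)%E.
  move=> mk koo; rewrite ge0_integralZl//; first by rewrite lte_mul_pinfty.
    exact: measurable_sqr_normc.
  by move=> t _; rewrite lee_fin sqr_ge0.
rewrite ge0_integralD//; first by apply: lte_add_pinfty; exact: p2.
- by move=> t _; rewrite mule_ge0// lee_fin sqr_ge0.
- by apply: emeasurable_funM => //; exact: measurable_sqr_normc.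
- by move=> t _; rewrite mule_ge0// lee_fin sqr_ge0.
- by apply: emeasurable_funM => //; exact: measurable_sqr_normc.
Qed.

Lemma in_L2Z c f : in_L2 f -> in_L2 (fun t => c * f t).
Proof.
move=> /in_L2P[mf foo].
apply: (@in_L2_le _ (fun t => (normc c ^+ 2)%:E * ((normc (f t)) ^+ 2)%:E)%E).
- by apply: cmeasM => //; exact: cmeas_cst.
- by apply: emeasurable_funM => //; exact: measurable_sqr_normc.
- by move=> t; rewrite -EFinM lee_fin normcM exprMn.
rewrite ge0_integralZl//.
- by rewrite lte_mul_pinfty// lee_fin sqr_ge0.
- exact: measurable_sqr_normc.
- by move=> t _; rewrite lee_fin sqr_ge0.
- by rewrite lee_fin sqr_ge0.
Qed.

Lemma in_L2_0 : in_L2 (fun _ : 'cV[R]_d => 0 : R[i]).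
Proof.
apply/in_L2P; split; first exact: cmeas_cst.
by under eq_integral do rewrite normc0 expr0n; rewrite integral0.
Qed.

Lemma cintegrable_L2 f h : in_L2 f -> in_L2 h -> cintegrable lebd (fun t => f t * conjc (h t)).
Proof.
move=> /in_L2P[mf foo] /in_L2P[mh hoo].
apply: (@le_cintegrable _ _ _ _ _ (fun t => ((normc (f t)) ^+ 2)%:E + ((normc (h t)) ^+ 2)%:E)%E).
- by apply: cmeasM => //; exact: cmeas_conj.
- by apply: emeasurable_funD; exact: measurable_sqr_normc.
- move=> t; rewrite -EFinD lee_fin normcM normc_conj.
  have := sqr_ge0 (normc (f t) - normc (h t)).
  have := sqr_ge0 (normc (f t)); have := sqr_ge0 (normc (h t)); lra.
rewrite ge0_integralD//; first exact: lte_add_pinfty.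
- by move=> t _; rewrite lee_fin sqr_ge0.
- exact: measurable_sqr_normc.
- by move=> t _; rewrite lee_fin sqr_ge0.
- exact: measurable_sqr_normc.
Qed.

End L2_space.

Section L2_type.
Variables (R : realType) (d : nat).
Local Notation V := ('cV[R]_d -> R[i]).
Local Notation lebd := (leb R d).

Definition L2_pred : {pred V} := fun f => `[< in_L2 f >].

Lemma L2_submod : submod_closed L2_pred.
Proof.
split; first by apply/asboolP; exact: in_L2_0.
move=> c f h /asboolP fL /asboolP hL; apply/asboolP.
by apply: in_L2D => //; exact: in_L2Z.
Qed.

HB.instance Definition _ := GRing.isSubmodClosed.Build R[i] V L2_pred L2_submod.

(** Functions rather than classes modulo null sets, so the inner product is only semidefinite, as
    [tfsys] allows. *)
Record L2 := MkL2 { L2_val :> V; _ : L2_val \in L2_pred }.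

HB.instance Definition _ := [isSub for L2_val].
HB.instance Definition _ := [Choice of L2 by <:].
HB.instance Definition _ := [SubChoice_isSubLmodule of L2 by <:].

Lemma L2P (f : L2) : in_L2 f.
Proof. by case: f => f /= /asboolP. Qed.

Definition toL2 (f : V) (fL : in_L2 f) : L2 := MkL2 (asboolT fL).

Lemma L2_ext (f h : L2) : (forall t, f t = h t) -> f = h.
Proof. by move=> e; apply/val_inj/funext. Qed.

Lemma L2_D (f h : L2) t : (f + h) t = f t + h t.
Proof. by []. Qed.

Lemma L2_Z c (f : L2) t : (c *: f) t = c * f t.
Proof. by []. Qed.

Lemma L2_sum I (s : seq I) (F : I -> L2) t : (\sum_(i <- s) F i) t = \sum_(i <- s) F i t.
Proof. by elim/big_rec2: _ => // i y x _ <-. Qed.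

Lemma innerE (f h : V) : inner f h = cint lebd (fun t => f t * conjc (h t)).
Proof. by []. Qed.

Lemma tfshiftE z (f : V) t :
  tfshift z f t = cis (2 * pi * dotv (dsubmx z) t) * f (t - usubmx z).
Proof. by []. Qed.

Lemma cmeas_L2 (f : V) : in_L2 f -> cmeas f.
Proof. by move=> [f1 f2 _]; split. Qed.

Lemma cmeas_tfshift z (f : V) : cmeas f -> cmeas (tfshift z f).
Proof.
move=> mf; apply: cmeasM.
- apply: cmeas_cis; apply: measurable_funM; first exact: measurable_cst.
  by apply: measurable_dotv => //; exact: measurable_cst.
- have mt : measurable_fun setT (fun t : 'cV[R]_d => t - usubmx z).
    by apply: measurable_subv => //; exact: measurable_cst.
  exact: (cmeas_comp mt mf).
Qed.

Lemma in_L2_tfshift z (f : V) : in_L2 f -> in_L2 (tfshift z f).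
Proof.
move=> /in_L2P[mf foo]; apply/in_L2P; split; first exact: cmeas_tfshift.
under eq_integral => t _ do rewrite tfshiftE normcM normc_cis mul1r.
rewrite (transports_shift (- usubmx z) (f := fun t => ((normc (f t)) ^+ 2)%:E))//.
- exact: measurable_sqr_normc.
- by move=> t; rewrite lee_fin sqr_ge0.
Qed.

Definition tfL2 z (f : L2) : L2 := toL2 (in_L2_tfshift z (L2P f)).

Lemma inner_tfshift z (f h : L2) : inner (tfL2 z f) (tfL2 z h) = inner f h.
Proof.
rewrite !innerE.
rewrite -(cint_transport (transports_shift (- usubmx z)) (f := fun t => f t * conjc (h t))).
  congr cint; apply/funext => t /=; rewrite !tfshiftE conjcM conjc_cis mulrACA -cisD.
  by rewrite subrr cis0 mul1r.
by apply: cmeasM; [|apply: cmeas_conj]; apply: cmeas_L2; exact: L2P.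
Qed.

(** Translating by the time part of [z] the modulation of [w] leaves a phase independent of [t]: the
    cocycle that makes the representation projective. *)
Lemma tfshift_comp z w (f : V) t : tfshift z (tfshift w f) t =
  cis (- (2 * pi * dotv (dsubmx w) (usubmx z))) * tfshift (z + w) f t.
Proof.
have eu : usubmx (z + w) = usubmx z + usubmx w by apply/colP => i; rewrite !mxE.
have ed : dsubmx (z + w) = dsubmx z + dsubmx w by apply/colP => i; rewrite !mxE.
rewrite !tfshiftE eu ed opprD addrA mulrA [RHS]mulrA -!cisD; congr (cis _ * _).
by rewrite dotvDl dotvDr dotvNr; ring.
Qed.

Lemma inner_conj (f h : L2) : inner h f = conjc (inner f h).
Proof.
rewrite !innerE -cint_conj; last by apply: cintegrable_L2; exact: L2P.
by congr cint; apply/funext => t; rewrite conjcM conjcK mulrC.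
Qed.

Lemma innerD (f g h : L2) : inner (f + g : L2) h = inner f h + inner g h.
Proof.
rewrite !innerE -cintD; try by apply: cintegrable_L2; exact: L2P.
by congr cint; apply/funext => t; rewrite L2_D mulrDl.
Qed.

Lemma innerZ c (f h : L2) : inner (c *: f : L2) h = c * inner f h.
Proof.
rewrite !innerE -cintZ; last by apply: cintegrable_L2; exact: L2P.
by congr cint; apply/funext => t; rewrite L2_Z mulrA.
Qed.

Lemma inner_self (f : L2) : (complex.Re (inner f f))%:E = sqL2 f.
Proof.
rewrite innerE /= /Rintegral.
have e : (\int[lebd]_t (complex.Re (f t * conjc (f t)))%:E)%E = sqL2 f.
  by apply: eq_integral => t _; rewrite mulcJE.
rewrite e fineK// ge0_fin_numE; last by apply: integral_ge0 => t _; rewrite lee_fin sqr_ge0.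
by have /in_L2P[] := L2P f.
Qed.

Lemma inner_self_ge0 (f : L2) : 0 <= complex.Re (inner f f).
Proof.
by rewrite -lee_fin inner_self; apply: integral_ge0 => t _; rewrite lee_fin sqr_ge0.
Qed.

Lemma tfL2_comp z w : exists2 c : R[i], normc c = 1 &
  forall f : L2, tfL2 z (tfL2 w f) = c *: tfL2 (z + w) f.
Proof.
exists (cis (- (2 * pi * dotv (dsubmx w) (usubmx z)))); first exact: normc_cis.
by move=> f; apply: L2_ext => t; rewrite L2_Z; exact: tfshift_comp.
Qed.

Lemma tfL2D z (f h : L2) : tfL2 z (f + h) = tfL2 z f + tfL2 z h.
Proof. by apply: L2_ext => t; rewrite L2_D /= !tfshiftE mulrDr. Qed.

Lemma tfL2Z z c (f : L2) : tfL2 z (c *: f) = c *: tfL2 z f.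
Proof. by apply: L2_ext => t; rewrite L2_Z /= !tfshiftE mulrCA. Qed.

Definition L2sys : tfsys R (d + d) := Tfsys (fun f g h => innerD f g h)
  innerZ inner_conj inner_self_ge0 tfL2D tfL2Z inner_tfshift tfL2_comp.

Lemma nsq_L2 (f : L2) : (@nsq _ _ L2sys f)%:E = sqL2 f.
Proof. exact: inner_self. Qed.

End L2_type.

(** * Half-open boxes *)

Section boxes.
Variables (R : realType) (d : nat).
Local Notation lebd := (leb R d).
Implicit Types a b : 'I_d -> R.

Definition ocbox a b : set 'cV[R]_d := [set x | forall i, a i < x i ord0 <= b i].

Lemma measurable_ocbox a b : measurable (ocbox a b).
Proof.
have := @measurable_box R d (fun i => `]a i, b i]%classic) (fun _ => measurable_itv _).
by congr measurable; apply/seteqP; split => x /= h i; have := h i; rewrite in_itv.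
Qed.

Lemma leb_ocbox a b : lebd (ocbox a b) = (\prod_i Num.max 0 (b i - a i))%:E.
Proof.
transitivity (\prod_(i < d) lebesgue_measure (`]a i, b i]%classic : set (measurableTypeR R)))%E.
  by rewrite -leb_box.
rewrite -prodEFin; apply: eq_bigr => i _; rewrite lebesgue_measure_itv /= lte_fin.
case: ltP => h; first by rewrite -EFinB max_r// subr_ge0 ltW.
by rewrite max_l// subr_le0.
Qed.

Lemma ocboxI a b a' b' : ocbox a b `&` ocbox a' b' =
  ocbox (fun i => Num.max (a i) (a' i)) (fun i => Num.min (b i) (b' i)).
Proof.
apply/seteqP; split => x /=.
  move=> [h h'] i; have /andP[h1 h2] := h i; have /andP[h3 h4] := h' i.
  by rewrite gt_max h1 h3 le_min h2 h4.
move=> h; split=> i; have := h i; rewrite gt_max le_min => /andP[/andP[h1 h2] /andP[h3 h4]].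
  by rewrite h1 h3.
by rewrite h2 h4.
Qed.

Lemma ocbox_volume_cvg a b (e : R) : 0 < e -> exists2 r : R, 0 < r &
  \prod_i Num.max 0 (b i - a i) - \prod_i Num.max 0 ((b i - r) - (a i + r)) < e.
Proof.
move=> e0.
have cM : continuous (fun x : R^o * R^o => x.1 * x.2 : R^o).
  by move=> x; apply: cvgM; [exact: cvg_fst|exact: cvg_snd].
have : (fun r => \prod_i Num.max 0 ((b i - r) - (a i + r))) @ (0 : R) -->
    (\prod_i Num.max 0 ((b i - 0) - (a i + 0)) : R).
  apply: (@cvg_big _ _ _ _ _ cM _ (nbhs (0 : R))) => i _.
  apply: (@continuous_max _ _ (fun=> 0) (fun r : R => (b i - r) - (a i + r)) 0).
    exact: cvg_cst.
  by apply: cvgB; [apply: cvgB|apply: cvgD] => //; exact: cvg_cst.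
move=> /cvgrPdist_lt/(_ _ e0); rewrite -nbhs_ballE => -[r /= r0 h].
exists (r / 2); first by rewrite divr_gt0.
have := h (r / 2); rewrite /ball /= sub0r normrN gtr0_norm ?divr_gt0//.
under eq_bigr do rewrite subr0 addr0.
move=> h'; apply: le_lt_trans (h' _); first exact: ler_norm.
by move: r0 => /=; lra.
Qed.

(** A slab in one coordinate is a countable union of boxes, and slabs generate the Borel sets of the
    coordinates. *)
Lemma ocbox_sigma : (measurable : set (set 'cV[R]_d)) `<=`
  <<s [set E | exists a b, E = ocbox a b] >>.
Proof.
set G := [set E | _]; set SG := <<s G>>.
have sSG : sigma_algebra setT SG := smallest_sigma_algebra setT G.
have [s0 sD sU] := sSG.
apply: smallest_sub => //; rewrite -bigcup_seq => _ [/= i _ [B mB <-]].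
rewrite setTI.
have : <<s (@ocitv R) >> `<=` [set B | SG ((fun x : 'cV[R]_d => x i ord0) @^-1` B)].
  apply: smallest_sub.
    split => /=.
    - exact: s0.
    - by move=> A hA; exact: (sD _ hA).
    - by move=> F hF; rewrite preimage_bigcup; exact: sU.
  move=> _ [[x y] _ <-] /=.
  pose a N j : R := if j == i then x else - N%:R; pose b N j : R := if j == i then y else N%:R.
  have -> : (fun x : 'cV[R]_d => x i ord0) @^-1` `]x, y]%classic = \bigcup_N ocbox (a N) (b N).
    apply/seteqP; split => z /=.
      rewrite in_itv /= => hz; exists (Num.truncn `|z|).+1 => // j; rewrite /a /b.
      case: eqP => [->//|_].
      have h := cv_norm_coord z j; have h' : `|z| < (Num.truncn `|z|).+1%:R by exact: truncnS_gt.
      by move: (le_lt_trans h h'); rewrite ltr_norml => /andP[-> /ltW ->].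
    by move=> [N _ /(_ i)]; rewrite /a /b eqxx in_itv.
  apply: sU => N; apply: sub_sigma_algebra.
  by exists (a N), (b N).
by apply; exact: mB.
Qed.

End boxes.

(** * Strong continuity of time-frequency shifts *)

Section indicator_vectors.
Variables (R : realType) (d : nat).
Local Notation lebd := (leb R d).
Local Notation S := (L2sys R d).
Local Notation V := ('cV[R]_d -> R[i]).

Definition ind (E : set 'cV[R]_d) : V := fun t => (\1_E t : R)%:C.

Lemma normc_ind E t : normc (ind E t) = \1_E t.
Proof. by rewrite /ind normc_real ger0_norm. Qed.

Lemma cmeas_ind E : measurable E -> cmeas (ind E).
Proof. by move=> mE; apply: cmeas_real; exact: measurable_indic. Qed.

Lemma sqL2_ind E : measurable E -> sqL2 (ind E) = lebd E.
Proof.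
move=> mE; rewrite /sqL2; under eq_integral => t _ do rewrite normc_ind.
have -> : (fun t => ((\1_E t : R) ^+ 2)%:E) = (fun t => (\1_E t)%:E) :> ('cV[R]_d -> \bar R).
  by apply/funext => t; rewrite indicE; case: (t \in E); rewrite /= ?expr1n ?expr0n.
by rewrite integral_indic// setIT.
Qed.

Lemma in_L2_ind E : measurable E -> (lebd E < +oo)%E -> in_L2 (ind E).
Proof.
by move=> mE Eoo; apply/in_L2P; split; [exact: cmeas_ind|rewrite -/(sqL2 _) sqL2_ind].
Qed.

Lemma cos_near1 (eta : R) : 0 < eta -> exists2 dl : R, 0 < dl &
  forall x : R, `|x| < dl -> 1 - eta < cos x.
Proof.
move=> eta0; have := @continuous_cos R 0; move=> /cvgrPdist_lt/(_ _ eta0).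
rewrite -nbhs_ballE => -[r /= r0 h]; exists r => // x hx.
have := h x; rewrite /ball /= sub0r normrN => /(_ hx); rewrite cos0 => /(le_lt_trans (ler_norm _)).
lra.
Qed.

(** The squared distance from [f] to its shift is [2 v0 - 2 Re <tf u f, f>]. On the slightly
    shrunken box the translate is still 1 and the cosine of the phase is at least [1 - eta], so the
    real part is at least [(1 - eta) * vr]. *)
Lemma ocbox_tf_continuous a b (f : S) : (forall t, L2_val f t = ind (ocbox a b) t) ->
  tf_continuous f.
Proof.
move=> fE e e0.
set B := ocbox a b; set v0 := \prod_i Num.max 0 (b i - a i) : R.
have mB : measurable B by exact: measurable_ocbox.
have lB : lebd B = v0%:E by exact: leb_ocbox.
have v00 : 0 <= v0 by apply: prodr_ge0 => i _; rewrite le_max lexx.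
have nf : nsq f = v0.
  apply: EFin_inj; rewrite nsq_L2 -lB -sqL2_ind// /sqL2.
  by apply: eq_integral => t _; rewrite fE.
have e8 : 0 < e / 8 by rewrite divr_gt0.
have [r r0 hr] := ocbox_volume_cvg a b e8.
pose eta := Num.min 1 (e / (8 * (v0 + 1))).
have v1 : 0 < 8 * (v0 + 1) by rewrite mulr_gt0// ltr_wpDl.
have eta0 : 0 < eta by rewrite lt_min ltr01 divr_gt0.
have eta1 : eta <= 1 by rewrite ge_min lexx.
have etae : eta * v0 <= e / 8.
  have : eta * (8 * (v0 + 1)) <= e by rewrite -ler_pdivlMr// ge_min lexx orbT.
  lra.
have [dc dc0 hdc] := cos_near1 eta0.
pose L := \sum_i (`|a i| + `|b i|).
have L0 : 0 <= L by apply: sumr_ge0 => i _; rewrite addr_ge0.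
have K0 : 0 <= 2 * pi * (d%:R * L) :> R by rewrite !mulr_ge0// pi_ge0.
(* [L] bounds the points of the box, so for [|u| < d1] the phase stays below the threshold [dc] of
   the cosine. *)
have [d1 d10 hd1] := @small_coeff R _ (dc / 2) K0 (divr_gt0 dc0 (ltr0Sn R 1)).
exists (Num.min r d1); first by rewrite lt_min r0.
move=> u; rewrite lt_min => /andP[ur ud].
have usub i : `|usubmx u i ord0| <= `|u| by rewrite mxE; exact: cv_norm_coord.
have dsub : `|dsubmx u| <= `|u|.
  by apply: cv_norm_le => // i; rewrite mxE; exact: cv_norm_coord.
pose Br := ocbox (fun i => a i + r) (fun i => b i - r).
set vr := \prod_i Num.max 0 (b i - r - (a i + r)) in hr.
have mBr : measurable Br by exact: measurable_ocbox.
have lBr : lebd Br = vr%:E by exact: leb_ocbox.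
have Re_ge : (1 - eta) * vr <= complex.Re (ip (tf u f) f).
  rewrite -lee_fin.
  have gi : cintegrable lebd (fun t => tfshift u (L2_val f) t * conjc (L2_val f t)).
    apply: cintegrable_L2; last exact: L2P.
    by apply: in_L2_tfshift; exact: L2P.
  have -> : (complex.Re (ip (tf u f) f))%:E =
     (\int[lebd]_t (complex.Re (tfshift u (L2_val f) t * conjc (L2_val f t)))%:E)%E.
    rewrite /= /Rintegral fineK//; apply: integrable_fin_num => //.
    exact: (cintegrable_Re gi).
  have i1 : (\int[lebd]_t (\1_Br t : R)%:E = vr%:E)%E by rewrite integral_indic// setIT; exact: lBr.
  have -> : ((1 - eta) * vr)%:E = (\int[lebd]_t ((1 - eta) * \1_Br t)%:E)%E.
    rewrite EFinM -i1 -integralZl//=; last first.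
      apply/integrableP; split; first by apply/measurable_EFinP; exact: measurable_indic.
      under eq_integral => t _ do rewrite /= ger0_norm//.
      by rewrite i1 ltry.
  have ii : lebd.-integrable setT (fun t => ((1 - eta) * \1_Br t)%:E).
    apply/integrableP; split.
      apply/measurable_EFinP; apply: measurable_funM; first exact: measurable_cst.
      exact: measurable_indic.
    under eq_integral => t _ do rewrite /= ger0_norm ?mulr_ge0 ?subr_ge0// EFinM.
    rewrite ge0_integralZl//.
    - by rewrite i1 -EFinM ltry.
    - by apply/measurable_EFinP; exact: measurable_indic.
    - by rewrite lee_fin subr_ge0.
  apply: le_integral => //; first exact: (cintegrable_Re gi).
  move=> t _; rewrite lee_fin tfshiftE !fE.
  have sBrB : Br `<=` B.
    move=> x hx i; have /andP[h1 h2] := hx i; apply/andP; split.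
      by apply: lt_trans h1; rewrite ltrDl.
    by apply: le_trans h2 _; rewrite lerBlDr lerDl ltW.
  have [tB|tB] := boolP (t \in B); last first.
    rewrite /ind [\1_(ocbox a b) t]indicE (negPf tB) conjc_real mulr0 /= indicE.
    rewrite (_ : t \in Br = false) ?mulr0//.
    by apply/negbTE; apply: contra tB => /set_mem/sBrB h; exact/mem_set.
  rewrite /ind [\1_(ocbox a b) t]indicE tB conjc_real mulr1 mulrC.
  have Bt : B t by exact: set_mem.
  have tL : `|t| <= L.
    apply: cv_norm_le => // i; have /andP[h1 h2] := Bt i.
    have : `|t i ord0| <= `|a i| + `|b i|.
      rewrite ler_norml; move: (ler_norm (b i)) (ler_norm (- a i)) (normr_ge0 (a i)) (normr_ge0 (b i)).
      by rewrite normrN => *; apply/andP; split; lra.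
    move=> h; apply: (le_trans h); rewrite /L (bigD1 i)//= lerDl.
    by apply: sumr_ge0 => j _; rewrite addr_ge0.
  have cosge : 1 - eta <= cos (2 * pi * dotv (dsubmx u) t).
    apply/ltW/hdc.
    have p0 : 0 <= 2 * pi :> R by rewrite mulr_ge0// pi_ge0.
    rewrite normrM (ger0_norm p0).
    apply: (@le_lt_trans _ _ (d1 * (2 * pi * (d%:R * L)))); last by apply: le_lt_trans hd1 _; lra.
    rewrite [leRHS]mulrCA; apply: ler_wpM2l; first exact: p0.
    apply: (le_trans (dotv_le _ _)); rewrite [leRHS]mulrCA; apply: ler_wpM2l => //.
    by apply: ler_pM => //; apply: le_trans dsub _; exact: ltW.
  have cosge0 : 0 <= cos (2 * pi * dotv (dsubmx u) t) by apply: le_trans cosge; rewrite subr_ge0.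
  rewrite indicE; have [tBr|tBr] := boolP (t \in Br).
    rewrite indicE; have -> : t - usubmx u \in ocbox a b.
      apply/mem_set => i; have /andP[h1 h2] := set_mem tBr i; rewrite 2!mxE.
      have : `|usubmx u i ord0| < r by exact: le_lt_trans (usub i) ur.
      by rewrite ltr_norml => /andP[h3 h4]; apply/andP; split; lra.
    by rewrite /= !mulr1 !mulr0 subr0 mul1r.
  (* Off [Br] only nonnegativity of the integrand is claimed, and [eta <= 1] makes the cosine
     nonnegative. *)
  rewrite /= !mulr0 subr0. by rewrite mul0r mulr_ge0.
change (nsq (tf u f - f) < e); rewrite nsqB nsq_tf nf.
have h1 : v0 - vr < e / 8 by exact: hr.
have : eta * vr <= eta * v0.
  apply: ler_wpM2l; first exact: ltW.
  apply: ler_prod => i _; rewrite le_max lexx /= ge_max le_max lexx /=.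
  by rewrite le_max; apply/orP; right; move: r0; clear; move=> r0; lra.
lra.
Qed.

End indicator_vectors.

Import HBNNSimple.

Section L2_continuity.
Variables (R : realType) (d : nat).
Local Notation lebd := (leb R d).
Local Notation S := (L2sys R d).
Local Notation V := ('cV[R]_d -> R[i]).

Lemma tf_continuous_dominated (f : L2 R d) (fn : nat -> L2 R d) :
  (forall n, tf_continuous (fn n : S)) ->
  (forall t, normc (f t - fn n t) @[n --> \oo] --> (0 : R)) ->
  (forall n t, normc (f t - fn n t) <= normc (f t)) -> tf_continuous (f : S).
Proof.
move=> fnc fncvg fnle; apply: tf_continuous_lim => e e0.
have mL (h : L2 R d) : measurable_fun setT (fun t => (normc (h t) ^+ 2)%:E : \bar R).
  by apply: measurable_sqr_normc; apply: cmeas_L2; exact: L2P.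
have [] := @dominated_convergence _ _ R lebd setT measurableT
  (fun n t => (normc ((f - fn n : L2 R d) t) ^+ 2)%:E) (cst 0%E)
  (fun t => (normc (f t) ^+ 2)%:E).
- by move=> n; exact: mL.
- exact: measurable_cst.
- apply: aeW => t _; rewrite /=; apply: cvg_EFin; first exact: nearW.
  have -> : fine \o (fun n => (normc (f t - fn n t) ^+ 2)%:E) =
      (fun n => normc (f t - fn n t) * normc (f t - fn n t)) by apply/funext => n /=; rewrite expr2.
  by rewrite -[0](mulr0 0); apply: cvgM; exact: fncvg.
- apply/integrableP; split; first exact: mL.
  under eq_integral => t _ do rewrite gee0_abs ?lee_fin ?sqr_ge0//.
  by have /in_L2P[] := L2P f.
- apply: aeW => t n _; rewrite gee0_abs ?lee_fin ?sqr_ge0//.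
  by rewrite ler_sqr ?nnegrE ?normc_ge0//; exact: fnle.
move=> _ _; rewrite integral_cst//= mul0e => h.
have /fine_cvgP[_ /cvgrPdist_lt/(_ _ e0)[N _ hN]] := h.
exists (fn N) => //; have := hN N (leqnn N) => /=.
rewrite (_ : integral _ _ _ = (@nsq _ _ S (f - fn N))%:E); last by rewrite nsq_L2.
by rewrite sub0r normrN => /(le_lt_trans (ler_norm _)).
Qed.

Lemma tf_continuous_sum I (s : seq I) (F : I -> S) :
  (forall i, tf_continuous (F i)) -> tf_continuous (\sum_(i <- s) F i).
Proof.
move=> FC; elim: s => [|i s IH].
  by rewrite big_nil -(scale0r (0 : S)); apply: tf_continuousZ => e e0; exists 1 => // u _;
     rewrite (_ : tf u 0 = 0) ?subr0 ?/nsq ?ip0l//; rewrite -(scale0r (0 : S)) tfZ !scale0r.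
by rewrite big_cons; apply: tf_continuousD.
Qed.

Let Q (L : nat) : set 'cV[R]_d := ocbox (fun=> - L%:R) (fun=> L%:R).

Let mQ L : measurable (Q L). Proof. exact: measurable_ocbox. Qed.

Let Qoo L E : measurable E -> (lebd (E `&` Q L) < +oo)%E.
Proof.
move=> mE; apply: (@le_lt_trans _ _ (lebd (Q L))).
  by apply: le_measure; rewrite ?inE//; exact: measurableI.
by rewrite [X in (X < _)%E]leb_ocbox ltry.
Qed.

(** A pi-lambda argument: the good sets form a lambda-system (increasing unions by dominated
    convergence) that contains the boxes. Intersecting with the cube [Q L] keeps all indicators
    square integrable. *)
Lemma tf_continuous_ind (E : set 'cV[R]_d) (L : nat) (f : L2 R d) : measurable E ->
  (forall t, f t = ind (E `&` Q L) t) -> tf_continuous (f : S).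
Proof.
move=> mE; move: f.
pose G : set (set 'cV[R]_d) := [set E | exists a b, E = ocbox a b].
pose H : set (set 'cV[R]_d) := [set E | measurable E /\ forall f : L2 R d,
  (forall t, f t = ind (E `&` Q L) t) -> tf_continuous (f : S)].
suff : H E by case.
have GI : setI_closed G.
  by move=> _ _ [a [b ->]] [a' [b' ->]]; rewrite ocboxI; do 2 eexists.
apply: (@lambda_system_subset _ G GI setT H) => //; last exact: ocbox_sigma.
- split => //.
  + split=> // f fE; apply: (@ocbox_tf_continuous R d (fun=> - L%:R) (fun=> L%:R)) => t.
    by rewrite fE setTI.
  + move=> A B BA [mA hA] [mB hB]; split; first exact: measurableD.
    move=> f fE.
    pose fA : S := toL2 (in_L2_ind (measurableI _ _ mA (mQ L)) (Qoo L mA)).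
    pose fB : S := toL2 (in_L2_ind (measurableI _ _ mB (mQ L)) (Qoo L mB)).
    have -> : f = fA + (-1) *: fB.
      apply: L2_ext => t; rewrite fE L2_D L2_Z mulN1r /= /ind -raddfB /=; congr (_%:C).
      rewrite !indicE (classical_sets.in_setI _ (A `\` B)) classical_sets.in_setD !classical_sets.in_setI.
      case: (boolP (t \in A)) => tA; case: (boolP (t \in B)) => tB; case: (t \in Q L);
        rewrite /= ?subrr ?subr0//.
      by move: tA; rewrite (mem_set (BA _ (set_mem tB))).
    by apply: tf_continuousD; [exact: hA|apply: tf_continuousZ; exact: hB].
  + move=> F ndF HF; have mF n : measurable (F n) by case: (HF n).
    split; first exact: bigcup_measurable.
    move=> f fE.
    pose fn n : L2 R d := toL2 (in_L2_ind (measurableI _ _ (mF n) (mQ L)) (Qoo L (mF n))).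
    have sub n t : t \in F n `&` Q L -> t \in (\bigcup_i F i) `&` Q L.
      by move=> /set_mem[h1 h2]; apply/mem_set; split=> //; exists n.
    apply: (@tf_continuous_dominated f fn).
    * by move=> n; have [_] := HF n; apply.
    * move=> t; have [tF|tF] := boolP (t \in (\bigcup_i F i) `&` Q L).
        have [[N _ FNt] tQ] := set_mem tF.
        apply: cvg_near_cst; exists N => // n /= Nn.
        have tn : t \in F n `&` Q L.
          by apply/mem_set; split=> //; move: t FNt {tF tQ}; exact/subsetPset/ndF.
        by rewrite fE /= /ind !indicE tF tn !subrr expr0n /= addr0 sqrtr0.
      apply: cvg_near_cst; exists 0%N => // n /= _.
      rewrite fE /= /ind !indicE (negPf tF).
      have -> : t \in F n `&` Q L = false by apply/negbTE; apply: contra tF; exact: sub.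
      by rewrite !subrr expr0n /= addr0 sqrtr0.
    * move=> n t; rewrite fE (_ : fn n t = ind (F n `&` Q L) t)// /ind -raddfB !normc_real !indicE.
      case: (boolP (t \in F n `&` Q L)) => [/sub ->|_]; first by rewrite subrr normr0.
      by rewrite subr0.
- move=> _ [a [b ->]]; split; first exact: measurable_ocbox.
  by move=> f fE; apply: ocbox_tf_continuous => t; rewrite fE [in LHS]ocboxI.
Qed.

Lemma in_L2_normc_le (f h : V) : cmeas f -> in_L2 h -> (forall t, normc (f t) <= normc (h t)) -> in_L2 f.
Proof.
move=> mf /in_L2P[mh hoo] fh; apply: (in_L2_le mf (measurable_sqr_normc mh)) => // t.
by rewrite lee_fin ler_sqr ?nnegrE ?normc_ge0.
Qed.

(** Increasing simple functions, cut off to growing cubes, converge pointwise to [h] and stay below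
    it; each is a finite combination of indicators. *)
Lemma tf_continuous_ge0 (h : 'cV[R]_d -> R) (f : L2 R d) : measurable_fun setT h ->
  (forall t, 0 <= h t) -> (forall t, f t = (h t)%:C) -> tf_continuous (f : S).
Proof.
move=> mh h0 fE; have mE : measurable_fun setT (fun t => (h t)%:E) by exact/measurable_EFinP.
pose a n := nnsfun_approx measurableT mE n.
have acvg t : (fun n => a n t) @ \oo --> h t.
  have := cvg_nnsfun_approx measurableT mE (fun t _ => h0 t) (x := t) I.
  by move=> /fine_cvgP[].
have ale n t : a n t <= h t.
  have nda : {homo (fun n => a n t) : n m / (n <= m)%N >-> n <= m}.
    by move=> n1 m1 nm; have := nd_nnsfun_approx measurableT mE nm => /lefP/(_ t).
  by rewrite -(cvg_lim (@Rhausdorff R) (acvg t)); apply: nondecreasing_cvgn_le => //; apply/cvg_ex; exists (h t).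
pose k n : V := fun t => (a n t * \1_(Q n) t)%:C.
have k01 n t : 0 <= a n t * \1_(Q n) t <= h t.
  rewrite mulr_ge0//= (le_trans _ (ale n t))//.
  by rewrite indicE; case: (t \in _); rewrite ?mulr1 ?mulr0.
have kL n : in_L2 (k n).
  apply: (in_L2_normc_le (h := f)); last 2 first.
  - exact: L2P.
  - by move=> t; rewrite fE !normc_real; have /andP[k0 k1] := k01 n t; rewrite !ger0_norm.
  - by apply: cmeas_real; apply: measurable_funM => //; exact: measurable_indic.
apply: (@tf_continuous_dominated f (fun n => toL2 (kL n))).
- move=> n.
  have mA y : measurable (a n @^-1` [set y]) by exact: measurable_sfunP.
  pose F y : S := y%:C *: (toL2 (in_L2_ind (measurableI _ _ (mA y) (mQ n)) (Qoo n (mA y))) : S).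
  have -> : toL2 (kL n) = \sum_(y <- finmap.enum_fset (fset_set (range (a n)))) F y.
    apply: L2_ext => t; rewrite (L2_sum _ F) /= /k (fimfunE (a n)) fsbig_finite//=.
    rewrite mulr_suml raddf_sum; apply: eq_bigr => y _.
    transitivity (y%:C * ind (a n @^-1` [set y] `&` Q n) t); last by [].
    rewrite /ind -rmorphM /= -mulrA; congr (_%:C); congr (_ * _).
    by rewrite !indicE classical_sets.in_setI; case: (_ \in _); rewrite ?mul1r ?mul0r.
  apply: tf_continuous_sum => y; apply: tf_continuousZ.
  exact: (tf_continuous_ind (L := n) (mA y)).
- move=> t.
  have -> : (fun n => normc (f t - toL2 (kL n) t)) = (fun n => `|h t - a n t * \1_(Q n) t|).
    by apply/funext => n; rewrite fE (_ : toL2 (kL n) t = k n t)// /k -raddfB normc_real.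
  apply/norm_cvg0P.
  have cQ : (fun n => a n t * \1_(Q n) t) @ \oo --> h t.
    rewrite -[h t]mulr1; apply: cvgM; first exact: acvg.
    apply: cvg_near_cst; exists (Num.truncn `|t|).+1 => // n /= tn.
    rewrite indicE mem_set// => i.
    have : `|t i ord0| < n%:R.
      apply: le_lt_trans (cv_norm_coord t i) _; apply: lt_le_trans (truncnS_gt _) _.
      by rewrite ler_nat.
    by rewrite ltr_norml => /andP[-> /ltW ->].
  by rewrite -[0](subrr (h t)); apply: cvgB => //; exact: cvg_cst.
- move=> n t; rewrite fE (_ : toL2 (kL n) t = k n t)// /k -raddfB !normc_real.
  have /andP[k0 k1] := k01 n t.
  by rewrite !ger0_norm ?subr_ge0// gerBl.
Qed.

Lemma L2_tf_continuous (f : S) : tf_continuous f.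
Proof.
have [mR mI] : cmeas (f : L2 R d) by apply: cmeas_L2; exact: L2P.
have part (h : 'cV[R]_d -> R) : measurable_fun setT h -> (forall t, `|h t| <= normc (f t)) ->
    exists2 fh : S, (forall t, fh t = (h t)%:C) & tf_continuous fh.
  move=> mh hf.
  have mp : measurable_fun setT (fun t => Num.max (h t) 0).
    by apply: measurable_maxr => //; exact: measurable_cst.
  have mn : measurable_fun setT (fun t => Num.max (- h t) 0).
    by apply: measurable_maxr; [exact: measurableT_comp|exact: measurable_cst].
  have pL : in_L2 (fun t => (Num.max (h t) 0)%:C).
    apply: (in_L2_normc_le (h := f)); [exact: cmeas_real|exact: L2P|move=> t].
    rewrite normc_real (le_trans _ (hf t))//.
    by case: (leP (h t) 0) => _; rewrite ?normr0.
  have nL : in_L2 (fun t => (Num.max (- h t) 0)%:C).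
    apply: (in_L2_normc_le (h := f)); [exact: cmeas_real|exact: L2P|move=> t].
    rewrite normc_real (le_trans _ (hf t))//.
    by case: (leP (- h t) 0) => _; rewrite ?normr0 ?normrN.
  exists ((toL2 pL : S) + (-1) *: (toL2 nL : S)).
    move=> t; rewrite L2_D L2_Z mulN1r /= -raddfB; congr (_%:C).
    by case: (leP (h t) 0); case: (leP (- h t) 0); lra.
  apply: tf_continuousD; last apply: tf_continuousZ.
    by apply: (tf_continuous_ge0 mp) => // t; rewrite le_max lexx orbT.
  by apply: (tf_continuous_ge0 mn) => // t; rewrite le_max lexx orbT.
have [u uE uc] := part _ mR (fun t => ler_Re_normc (f t)).
have [v vE vc] := part _ mI (fun t => ler_Im_normc (f t)).
have -> : f = u + 'i%C *: v.
  apply: L2_ext => t; rewrite L2_D L2_Z uE vE.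
  by case: (f t) => a b /=; apply/eqP; rewrite eq_complex /=; apply/andP; split; apply/eqP; ring.
by apply: tf_continuousD => //; exact: tf_continuousZ.
Qed.

End L2_continuity.

(** * The exponential weight and the Poisson kernel *)

Section poisson_kernel.
Variable R : realType.
Local Notation mu := (@lebesgue_measure R).
Implicit Types eps a b v s : R.

Definition pweight eps s : R := expR (- (eps * `|s|)).

(** The Fourier transform of [pweight eps]: the Poisson kernel of height [eps / (2 pi)], of total
    mass 1. Both the weight and the kernel have elementary antiderivatives. *)
Definition pkern eps v : R := 2 * eps / (eps ^+ 2 + (2 * pi * v) ^+ 2).

Lemma pden_gt0 eps v : 0 < eps -> 0 < eps ^+ 2 + v ^+ 2.
Proof. by move=> e0; rewrite ltr_pwDl ?sqr_ge0// exprn_gt0. Qed.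

Lemma pkern_ge0 eps v : 0 < eps -> 0 <= pkern eps v.
Proof. by move=> e0; rewrite divr_ge0 ?(ltW (pden_gt0 _ e0))// mulr_ge0// ltW. Qed.

Lemma cvgr_bounded_expR (eps M : R) (F h : R -> R) : 0 < eps ->
  (forall s, `|h s| <= M) -> (forall s, F s = expR (- (eps * s)) * h s) -> F s @[s --> +oo] --> (0 : R).
Proof.
move=> e0 hM FE.
have M0 : 0 <= M by apply: le_trans (hM 0).
have eM : expR (- (eps * s)) * M @[s --> +oo] --> (0 : R).
  rewrite -[0](mul0r M); apply: cvgMl.
  apply: (@cvg_comp _ _ _ (fun s => eps * s) (fun s => expR (- s)) (pinfty_nbhs R) (pinfty_nbhs R)).
    by apply/cvgryPge => A; exists (A / eps); split; [exact: num_real|move=> x /ltW; rewrite ler_pdivrMr// mulrC].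
  exact: cvgr_expR.
apply/norm_cvg0P; apply: (squeeze_cvgr _ (cvg_cst (0 : R)) eM).
near=> s; rewrite normr_ge0 FE normrM ger0_norm ?expR_ge0//=.
by rewrite ler_wpM2l ?expR_ge0.
Unshelve. all: by end_near. Qed.

(** Adding 1 to the cosine makes the integrand nonnegative, as the improper form of the fundamental
    theorem requires; [F] is an explicit antiderivative vanishing at infinity. *)
Lemma integral_exp_cos_half eps b : 0 < eps ->
  (\int[mu]_(s in `[0%R, +oo[) (expR (- (eps * s)) * (1 + cos (b * s)))%:E =
   (1 / eps + eps / (eps ^+ 2 + b ^+ 2))%:E)%E.
Proof.
move=> e0; have D0 := pden_gt0 b e0.
pose h s := - 1 / eps + (b * sin (b * s) - eps * cos (b * s)) / (eps ^+ 2 + b ^+ 2).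
pose F s := expR (- (eps * s)) * h s.
have dF s : is_derive s (1 : R) F (expR (- (eps * s)) * (1 + cos (b * s))).
  apply: is_derive_eq; rewrite /GRing.scale /=.
  have e1 : eps != 0 by rewrite gt_eqF. have D1 : eps ^+ 2 + b ^+ 2 != 0 by rewrite gt_eqF.
  rewrite /h; move: (expR _) (sin _) (cos _) => E sn cs; field.
  by rewrite e1 D1.
have cF s : {for s, continuous F} by apply: differentiable_continuous; apply/derivable1_diffP; apply: ex_derive.
rewrite (ge0_continuous_FTC2y (F := F) (l := 0)).
- rewrite /F /h !mulr0 oppr0 expR0 sin0 cos0 -EFinB; congr (_%:E).
  have e1 : eps != 0 by rewrite gt_eqF. have D1 : eps ^+ 2 + b ^+ 2 != 0 by rewrite gt_eqF.
  by field; rewrite e1 D1.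
- by move=> s _; rewrite mulr_ge0 ?expR_ge0// -(opprK 1) addrC subr_ge0; exact: cos_geN1.
- apply: continuous_subspaceT => s; apply: differentiable_continuous; apply/derivable1_diffP.
  exact: ex_derive.
- apply: (@cvgr_bounded_expR eps (1 / eps + (`|b| + eps) / (eps ^+ 2 + b ^+ 2)) F h) => // s.
  have e1 : 0 <= 1 / eps by rewrite divr_ge0// ltW.
  rewrite (le_trans (ler_normD _ _))//; apply: lerD; first by rewrite mulNr normrN ger0_norm.
  rewrite normrM (ger0_norm (x := _^-1)) ?invr_ge0 ?(ltW D0)//.
  apply: ler_wpM2r; first by rewrite invr_ge0 ltW.
  rewrite (le_trans (ler_normB _ _))// !normrM; apply: lerD.
    by rewrite ler_piMr// ler_norml sin_geN1 sin_le1.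
  by rewrite (ger0_norm (ltW e0)) ler_piMr ?(ltW e0)// ler_norml cos_geN1 cos_le1.
- by move=> s _; exact: ex_derive.
- by apply: cvg_at_right_filter; exact: cF.
- by move=> s _; rewrite derive1E derive_val.
Qed.

Lemma continuous_pweight eps : continuous (pweight eps).
Proof.
move=> s; apply: continuous_comp; last exact: continuous_expR.
by apply: cvgN; apply: cvgM; [exact: cvg_cst|exact: norm_continuous].
Qed.

Lemma continuous_cosM b : continuous (fun s : R => cos (b * s)).
Proof.
move=> s; apply: continuous_comp; last exact: continuous_cos.
by apply: cvgM; [exact: cvg_cst|exact: cvg_id].
Qed.

Lemma integral_exp_cos eps b : 0 < eps ->
  (\int[mu]_s (pweight eps s * (1 + cos (b * s)))%:E =
   (2 / eps + 2 * eps / (eps ^+ 2 + b ^+ 2))%:E)%E.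
Proof.
move=> e0; rewrite ge0_symfun_integralT.
- rewrite (_ : [set x | 0 <= x] = `[0, +oo[%classic); last first.
    by apply/seteqP; split => x /=; rewrite in_itv /= andbT.
  rewrite (_ : (2 / eps + 2 * eps / (eps ^+ 2 + b ^+ 2))%:E =
     2%:E * (1 / eps + eps / (eps ^+ 2 + b ^+ 2))%:E)%E; last first.
    by rewrite -EFinM; congr (_%:E); ring.
  rewrite -integral_exp_cos_half//; congr (_ * _)%E; apply: eq_integral => s.
  by rewrite inE /= in_itv /= andbT => s0; rewrite /pweight ger0_norm.
- by move=> s; rewrite mulr_ge0 ?expR_ge0// -(opprK 1) addrC subr_ge0; exact: cos_geN1.
- move=> s; apply: cvgM; first exact: continuous_pweight.
  by apply: cvgD; [exact: cvg_cst|exact: continuous_cosM].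
- by move=> s /=; rewrite /pweight normrN mulrN cosN.
Qed.

Lemma integral_pweight eps : 0 < eps -> (\int[mu]_s (pweight eps s)%:E = (2 / eps)%:E)%E.
Proof.
move=> e0; have e1 : eps != 0 by rewrite gt_eqF.
have := integral_exp_cos 0 e0.
have hs s : (pweight eps s * (1 + cos (0 * s)))%:E = (2%:E * (pweight eps s)%:E)%E.
  by rewrite mul0r cos0 -EFinM; congr (_%:E); ring.
under eq_integral => s _ do rewrite hs.
rewrite ge0_integralZl//.
- rewrite (_ : 2 / eps + _ = 2 * (2 / eps)); last by rewrite expr0n addr0; field.
  move=> h; have : (2^-1%:E * (2%:E * \int[mu]_s (pweight eps s)%:E) = 2^-1%:E * (2 * (2 / eps))%:E)%E by rewrite h.
  by rewrite muleA -!EFinM mulVf// mul1e mulKf.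
- apply/measurable_EFinP; apply: continuous_measurable_fun; exact: continuous_pweight.
- by move=> s _; rewrite lee_fin expR_ge0.
Qed.


Lemma cintegrable_pweight eps b : 0 < eps ->
  cintegrable mu (fun s => (pweight eps s)%:C * cis (b * s)).
Proof.
move=> e0; have mp : measurable_fun setT (pweight eps).
  by apply: continuous_measurable_fun; exact: continuous_pweight.
split; first by apply: cmeasM; [exact: cmeas_real|apply: cmeas_cis; apply: measurable_funM => //; exact: measurable_cst].
under eq_integral => s _ do rewrite normcM normc_cis mulr1 normc_real ger0_norm ?expR_ge0//.
by rewrite integral_pweight// ltry.
Qed.

(** The imaginary part vanishes by evenness of the weight; the real part is the difference of
    [integral_exp_cos] and [integral_pweight]. *)
Lemma cint_pweight eps a : 0 < eps ->
  cint mu (fun s => (pweight eps s)%:C * cis (2 * pi * a * s)) = (pkern eps a)%:C.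
Proof.
move=> e0; set b := 2 * pi * a; set f := fun s => _.
have fi : cintegrable mu f by exact: cintegrable_pweight.
have fJ : conjc (cint mu f) = cint mu f.
  rewrite -cint_conj// -(cint_transport (@transports_opp1 R) (f := f)); last by case: fi.
  congr cint; apply/funext => s; rewrite /f conjcM conjc_real conjc_cis.
  by rewrite /pweight normrN mulrN.
have Im0 : complex.Im (cint mu f) = 0.
  by move/(congr1 (@complex.Im R)): fJ; rewrite Im_conjc; move: (complex.Im _) => y; lra.
have Re1 : complex.Re (cint mu f) = pkern eps a.
  have mp : measurable_fun setT (pweight eps).
    by apply: continuous_measurable_fun; exact: continuous_pweight.
  have pi : mu.-integrable setT (fun s => (pweight eps s)%:E).
    apply/integrableP; split; first exact/measurable_EFinP.
    under eq_integral => s _ do rewrite gee0_abs ?lee_fin ?expR_ge0//.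
    by rewrite integral_pweight// ltry.
  have Ri := cintegrable_Re fi.
  have : (\int[mu]_s (pweight eps s)%:E + \int[mu]_s (complex.Re (f s))%:E =
          (2 / eps + 2 * eps / (eps ^+ 2 + b ^+ 2))%:E)%E.
    rewrite -integralD// -integral_exp_cos//; apply: eq_integral => s _.
    rewrite -EFinD; congr (_%:E); rewrite /f /= mul0r subr0; ring.
  rewrite integral_pweight// => h.
  have -> : complex.Re (cint mu f) = fine (\int[mu]_s (complex.Re (f s))%:E) by [].
  have : (\int[mu]_s (complex.Re (f s))%:E \is a fin_num)%E by exact: integrable_fin_num.
  move: h; move: (\int[mu]_s _)%E => [r| |]//= [h] _; rewrite /pkern -/b; lra.
by move: Im0 Re1; move: (cint mu f) => [x y] /= -> ->.
Qed.

Lemma continuous_pkern eps : 0 < eps -> continuous (pkern eps).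
Proof.
move=> e0 v; apply: cvgM; first exact: cvg_cst.
apply: cvgV; first by rewrite gt_eqF// pden_gt0.
apply: cvgD; first exact: cvg_cst.
have h : (fun v : R => 2 * pi * v) x @[x --> v] --> 2 * pi * v by apply: cvgM; [exact: cvg_cst|exact: cvg_id].
by rewrite expr2; under eq_fun do rewrite expr2; apply: cvgM.
Qed.

Lemma measurable_pkern eps : 0 < eps -> measurable_fun setT (pkern eps).
Proof. by move=> e0; apply: continuous_measurable_fun; exact: continuous_pkern. Qed.

Lemma integral_pkern eps : 0 < eps -> (\int[mu]_v (pkern eps v)%:E = 1)%E.
Proof.
move=> e0; have e1 : eps != 0 by rewrite gt_eqF.
have p0 : 0 < pi :> R := pi_gt0 R; have p1 : pi != 0 :> R by rewrite gt_eqF.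
pose F v := atan (2 * pi / eps * v) / pi.
have dF v : is_derive v (1 : R) F (pkern eps v).
  apply: is_derive_eq; rewrite /GRing.scale /= /pkern.
  have D1 : eps ^+ 2 + (2 * pi * v) ^+ 2 != 0 by rewrite gt_eqF// pden_gt0.
  have D2 : 1 + (2 * pi / eps * v) ^+ 2 != 0 by rewrite gt_eqF// ltr_pwDl ?sqr_ge0.
  move: D1 D2 p1; move: (atan _); move: (@pi R) => q at_ D1 D2 q1; by field; rewrite D1 e1 q1.
have cF w : {for w, continuous F} by apply: differentiable_continuous; apply/derivable1_diffP; apply: ex_derive.
rewrite (ge0_symfun_integralT (f := pkern eps)).
- rewrite (_ : [set x | 0 <= x] = `[0, +oo[%classic); last first.
    by apply/seteqP; split => x /=; rewrite in_itv /= andbT.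
  rewrite (ge0_continuous_FTC2y (f := pkern eps) (F := F) (l := 2^-1)).
  + by rewrite /F mulr0 atan0 mul0r -EFinB subr0 -EFinM mulfV.
  + by move=> v _; exact: pkern_ge0.
  + by apply: continuous_subspaceT; exact: continuous_pkern.
  + rewrite (_ : 2^-1 = pi / 2 / pi :> R); last by rewrite mulrAC mulfV ?mul1r.
    apply: cvgMl.
    apply: (@cvg_comp _ _ _ (fun v => 2 * pi / eps * v) (@atan R) (pinfty_nbhs R) (pinfty_nbhs R)).
      apply/cvgryPge => A; exists (A / (2 * pi / eps)); split; first exact: num_real.
      by move=> x /ltW; rewrite ler_pdivrMr ?divr_gt0 ?mulr_gt0// mulrC.
    exact: cvgy_atan.
  + by move=> v _; exact: ex_derive.
  + by apply: cvg_at_right_filter; exact: cF.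
  + by move=> v _; rewrite derive1E derive_val.
- by move=> v; exact: pkern_ge0.
- exact: continuous_pkern.
- by move=> v; rewrite /pkern /= mulrN sqrrN.
Qed.

(** Away from 0 the kernel is [eps] times a constant times the fixed integrable function [pkern 1];
    this makes the family an approximate identity. *)
Lemma pkern_tail (r : R) : 0 < r -> exists2 C : R, 0 <= C &
  forall eps v, 0 < eps <= 1 -> r <= `|v| -> pkern eps v <= eps * C * pkern 1 v.
Proof.
move=> r0; have p0 : 0 < pi :> R := pi_gt0 R.
have w0 : 0 < (2 * pi * r) ^+ 2 by rewrite exprn_gt0// !mulr_gt0.
exists (1 + ((2 * pi * r) ^+ 2)^-1); first by rewrite addr_ge0// invr_ge0 ltW.
move=> eps v /andP[e0 e1] rv; rewrite /pkern.
have wv : (2 * pi * r) ^+ 2 <= (2 * pi * v) ^+ 2.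
  rewrite (exprMn _ _ r) (exprMn _ _ v); apply: ler_wpM2l; first exact: sqr_ge0.
  by rewrite -(real_normK (num_real v)) ler_sqr ?nnegrE ?(ltW r0).
move: wv w0; move: (_ ^+ 2) ((2 * pi * v) ^+ 2) => w0 w wv w00.
have w1 : 0 < w by apply: lt_le_trans wv.
have e2 : 0 < eps ^+ 2 by rewrite exprn_gt0.
rewrite ler_pdivrMr ?addr_gt0//.
rewrite (_ : eps * (1 + w0^-1) * (2 * 1 / (1 ^+ 2 + w)) * (eps ^+ 2 + w) =
  (2 * eps) * ((1 + w0^-1) * (eps ^+ 2 + w) / (1 + w))); last by rewrite expr1n; field; rewrite !gt_eqF// addr_gt0.
rewrite ler_peMr ?mulr_ge0 ?(ltW e0)// ler_pdivlMr ?addr_gt0// mul1r.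
have h1 : 1 <= w0^-1 * w by rewrite mulrC ler_pdivlMr ?mul1r.
have h2 : 0 <= (1 + w0^-1) * eps ^+ 2 by rewrite mulr_ge0 ?(ltW e2)// addr_ge0// invr_ge0 ltW.
rewrite mulrDr [leRHS](_ : _ = (1 + w0^-1) * eps ^+ 2 + (w + w0^-1 * w)); last by ring.
by move: h1 h2; clear; lra.
Qed.

End poisson_kernel.

(** * Integrals of products of functions of one coordinate *)

Section product_integrals.
Variable R : realType.
Local Notation mu := (@lebesgue_measure R).

Lemma cint_prod d1 d2 (T1 : measurableType d1) (T2 : measurableType d2)
    (m1 : {sigma_finite_measure set T1 -> \bar R}) (m2 : {sigma_finite_measure set T2 -> \bar R})
    (F : T1 * T2 -> R[i]) : cintegrable (m1 \x m2)%E F ->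
  cint (m1 \x m2)%E F = cint m1 (fun x => cint m2 (fun y => F (x, y))).
Proof.
move=> Fi; rewrite [LHS]/cint [RHS]/cint /=; congr (_ +i* _).
- by rewrite (Rint_prod1 (f := fun z => complex.Re (F z)) (cintegrable_Re Fi)).
- by rewrite (Rint_prod1 (f := fun z => complex.Im (F z)) (cintegrable_Im Fi)).
Qed.

Lemma normc_prod I (s : seq I) (F : I -> R[i]) :
  normc (\prod_(i <- s) F i) = \prod_(i <- s) normc (F i).
Proof. by elim/big_rec2: _ => [|i x y _ <-]; rewrite ?normcM//; exact: normc1. Qed.

Lemma cmeas_prod d (T : measurableType d) I (s : seq I) (F : I -> T -> R[i]) :
  (forall i, cmeas (F i)) -> cmeas (fun x => \prod_(i <- s) F i x).
Proof.
move=> mF; elim: s => [|i s IH].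
  by under eq_fun do rewrite big_nil; exact: cmeas_cst.
by under eq_fun do rewrite big_cons; exact: cmeasM.
Qed.

Lemma cmeas_coord n (f : R -> R[i]) (i : 'I_n) : cmeas (f : measurableTypeR R -> R[i]) ->
  cmeas (fun x : 'cV[R]_n => f (x i ord0)).
Proof. exact: (cmeas_comp (measurable_coord i)). Qed.

Lemma cintegrable_leb_prod n (F : 'I_n -> R -> R[i]) : (forall i, cintegrable mu (F i)) ->
  cintegrable (leb R n) (fun x => \prod_i F i (x i ord0)).
Proof.
move=> Fi; split.
  by apply: (cmeas_prod _ (F := fun i (x : 'cV[R]_n) => F i (x i ord0))) => i; apply: cmeas_coord; case: (Fi i).
under eq_integral => x _ do rewrite normc_prod.
rewrite (ge0_integral_prod (w := fun i s => normc (F i s))).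
- rewrite (_ : (\prod_(i < n) _)%E = (\prod_(i < n) fine (\int[mu]_x (normc (F i x))%:E))%:E) ?ltry//.
  rewrite -prodEFin; apply: eq_bigr => i _; rewrite fineK// ge0_fin_numE; first by case: (Fi i).
  by apply: integral_ge0 => s _; rewrite lee_fin normc_ge0.
- by move=> i; apply: measurable_normc; case: (Fi i).
- by move=> i s; rewrite normc_ge0.
Qed.

Lemma cint_leb_prod n (F : 'I_n -> R -> R[i]) : (forall i, cintegrable mu (F i)) ->
  cint (leb R n) (fun x => \prod_i F i (x i ord0)) = \prod_i cint mu (F i).
Proof.
elim: n F => [|n IH] F Fi.
  rewrite big_ord0 (_ : (fun x : 'cV[R]_0 => _) = cst 1); last by apply/funext => x; rewrite big_ord0.
  have l0 : leb R 0 [set: 'cV[R]_0] = 1%E by rewrite /= diracE in_setT.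
  have ic (r : R) : (\int[leb R 0]_(_ in [set: 'cV[R]_0]) r%:E = r%:E)%E.
    transitivity (r%:E * leb R 0 [set: 'cV[R]_0])%E; last by rewrite l0 mule1.
    exact: (@integral_cst _ _ _ (leb R 0) setT measurableT r%:E).
  by rewrite /cint /Rintegral !ic.
have Gi := cintegrable_leb_prod Fi.
have tc : transports (mu \x leb R n)%E (leb R n.+1) (@cons_col R n).
  by apply: pushforward_transports => //; exact: measurable_cons_col.
rewrite -(cint_transport tc); last by case: Gi.
rewrite cint_prod; last first.
  exact: (cintegrable_transport (@measurable_cons_col R n) tc Gi).
rewrite big_ord_recl mulrC -IH; last by move=> i; exact: Fi.
rewrite -cintZ//; congr cint; apply/funext => s.
have Hi : cintegrable (leb R n) (fun x => \prod_i F (lift ord0 i) (x i ord0)).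
  by apply: (cintegrable_leb_prod (F := fun i => F (lift ord0 i))) => i; exact: Fi.
rewrite [RHS]mulrC -cintZ//; congr cint; apply/funext => v.
rewrite big_ord_recl cons_col_0; congr (_ * _).
by apply: eq_bigr => i _; rewrite cons_col_lift.
Qed.

End product_integrals.

(** * Product weights and kernels on columns *)

Section poisson_kernel_columns.
Variables (R : realType) (d : nat).
Local Notation mu := (@lebesgue_measure R).
Local Notation lebd := (leb R d).
Implicit Types (eps : R) (v x : 'cV[R]_d).

Definition PW eps x : R := \prod_i pweight eps (x i ord0).
Definition PK eps v : R := \prod_i pkern eps (v i ord0).

Lemma cis_sum I (s : seq I) (a : I -> R) : cis (\sum_(i <- s) a i) = \prod_(i <- s) cis (a i).
Proof. by elim/big_rec2: _ => [|i x y _ <-]; [exact: cis0|exact: cisD]. Qed.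

Lemma real_complex_prod I (s : seq I) (a : I -> R) :
  (\prod_(i <- s) a i)%:C = \prod_(i <- s) (a i)%:C.
Proof. exact: (rmorph_prod (real_complex R)). Qed.

Let factor eps v x : (PW eps x)%:C * cis (2 * pi * dotv x v) =
  \prod_i ((pweight eps (x i ord0))%:C * cis (2 * pi * v i ord0 * x i ord0)).
Proof.
rewrite /PW real_complex_prod mulr_sumr cis_sum -big_split; apply: eq_bigr => i _ /=.
by congr (_ * cis _); rewrite -!mulrA (mulrC (v i ord0)).
Qed.

Lemma cintegrable_PW eps v : 0 < eps ->
  cintegrable lebd (fun x => (PW eps x)%:C * cis (2 * pi * dotv x v)).
Proof.
move=> e0; under eq_fun do rewrite factor.
apply: (cintegrable_leb_prod (F := fun i s => (pweight eps s)%:C * cis (2 * pi * v i ord0 * s))) => i.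
exact: cintegrable_pweight.
Qed.

Lemma cint_PW eps v : 0 < eps ->
  cint lebd (fun x => (PW eps x)%:C * cis (2 * pi * dotv x v)) = (PK eps v)%:C.
Proof.
move=> e0; under eq_fun do rewrite factor.
rewrite (cint_leb_prod (F := fun i s => (pweight eps s)%:C * cis (2 * pi * v i ord0 * s))).
  by rewrite real_complex_prod; apply: eq_bigr => i _; exact: cint_pweight.
by move=> i; exact: cintegrable_pweight.
Qed.

Lemma PW_ge0 eps x : 0 <= PW eps x.
Proof. by apply: prodr_ge0 => i _; exact: expR_ge0. Qed.

Lemma PW_le1 eps x : 0 < eps -> PW eps x <= 1.
Proof.
move=> e0; apply: prodr_ile1 => i _; rewrite expR_ge0 /= -expR0 ler_expR oppr_le0.
by rewrite mulr_ge0// ltW.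
Qed.

Lemma PW_homo eps eps' x : 0 < eps <= eps' -> PW eps' x <= PW eps x.
Proof.
move=> /andP[e0 ee]; apply: ler_prod => i _; rewrite expR_ge0 /= ler_expR lerN2.
by rewrite ler_wpM2r.
Qed.

Lemma measurable_PW eps : measurable_fun setT (PW eps).
Proof.
apply: measurable_prod => i _; apply: (measurableT_comp _ (measurable_coord i)).
by apply: continuous_measurable_fun; exact: continuous_pweight.
Qed.

Lemma PW_cvg x : PW n.+1%:R^-1 x @[n --> \oo] --> (1 : R).
Proof.
have c1 i : pweight n.+1%:R^-1 (x i ord0) @[n --> \oo] --> (1 : R).
  have h : - (n.+1%:R^-1 * `|x i ord0|) @[n --> \oo] --> (0 : R).
    rewrite -[X in _ --> X]oppr0; apply: cvgN; rewrite -[X in _ --> X](mul0r `|x i ord0|).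
    by apply: cvgMl; exact: cvg_harmonic.
  rewrite -[X in _ --> X]expR0; apply: (cvg_comp _ _ h); exact: continuous_expR.
pose f i (n : nat) : R := pweight n.+1%:R^-1 (x i ord0).
have H s : (fun n => \prod_(j <- s) f j n) @ \oo --> \prod_(j <- s) (1 : R).
  elim: s => [|i s IH].
    by rewrite big_nil; under eq_fun do rewrite big_nil; exact: cvg_cst.
  rewrite big_cons; under eq_fun do rewrite big_cons.
  exact: (cvgM (c1 i) IH).
by have := H (index_enum 'I_d); rewrite (big1_eq (index_enum 'I_d)).
Qed.

Lemma PK_ge0 eps v : 0 < eps -> 0 <= PK eps v.
Proof. by move=> e0; apply: prodr_ge0 => i _; exact: pkern_ge0. Qed.

Lemma measurable_PK eps : 0 < eps -> measurable_fun setT (PK eps).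
Proof.
move=> e0; apply: measurable_prod => i _; apply: (measurableT_comp _ (measurable_coord i)).
exact: measurable_pkern.
Qed.

Lemma integral_PK eps : 0 < eps -> (\int[lebd]_v (PK eps v)%:E = 1)%E.
Proof.
move=> e0; rewrite (ge0_integral_prod (w := fun=> pkern eps)).
- by rewrite big1// => i _; exact: integral_pkern.
- by move=> i; exact: measurable_pkern.
- by move=> i s; exact: pkern_ge0.
Qed.

Lemma measurable_norm_ge (r : R) : 0 < r -> measurable [set v : 'cV[R]_d | r <= `|v|].
Proof.
move=> r0; rewrite -[X in measurable X]setCK; apply: measurableC.
have -> : ~` [set v : 'cV[R]_d | r <= `|v|] = [set v | forall i, `]-r, r[%classic (v i ord0)].
  apply/seteqP; split => v /=.
    move=> /negP; rewrite -ltNge => vr i; rewrite in_itv /= -ltr_norml.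
    exact: le_lt_trans (cv_norm_coord v i) vr.
  move=> h; apply/negP; rewrite -ltNge; apply: cv_norm_lt => // i.
  by have := h i; rewrite in_itv /= -ltr_norml.
by apply: (measurable_box (A := fun=> `]-r, r[%classic)) => i; exact: measurable_itv.
Qed.

(* Outside the cube of radius r some coordinate factor is at most eps * C times pkern 1. *)
Lemma PK_tail (r : R) : 0 < r -> exists2 C : R, 0 <= C & forall eps, 0 < eps <= 1 ->
  (\int[lebd]_v (PK eps v * \1_[set v | (r <= `|v|)%R] v)%:E <= (eps * C)%:E)%E.
Proof.
move=> r0; have [C C0 hC] := pkern_tail r0.
exists (d%:R * C); first by rewrite mulr_ge0.
move=> eps /[dup] e01 /andP[e0 e1].
pose w (i j : 'I_d) := if j == i then pkern 1 else pkern eps : R -> R.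
have w0 i j s : 0 <= w i j s by rewrite /w; case: eqP => _; exact: pkern_ge0.
have mw i j : measurable_fun setT (w i j).
  by rewrite /w; case: eqP => _; exact: measurable_pkern.
have mW i : measurable_fun setT (fun v : 'cV[R]_d => \prod_j w i j (v j ord0)).
  by apply: measurable_prod => j _; apply: (measurableT_comp _ (measurable_coord j)); exact: mw.
have W0 i (v : 'cV[R]_d) : 0 <= \prod_j w i j (v j ord0) by apply: prodr_ge0 => j _; exact: w0.
have Wi i : (\int[lebd]_v (\prod_j w i j (v j ord0))%:E = 1)%E.
  rewrite (ge0_integral_prod (w := w i))//.
  by rewrite big1// => j _; rewrite /w; case: eqP => _; apply: integral_pkern.
apply: (@le_trans _ _ (\int[lebd]_v (\sum_(i < d) (eps * C)%:E * (\prod_j w i j (v j ord0))%:E))%E).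
  apply: ge0_le_integral => //.
  - by move=> v _; rewrite lee_fin mulr_ge0//; exact: PK_ge0.
  - apply/measurable_EFinP; apply: measurable_funM; first exact: measurable_PK.
    by apply: measurable_indic; exact: measurable_norm_ge.
  - apply: emeasurable_sum => i; apply: measurable_funeM; exact/measurable_EFinP.
  - move=> v _; rewrite indicE; have [vr|vr] := boolP (v \in _); last first.
      rewrite mulr0; by apply: sume_ge0 => i _; rewrite -EFinM lee_fin !mulr_ge0// ltW.
    have [i ri] : exists i, r <= `|v i ord0|.
      apply: contrapT => /forallNP h; move: (set_mem vr); rewrite /= leNgt cv_norm_lt// => i.
      by rewrite ltNge; apply/negP; exact: h.
    rewrite mulr1 (bigD1 i)//= -[leLHS]adde0; apply: leeD; last first.
      by apply: sume_ge0 => j _; rewrite -EFinM lee_fin !mulr_ge0// ltW.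
    rewrite -EFinM lee_fin /PK (bigD1 i)//= [X in _ <= _ * X](bigD1 i)//= mulrA.
    have -> : \prod_(j < d | j != i) w i j (v j ord0) = \prod_(j < d | j != i) pkern eps (v j ord0).
      by apply: eq_bigr => j /negPf ji; rewrite /w ji.
    apply: ler_wpM2r; first by apply: prodr_ge0 => j _; exact: pkern_ge0.
    by rewrite /w eqxx; exact: hC.
rewrite ge0_integral_sum//.
- rewrite (eq_bigr (fun=> (eps * C)%:E)); last first.
    move=> i _; rewrite ge0_integralZl//.
    + by rewrite -[RHS]mule1 -(Wi i).
    + exact/measurable_EFinP.
    + by move=> v _; rewrite lee_fin.
    + by rewrite lee_fin mulr_ge0// ltW.
  by rewrite sumEFin lee_fin sumr_const card_ord -[leLHS]mulr_natl mulrCA.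
- by move=> i; apply: measurable_funeM; exact/measurable_EFinP.
- by move=> i v _; rewrite -EFinM lee_fin !mulr_ge0// ltW.
Qed.

End poisson_kernel_columns.

(** * The Poisson kernels as an approximate identity *)

Section approximate_identity.
Variables (R : realType) (d : nat).
Local Notation lebd := (leb R d).

Lemma cint_real dd (T : measurableType dd) (m : {measure set T -> \bar R}) (u : T -> R) :
  cint m (fun x => (u x)%:C) = (fine (\int[m]_x (u x)%:E)%E)%:C.
Proof.
rewrite /cint; congr (_ +i* _); rewrite /Rintegral.
by rewrite (_ : integral _ _ _ = 0%E)//; apply: integral0_eq.
Qed.

Lemma PK_opp eps (v : 'cV[R]_d) : PK eps (- v) = PK eps v.
Proof. by apply: eq_bigr => i _; rewrite mxE /pkern mulrN sqrrN. Qed.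

Lemma cint_PK eps : 0 < eps -> cint lebd (fun v => (PK eps v)%:C) = 1.
Proof. by move=> e0; rewrite cint_real integral_PK. Qed.

Lemma cintegrable_PKM eps (G : 'cV[R]_d -> R[i]) M : 0 < eps -> cmeas G ->
  (forall v, normc (G v) <= M) -> cintegrable lebd (fun v => (PK eps v)%:C * G v).
Proof.
move=> e0 mG GM; have mPK := @measurable_PK R d _ e0; have M0 : 0 <= M by apply: le_trans (GM 0); exact: normc_ge0.
apply: (@le_cintegrable _ _ R lebd _ (fun v => M%:E * (PK eps v)%:E)%E).
- by apply: cmeasM => //; exact: cmeas_real.
- by apply: measurable_funeM; exact/measurable_EFinP.
- move=> v; rewrite normcM normc_real ger0_norm ?PK_ge0// -EFinM lee_fin mulrC.
  by apply: ler_wpM2r; [exact: PK_ge0|exact: GM].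
- rewrite ge0_integralZl//; first by rewrite integral_PK// mule1 ltry.
    exact/measurable_EFinP.
  by move=> v _; rewrite lee_fin PK_ge0.
Qed.

(** The kernel has mass 1, so [G - G 0] is averaged: it is below [e / 2] near 0 and at most [2 M] on
    the rest, where the mass is at most [eps * C]. *)
Lemma approx_identity (G : 'cV[R]_d -> R[i]) M : cmeas G ->
  (forall v, normc (G v) <= M) ->
  (forall e, 0 < e -> exists2 r : R, 0 < r & forall v, `|v| < r -> normc (G v - G 0) < e) ->
  forall e, 0 < e -> exists2 eps0 : R, 0 < eps0 & forall eps, 0 < eps <= eps0 ->
    normc (cint lebd (fun v => (PK eps v)%:C * G v) - G 0) <= e.
Proof.
move=> mG GM Gc e e0; have M0 : 0 <= M by apply: le_trans (GM 0); exact: normc_ge0.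
have [r r0 hr] := Gc (e / 2) (divr_gt0 e0 (ltr0Sn _ 1)).
have [C C0 hC] := @PK_tail R d _ r0.
have K0 : 0 <= 2 * M * C by rewrite !mulr_ge0.
have [e1 e10 he1] := small_coeff K0 (divr_gt0 e0 (ltr0Sn R 1)).
exists (Num.min 1 e1); first by rewrite lt_min ltr01.
move=> eps; rewrite le_min => /and3P[p0 p1 pe].
have mPK := @measurable_PK R d _ p0.
have GM2 v : normc (G v - G 0) <= 2 * M.
  by apply: (le_trans (le_normcD _ _)); rewrite normcN; have := GM v; have := GM 0; lra.
have mD : cmeas (fun v => G v - G 0) by apply: cmeasD => //; exact: cmeas_cst.
have i1 : cintegrable lebd (fun v => (PK eps v)%:C * G v) by exact: cintegrable_PKM.
have i2 := cintegrable_PKM p0 mD GM2.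
have -> : cint lebd (fun v => (PK eps v)%:C * G v) - G 0 =
    cint lebd (fun v => (PK eps v)%:C * (G v - G 0)).
  have iK : cintegrable lebd (fun v => (PK eps v)%:C).
    have n1 : normc (1 : R[i]) <= 1 by rewrite normc1.
    have := @cintegrable_PKM eps (fun=> 1) 1 p0 (@cmeas_cst _ _ _ 1) (fun=> n1).
    by under eq_fun do rewrite mulr1.
  rewrite -[X in _ - X]mulr1 -(cint_PK p0) -mulNr -cintZ// -cintD//; last exact: cintegrableZ.
  by congr cint; apply/funext => v; ring.
have mI := @measurable_norm_ge R d _ r0.
have mf1 : measurable_fun setT (fun v : 'cV[R]_d => (e / 2)%:E * (PK eps v)%:E)%E.
  by apply: measurable_funeM; exact/measurable_EFinP.
have mPI : measurable_fun setT (fun v : 'cV[R]_d => PK eps v * \1_[set v | r <= `|v|] v).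
  by apply: measurable_funM => //; exact: measurable_indic.
have mf2 : measurable_fun setT (fun v : 'cV[R]_d =>
    (2 * M)%:E * (PK eps v * \1_[set v | (r <= `|v|)%R] v)%:E)%E.
  by apply: measurable_funeM; exact/measurable_EFinP.
rewrite -lee_fin; apply: (le_trans (normc_cint_leT _ _)); first by case: i2.
apply: (@le_trans _ _ (\int[lebd]_v ((e / 2)%:E * (PK eps v)%:E +
    (2 * M)%:E * (PK eps v * \1_[set v | (r <= `|v|)%R] v)%:E))%E).
  apply: ge0_le_integral => //.
  - by move=> v _; rewrite lee_fin normc_ge0.
  - by apply: measurable_normcE; case: i2.
  - exact: emeasurable_funD.
  - move=> v _; rewrite normcM normc_real ger0_norm ?PK_ge0// -!EFinM -EFinD lee_fin.
    rewrite indicE; have [vr|vr] := boolP (v \in _).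
      rewrite mulr1 mulrC; apply: (@le_trans _ _ (2 * M * PK eps v)).
        by apply: ler_wpM2r; [exact: PK_ge0|exact: GM2].
      by rewrite lerDr mulr_ge0 ?PK_ge0// ltW// divr_gt0.
    rewrite !mulr0 addr0 mulrC; apply: ler_wpM2r; first exact: PK_ge0.
    apply/ltW/hr; rewrite ltNge; apply/negP => h; move/negP: vr; apply; exact/mem_set.
have e2 : 0 <= e / 2 by rewrite divr_ge0// ltW.
rewrite ge0_integralD//; last 2 first.
- by move=> v _; rewrite -EFinM lee_fin mulr_ge0// PK_ge0.
- by move=> v _; rewrite -EFinM lee_fin !mulr_ge0// PK_ge0.
rewrite ge0_integralZl//; last 2 first.
- exact/measurable_EFinP.
- by move=> v _; rewrite lee_fin PK_ge0.
rewrite ge0_integralZl//; last 3 first.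
- exact/measurable_EFinP.
- by move=> v _; rewrite lee_fin mulr_ge0// PK_ge0.
- by rewrite lee_fin mulr_ge0.
rewrite integral_PK// mule1.
apply: (@le_trans _ _ ((e / 2)%:E + (2 * M)%:E * (eps * C)%:E)%E).
  apply: leeD => //; apply: lee_wpmul2l; first by rewrite lee_fin mulr_ge0.
  by apply: hC; rewrite p0.
rewrite -EFinM -EFinD lee_fin.
have : eps * (2 * M * C) <= e1 * (2 * M * C) by apply: ler_wpM2r.
by move: he1; move: (e1 * _) => q; move: (eps); clear; move=> x ? ?; lra.
Qed.

End approximate_identity.

(** * A regularized Parseval identity *)

Section moyal_identity.
Variables (R : realType) (d : nat).
Local Notation lebd := (leb R d).
Local Notation C := 'cV[R]_d.
Local Notation lebdd := (leb R (d + d)).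
Local Notation CC := 'cV[R]_(d + d).

Lemma transports_refl (a : C) : transports lebd lebd (fun x => a - x).
Proof.
move=> f mf f0; rewrite -(transports_shift a mf f0).
rewrite -(transports_opp (f := fun x => f (x + a)))//.
  by apply: eq_integral => x _; rewrite addrC.
by apply: (measurableT_comp mf); apply: measurable_addv => //; exact: measurable_cst.
Qed.

Lemma integral_mul_le (f h : C -> R[i]) (phi psi : C -> C) : cmeas f -> cmeas h ->
  measurable_fun setT phi -> measurable_fun setT psi ->
  transports lebd lebd phi -> transports lebd lebd psi ->
  (\int[lebd]_x (normc (f (phi x)) * normc (h (psi x)))%:E <= sqL2 f + sqL2 h)%E.
Proof.
move=> mf mh mphi mpsi tphi tpsi.
have m1 : measurable_fun setT (fun x => (normc (f (phi x)) ^+ 2)%:E).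
  exact: (measurable_sqr_normc (cmeas_comp mphi mf)).
have m2 : measurable_fun setT (fun x => (normc (h (psi x)) ^+ 2)%:E).
  exact: (measurable_sqr_normc (cmeas_comp mpsi mh)).
apply: (@le_trans _ _ (\int[lebd]_x ((normc (f (phi x)) ^+ 2)%:E + (normc (h (psi x)) ^+ 2)%:E))%E).
  apply: ge0_le_integral => //.
  - by move=> x _; rewrite lee_fin mulr_ge0 ?normc_ge0.
  - apply/measurable_EFinP; apply: measurable_funM; apply: measurable_normc; exact: cmeas_comp.
  - exact: emeasurable_funD.
  - move=> x _; rewrite -EFinD lee_fin; move: (normc _) (normc _) => a b.
    by have := sqr_ge0 (a - b); have := sqr_ge0 a; have := sqr_ge0 b; rewrite sqrrB; lra.
rewrite ge0_integralD//; try by move=> x _; rewrite lee_fin sqr_ge0.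
rewrite (tphi (fun x => (normc (f x) ^+ 2)%:E)); last 2 first.
- exact: measurable_sqr_normc.
- by move=> y; rewrite lee_fin sqr_ge0.
rewrite (tpsi (fun x => (normc (h x) ^+ 2)%:E))//.
- exact: measurable_sqr_normc.
- by move=> y; rewrite lee_fin sqr_ge0.
Qed.

Let mU : measurable_fun setT (fun p : CC => usubmx p).
Proof. by apply: measurable_usubmx; exact: measurable_id. Qed.

Let mD : measurable_fun setT (fun p : CC => dsubmx p).
Proof. by apply: measurable_dsubmx; exact: measurable_id. Qed.

Lemma cint_col_mx (F : CC -> R[i]) : cintegrable lebdd F ->
  cint lebdd F = cint lebd (fun x => cint lebd (fun y => F (col_mx x y))).
Proof.
move=> [mF iF]; have tc := @transports_col_mx R d d.
rewrite -(cint_transport tc mF); apply: cint_prod.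
apply: (cintegrable_transport _ tc) => //.
by apply: measurable_col_mx; [exact: measurable_fst|exact: measurable_snd].
Qed.

Definition FT (F : C -> R[i]) (xi : C) : R[i] :=
  cint lebd (fun t => F t * cis (- (2 * pi * dotv xi t))).

Lemma inner_FT (f g : C -> R[i]) z :
  inner f (tfshift z g) = FT (fun t => f t * conjc (g (t - usubmx z))) (dsubmx z).
Proof.
rewrite innerE /FT; congr cint; apply/funext => t.
by rewrite tfshiftE conjcM conjc_cis mulrCA mulrC.
Qed.

Lemma cintegrable_tensor (F1 F2 : C -> R[i]) : cintegrable lebd F1 -> cintegrable lebd F2 ->
  cintegrable lebdd (fun p => F1 (usubmx p) * conjc (F2 (dsubmx p))).
Proof.
move=> [m1 i1] [m2 i2].
have mt : cmeas (fun p : CC => F1 (usubmx p) * conjc (F2 (dsubmx p))).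
  apply: cmeasM; first exact: (cmeas_comp mU m1).
  by apply: cmeas_conj; exact: (cmeas_comp mD m2).
split=> //.
have n2 : (0 <= \int[lebd]_x (normc (F2 x))%:E)%E by apply: integral_ge0 => x _; rewrite lee_fin normc_ge0.
have e x : (\int[lebd]_y (normc (F1 x * conjc (F2 y)))%:E =
    (normc (F1 x))%:E * \int[lebd]_y (normc (F2 y))%:E)%E.
  rewrite -ge0_integralZl//.
  - by apply: eq_integral => y _; rewrite normcM normc_conj.
  - exact: measurable_normcE.
  - by move=> y _; rewrite lee_fin normc_ge0.
  - by rewrite lee_fin normc_ge0.
rewrite ge0_integral_col_mx; last 2 first.
- exact: (measurable_normcE mt).
- by move=> y; rewrite lee_fin normc_ge0.
have e' x : (\int[lebd]_y (normc (F1 (usubmx (col_mx x y)) * conjc (F2 (dsubmx (col_mx x y)))))%:E =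
    (normc (F1 x))%:E * \int[lebd]_y (normc (F2 y))%:E)%E.
  by rewrite -e; apply: eq_integral => y _; rewrite col_mxKu col_mxKd.
under eq_integral => x _ do rewrite e'.
rewrite ge0_integralZr//; last 2 first.
- exact: measurable_normcE.
- by move=> y _; rewrite lee_fin normc_ge0.
have n1 : (0 <= \int[lebd]_x (normc (F1 x))%:E)%E by apply: integral_ge0 => x _; rewrite lee_fin normc_ge0.
by apply: lte_mul_pinfty => //; rewrite ge0_fin_numE.
Qed.

(** The weight makes the triple integral absolutely convergent; integrating the frequency before the
    other variables turns the weight into its Fourier transform [PK]. *)
Lemma fourier_pairing eps (F1 F2 : C -> R[i]) : 0 < eps ->
  cintegrable lebd F1 -> cintegrable lebd F2 ->
  cint lebd (fun xi => (PW eps xi)%:C * (FT F1 xi * conjc (FT F2 xi))) =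
  cint lebdd (fun p => (PK eps (usubmx p - dsubmx p))%:C * (F1 (usubmx p) * conjc (F2 (dsubmx p)))).
Proof.
move=> e0 F1i F2i; have ti := cintegrable_tensor F1i F2i.
have mdot : measurable_fun setT (fun q : CC * C => 2 * pi * dotv q.2 (dsubmx q.1 - usubmx q.1)).
  apply: measurable_funM; first exact: measurable_cst.
  apply: measurable_dotv; first exact: measurable_snd.
  apply: measurable_subv; first exact: (measurableT_comp mD measurable_fst).
  exact: (measurableT_comp mU measurable_fst).
pose H (q : CC * C) : R[i] := (F1 (usubmx q.1) * conjc (F2 (dsubmx q.1))) *
  ((PW eps q.2)%:C * cis (2 * pi * dotv q.2 (dsubmx q.1 - usubmx q.1))).
have mH : cmeas H.
  apply: cmeasM.
    by apply: (cmeas_comp (phi := fst) _ (f := fun p => F1 (usubmx p) * conjc (F2 (dsubmx p)))) => //; case: ti.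
  apply: cmeasM; last exact: cmeas_cis.
  apply: cmeas_real; apply: (measurableT_comp _ measurable_snd); exact: measurable_PW.
have PWi : (\int[lebd]_x (PW eps x)%:E < +oo)%E.
  have [_] := @cintegrable_PW R d eps 0 e0.
  by under eq_integral => x _ do rewrite normcM normc_cis mulr1 normc_real ger0_norm ?PW_ge0//.
have mPW : measurable_fun setT (fun x : C => (PW eps x)%:E) by apply/measurable_EFinP; exact: measurable_PW.
have PW0 : (0 <= \int[lebd]_x (PW eps x)%:E)%E by apply: integral_ge0 => x _; rewrite lee_fin PW_ge0.
have Hoo : (\int[lebdd]_p \int[lebd]_xi (normc (H (p, xi)))%:E < +oo)%E.
  have e p : (\int[lebd]_xi (normc (H (p, xi)))%:E =
      (normc (F1 (usubmx p) * conjc (F2 (dsubmx p))))%:E * \int[lebd]_x (PW eps x)%:E)%E.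
    rewrite -ge0_integralZl//.
    - apply: eq_integral => x _.
      by rewrite /H normcM [normc (_%:C * _)]normcM normc_cis mulr1 normc_real ger0_norm ?PW_ge0.
    - by move=> y _; rewrite lee_fin PW_ge0.
    - by rewrite lee_fin normc_ge0.
  under eq_integral => p _ do rewrite e.
  have [m3 i3] := ti.
  rewrite ge0_integralZr//; last 2 first.
  - exact: (measurable_normcE m3).
  - by move=> y _; rewrite lee_fin normc_ge0.
  have n1 : (0 <= \int[lebdd]_p (normc (F1 (usubmx p) * conjc (F2 (dsubmx p))))%:E)%E.
    by apply: integral_ge0 => x _; rewrite lee_fin normc_ge0.
  by apply: lte_mul_pinfty => //; rewrite ge0_fin_numE.
transitivity (cint lebd (fun xi => cint lebdd (fun p => H (p, xi)))).
  congr cint; apply/funext => xi.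
  have mci (F : C -> R[i]) : cintegrable lebd F -> cintegrable lebd (fun t => F t * cis (- (2 * pi * dotv xi t))).
    move=> [mF iF]; split.
      apply: cmeasM => //; apply: cmeas_cis; apply: measurableT_comp => //.
      apply: measurable_funM; first exact: measurable_cst.
      by apply: measurable_dotv => //; exact: measurable_cst.
    by under eq_integral => t _ do rewrite normcM normc_cis mulr1.
  have ci1 := mci _ F1i; have ci2 := mci _ F2i.
  have cc2 : cintegrable lebd (fun t => conjc (F2 t * cis (- (2 * pi * dotv xi t)))).
    have [m2 i2] := ci2; split; first exact: cmeas_conj.
    by under eq_integral => t _ do rewrite normc_conj.
  have tci := cintegrable_tensor ci1 ci2.
  have -> : FT F1 xi * conjc (FT F2 xi) = cint lebdd (fun p =>
      (F1 (usubmx p) * cis (- (2 * pi * dotv xi (usubmx p)))) * conjc (F2 (dsubmx p) * cis (- (2 * pi * dotv xi (dsubmx p))))).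
    rewrite cint_col_mx// mulrC /FT -cintZ//; congr cint; apply/funext => s.
    rewrite mulrC -cint_conj// -cintZ//.
    by congr cint; apply/funext => t; rewrite col_mxKu col_mxKd.
  rewrite -cintZ//; congr cint; apply/funext => p; rewrite /H /=.
  rewrite conjcM conjc_cis opprK dotvDr dotvNr (mulrBr (2 * pi)) cisD.
  by rewrite -!mulrA; move: (cis _) (cis _) (PW _ _)%:C => a b c; ring.
rewrite -(cint_fubini (m1 := lebdd) (m2 := lebd) (F := H))//.
congr cint; apply/funext => p; rewrite /H /=.
rewrite cintZ; last exact: cintegrable_PW.
by rewrite cint_PW// mulrC -PK_opp opprB.
Qed.

End moyal_identity.

(** * The regularized Moyal identity *)

Section moyal.
Variables (R : realType) (d : nat).
Local Notation lebd := (leb R d).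
Local Notation C := 'cV[R]_d.
Local Notation lebdd := (leb R (d + d)).
Local Notation CC := 'cV[R]_(d + d).
Implicit Types f g h : L2 R d.

Let cL f : cmeas f.
Proof. by apply: cmeas_L2; exact: L2P. Qed.

Let mU : measurable_fun setT (fun p : CC => usubmx p).
Proof. by apply: measurable_usubmx; exact: measurable_id. Qed.

Let mD : measurable_fun setT (fun p : CC => dsubmx p).
Proof. by apply: measurable_dsubmx; exact: measurable_id. Qed.

Let mshift (a : C) : measurable_fun setT (fun x : C => x - a).
Proof. by apply: measurable_subv => //; exact: measurable_cst. Qed.

Let mrefl (a : C) : measurable_fun setT (fun x : C => a - x).
Proof. by apply: measurable_subv => //; exact: measurable_cst. Qed.

Definition cross (f g : C -> R[i]) (v : C) : R[i] := cint lebd (fun s => f s * conjc (g (s - v))).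

Lemma cross_inner (f g : C -> R[i]) v : cross f g v = inner f (tfshift (col_mx v 0) g).
Proof.
rewrite innerE; congr cint; apply/funext => t.
by rewrite tfshiftE col_mxKu col_mxKd dotv0l mulr0 cis0 mul1r.
Qed.

Lemma sqL2_fin f : (sqL2 f < +oo)%E.
Proof. by have /in_L2P[] := L2P f. Qed.

Lemma sqL2_ge0 (f : C -> R[i]) : (0 <= sqL2 f)%E.
Proof. by apply: integral_ge0 => t _; rewrite lee_fin sqr_ge0. Qed.

Let bnd f g : R := fine (sqL2 f + sqL2 g)%E.

Let bndE f g : (sqL2 f + sqL2 g = (bnd f g)%:E)%E.
Proof. by rewrite /bnd fineK// fin_numD !ge0_fin_numE ?sqL2_ge0// !sqL2_fin. Qed.

Let bnd0 f g : 0 <= bnd f g.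
Proof. by rewrite fine_ge0// adde_ge0// sqL2_ge0. Qed.

Lemma cmeas_cross f g : cmeas (cross f g).
Proof.
apply: (@cmeas_cint _ _ C C R lebd (fun q : C * C => f q.2 * conjc (g (q.2 - q.1)))).
apply: cmeasM; first exact: (cmeas_comp measurable_snd (cL f)).
apply: cmeas_conj; apply: (cmeas_comp (phi := fun q : C * C => q.2 - q.1)) => //.
by apply: measurable_subv; [exact: measurable_snd|exact: measurable_fst].
Qed.

Lemma normc_cross_le f g v : normc (cross f g v) <= bnd f g.
Proof.
rewrite -lee_fin -bndE; apply: le_trans (normc_cint_leT _ _) _.
  by apply: cmeasM => //; apply: cmeas_conj; exact: (cmeas_comp (mshift v)).
under eq_integral => t _ do rewrite normcM normc_conj.
apply: (@integral_mul_le _ _ f g id (fun t => t - v)) => //.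
exact: transports_shift.
Qed.

Let sh f (x : C) : C -> R[i] := fun t => f (t - x).

Let F f g (x : C) : C -> R[i] := fun t => f t * conjc (g (t - x)).

Let cF f g x : cintegrable lebd (F f g x).
Proof.
split; first by apply: cmeasM => //; apply: cmeas_conj; exact: (cmeas_comp (mshift x)).
under eq_integral => t _ do rewrite normcM normc_conj.
apply: (@le_lt_trans _ _ (bnd f g)%:E); last exact: ltry.
rewrite -bndE; apply: (@integral_mul_le _ _ f g id (fun t => t - x)) => //.
exact: transports_shift.
Qed.

(** The frequency integral at a fixed time shift [x], damped by [PW] to make it converge
    absolutely. *)
Definition moyal_slice eps f1 f2 g1 g2 (x : C) : R[i] := cint lebd (fun xi =>
  (PW eps xi)%:C * (inner f1 (tfshift (col_mx x xi) g1) * conjc (inner f2 (tfshift (col_mx x xi) g2)))).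

Let cross_refl g1 g2 s t :
  cint lebd (fun x => conjc (g1 (s - x)) * g2 (t - x)) = conjc (cross g1 g2 (s - t)).
Proof.
rewrite -cint_conj; last exact: (cF g1 g2 (s - t)).
rewrite -(cint_transport (transports_refl s) (f := fun y => conjc (g1 y * conjc (g2 (y - (s - t)))))); last first.
  by apply: cmeas_conj; case: (cF g1 g2 (s - t)).
congr cint; apply/funext => x; rewrite conjcM conjcK; congr (_ * g2 _).
by apply/colP => i; rewrite !mxE; ring.
Qed.

Let sqint (M : R) (k : C -> R) : 0 <= M -> measurable_fun setT k ->
  (forall p, 0 <= k p) -> (\int[lebd]_p (k p)%:E < +oo)%E ->
  (\int[lebd]_p ((M * k p)%:E) < +oo)%E.
Proof.
move=> M0 mk k0 koo; under eq_integral => p _ do rewrite EFinM.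
rewrite ge0_integralZl//; last 2 first.
- exact/measurable_EFinP.
- by move=> p _; rewrite lee_fin.
have i0 : (0 <= \int[lebd]_p (k p)%:E)%E by apply: integral_ge0 => p _; rewrite lee_fin.
by rewrite lte_mul_pinfty.
Qed.

(* PK * f1 * conj f2 over the plane of (s, t), with t = s - v *)
Let J eps f1 f2 (p : CC) : R[i] :=
  (PK eps (usubmx p - dsubmx p))%:C * (f1 (usubmx p) * conjc (f2 (dsubmx p))).

Let mUD : measurable_fun setT (fun p : CC => usubmx p - dsubmx p).
Proof. exact: measurable_subv. Qed.

Let cJ eps f1 f2 : 0 < eps -> cmeas (J eps f1 f2).
Proof.
move=> e0; apply: cmeasM.
  by apply: cmeas_real; apply: (measurableT_comp _ mUD); exact: measurable_PK.
by apply: cmeasM; [exact: (cmeas_comp mU)|apply: cmeas_conj; exact: (cmeas_comp mD)].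
Qed.

Let Jsub eps f1 f2 s v : J eps f1 f2 (col_mx s (s - v)) = (PK eps v)%:C * F f1 f2 v s.
Proof.
rewrite /J col_mxKu col_mxKd /F; congr ((PK eps _)%:C * _).
by rewrite opprB addrC subrK.
Qed.

Let cK eps f1 f2 : 0 < eps -> cmeas (fun q : C * C => (PK eps q.1)%:C * F f1 f2 q.1 q.2).
Proof.
move=> e0; apply: cmeasM.
  by apply: cmeas_real; apply: (measurableT_comp _ measurable_fst); exact: measurable_PK.
apply: cmeasM; first exact: (cmeas_comp measurable_snd (cL f1)).
apply: cmeas_conj; apply: (cmeas_comp (phi := fun q : C * C => q.2 - q.1)) => //.
by apply: measurable_subv; [exact: measurable_snd|exact: measurable_fst].
Qed.

Let int_F f1 f2 v : (\int[lebd]_s (normc (F f1 f2 v s))%:E <= (bnd f1 f2)%:E)%E.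
Proof.
under eq_integral => t _ do rewrite normcM normc_conj.
rewrite -bndE; apply: (@integral_mul_le _ _ f1 f2 id (fun t => t - v)) => //.
exact: transports_shift.
Qed.

Let Koo eps f1 f2 : 0 < eps ->
  (\int[lebd]_v \int[lebd]_s (normc ((PK eps v)%:C * F f1 f2 v s))%:E < +oo)%E.
Proof.
move=> e0; have mPK := @measurable_PK R d _ e0.
apply: (@le_lt_trans _ _ (\int[lebd]_v (bnd f1 f2 * PK eps v)%:E)%E); last first.
  apply: sqint => //.
    by move=> p; exact: PK_ge0.
  by rewrite integral_PK// ltry.
apply: ge0_le_integral => //.
- by move=> v _; apply: integral_ge0 => s _; rewrite lee_fin normc_ge0.
- apply: (measurable_fun_fubini_tonelli_F (fun q : C * C => (normc ((PK eps q.1)%:C * F f1 f2 q.1 q.2))%:E)).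
    by apply: measurable_normcE; exact: cK.
  by move=> q; rewrite lee_fin normc_ge0.
- by apply/measurable_EFinP; apply: measurable_funM => //; exact: measurable_cst.
- move=> v _; under eq_integral => s _ do rewrite normcM EFinM.
  rewrite ge0_integralZl//; last 3 first.
  + by apply: measurable_normcE; case: (cF f1 f2 v).
  + by move=> s _; rewrite lee_fin normc_ge0.
  + by rewrite lee_fin normc_ge0.
  rewrite normc_real ger0_norm ?PK_ge0// mulrC EFinM.
  by apply: lee_wpmul2l; [rewrite lee_fin PK_ge0|exact: int_F].
Qed.

Let integral_J eps f1 f2 : 0 < eps ->
  (\int[lebdd]_p (normc (J eps f1 f2 p))%:E =
   \int[lebd]_v \int[lebd]_s (normc ((PK eps v)%:C * F f1 f2 v s))%:E)%E.
Proof.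
move=> e0; rewrite ge0_integral_col_mx; last 2 first.
- by apply: measurable_normcE; exact: cJ.
- by move=> p; rewrite lee_fin normc_ge0.
transitivity (\int[lebd]_s \int[lebd]_v (normc ((PK eps v)%:C * F f1 f2 v s))%:E)%E; last first.
  apply/esym/(fubini_tonelli (fun q : C * C => (normc ((PK eps q.1)%:C * F f1 f2 q.1 q.2))%:E)).
    by apply: measurable_normcE; exact: cK.
  by move=> q; rewrite lee_fin normc_ge0.
apply: eq_integral => s _.
rewrite -(transports_refl s (f := fun t => (normc (J eps f1 f2 (col_mx s t)))%:E)); last 2 first.
- apply: measurable_normcE; apply: (cmeas_comp _ (cJ f1 f2 e0)).
  by apply: measurable_col_mx => //; exact: measurable_cst.
- by move=> p; rewrite lee_fin normc_ge0.
by apply: eq_integral => v _; rewrite Jsub.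
Qed.

Let iJ eps f1 f2 : 0 < eps -> cintegrable lebdd (J eps f1 f2).
Proof. by move=> e0; split; [exact: cJ|rewrite integral_J//; exact: Koo]. Qed.

(** At fixed [x], [fourier_pairing] applies to the windowed products. Integrating over [x] next
    produces the correlation of [g1] and [g2] at [s - t], and the substitution [t = s - v] followed
    by Fubini produces that of [f1] and [f2]. *)
Lemma moyal_slice_spec eps f1 f2 g1 g2 : 0 < eps ->
  cintegrable lebd (moyal_slice eps f1 f2 g1 g2) /\
  cint lebd (moyal_slice eps f1 f2 g1 g2) =
  cint lebd (fun v => (PK eps v)%:C * (cross f1 f2 v * conjc (cross g1 g2 v))).
Proof.
move=> e0.
pose H (q : C * CC) : R[i] := J eps f1 f2 q.2 * (conjc (g1 (usubmx q.2 - q.1)) * g2 (dsubmx q.2 - q.1)).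
have mH : cmeas H.
  apply: cmeasM; first exact: (cmeas_comp measurable_snd (cJ f1 f2 e0)).
  apply: cmeasM.
    apply: cmeas_conj; apply: (cmeas_comp (phi := fun q : C * CC => usubmx q.2 - q.1)) => //.
    by apply: measurable_subv; [exact: (measurableT_comp mU measurable_snd)|exact: measurable_fst].
  apply: (cmeas_comp (phi := fun q : C * CC => dsubmx q.2 - q.1)) => //.
  by apply: measurable_subv; [exact: (measurableT_comp mD measurable_snd)|exact: measurable_fst].
have sliceE x : moyal_slice eps f1 f2 g1 g2 x = cint lebdd (fun p => H (x, p)).
  rewrite /moyal_slice.
  rewrite (_ : (fun xi => _) = (fun xi => (PW eps xi)%:C *
      (FT (F f1 g1 x) xi * conjc (FT (F f2 g2 x) xi)))); last first.
    by apply/funext => xi; rewrite !inner_FT !col_mxKu !col_mxKd.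
  rewrite (fourier_pairing e0 (cF f1 g1 x) (cF f2 g2 x)); congr cint; apply/funext => p.
  by rewrite /H /J /F /= conjcM conjcK; ring.
have Hb p : (\int[lebd]_x (normc (H (x, p)))%:E <= (bnd g1 g2)%:E * (normc (J eps f1 f2 p))%:E)%E.
  have HE x : (normc (H (x, p)))%:E = ((normc (J eps f1 f2 p))%:E *
      (normc (conjc (g1 (usubmx p - x)) * g2 (dsubmx p - x)))%:E)%E by rewrite /H normcM EFinM.
  under eq_integral => x _ do rewrite HE.
  rewrite ge0_integralZl//; last 3 first.
  - apply: measurable_normcE; apply: cmeasM; last exact: (cmeas_comp (mrefl _)).
    by apply: cmeas_conj; exact: (cmeas_comp (mrefl _)).
  - by move=> x _; rewrite lee_fin normc_ge0.
  - by rewrite lee_fin normc_ge0.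
  rewrite muleC; apply: lee_wpmul2r; first by rewrite lee_fin normc_ge0.
  under eq_integral => x _ do rewrite normcM normc_conj.
  rewrite -bndE; apply: (@integral_mul_le _ _ g1 g2 (fun x => usubmx p - x) (fun x => dsubmx p - x)) => //.
    exact: transports_refl.
  exact: transports_refl.
have Hoo : (\int[lebd]_x \int[lebdd]_p (normc (H (x, p)))%:E < +oo)%E.
  rewrite (fubini_tonelli (fun q : C * CC => (normc (H q))%:E)); last 2 first.
  - exact: measurable_normcE.
  - by move=> q; rewrite lee_fin normc_ge0.
  apply: (@le_lt_trans _ _ (\int[lebdd]_p ((bnd g1 g2)%:E * (normc (J eps f1 f2 p))%:E))%E).
    apply: ge0_le_integral => //.
    - by move=> p _; apply: integral_ge0 => x _; rewrite lee_fin normc_ge0.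
    - apply: (measurable_fun_fubini_tonelli_G (fun q : C * CC => (normc (H q))%:E)) => //.
        exact: measurable_normcE.
      by move=> q; rewrite lee_fin normc_ge0.
    - by apply: measurable_funeM; apply: measurable_normcE; exact: cJ.
  have [_ Joo] := iJ f1 f2 e0.
  rewrite ge0_integralZl//; last 3 first.
  - by apply: measurable_normcE; exact: cJ.
  - by move=> x _; rewrite lee_fin normc_ge0.
  - by rewrite lee_fin.
  by apply: lte_mul_pinfty; rewrite ?lee_fin ?bnd0.
have sliceF : moyal_slice eps f1 f2 g1 g2 = (fun x => cint lebdd (fun p => H (x, p))).
  by apply/funext => x; exact: sliceE.
split; first by rewrite sliceF; exact: cintegrable_cint.
rewrite sliceF cint_fubini//.
transitivity (cint lebdd (fun p => J eps f1 f2 p * conjc (cross g1 g2 (usubmx p - dsubmx p)))).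
  congr cint; apply/funext => p; rewrite -cross_refl -cintZ//.
  split.
    apply: cmeasM; last exact: (cmeas_comp (mrefl _)).
    by apply: cmeas_conj; exact: (cmeas_comp (mrefl _)).
  under eq_integral => x _ do rewrite normcM normc_conj.
  apply: le_lt_trans (integral_mul_le (cL g1) (cL g2) (mrefl _) (mrefl _) (transports_refl _) (transports_refl _)) _.
  by rewrite bndE ltry.
have mc : cmeas (fun p : CC => J eps f1 f2 p * conjc (cross g1 g2 (usubmx p - dsubmx p))).
  by apply: cmeasM; [exact: cJ|apply: cmeas_conj; exact: (cmeas_comp mUD (cmeas_cross g1 g2))].
rewrite cint_col_mx; last first.
  have [_ Joo] := iJ f1 f2 e0.
  apply: (@le_cintegrable _ _ R lebdd _ (fun p => (bnd g1 g2)%:E * (normc (J eps f1 f2 p))%:E)%E) => //.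
  - by apply: measurable_funeM; apply: measurable_normcE; exact: cJ.
  - move=> p; rewrite normcM normc_conj -EFinM lee_fin mulrC.
    by apply: ler_wpM2r; [exact: normc_ge0|exact: normc_cross_le].
  - rewrite ge0_integralZl//; last 3 first.
    + by apply: measurable_normcE; exact: cJ.
    + by move=> x _; rewrite lee_fin normc_ge0.
    + by rewrite lee_fin.
    by apply: lte_mul_pinfty; rewrite ?lee_fin ?bnd0.
pose L (q : C * C) : R[i] := conjc (cross g1 g2 q.1) * ((PK eps q.1)%:C * F f1 f2 q.1 q.2).
have mL : cmeas L.
  apply: cmeasM; last exact: cK.
  by apply: cmeas_conj; exact: (cmeas_comp measurable_fst (cmeas_cross g1 g2)).
transitivity (cint lebd (fun s => cint lebd (fun v => L (v, s)))).
  congr cint; apply/funext => s.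
  rewrite -(cint_transport (transports_refl s)); last first.
    by apply: (cmeas_comp _ mc); apply: measurable_col_mx => //; exact: measurable_cst.
  congr cint; apply/funext => v.
  by rewrite Jsub col_mxKu col_mxKd /L /= opprB addrC (addrC s) subrK mulrC || rewrite Jsub col_mxKu col_mxKd subKr mulrC.
rewrite -(cint_fubini (F := L)) => //; last first.
  apply: (@le_lt_trans _ _ (\int[lebd]_v ((bnd g1 g2)%:E *
      \int[lebd]_s (normc ((PK eps v)%:C * F f1 f2 v s))%:E))%E).
    apply: ge0_le_integral => //.
    - by move=> v _; apply: integral_ge0 => s _; rewrite lee_fin normc_ge0.
    - apply: (measurable_fun_fubini_tonelli_F (fun q : C * C => (normc (L q))%:E)).
        exact: measurable_normcE.
      by move=> q; rewrite lee_fin normc_ge0.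
    - apply: measurable_funeM.
      apply: (measurable_fun_fubini_tonelli_F (fun q : C * C => (normc ((PK eps q.1)%:C * F f1 f2 q.1 q.2))%:E)).
        by apply: measurable_normcE; exact: cK.
      by move=> q; rewrite lee_fin normc_ge0.
    - move=> v _.
      have LE s : (normc (L (v, s)))%:E = ((normc (cross g1 g2 v))%:E *
          (normc ((PK eps v)%:C * F f1 f2 v s))%:E)%E by rewrite /L normcM normc_conj EFinM.
      under eq_integral => s _ do rewrite LE.
      rewrite ge0_integralZl//; last 3 first.
      + apply: measurable_normcE; apply: cmeasM; first exact: cmeas_cst.
        by case: (cF f1 f2 v).
      + by move=> s _; rewrite lee_fin normc_ge0.
      + by rewrite lee_fin normc_ge0.
      apply: lee_wpmul2r; first by apply: integral_ge0 => s _; rewrite lee_fin normc_ge0.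
      by rewrite lee_fin normc_cross_le.
  rewrite ge0_integralZl//; last 3 first.
  - apply: (measurable_fun_fubini_tonelli_F (fun q : C * C => (normc ((PK eps q.1)%:C * F f1 f2 q.1 q.2))%:E)).
      by apply: measurable_normcE; exact: cK.
    by move=> q; rewrite lee_fin normc_ge0.
  - by move=> v _; apply: integral_ge0 => s _; rewrite lee_fin normc_ge0.
  - by rewrite lee_fin.
  by apply: lte_mul_pinfty; rewrite ?lee_fin ?bnd0//; exact: Koo.
congr cint; apply/funext => v; rewrite /L.
rewrite (_ : (fun s => _) = (fun s => (conjc (cross g1 g2 v) * (PK eps v)%:C) * F f1 f2 v s)); last first.
  by apply/funext => s; rewrite mulrA.
rewrite cintZ// -[cint lebd (F f1 f2 v)]/(cross f1 f2 v).
by move: (conjc (cross g1 g2 v)) (cross f1 f2 v) => p q; ring.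
Qed.

End moyal.

(** * Moyal's orthogonality relation *)

Section orthogonality.
Variables (R : realType) (d : nat).
Local Notation lebd := (leb R d).
Local Notation C := 'cV[R]_d.
Local Notation lebdd := (leb R (d + d)).
Local Notation CC := 'cV[R]_(d + d).
Local Notation S := (L2sys R d).
Implicit Types f g h : L2 R d.

Lemma cmeas_stft f g : cmeas (fun z : CC => inner f (tfshift z g)).
Proof.
apply: (@cmeas_cint _ _ CC C R lebd (fun q : CC * C => f q.2 * conjc (tfshift q.1 g q.2))).
have mf : cmeas f by apply: cmeas_L2; exact: L2P.
have mg : cmeas g by apply: cmeas_L2; exact: L2P.
apply: cmeasM; first exact: (cmeas_comp measurable_snd mf).
apply: cmeas_conj; apply: cmeasM.
  apply: cmeas_cis; apply: measurable_funM; first exact: measurable_cst.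
  by apply: measurable_dotv; [apply: measurable_dsubmx; exact: measurable_fst|exact: measurable_snd].
apply: (cmeas_comp (phi := fun q : CC * C => q.2 - usubmx q.1)) => //.
by apply: measurable_subv; [exact: measurable_snd|apply: measurable_usubmx; exact: measurable_fst].
Qed.

Lemma norm_col0 (v : C) : `|col_mx v (0 : C)| <= `|v|.
Proof.
apply: cv_norm_le => // i; case: (split_ordP i) => j ->.
  by rewrite col_mxEu; exact: cv_norm_coord.
by rewrite col_mxEd mxE normr0.
Qed.

Lemma cross_continuous f g e : 0 < e -> exists2 r : R, 0 < r &
  forall v, `|v| < r -> normc (cross f g v - cross f g 0) < e.
Proof.
move=> e0; have n0 : 0 <= nsq (f : S) by exact: ip_ge0.
have [x x0 hx] := small_coeff n0 (divr_gt0 (exprn_gt0 2 e0) (ltr0Sn R 1)).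
have [r r0 hr] := L2_tf_continuous (g : S) x0.
exists r => // v vr.
have -> : cross f g v - cross f g 0 = ip (f : S) (tf (col_mx v 0) (g : S) - (g : S)).
  have -> : cross f g 0 = ip (f : S) (g : S).
    by rewrite /= innerE; congr cint; apply/funext => t; rewrite subr0.
  by rewrite cross_inner ipBr.
have cs := ip_cauchy_schwarz (f : S) (tf (col_mx v 0) (g : S) - (g : S)).
have h := hr _ (le_lt_trans (norm_col0 v) vr).
rewrite -(ltr_pXn2r (n := 2))// ?nnegrE ?normc_ge0 ?(ltW e0)//.
apply: (le_lt_trans cs); apply: (@le_lt_trans _ _ (x * nsq (f : S))).
  by rewrite mulrC; apply: ler_wpM2r => //; exact: ltW.
apply: (le_lt_trans hx); rewrite ltr_pdivrMr// mulr_natr mulr2n ltrDl.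
exact: exprn_gt0.
Qed.

Lemma cross0 f : cross f f 0 = (nsq (f : S))%:C.
Proof.
rewrite -[RHS]ipff /= innerE; congr cint; apply/funext => t; by rewrite subr0.
Qed.

Lemma cross_bound f g : exists2 M : R, 0 <= M & forall v, normc (cross f g v) <= M.
Proof.
exists (fine (sqL2 f + sqL2 g)%E); last exact: normc_cross_le.
by rewrite fine_ge0// adde_ge0// sqL2_ge0.
Qed.

(** The product of the two correlations is bounded and continuous at 0, so averaging it against
    [PK eps] tends to its value at 0. *)
Lemma moyal_limit f1 f2 g1 g2 e : 0 < e -> exists2 eps0 : R, 0 < eps0 & forall eps, 0 < eps <= eps0 ->
  normc (cint lebd (moyal_slice eps f1 f2 g1 g2) - cross f1 f2 0 * conjc (cross g1 g2 0)) <= e.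
Proof.
move=> e0; have [M M0 hM] := cross_bound f1 f2; have [N N0 hN] := cross_bound g1 g2.
pose G v := cross f1 f2 v * conjc (cross g1 g2 v).
have mG : cmeas G.
  by apply: cmeasM; [exact: cmeas_cross|apply: cmeas_conj; exact: cmeas_cross].
have GM v : normc (G v) <= M * N by rewrite normcM normc_conj ler_pM ?normc_ge0.
have Gc a : 0 < a -> exists2 r : R, 0 < r & forall v, `|v| < r -> normc (G v - G 0) < a.
  move=> a0; have MN0 : 0 <= M + N by rewrite addr_ge0.
  have [x x0 hx] := small_coeff MN0 (divr_gt0 a0 (ltr0Sn R 1)).
  have [r1 r10 h1] := cross_continuous f1 f2 x0.
  have [r2 r20 h2] := cross_continuous g1 g2 x0.
  exists (Num.min r1 r2); first by rewrite lt_min r10.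
  move=> v; rewrite lt_min => /andP[vr1 vr2].
  have cB (p q : R[i]) : conjc (p - q) = conjc p - conjc q by exact: (rmorphB (@conjc R)).
  have -> : G v - G 0 = (cross f1 f2 v - cross f1 f2 0) * conjc (cross g1 g2 v) +
      cross f1 f2 0 * conjc (cross g1 g2 v - cross g1 g2 0).
    by rewrite cB /G; ring.
  apply: (le_lt_trans (le_normcD _ _)); rewrite !normcM !normc_conj.
  apply: (@le_lt_trans _ _ (x * N + M * x)).
    by apply: lerD; apply: ler_pM; rewrite ?normc_ge0//; apply: ltW; [exact: h1|exact: h2].
  by move: hx a0; rewrite mulrDr (mulrC M); move: (x * M) (x * N); clear; move=> p q ? ?; lra.
have [eps0 eps00 he] := approx_identity mG GM Gc e0.
exists eps0 => // eps /[dup] epsl /andP[p0 _].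
by have [_ ->] := moyal_slice_spec f1 f2 g1 g2 p0; exact: he.
Qed.

Lemma stft_slice_le f1 f2 g1 g2 eps : 0 < eps ->
  ((normc (cint lebd (moyal_slice eps f1 f2 g1 g2)))%:E <=
   \int[lebdd]_z (normc (inner f1 (tfshift z g1)) * normc (inner f2 (tfshift z g2)))%:E)%E.
Proof.
move=> e0; have [[mS _] _] := moyal_slice_spec f1 f2 g1 g2 e0.
have mV : measurable_fun setT (fun z : CC => (normc (inner f1 (tfshift z g1)) * normc (inner f2 (tfshift z g2)))%:E).
  by apply/measurable_EFinP; apply: measurable_funM; apply: measurable_normc; exact: cmeas_stft.
have V0 (z : CC) : (0 <= (normc (inner f1 (tfshift z g1)) * normc (inner f2 (tfshift z g2)))%:E)%E.
  by rewrite lee_fin mulr_ge0 ?normc_ge0.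
apply: (le_trans (normc_cint_leT _ mS)); rewrite ge0_integral_col_mx//.
have mcol (x : C) : measurable_fun setT (fun y : C => col_mx x y).
  by apply: measurable_col_mx => //; exact: measurable_cst.
apply: ge0_le_integral => //.
- by move=> x _; rewrite lee_fin normc_ge0.
- exact: measurable_normcE.
- exact: (measurable_col_mx_inner mV V0).
- move=> x _; rewrite /moyal_slice.
  have mI : cmeas (fun xi : C => (PW eps xi)%:C *
      (inner f1 (tfshift (col_mx x xi) g1) * conjc (inner f2 (tfshift (col_mx x xi) g2)))).
    apply: cmeasM; first by apply: cmeas_real; exact: measurable_PW.
    apply: cmeasM; first exact: (cmeas_comp (mcol x) (cmeas_stft f1 g1)).
    by apply: cmeas_conj; exact: (cmeas_comp (mcol x) (cmeas_stft f2 g2)).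
  apply: (le_trans (normc_cint_leT _ mI)); apply: ge0_le_integral => //.
  + by move=> y _; rewrite lee_fin normc_ge0.
  + exact: measurable_normcE.
  + exact: (measurableT_comp mV (mcol x)).
  + move=> y _; rewrite lee_fin !normcM normc_conj normc_real ger0_norm ?PW_ge0//.
    by rewrite ler_piMl ?PW_le1// mulr_ge0 ?normc_ge0.
Qed.

(** The modulus of the regularized integral is below the right side because [PW <= 1], and its limit
    is the product of the two inner products (up to conjugation). This inequality is the source of
    the reproducing property of the kernel. *)
Lemma moyal_le f1 f2 g1 g2 :
  ((normc (inner f1 f2) * normc (inner g1 g2))%:E <=
   \int[lebdd]_z (normc (inner f1 (tfshift z g1)) * normc (inner f2 (tfshift z g2)))%:E)%E.
Proof.
have c0 f g : cross f g 0 = inner f g.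
  by rewrite innerE; congr cint; apply/funext => t; rewrite subr0.
apply/lee_addgt0Pr => e e0; have [eps0 p0 h] := moyal_limit f1 f2 g1 g2 e0.
have he := h eps0; rewrite p0 lexx in he; have {he} := he isT.
rewrite !c0 => he; apply: le_trans (leeD (stft_slice_le f1 f2 g1 g2 p0) (lexx e%:E)).
rewrite -EFinD lee_fin -(normc_conj (inner g1 g2)) -normcM.
rewrite -[X in normc X](subrK (cint lebd (moyal_slice eps0 f1 f2 g1 g2))).
by apply: (le_trans (le_normcD _ _)); rewrite addrC lerD2l normcB.
Qed.

Lemma stft_sqr_le f g z : normc (inner f (tfshift z g)) ^+ 2 <= nsq (f : S) * nsq (g : S).
Proof. by have := ip_cauchy_schwarz (f : S) (tf z (g : S)); rewrite nsq_tf. Qed.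

Lemma integral_PW_stft f g eps : 0 < eps ->
  (\int[lebdd]_z (PW eps (dsubmx z) * normc (inner f (tfshift z g)) ^+ 2)%:E =
   (complex.Re (cint lebd (moyal_slice eps f f g g)))%:E)%E.
Proof.
move=> e0; have [Si _] := moyal_slice_spec f f g g e0.
have mV : measurable_fun setT (fun z : CC => (PW eps (dsubmx z) * normc (inner f (tfshift z g)) ^+ 2)%:E).
  apply/measurable_EFinP; apply: measurable_funM.
    by apply: (measurableT_comp (measurable_PW _)); apply: measurable_dsubmx; exact: measurable_id.
  by apply: measurable_funX; apply: measurable_normc; exact: cmeas_stft.
have V0 (z : CC) : (0 <= (PW eps (dsubmx z) * normc (inner f (tfshift z g)) ^+ 2)%:E)%E.
  by rewrite lee_fin mulr_ge0 ?sqr_ge0 ?PW_ge0.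
have mcol (x : C) : measurable_fun setT (fun y : C => col_mx x y).
  by apply: measurable_col_mx => //; exact: measurable_cst.
rewrite ge0_integral_col_mx//.
have inner_int x : (\int[lebd]_y (PW eps (dsubmx (col_mx x y)) * normc (inner f (tfshift (col_mx x y) g)) ^+ 2)%:E =
   (complex.Re (moyal_slice eps f f g g x))%:E)%E.
  rewrite /moyal_slice.
  rewrite (_ : (fun xi => _) = (fun xi => (PW eps xi * normc (inner f (tfshift (col_mx x xi) g)) ^+ 2)%:C)); last first.
    by apply/funext => xi; rewrite mulcJE -rmorphM.
  rewrite cint_real /= fineK; first by apply: eq_integral => y _; rewrite col_mxKd.
  have mI : measurable_fun setT (fun y : C => (PW eps y * normc (inner f (tfshift (col_mx x y) g)) ^+ 2)%:E).
    apply/measurable_EFinP; apply: measurable_funM; first exact: measurable_PW.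
    apply: measurable_funX; apply: measurable_normc.
    exact: (cmeas_comp (mcol x) (cmeas_stft f g)).
  rewrite ge0_fin_numE; last by apply: integral_ge0 => y _; rewrite lee_fin mulr_ge0 ?sqr_ge0 ?PW_ge0.
  have nn : 0 <= nsq (f : S) * nsq (g : S) by rewrite mulr_ge0//; exact: ip_ge0.
  have mPW : measurable_fun setT (fun y : C => (PW eps y)%:E) by apply/measurable_EFinP; exact: measurable_PW.
  apply: (@le_lt_trans _ _ (\int[lebd]_y ((nsq (f : S) * nsq (g : S))%:E * (PW eps y)%:E))%E).
    apply: ge0_le_integral => //.
    - by move=> y _; rewrite lee_fin mulr_ge0 ?sqr_ge0 ?PW_ge0.
    - exact: measurable_funeM.
    - by move=> y _; rewrite -EFinM lee_fin mulrC; apply: ler_wpM2r; [exact: PW_ge0|exact: stft_sqr_le].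
  rewrite ge0_integralZl//; last first.
    by move=> y _; rewrite lee_fin PW_ge0.
  rewrite lte_mul_pinfty//.
  have [_] := @cintegrable_PW R d eps 0 e0.
  by under eq_integral => y _ do rewrite normcM normc_cis mulr1 normc_real ger0_norm ?PW_ge0//.
under eq_integral => x _ do rewrite inner_int.
rewrite [RHS]/= /Rintegral fineK//; apply: integrable_fin_num => //.
exact: (cintegrable_Re Si).
Qed.

(** For equal pairs the integrand is nonnegative, and the weights of parameter [1 / (n + 1)]
    increase to 1: monotone convergence on one side, [moyal_limit] on the other. *)
Lemma stft_orthogonality f g :
  (\int[lebdd]_z (normc (inner f (tfshift z g)) ^+ 2)%:E = (nsq (f : S) * nsq (g : S))%:E)%E.
Proof.
pose u n (z : CC) : \bar R := (PW n.+1%:R^-1 (dsubmx z) * normc (inner f (tfshift z g)) ^+ 2)%:E.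
have mV : measurable_fun setT (fun z : CC => normc (inner f (tfshift z g)) ^+ 2).
  by apply: measurable_funX; apply: measurable_normc; exact: cmeas_stft.
have mu n : measurable_fun setT (u n).
  apply/measurable_EFinP; apply: measurable_funM => //.
  by apply: (measurableT_comp (measurable_PW _)); apply: measurable_dsubmx; exact: measurable_id.
have u0 n z : (0 <= u n z)%E by rewrite lee_fin mulr_ge0 ?sqr_ge0 ?PW_ge0.
have ndu z : {homo u ^~ z : n m / (n <= m)%N >-> (n <= m)%E}.
  move=> n m nm; rewrite lee_fin ler_wpM2r ?sqr_ge0//; apply: PW_homo.
  by rewrite invr_gt0 ltr0n /= lef_pV2 ?posrE ?ltr0n// ler_nat.
have ulim z : u ^~ z @ \oo --> (normc (inner f (tfshift z g)) ^+ 2)%:E.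
  apply: cvg_EFin; first exact: nearW.
  rewrite -[X in _ --> X]mul1r; apply: cvgMl; exact: PW_cvg.
have h1 := @cvg_monotone_convergence _ _ R lebdd setT measurableT u mu (fun n z _ => u0 n z) (fun z _ => ndu z).
have e1 : (\int[lebdd]_z limn (u^~ z) = \int[lebdd]_z (normc (inner f (tfshift z g)) ^+ 2)%:E)%E.
  by apply: eq_integral => z _; exact: cvg_lim (ulim z).
rewrite e1 in h1.
have h2 : (fun n => \int[lebdd]_z u n z)%E @ \oo --> (nsq (f : S) * nsq (g : S))%:E.
  have iu n : (\int[lebdd]_z u n z = (complex.Re (cint lebd (moyal_slice n.+1%:R^-1 f f g g)))%:E)%E.
    by rewrite integral_PW_stft// invr_gt0 ltr0n.
  under eq_fun do rewrite iu.
  apply: cvg_EFin; first exact: nearW.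
  apply/cvgrPdist_le => e e0; have [eps0 p0 h] := moyal_limit f f g g e0.
  near=> n.
  have : normc (cint lebd (moyal_slice n.+1%:R^-1 f f g g) - (nsq (f : S) * nsq (g : S))%:C) <= e.
    have := h n.+1%:R^-1; rewrite !cross0 conjc_real -rmorphM; apply.
    rewrite invr_gt0 ltr0n /= -[leRHS]invrK lef_pV2 ?posrE ?invr_gt0 ?ltr0n//.
    near: n; exists (Num.truncn eps0^-1) => // n /= ln.
    by apply: (le_trans (ltW (truncnS_gt _))); rewrite ler_nat.
  move=> h3; rewrite distrC; apply: le_trans h3.
  by apply: le_trans (ler_Re_normc _); rewrite raddfB.
exact: (cvg_unique _ h1 h2).
Unshelve. all: by end_near. Qed.

End orthogonality.

(** * Riemann sums of the transform: error bounds *)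

Section tightness.
Variables (R : realType) (n : nat) (S : tfsys R n) (g : S).
Variables (m : 'cV[int]_n -> R) (M : R).
Hypothesis gm : majorized g m M.
Hypothesis gc : tf_continuous g.
Implicit Types (f h : S) (z w u : 'cV[R]_n).

Local Notation "<< f , h >>" := (@ip _ _ S f h) (at level 0, f, h at level 99).
Local Notation "z ~> f" := (@tf _ _ S z f) (at level 35, right associativity).
Local Notation nsq := (@nsq _ _ S).
Local Notation iv := (@intv R n).

Let m0 j : 0 <= m j. Proof. by have [] := gm. Qed.

Let mM s : uniq s -> \sum_(j <- s) m j <= M. Proof. by have [_ + _] := gm; apply. Qed.

Lemma kern_difference u w : normc <<u ~> g - g, w ~> (u ~> g - g)>> <=
  2 * m (flv w) + m (flv (w - u)) + m (flv (w + u)).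
Proof.
have le z : normc <<g, z ~> g>> <= m (flv z) by have [_ _] := gm; apply.
rewrite tfB ipBr !ipBl.
have h1 : normc <<u ~> g, w ~> (u ~> g)>> <= m (flv w).
  by rewrite tf_normc_comp tf_normc_shift addrK.
have h2 : normc <<g, w ~> (u ~> g)>> <= m (flv (w + u)) by rewrite tf_normc_comp.
have h3 : normc <<u ~> g, w ~> g>> <= m (flv (w - u)) by rewrite tf_normc_shift.
have h4 := le w.
have tri (a b : R[i]) : normc (a - b) <= normc a + normc b.
  by apply: le_trans (le_normcD _ _) _; rewrite normcN.
apply: (le_trans (tri _ _)); apply: (le_trans (lerD (tri _ _) (tri _ _))).
by move: h1 h2 h3 h4; move: (normc _) (normc _) (normc _) (normc _) => a b c d; move: (m _) (m _) (m _) => x y t; lra.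
Qed.

(** Schur's test for the shifts of [h = u ~> g - g], with row sums scaled by the cell volume. In a
    fixed ball there are of order [eps^-n] points, each term being at most [nsq h], which is small
    by strong continuity; outside it the tail of the majorant is small. Neither bound depends on [f]
    or on [u]. *)
Lemma difference_bessel (beta : R) : 0 < beta -> exists2 dl : R, 0 < dl & dl <= 1 /\
  forall eps, 0 < eps <= dl -> forall u, `|u| <= eps -> forall f s, uniq s ->
  eps ^+ n * (\sum_(k <- s) normc <<f, (eps%:M *m iv k) ~> (u ~> g - g)>> ^+ 2) <= beta * nsq f.
Proof.
move=> b0; have p5 : 0 < 5 ^+ n :> R by rewrite exprn_gt0.
(* The far part consists of four tail sums of at most [beta / 8] each; [5 ^+ n] absorbs the cell
   count times [eps ^+ n]. *)
have e10 : 0 < beta / (8 * 5 ^+ n) by rewrite divr_gt0// mulr_gt0.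
have [T hT] := lattice_tail m0 mM e10.
(* One unit more than [T], to leave room for the shift by [u]; [K] bounds [eps ^+ n] times the
   number of points within [L]. *)
pose L : R := T.+1%:R; pose K : R := (4 * L + 3) ^+ n.
have L0 : 0 <= L by rewrite /L.
have K0 : 0 < K by rewrite exprn_gt0// ltr_wpDl// mulr_ge0.
have b2 : 0 < beta / (2 * K) by rewrite divr_gt0// mulr_gt0.
have [r r0 hr] := gc b2.
exists (Num.min 1 (r / 2)); first by rewrite lt_min ltr01 divr_gt0.
split; first by rewrite ge_min lexx.
move=> eps; rewrite le_min => /and3P[e0 e1 er] u ue f s us.
have ur : `|u| < r by apply: (le_lt_trans ue); apply: (le_lt_trans er); rewrite ltr_pdivrMr// mulr_natr mulr2n ltrDl.
set h := u ~> g - g; have nh : nsq h < beta / (2 * K) by exact: hr.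
have en0 : 0 < eps ^+ n by rewrite exprn_gt0.
have E (k : 'cV[int]_n) : eps%:M *m iv k = eps *: iv k by rewrite mul_scalar_mx.
suff row i : \sum_(j <- s) normc <<(eps%:M *m iv i) ~> h, (eps%:M *m iv j) ~> h>> <= beta / eps ^+ n.
  have := @gram_bessel _ _ _ _ s (fun k => (eps%:M *m iv k) ~> h) (beta / eps ^+ n) f.
  move=> /(_ (divr_ge0 (ltW b0) (ltW en0)) row) H.
  by rewrite mulrC -ler_pdivlMr// mulrAC.
pose z0 := - (eps%:M *m iv i); pose w j := z0 + eps%:M *m iv j.
have wE j : normc <<(eps%:M *m iv i) ~> h, (eps%:M *m iv j) ~> h>> = normc <<h, w j ~> h>>.
  by rewrite tf_normc_shift /w addrC.
rewrite (eq_bigr (fun j => normc <<h, w j ~> h>>)); last by move=> j _; exact: wE.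
rewrite ler_pdivlMr// (bigID (fun j => `|w j| <= L))/= mulrDl.
have near : (\sum_(j <- s | `|w j| <= L) normc <<h, w j ~> h>>) * eps ^+ n <= beta / 2.
  rewrite -big_filter; set sn := [seq j <- s | _].
  have hn j : normc <<h, w j ~> h>> <= nsq h.
    have := ip_cauchy_schwarz h (w j ~> h); rewrite nsq_tf -expr2.
    by rewrite ler_sqr ?nnegrE ?normc_ge0// nsq_ge0.
  pose b := (Num.truncn (2 * L / eps)).+1.
  have q0 : 0 <= 2 * L / eps by rewrite divr_ge0 ?mulr_ge0// ltW.
  have bge : 2 * L / eps <= b%:R by exact/ltW/truncnS_gt.
  have ble : b%:R <= 2 * L / eps + 1 by rewrite /b -addn1 natrD lerD2r truncn_le.
  have sz : (size sn <= b.*2.+1 ^ n)%N.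
    apply: (@uniq_size_close R); first by rewrite filter_uniq.
    move=> k l; rewrite !mem_filter => /andP[hk _] /andP[hl _].
    apply: le_trans bge; rewrite ler_pdivlMr// mulrC.
    have -> : eps * `|iv k - iv l| = `|w k - w l|.
      rewrite -{1}(ger0_norm (ltW e0)) -normrZ; congr (`| _ |).
      by rewrite /w !E scalerBr opprD addrACA subrr add0r.
    by apply: (le_trans (ler_normB _ _)); move: hk hl; lra.
  apply: (@le_trans _ _ ((size sn)%:R * nsq h * eps ^+ n)).
    apply: ler_wpM2r; first exact: ltW.
    apply: (@le_trans _ _ (\sum_(j <- sn) nsq h)); first by apply: ler_sum.
    by rewrite big_const_seq count_predT iter_addr addr0 mulr_natl.
  have szK : (size sn)%:R * eps ^+ n <= K.
    apply: (@le_trans _ _ ((b.*2.+1)%:R ^+ n * eps ^+ n)).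
      by apply: ler_wpM2r; [exact: ltW|rewrite -natrX ler_nat].
    rewrite -exprMn; apply: lerXn2r; rewrite ?nnegrE ?mulr_ge0 ?(ltW e0)//.
      by rewrite addr_ge0// mulr_ge0.
    rewrite -addn1 -mul2n natrD natrM.
    have h1 : b%:R * eps <= 2 * L + eps.
      have : b%:R * eps <= (2 * L / eps + 1) * eps by apply: ler_wpM2r => //; exact: ltW.
      by rewrite mulrDl mul1r divfK// gt_eqF.
    by move: h1 e1; move: (b%:R) => x; lra.
  rewrite mulrAC; apply: (@le_trans _ _ (K * nsq h)); first by apply: ler_wpM2r => //; exact: nsq_ge0.
  apply: (@le_trans _ _ (K * (beta / (2 * K)))); first by apply: ler_wpM2l; exact: ltW.
  by rewrite le_eqVlt; apply/orP; left; apply/eqP; field; rewrite gt_eqF.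
have far : (\sum_(j <- s | ~~ (`|w j| <= L)) normc <<h, w j ~> h>>) * eps ^+ n <= beta / 2.
  rewrite -big_filter; set sn := [seq j <- s | _].
  have usn : uniq sn by rewrite filter_uniq.
  have u1 : `|u| <= 1 by apply: (le_trans ue).
  have fars j : j \in sn -> L < `|w j| by rewrite mem_filter -ltNge => /andP[].
  pose N := (Num.truncn eps^-1).+1.
  have sp : spaced (eps%:M : 'M[R]_n) N.
    move=> v; rewrite mul_scalar_mx normrZ (ger0_norm (ltW e0)) mulrA ler_peMl//.
    by rewrite -ler_pdivrMr// mul1r ltW// truncnS_gt.
  have Nle : (N.*2.+1)%:R * eps <= 5.
    have : N%:R <= eps^-1 + 1 by rewrite /N -addn1 natrD lerD2r truncn_le// invr_ge0 ltW.
    move=> hN; have : N%:R * eps <= (eps^-1 + 1) * eps by apply: ler_wpM2r => //; exact: ltW.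
    rewrite mulrDl mulVf ?gt_eqF// mul1r -addn1 -mul2n natrD natrM.
    by move: e1; move: (N%:R) => x; lra.
  have NK : (N.*2.+1 ^ n)%:R * eps ^+ n <= 5 ^+ n.
    by rewrite natrX -exprMn; apply: lerXn2r; rewrite ?nnegrE ?mulr_ge0 ?(ltW e0).
  have part (y : 'cV[R]_n) : `|y| <= 1 -> (\sum_(j <- sn) m (flv (w j + y))) * eps ^+ n <= beta / 8.
    move=> y1; apply: (@le_trans _ _ ((N.*2.+1 ^ n)%:R * (beta / (8 * 5 ^+ n)) * eps ^+ n)).
      apply: ler_wpM2r; first exact: ltW.
      rewrite (eq_bigr (fun j => m (flv ((z0 + y) + eps%:M *m iv j)))); last first.
        by move=> j _; rewrite /w addrAC.
      apply: hT => // j js; have Lw := fars j js.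
      have -> : z0 + y + eps%:M *m iv j = w j + y by rewrite /w addrAC.
      have : `|w j| <= `|w j + y| + `|y| by rewrite -{1}(addrK y (w j)) ler_normB.
      have : L = T%:R + 1 by rewrite /L -addn1 natrD.
      by move: Lw y1; lra.
    rewrite mulrAC; apply: (@le_trans _ _ (5 ^+ n * (beta / (8 * 5 ^+ n)))).
      by apply: ler_wpM2r => //; exact: ltW.
    by rewrite le_eqVlt; apply/orP; left; apply/eqP; field; rewrite gt_eqF.
  have p0 := part 0; have pu := part u; have pn := part (- u).
  rewrite normr0 in p0; rewrite normrN in pn.
  have {}p0 := p0 ler01; have {}pu := pu u1; have {}pn := pn u1.
  apply: (@le_trans _ _ ((2 * (\sum_(j <- sn) m (flv (w j + 0))) + (\sum_(j <- sn) m (flv (w j - u)))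
     + (\sum_(j <- sn) m (flv (w j + u)))) * eps ^+ n)).
    apply: ler_wpM2r; first exact: ltW.
    rewrite mulr_sumr -!big_split /=; apply: ler_sum => j _; rewrite addr0.
    exact: kern_difference.
  rewrite !mulrDl -mulrA; move: p0 pu pn.
  by move: (_ * eps ^+ n) (_ * eps ^+ n) (_ * eps ^+ n) => x y t; lra.
by move: near far; move: (_ * eps ^+ n) (_ * eps ^+ n) => x y; lra.
Qed.

End tightness.

(** * Near tightness of fine cubic lattices *)

Section near_tight.
Variables (R : realType) (d : nat).
Local Notation S := (L2sys R d).
Local Notation n := (d + d)%N.
Variables (g : L2 R d) (m : 'cV[int]_n -> R) (M : R).
Hypothesis gm : majorized (g : S) m M.
Hypothesis g0 : 0 < nsq (g : S).
Local Notation iv := (@intv R n).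

(** Tiling space by cubes of side [dl] writes the integral [nsq f * G] as the average over [u] in
    one cube of the sums over the grid translated by [u]. Each of these differs little from the
    untranslated sum by [difference_bessel], in both directions. *)
Lemma L2_near_tight : near_tight (g : S).
Proof.
move=> eta eta0; set G := nsq (g : S).
pose e := Num.min 1 (eta / 4).
have e0 : 0 < e by rewrite lt_min ltr01 divr_gt0.
have e1 : e <= 1 by rewrite ge_min lexx.
have e4 : e <= eta / 4 by rewrite ge_min lexx orbT.
have ei0 : 0 < 1 + e^-1 by rewrite addr_gt0// invr_gt0.
(* Compensates the large factor [1 + e^-1] that [sqr_normc_le_eps] puts on the error term. *)
pose beta := G * (eta / 4) / (1 + e^-1).
have b0 : 0 < beta by rewrite divr_gt0// mulr_gt0// divr_gt0.
have bE : (1 + e^-1) * beta = G * (eta / 4) by rewrite /beta mulrC divfK// gt_eqF.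
have [dl dl0 [dl1 hdl]] := difference_bessel gm (@L2_tf_continuous R d g) b0.
exists dl, (dl ^+ n / G).
have dn0 : 0 < dl ^+ n by rewrite exprn_gt0.
pose Fn (f : S) (x : 'cV[R]_n) : R := normc (ip f (tf x (g : S))) ^+ 2.
pose a (f : S) k : R := Fn f (dl%:M *m iv k).
have mF f : measurable_fun setT (fun x : 'cV[R]_n => (Fn f x)%:E).
  by apply: measurable_sqr_normc; exact: (cmeas_stft f g).
have F0 f x : 0 <= Fn f x by exact: sqr_ge0.
have FE0 f x : (0 <= (Fn f x)%:E)%E by rewrite lee_fin; exact: F0.
have E k : dl%:M *m iv k = dl *: iv k by rewrite mul_scalar_mx.
have cubeu (u : 'cV[R]_n) : cube dl u -> `|u| <= dl.
  move=> h; apply: cv_norm_le; first exact: ltW.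
  by move=> i; have /andP[h1 h2] := h i; rewrite ger0_norm// ltW.
have pert f s u : uniq s -> `|u| <= dl ->
    dl ^+ n * (\sum_(k <- s) normc (ip f (tf (dl%:M *m iv k) (tf u (g : S) - (g : S)))) ^+ 2) <= beta * nsq f.
  by move=> us ul; apply: hdl => //; rewrite dl0 lexx.
have FE f u k : Fn f (u + dl *: iv k) = normc (ip f (tf (dl%:M *m iv k) (tf u (g : S)))) ^+ 2.
  by rewrite /Fn tf_normc_comp E addrC.
have up f s u : uniq s -> cube dl u -> dl ^+ n * (\sum_(k <- s) a f k) <=
    (1 + e) * (dl ^+ n * \sum_(k <- s) Fn f (u + dl *: iv k)) + G * (eta / 4) * nsq f.
  move=> us /cubeu ul; have h := pert f s u us ul.
  apply: (@le_trans _ _ (dl ^+ n * (\sum_(k <- s) ((1 + e) * Fn f (u + dl *: iv k) +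
     (1 + e^-1) * normc (ip f (tf (dl%:M *m iv k) (tf u (g : S) - (g : S)))) ^+ 2)))).
    apply: ler_wpM2l; first exact: ltW.
    apply: ler_sum => k _; rewrite FE /a /Fn.
    apply: le_trans (sqr_normc_le_eps _ (ip f (tf (dl%:M *m iv k) (tf u (g : S)))) e0) _.
    by rewrite lerD2l [in leRHS]tfB ipBr normcB.
  rewrite big_split /= -!mulr_sumr mulrDr; apply: lerD; first by rewrite mulrCA.
  rewrite mulrCA -bE -mulrA; apply: ler_wpM2l => //; exact: ltW.
have lo f s u : uniq s -> cube dl u -> dl ^+ n * (\sum_(k <- s) Fn f (u + dl *: iv k)) <=
    (1 + e) * (dl ^+ n * \sum_(k <- s) a f k) + G * (eta / 4) * nsq f.
  move=> us /cubeu ul; have h := pert f s u us ul.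
  apply: (@le_trans _ _ (dl ^+ n * (\sum_(k <- s) ((1 + e) * a f k +
     (1 + e^-1) * normc (ip f (tf (dl%:M *m iv k) (tf u (g : S) - (g : S)))) ^+ 2)))).
    apply: ler_wpM2l; first exact: ltW.
    apply: ler_sum => k _; rewrite FE /a /Fn.
    apply: le_trans (sqr_normc_le_eps _ (ip f (tf (dl%:M *m iv k) (g : S))) e0) _.
    by rewrite lerD2l [in leRHS]tfB ipBr.
  rewrite big_split /= -!mulr_sumr mulrDr; apply: lerD; first by rewrite mulrCA.
  rewrite mulrCA -bE -mulrA; apply: ler_wpM2l => //; exact: ltW.
have total f : (\int[leb R n]_x (Fn f x)%:E = (nsq f * G)%:E)%E by exact: stft_orthogonality.
have mC : measurable (@cube R n dl) by exact: measurable_cube.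
have lC : leb R n (@cube R n dl) = (dl ^+ n)%:E by exact: leb_cube.
have icst (c : R) : (\int[leb R n]_(x in @cube R n dl) c%:E = (c * dl ^+ n)%:E)%E.
  by rewrite integral_cst// EFinM; congr (_ * _)%E; exact: lC.
have mFs f (s : seq 'cV[int]_n) : measurable_fun setT (fun u : 'cV[R]_n => (\sum_(k <- s) Fn f (u + dl *: iv k))%:E).
  apply/measurable_EFinP; apply: measurable_sum => k.
  apply/measurable_EFinP; apply: (measurableT_comp (mF f)).
  by apply: measurable_addv => //; exact: measurable_cst.
have cubes f s : uniq s -> (\int[leb R n]_(u in @cube R n dl) (\sum_(k <- s) Fn f (u + dl *: iv k))%:E =
    \sum_(k <- s) \int[leb R n]_(u in @cube R n dl) (Fn f (u + dl *: iv k))%:E)%E.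
  move=> us; rewrite -ge0_integral_sum//.
  - by apply: eq_integral => u _; rewrite sumEFin.
  - move=> k; apply: (measurable_funS measurableT) => //; apply: (measurableT_comp (mF f)).
    by apply: measurable_addv => //; exact: measurable_cst.
have nf (f : S) : 0 <= nsq f by exact: ip_ge0.
have G0 : G != 0 by rewrite gt_eqF.
split=> //; first by rewrite divr_gt0.
- move=> f s us.
  have h : ((dl ^+ n)%:E * (dl ^+ n * \sum_(k <- s) a f k)%:E <=
      (dl ^+ n)%:E * ((1 + e) * (nsq f * G) + G * (eta / 4) * nsq f)%:E)%E.
    rewrite -!EFinM [X in (X%:E <= _)%E]mulrC -icst.
    apply: (@le_trans _ _ (\int[leb R n]_(u in @cube R n dl)
      (((1 + e) * dl ^+ n)%:E * (\sum_(k <- s) Fn f (u + dl *: iv k))%:E + (G * (eta / 4) * nsq f)%:E))%E).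
      apply: ge0_le_integral => //.
      - by move=> u _; rewrite lee_fin mulr_ge0 ?(ltW dn0)//; apply: sumr_ge0 => k _; exact: F0.
      - apply: emeasurable_funD => //; apply: measurable_funeM.
        exact: (measurable_funS measurableT).
      - by move=> u uC; rewrite -EFinM -EFinD lee_fin -(mulrA (1 + e)); exact: up.
    rewrite ge0_integralD//; last 3 first.
    + by move=> u _; rewrite -EFinM lee_fin !mulr_ge0 ?addr_ge0 ?(ltW e0) ?(ltW dn0)//; apply: sumr_ge0 => k _; exact: F0.
    + by apply: measurable_funeM; exact: (measurable_funS measurableT).
    + have q4 : 0 <= eta / 4 by rewrite divr_ge0// ltW.
      by move=> u _; rewrite lee_fin; apply: mulr_ge0 => //; apply: mulr_ge0 => //; exact: ltW.
    rewrite icst ge0_integralZl//; last 3 first.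
    + exact: (measurable_funS measurableT).
    + by move=> u _; rewrite lee_fin; apply: sumr_ge0 => k _; exact: F0.
    + by rewrite lee_fin mulr_ge0 ?addr_ge0 ?(ltW e0) ?(ltW dn0).
    rewrite cubes//.
    have -> : dl ^+ n * ((1 + e) * (nsq f * G) + G * (eta / 4) * nsq f) =
      (1 + e) * dl ^+ n * (nsq f * G) + G * (eta / 4) * nsq f * dl ^+ n by ring.
    rewrite [leRHS]EFinD; apply: leeD => //.
    rewrite [leRHS]EFinM; apply: lee_wpmul2l.
      by rewrite lee_fin mulr_ge0 ?addr_ge0 ?(ltW e0) ?(ltW dn0).
    by rewrite -total; exact: (@cell_sum_le R n dl dl0 (fun x => (Fn f x)%:E) s (mF f) (FE0 f) us).
  rewrite -!EFinM lee_fin ler_pM2l// in h.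
  rewrite mulrAC ler_pdivrMr//; apply: (le_trans h).
  rewrite (_ : (1 + e) * (nsq f * G) + G * (eta / 4) * nsq f = (1 + e + eta / 4) * (nsq f * G)); last by ring.
  rewrite -mulrA; apply: ler_wpM2r; first by apply: mulr_ge0 => //; exact: ltW.
  by move: e4 eta0; lra.
- move=> f; have [nf0|nf0] := eqVneq (nsq f) 0.
    by exists [::] => //; rewrite nf0 mulr0 big_nil mulr0.
  have nfp : 0 < nsq f by rewrite lt_def nf0 nf.
  (* If no finite set reached the bound, all finite sums would obey [H'], and averaging would give
     an integral smaller than [nsq f * G]. *)
  apply: contrapT => H.
  have H' s : uniq s -> dl ^+ n * (\sum_(k <- s) a f k) <= (1 - eta) * nsq f * G.
    move=> us; rewrite leNgt; apply/negP => h; apply: H; exists s => //.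
    by rewrite mulrAC ler_pdivlMr// ltW.
  have eta1 : 0 <= (1 - eta) * nsq f * G.
    by have := H' [::] isT; rewrite big_nil mulr0.
  have {}eta1 : 0 <= 1 - eta by move: eta1; rewrite -mulrA pmulr_lge0// mulr_gt0.
  have : (\int[leb R n]_x (Fn f x)%:E <= ((1 + e) * ((1 - eta) * nsq f * G) + G * (eta / 4) * nsq f)%:E)%E.
    apply: (@le_cell_sum R n dl dl0 (fun x => (Fn f x)%:E) _ (mF f) (FE0 f)) => s us.
    rewrite -cubes//.
    have c0 : 0 <= (1 + e) * ((1 - eta) * nsq f * G) + G * (eta / 4) * nsq f.
      have q4 : 0 <= eta / 4 by rewrite divr_ge0// ltW.
      have e10 : 0 <= 1 + e by rewrite addr_ge0// ltW.
      have G00 : 0 <= G by exact: ltW.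
      by apply: addr_ge0; apply: mulr_ge0 => //; apply: mulr_ge0 => //; exact: mulr_ge0.
    apply: (@le_trans _ _ (\int[leb R n]_(u in @cube R n dl)
        (((1 + e) * ((1 - eta) * nsq f * G) + G * (eta / 4) * nsq f) / dl ^+ n)%:E)%E).
      apply: ge0_le_integral => //.
      - by move=> u _; rewrite lee_fin; apply: sumr_ge0 => k _; exact: F0.
      - exact: (measurable_funS measurableT).
      - move=> u uC; rewrite lee_fin ler_pdivlMr// mulrC; apply: (le_trans (lo f s u us uC)).
        rewrite lerD2r; apply: ler_wpM2l; first by rewrite addr_ge0// ltW.
        exact: H'.
    by rewrite icst divfK// gt_eqF.
  rewrite total lee_fin.
  have -> : (1 + e) * ((1 - eta) * nsq f * G) + G * (eta / 4) * nsq f =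
     ((1 + e) * (1 - eta) + eta / 4) * (nsq f * G) by ring.
  rewrite -[X in X <= _]mul1r ler_pM2r ?mulr_gt0//.
  have : e * (1 - eta) <= eta / 4 by nra.
  by move: eta0; nra.
Qed.

End near_tight.

(** * From an integrable reproducing kernel to a summable majorant *)

Section kernel_majorant.
Variables (R : realType) (n : nat).
Local Notation lebn := (leb R n).
Local Notation W := 'cV[R]_n.
Local Notation iv := (@intv R n).
Variables (k : W -> R) (q rho : R).
Hypothesis k0 : forall z, 0 <= k z.
Hypothesis mk : measurable_fun setT k.
Hypothesis kern_reproducing : forall z u,
  ((k z * k u)%:E <= \int[lebn]_w (k w * k (w + (u - z)))%:E)%E.
Hypotheses (q0 : 0 < q) (r0 : 0 < rho) (r1 : rho <= 1).
Hypothesis hrho : forall u, `|u| <= rho -> q <= k u.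

Let mkE : measurable_fun setT (fun z => (k z)%:E).
Proof. exact/measurable_EFinP. Qed.

Hypothesis k_int : (\int[lebn]_z (k z)%:E < +oo)%E.

Let K1 : R := fine (\int[lebn]_z (k z)%:E)%E.

Let K1E : (\int[lebn]_z (k z)%:E = K1%:E)%E.
Proof. by rewrite /K1 fineK// ge0_fin_numE//; apply: integral_ge0 => z _; rewrite lee_fin. Qed.

Let K10 : 0 <= K1.
Proof. by rewrite fine_ge0//; apply: integral_ge0 => z _; rewrite lee_fin. Qed.

Let near1 (x : W) : R := \1_[set v : W | ~ (1 <= `|v|)] x.

Let mnear1 : measurable_fun setT near1.
Proof.
by apply: measurable_indic; apply: measurableC; exact: measurable_norm_ge.
Qed.

Let near1_ge0 x : 0 <= near1 x. Proof. by rewrite /near1 indicE. Qed.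

Let near1_le1 x : near1 x <= 1. Proof. by rewrite /near1 indicE lern1 leq_b1. Qed.

Let near1T x : `|x| < 1 -> near1 x = 1.
Proof. by move=> h; rewrite /near1 indicE mem_set//= => h'; move: h; rewrite ltNge h'. Qed.

Let pairk (j : 'cV[int]_n) (w : W) : \bar R := (\int[lebn]_y (k y * near1 (y - w + iv j))%:E)%E.

Let mpair j : measurable_fun setT (fun q : W * W => k q.2 * near1 (q.2 - q.1 + iv j)).
Proof.
apply: measurable_funM; first exact: (measurableT_comp mk measurable_snd).
apply: (measurableT_comp mnear1); apply: measurable_addv; last exact: measurable_cst.
by apply: measurable_subv; [exact: measurable_snd|exact: measurable_fst].
Qed.

Let mpair1 j w : measurable_fun setT (fun y => k y * near1 (y - w + iv j)).
Proof.
apply: measurable_funM => //; apply: (measurableT_comp mnear1).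
apply: measurable_addv; last exact: measurable_cst.
by apply: measurable_subv => //; exact: measurable_cst.
Qed.

Let pair0 j w y : 0 <= k y * near1 (y - w + iv j).
Proof. by rewrite mulr_ge0. Qed.

Let pairk0 j w : (0 <= pairk j w)%E.
Proof. by apply: integral_ge0 => y _; rewrite lee_fin. Qed.

Let mpairk j : measurable_fun setT (pairk j).
Proof.
apply: (measurable_fun_fubini_tonelli_F (fun q : W * W => (k q.2 * near1 (q.2 - q.1 + iv j))%:E)).
  exact/measurable_EFinP.
by move=> ?; rewrite lee_fin mulr_ge0.
Qed.

(** The mass of [k w * k y] over pairs with [y] within distance 1 of [w - j]; up to a constant
    factor this sequence is the majorant. *)
Let mass j : \bar R := (\int[lebn]_w ((k w)%:E * pairk j w))%E.

Let mass0 j : (0 <= mass j)%E.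
Proof. by apply: integral_ge0 => w _; rewrite mule_ge0// lee_fin. Qed.

(** A given pair [(w, y)] is counted only for labels [j] within distance 2 of one another, hence at
    most [5 ^ n] times, and the mass of all pairs is [K1 * K1]. *)
Lemma sum_mass_le (s : seq 'cV[int]_n) : uniq s ->
  (\sum_(j <- s) mass j <= ((5 ^ n)%:R * (K1 * K1))%:E)%E.
Proof.
move=> us; rewrite /mass -ge0_integral_sum//; last 2 first.
- by move=> j; apply: emeasurable_funM; [exact: mkE|exact: mpairk].
- by move=> j w _; rewrite mule_ge0// lee_fin.
have cnt w y : \sum_(j <- s) near1 (y - w + iv j) <= (5 ^ n)%:R.
  pose P j := y - w + iv j \in [set v : W | ~ (1 <= `|v|)].
  rewrite (eq_bigr (fun j => (P j)%:R)); last by move=> j _; rewrite /near1 indicE.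
  rewrite -natr_sum ler_nat.
  have cntE (t : seq 'cV[int]_n) : (\sum_(j <- t) P j = count P t)%N.
    by elim: t => [|i t IH]; rewrite ?big_nil ?big_cons ?IH.
  rewrite cntE -size_filter.
  apply: (@uniq_size_close R n 2); first by rewrite filter_uniq.
  move=> i j; rewrite !mem_filter => /andP[/set_mem/= hi _] /andP[/set_mem/= hj _].
  have -> : iv i - iv j = (y - w + iv i) - (y - w + iv j) by rewrite opprD addrACA subrr add0r.
  apply: (le_trans (ler_normB _ _)).
  by move: hi hj => /negP; rewrite -ltNge => hi /negP; rewrite -ltNge => hj; lra.
have inner_le w : (\sum_(j <- s) pairk j w <= ((5 ^ n)%:R * K1)%:E)%E.
  rewrite /pairk -ge0_integral_sum//; last 2 first.
  - by move=> j; exact/measurable_EFinP.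
  - by move=> j y _; rewrite lee_fin.
  apply: (@le_trans _ _ (\int[lebn]_y ((5 ^ n)%:R%:E * (k y)%:E))%E).
    apply: ge0_le_integral => //.
    - by move=> y _; apply: sume_ge0 => j _; rewrite lee_fin.
    - by apply: emeasurable_sum => j; exact/measurable_EFinP.
    - exact: measurable_funeM.
    - move=> y _; rewrite sumEFin lee_fin -mulr_sumr mulrC.
      by apply: ler_wpM2r => //; exact: cnt.
  rewrite ge0_integralZl//; last by move=> y _; rewrite lee_fin.
  by rewrite K1E -EFinM.
apply: (@le_trans _ _ (\int[lebn]_w (((5 ^ n)%:R * K1)%:E * (k w)%:E))%E).
  apply: ge0_le_integral => //.
  - by move=> w _; apply: sume_ge0 => j _; rewrite mule_ge0// lee_fin.
  - by apply: emeasurable_sum => j; apply: emeasurable_funM; [exact: mkE|exact: mpairk].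
  - exact: measurable_funeM.
  - move=> w _; rewrite [leRHS]muleC; apply: le_trans (lee_wpmul2l _ (inner_le w)); last by rewrite lee_fin.
    by rewrite ge0_sume_distrr.
rewrite ge0_integralZl//; last 2 first.
- by move=> y _; rewrite lee_fin.
- by rewrite lee_fin mulr_ge0.
by rewrite K1E -EFinM mulrA.
Qed.

Let mass_fin j : (mass j \is a fin_num)%E.
Proof.
rewrite ge0_fin_numE//; apply: (@le_lt_trans _ _ ((5 ^ n)%:R * (K1 * K1))%:E); last exact: ltry.
by have := @sum_mass_le [:: j] isT; rewrite big_seq1.
Qed.

(* For u in a small cube U and z in the unit cell of j, w + u - z stays within 1 of w - j. *)
Lemma kernel_majorant : exists (m : 'cV[int]_n -> R) (M : R),
  [/\ forall j, 0 <= m j, forall s, uniq s -> \sum_(j <- s) m j <= M & forall z, k z <= m (flv z)].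
Proof.
have rn0 : 0 < rho ^+ n by rewrite exprn_gt0.
(* Undoes the average over [u]: the kernel is at least [q] on a cube of volume [rho ^+ n]. *)
pose c : R := (q * rho ^+ n)^-1.
have c0 : 0 <= c by rewrite invr_ge0 mulr_ge0// ltW.
have fm0 j : 0 <= fine (mass j) by exact: fine_ge0.
exists (fun j => c * fine (mass j)), (c * ((5 ^ n)%:R * (K1 * K1))); split.
- by move=> j; rewrite mulr_ge0.
- move=> s us; rewrite -mulr_sumr; apply: ler_wpM2l => //.
  rewrite -lee_fin -sumEFin; apply: le_trans (sum_mass_le us).
  by apply: lee_sum => j _; rewrite fineK.
move=> z; set j := flv z.
have mC : measurable (@cube R n rho) by exact: measurable_cube.
have lC : lebn (@cube R n rho) = (rho ^+ n)%:E by exact: leb_cube.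
pose I (u : W) : R := \1_(@cube R n rho) u.
have I0 u : 0 <= I u by rewrite /I indicE.
have mI : measurable_fun setT I by exact: measurable_indic.
have mku : measurable_fun setT (fun q : W * W => I q.1 * (k q.2 * k (q.2 + (q.1 - z)))).
  apply: measurable_funM; first exact: (measurableT_comp mI measurable_fst).
  apply: measurable_funM; first exact: (measurableT_comp mk measurable_snd).
  apply: (measurableT_comp mk); apply: measurable_addv; first exact: measurable_snd.
  by apply: measurable_subv; [exact: measurable_fst|exact: measurable_cst].
have key : ((k z * (q) * rho ^+ n)%:E <= mass j)%E.
  have iI : (\int[lebn]_u (I u)%:E = (rho ^+ n)%:E)%E by rewrite integral_indic// setIT; exact: lC.
  apply: (@le_trans _ _ (\int[lebn]_u \int[lebn]_w (I u * (k w * k (w + (u - z))))%:E)%E).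
    have qq0 : 0 <= q by exact: ltW.
    rewrite EFinM -iI -ge0_integralZl//; last 3 first.
    - exact/measurable_EFinP.
    - by move=> u _; rewrite lee_fin.
    - by rewrite lee_fin mulr_ge0.
    apply: ge0_le_integral => //.
    - by move=> u _; rewrite -EFinM lee_fin; apply: mulr_ge0 => //; apply: mulr_ge0.
    - by apply: measurable_funeM; exact/measurable_EFinP.
    - apply: (measurable_fun_fubini_tonelli_F (fun q : W * W => (I q.1 * (k q.2 * k (q.2 + (q.1 - z))))%:E)).
        exact/measurable_EFinP.
      by move=> ?; rewrite lee_fin !mulr_ge0.
    - move=> u _; have [uC|uC] := boolP (u \in @cube R n rho); last first.
        by rewrite /I indicE (negPf uC) mule0; apply: integral_ge0 => w _; rewrite mul0r.
      rewrite /I indicE uC mule1.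
      under eq_integral => w _ do rewrite mul1r.
      apply: le_trans (kern_reproducing z u); rewrite lee_fin; apply: ler_wpM2l => //.
      apply: hrho; apply: cv_norm_le; first exact: ltW.
      by move=> i; have /andP[h1 h2] := set_mem uC i; rewrite ger0_norm// ltW.
  rewrite (fubini_tonelli (fun q : W * W => (I q.1 * (k q.2 * k (q.2 + (q.1 - z))))%:E)); last 2 first.
  - exact/measurable_EFinP.
  - by move=> ?; rewrite lee_fin !mulr_ge0.
  have mIk w : measurable_fun setT (fun u => I u * k (u + (w - z))).
    apply: measurable_funM; first exact: mI.
    by apply: (measurableT_comp mk); apply: measurable_addv => //; exact: measurable_cst.
  have sh w : (\int[lebn]_u (I u * (k w * k (w + (u - z))))%:E =
      (k w)%:E * \int[lebn]_u (I u * k (u + (w - z)))%:E)%E.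
    rewrite -ge0_integralZl//.
    - apply: eq_integral => u _; rewrite -EFinM; congr (_%:E).
      have -> : w + (u - z) = u + (w - z) by rewrite addrCA.
      exact: mulrCA.
    - exact/measurable_EFinP.
    - by move=> u _; rewrite lee_fin mulr_ge0.
    - by rewrite lee_fin.
  apply: ge0_le_integral => //.
  - by move=> w _; apply: integral_ge0 => u _; rewrite lee_fin !mulr_ge0.
  - apply: (measurable_fun_fubini_tonelli_G (fun q : W * W => (I q.1 * (k q.2 * k (q.2 + (q.1 - z))))%:E)).
      exact/measurable_EFinP.
    by move=> ?; rewrite lee_fin !mulr_ge0.
  - by apply: emeasurable_funM; [exact: mkE|exact: mpairk].
  - move=> w _; rewrite /= sh; apply: lee_wpmul2l; first by rewrite lee_fin.
    rewrite /pairk -(transports_shift (w - z) (f := fun y => (k y * near1 (y - w + iv j))%:E)); last 2 first.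
    + exact/measurable_EFinP.
    + by move=> y; rewrite lee_fin.
    apply: ge0_le_integral => //.
    + by move=> u _; rewrite lee_fin mulr_ge0.
    + exact/measurable_EFinP.
    + apply/measurable_EFinP; apply: (measurableT_comp (mpair1 j w)).
      by apply: measurable_addv => //; exact: measurable_cst.
    + move=> u _; rewrite lee_fin mulrC; apply: ler_wpM2l => //.
      rewrite /I indicE; have [uC|_] := boolP (u \in _); last exact: near1_ge0.
      rewrite near1T//; have -> : u + (w - z) - w + iv j = u - (z - iv j).
        by apply/colP => i; rewrite !mxE; ring.
      apply: cv_norm_lt => // i; have /andP[h1 h2] := set_mem uC i.
      have /andP[h3 h4] := flv_itv z i; rewrite -/j in h3 h4.
      have -> : (u - (z - iv j)) i ord0 = u i ord0 - (z - iv j) i ord0 by rewrite !mxE.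
      have rr := r1; move: h1 h2 h3 h4 rr; move: (u i ord0) ((z - iv j) i ord0) => a b *.
      by rewrite ltr_norml; apply/andP; split; lra.
have : k z * (q) * rho ^+ n <= fine (mass j) by rewrite -lee_fin fineK.
move=> h; have -> : k z = c * (k z * (q) * rho ^+ n).
  by rewrite /c -mulrA mulrC mulfK// gt_eqF// mulr_gt0.
exact: ler_wpM2l.
Qed.

End kernel_majorant.


(** * Majorants for windows with integrable kernel *)

Section majorants.
Variables (R : realType) (d : nat).
Local Notation S := (L2sys R d).
Local Notation n := (d + d)%N.
Local Notation lebn := (leb R n).
Local Notation W := 'cV[R]_n.
Variables (g : L2 R d).
Hypothesis g0 : 0 < nsq (g : S).
Local Notation iv := (@intv R n).

Let k (z : W) : R := normc (inner g (tfshift z g)).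

Let k0 z : 0 <= k z. Proof. exact: normc_ge0. Qed.

Let mk : measurable_fun setT k.
Proof. by apply: measurable_normc; exact: cmeas_stft. Qed.

(** [moyal_le] for [g], [pi(z) g] and the windows [g], [pi(u) g]; up to phases, both transforms are
    translates of the kernel. *)
Lemma kern_reproducing z u : ((k z * k u)%:E <= \int[lebn]_w (k w * k (w + (u - z)))%:E)%E.
Proof.
have := moyal_le g (tfL2 z g) g (tfL2 u g).
move=> h; apply: (le_trans h).
have e1 w : normc (inner g (tfshift w (tfL2 u g))) = k (w + u).
  exact: (tf_normc_comp (g : S) w u (g : S)).
have e2 w : normc (inner (tfL2 z g) (tfshift w (tfL2 u g))) = k (w + u - z).
  transitivity (normc (ip (tf z (g : S)) (tf (w + u) (g : S)))).
    exact: (tf_normc_comp (tf z (g : S)) w u (g : S)).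
  exact: tf_normc_shift.
by rewrite le_eqVlt; apply/orP; left; apply/eqP; apply: eq_integral => w _; rewrite e2 addrA.
Qed.

(** The kernel equals [nsq g] at 0. Where the shift moves [g] by at most [nsq g / 4] in squared
    norm, Cauchy-Schwarz loses at most half of this value. *)
Lemma kern_lower : exists2 rho : R, 0 < rho <= 1 & forall u, `|u| <= rho -> nsq (g : S) / 2 <= k u.
Proof.
have q0 : 0 < nsq (g : S) / 4 by rewrite divr_gt0.
have [r r0 hr] := @L2_tf_continuous R d (g : S) _ q0.
exists (Num.min 1 (r / 2)).
  by rewrite lt_min ltr01 divr_gt0//= ge_min lexx.
move=> u; rewrite le_min => /andP[_ ur].
have ul : `|u| < r by apply: (le_lt_trans ur); rewrite ltr_pdivrMr// mulr_natr mulr2n ltrDl.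
have h := hr _ ul; have cs := ip_cauchy_schwarz (g : S) (tf u (g : S) - (g : S)).
have tri : nsq (g : S) <= k u + normc (ip (g : S) (tf u (g : S) - (g : S))).
  have -> : nsq (g : S) = normc (ip (g : S) (g : S)).
    by rewrite ipff normc_real ger0_norm// ltW.
  have -> : ip (g : S) (g : S) = ip (g : S) (tf u (g : S)) - ip (g : S) (tf u (g : S) - (g : S)).
    by rewrite ipBr; ring.
  by apply: (le_trans (le_normcD _ _)); rewrite normcN.
have : normc (ip (g : S) (tf u (g : S) - (g : S))) <= nsq (g : S) / 2.
  rewrite -ler_sqr ?nnegrE ?normc_ge0 ?divr_ge0 ?(ltW g0)//.
  apply: (le_trans cs); apply: (@le_trans _ _ (nsq (g : S) * (nsq (g : S) / 4))).
    by apply: ler_wpM2l; exact: ltW.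
  by rewrite le_eqVlt; apply/orP; left; apply/eqP; field.
by move: tri; move: (normc _) => x; lra.
Qed.


Lemma M1_majorized : in_M1 g -> exists m M, majorized (g : S) m M.
Proof.
move=> gM1; have [rho /andP[r0 r1] hrho] := kern_lower.
have q0 : 0 < nsq (g : S) / 2 by rewrite divr_gt0.
have [m [M [m0 mM km]]] := kernel_majorant k0 mk kern_reproducing q0 r0 r1 hrho gM1.
by exists m, M.
Qed.

End majorants.

(** * Polynomial decay implies integrability *)

Section polynomial_decay.
Variable R : realType.
Local Notation mu := (@lebesgue_measure R).

(** The integrand is [(1 + |x|)^(-sigma)], written with [expR] and [ln]; on the half-line a power of
    [1 + x] is an antiderivative tending to 0. *)
Lemma integral_japanese (sigma : R) : 1 < sigma ->
  (\int[mu]_x (expR (- (sigma * ln (1 + `|x|))))%:E < +oo)%E.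
Proof.
move=> s1; have s0 : 0 < sigma - 1 by rewrite subr_gt0.
pose f (x : R) := expR (- (sigma * ln (1 + `|x|))).
have cf : continuous f.
  move=> x; apply: (continuous_comp (f := fun x => - (sigma * ln (1 + `|x|))) (g := @expR R)); last exact: continuous_expR.
  apply: cvgN; apply: cvgM; first exact: cvg_cst.
  have h : (fun x : R => 1 + `|x|) y @[y --> x] --> 1 + `|x|.
    by apply: cvgD; [exact: cvg_cst|exact: norm_continuous].
  by apply: (cvg_comp _ _ h); apply: continuous_ln; rewrite ltr_wpDr.
rewrite (ge0_symfun_integralT (f := f)) //; last 2 first.
- by move=> x; exact: expR_ge0.
- by move=> x /=; rewrite /f normrN.
rewrite (_ : [set x | 0 <= x] = `[0, +oo[%classic); last first.
  by apply/seteqP; split => x /=; rewrite in_itv /= andbT.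
pose F (x : R) := - expR (- ((sigma - 1) * ln (1 + x))) / (sigma - 1).
have dF (x : R) : 0 <= x -> is_derive x (1 : R) F (f x).
  move=> x0; have x1 : 0 < 1 + x by rewrite ltr_wpDr.
  have dl : is_derive x (1 : R) (fun x => ln (1 + x)) (1 + x)^-1.
    have h : is_derive (1 + x) (1 : R) (@ln R) (1 + x)^-1 by exact: is_derive1_ln.
    by apply: is_derive_eq; rewrite /GRing.scale /= add0r mulr1.
  apply: is_derive_eq; rewrite /GRing.scale /= /f (ger0_norm x0).
  have -> : expR (- (sigma * ln (1 + x))) = expR (- ((sigma - 1) * ln (1 + x))) * (1 + x)^-1.
    have E1 : (1 + x)^-1 = expR (- ln (1 + x)) by rewrite expRN lnK// posrE.
    by rewrite E1 -expRD; congr expR; ring.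
  move: (expR _) => E; field.
  by rewrite !gt_eqF.
rewrite (ge0_continuous_FTC2y (f := f) (F := F) (l := 0)).
- by rewrite -EFinB -EFinM ltry.
- by move=> x _; exact: expR_ge0.
- exact: continuous_subspaceT.
- rewrite -[X in _ --> X](mul0r (sigma - 1)^-1); apply: cvgMl.
  rewrite -[X in _ --> X]oppr0; apply: cvgN.
  apply: (@cvg_comp _ _ _ (fun x => (sigma - 1) * ln (1 + x)) (fun y => expR (- y)) (pinfty_nbhs R) (pinfty_nbhs R)); last exact: cvgr_expR.
  apply/cvgryPge => A; exists (expR (A / (sigma - 1))); split; first exact: num_real.
  move=> x Ax; rewrite mulrC -ler_pdivrMr// -(expRK (A / _)) ler_ln ?posrE ?expR_gt0//.
    by apply: ltW; apply: (lt_trans Ax); rewrite ltrDr.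
  by apply: (lt_trans (expR_gt0 (A / (sigma - 1)))); apply: (lt_trans Ax); rewrite ltrDr.
- by move=> x x0; have h := dF _ (ltW x0); exact: ex_derive.
- apply: cvg_at_right_filter; have h := dF 0 (lexx 0).
  by apply: differentiable_continuous; apply/derivable1_diffP; apply: ex_derive.
- move=> x; rewrite in_itv /= andbT => x0; have h := dF _ (ltW x0).
  by rewrite derive1E derive_val.
Qed.

Lemma coord_le_enorm n (z : 'cV[R]_n) i : `|z i ord0| <= enorm z.
Proof.
rewrite /enorm -sqrtr_sqr ler_wsqrtr// /dotv (bigD1 i)//= -expr2 lerDl.
by apply: sumr_ge0 => j _; rewrite -expr2 sqr_ge0.
Qed.

(** Every [1 + |z_i|] is at most [1 + |z|], so [(1 + |z|)^(-s)] is below the product over the [2d]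
    coordinates of [(1 + |z_i|)^(-s / 2d)], and [s / 2d > 1] makes each factor integrable. *)
Lemma Minfty_M1 d (s : R) (g : L2 R d) : (0 < d)%N -> (2 * d)%:R < s -> in_Minfty s g ->
  (\int[leb R (d + d)]_z (normc (inner g (tfshift z g)))%:E < +oo)%E.
Proof.
move=> d0 sd [C hC]; set n := (d + d)%N.
have nE : n%:R = (2 * d)%:R :> R by rewrite /n mul2n addnn.
have n0 : 0 < n%:R :> R by rewrite ltr0n /n addn_gt0 d0.
pose sigma := s / n%:R.
have s1 : 1 < sigma by rewrite ltr_pdivlMr// mul1r nE.
have s0 : 0 < s by apply: le_lt_trans sd; exact: ler0n.
pose w (x : R) := expR (- (sigma * ln (1 + `|x|))).
have C0 : 0 <= C.
  have := hC 0; rewrite /enorm /dotv big1; last by move=> i _; rewrite mxE mul0r.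
  rewrite sqrtr0 addr0 powR1 mulr1; apply: le_trans; exact: normc_ge0.
have mw : measurable_fun setT w.
  apply: (measurableT_comp (@measurable_expR R)); apply: measurableT_comp => //.
  apply: measurable_funM; first exact: measurable_cst.
  apply: (measurableT_comp (@measurable_ln R)); apply: measurable_funD; first exact: measurable_cst.
  exact: normr_measurable.
have w0 x : 0 <= w x by exact: expR_ge0.
have bound (z : 'cV[R]_n) : normc (inner g (tfshift z g)) <= C * \prod_i w (z i ord0).
  apply: (le_trans (hC z)); apply: ler_wpM2l => //.
  have e1 : 0 < 1 + enorm z by rewrite ltr_wpDr// sqrtr_ge0.
  rewrite /powR gt_eqF// /w -expR_sum ler_expR sumrN mulNr lerN2.
  apply: (@le_trans _ _ (\sum_(i < n) sigma * ln (1 + enorm z))).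
    apply: ler_sum => i _; apply: ler_wpM2l; first exact/ltW/(lt_trans ltr01).
    have p1 : 0 < 1 + `|z i ord0| by rewrite ltr_wpDr.
    by rewrite ler_ln// lerD2l coord_le_enorm.
  have ns : n%:R * sigma = s by rewrite /sigma mulrC divfK ?gt_eqF.
  by rewrite big_const_ord iter_addr addr0 -[leLHS]mulr_natl mulrA ns.
have mprod : measurable_fun setT (fun z : 'cV[R]_n => (\prod_i w (z i ord0))%:E).
  apply/measurable_EFinP; apply: measurable_prod => i _.
  by apply: (measurableT_comp mw); exact: measurable_coord.
apply: (@le_lt_trans _ _ (\int[leb R n]_z (C%:E * (\prod_i w (z i ord0))%:E))%E).
  apply: ge0_le_integral => //.
  - by move=> z _; rewrite lee_fin normc_ge0.
  - by apply: measurable_normcE; exact: cmeas_stft.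
  - exact: measurable_funeM.
  - by move=> z _; rewrite -EFinM lee_fin; exact: bound.
have iw : (\int[mu]_x (w x)%:E < +oo)%E by exact: integral_japanese.
have iw0 : (0 <= \int[mu]_x (w x)%:E)%E by apply: integral_ge0 => x _; rewrite lee_fin.
rewrite ge0_integralZl//; last by move=> z _; rewrite lee_fin prodr_ge0.
rewrite (ge0_integral_prod (w := fun=> w))//.
rewrite (eq_bigr (fun=> (fine (\int[mu]_x (w x)%:E))%:E)); last by move=> i _; rewrite fineK// ge0_fin_numE.
by rewrite prodEFin -EFinM ltry.
Qed.

End polynomial_decay.

(** * Orthonormal integer shifts of the indicator of the unit cube *)

Section unit_cube_vector.
Variables (R : realType) (d : nat).
Local Notation mu := (@lebesgue_measure R).
Local Notation lebd := (leb R d).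
Local Notation S := (L2sys R d).
Local Notation iv := (@intv R (d + d)).

Lemma cis_int (l : int) : cis (2 * pi * l%:~R) = 1 :> R[i].
Proof.
have c1 : cis (2 * pi) = 1 :> R[i].
  by rewrite /cis mulr_natl cos2pi sin2pi.
have cn (k : nat) : cis (2 * pi * k%:R) = 1 :> R[i].
  elim: k => [|k IH]; first by rewrite mulr0 cis0.
  have -> : 2 * pi * k.+1%:R = 2 * pi * k%:R + 2 * pi :> R by rewrite -[k.+1%:R]natr1 [LHS]mulrDr [X in _ + X]mulr1.
  by rewrite cisD IH c1 mul1r.
case: l => k; first exact: cn.
by rewrite NegzE mulrNz mulrN -conjc_cis cn conjc1.
Qed.

Lemma integral_unit_derive (f F : R -> R) : (forall s, is_derive s (1 : R) F (f s)) -> continuous f ->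
  F 1 = F 0 -> \int[mu]_s (f s * \1_(`[0, 1[%classic : set R) s) = 0.
Proof.
move=> dF cf F10.
have mf : measurable_fun setT f by exact: continuous_measurable_fun.
rewrite /Rintegral (_ : (\int[mu]_s (f s * \1_(`[0, 1[%classic : set R) s)%:E)%E = 0%E)//.
transitivity (\int[mu]_(s in `[0%R, 1%R[) (f s)%:E)%E.
  rewrite [RHS]integral_mkcond; apply: eq_integral => s _; rewrite patchE indicE.
  by case: ifP => h; rewrite ?mulr1 ?mulr0.
rewrite integral_itv_bndo_bndc; last first.
  by apply: measurable_funTS; exact/measurable_EFinP.
have cF (s : R) : {for s, continuous F}.
  by apply: differentiable_continuous; apply/derivable1_diffP; apply: ex_derive.
rewrite (continuous_FTC2 (F := F))//.
- by rewrite F10 subee.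
- exact: continuous_subspaceT.
- split.
  + by move=> s _; exact: ex_derive.
  + by apply: cvg_at_right_filter; exact: cF.
  + by apply: cvg_at_left_filter; exact: cF.
- by move=> s _; rewrite derive1E derive_val.
Qed.

Definition ucell (s : R) : R[i] := (\1_(`[0, 1[%classic : set R) s : R)%:C.

Lemma cint_cis_unit (l : int) : l != 0 -> cint mu (fun s => cis (2 * pi * l%:~R * s) * ucell s) = 0.
Proof.
move=> l0; set b := 2 * pi * l%:~R : R.
have b0 : b != 0 by rewrite !mulf_neq0 ?intr_eq0// gt_eqF// pi_gt0.
have [cb sb] : cos b = 1 /\ sin b = 0 by have := cis_int l; rewrite /cis => -[].
rewrite /cint; apply/eqP; rewrite eq_complex /=; apply/andP; split; apply/eqP.
- rewrite -[RHS](@integral_unit_derive (fun s => cos (b * s)) (fun s => sin (b * s) / b)).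
  + by congr fine; apply: eq_integral => s _; rewrite mulr0 subr0.
  + move=> s; apply: is_derive_eq; rewrite /GRing.scale /=.
    by rewrite mulr0 add0r mulr1 mulrCA mulVf ?mulr1.
  + exact: continuous_cosM.
  + by rewrite mulr1 mulr0 sin0 sb.
- rewrite -[RHS](@integral_unit_derive (fun s => sin (b * s)) (fun s => - cos (b * s) / b)).
  + by congr fine; apply: eq_integral => s _; rewrite mulr0 add0r.
  + move=> s; apply: is_derive_eq; rewrite /GRing.scale /=.
    by rewrite mulr0 add0r mulr1 opprK mulrCA mulVf ?mulr1 || (rewrite mulr0 add0r mulr1 mulNr opprK mulrCA mulVf ?mulr1).
  + move=> s; apply: continuous_comp; last exact: continuous_sin.
    by apply: cvgM; [exact: cvg_cst|exact: cvg_id].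
  + by rewrite mulr1 mulr0 cos0 cb.
Qed.

Definition ucube : set 'cV[R]_d := [set x | forall i, `[0, 1[%classic (x i ord0)].

Lemma measurable_ucube : measurable ucube.
Proof. by apply: (measurable_box (A := fun=> `[0, 1[%classic)) => i; exact: measurable_itv. Qed.

Lemma leb_ucube : lebd ucube = 1%E.
Proof.
rewrite (leb_box (A := fun=> `[0, 1[%classic)); last by move=> i; exact: measurable_itv.
by rewrite big1// => i _; rewrite lebesgue_measure_itv /= lte_fin ltr01 sube0.
Qed.

Lemma in_L2_ucube : in_L2 (ind ucube).
Proof. by apply: in_L2_ind; [exact: measurable_ucube|rewrite leb_ucube ltry]. Qed.

Definition unit_vector : S := toL2 in_L2_ucube.

Lemma ind_ucube x : ind ucube x = \prod_i ucell (x i ord0).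
Proof.
rewrite /ucell -real_complex_prod; congr (_%:C); rewrite indicE.
have [h|h] := boolP (x \in ucube).
  by rewrite big1// => i _; rewrite indicE mem_set//; exact: (set_mem h).
have [i hi] : exists i, ~ `[0, 1[%classic (x i ord0).
  by apply/existsNP => H; move/negP: h; apply; exact/mem_set.
by rewrite (bigD1 i)//= indicE memNset// mul0r.
Qed.

Lemma nsq_unit_vector : nsq unit_vector = 1.
Proof.
apply: EFin_inj; rewrite nsq_L2 -leb_ucube -sqL2_ind//; exact: measurable_ucube.
Qed.

(** The inner product factors over coordinates. A nonzero integer translation in some coordinate
    makes the supports disjoint; otherwise some nonzero integer frequency integrates to 0 over the
    unit interval. *)
Lemma unit_vector_ip0 (p : 'cV[int]_(d + d)) : p != 0 -> ip unit_vector (tf (iv p) unit_vector) = 0.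
Proof.
move=> p0; rewrite /= innerE.
pose F (i : 'I_d) (s : R) : R[i] := cis (2 * pi * (- p (rshift d i) ord0)%:~R * s) *
  (ucell s * ucell (s - (p (lshift d i) ord0)%:~R)).
have mu1 : cmeas (ucell : measurableTypeR R -> R[i]).
  by apply: cmeas_real; apply: measurable_indic; exact: measurable_itv.
have nu s : normc (ucell s) <= \1_(`[0, 1[%classic : set R) s by rewrite normc_real ger0_norm.
have Fi i : cintegrable mu (F i).
  apply: (@le_cintegrable _ _ R mu _ (fun s => (\1_(`[0, 1[%classic : set R) s)%:E)).
  - apply: cmeasM.
      by apply: cmeas_cis; apply: measurable_funM => //; exact: measurable_cst.
    apply: cmeasM => //.
    apply: (cmeas_comp (phi := fun s : measurableTypeR R => s - (p (lshift d i) ord0)%:~R)) => //.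
    by apply: measurable_funB => //; exact: measurable_cst.
  - by apply/measurable_EFinP; apply: measurable_indic; exact: measurable_itv.
  - move=> s; rewrite lee_fin !normcM normc_cis mul1r.
    apply: (@le_trans _ _ (\1_(`[0, 1[%classic : set R) s * 1)); last by rewrite mulr1.
    by apply: ler_pM; rewrite ?normc_ge0// (le_trans (nu _))// indicE lern1 leq_b1.
  - rewrite (@integral_indic _ _ R mu setT measurableT (`[0, 1[%classic : set (measurableTypeR R)) (measurable_itv _)).
    have h : (mu (`[0%R, 1%R[%classic : set R) < +oo)%E.
      by rewrite lebesgue_measure_itv /= lte_fin ltr01 sube0 ltry.
    by rewrite setIT; exact: h.
have FE (t : 'cV[R]_d) : ind ucube t * conjc (tfshift (iv p) (ind ucube) t) = \prod_i F i (t i ord0).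
  rewrite tfshiftE !ind_ucube.
  rewrite conjcM conjc_cis rmorph_prod mulrCA -big_split /= /dotv mulr_sumr -sumrN cis_sum -big_split.
  apply: eq_bigr => i _; rewrite /F /=; congr (_ * (_ * _)).
    by congr cis; rewrite !mxE intrN; ring.
  by rewrite /ucell !mxE; apply/eqP; rewrite eq_complex /= oppr0 !eqxx.
transitivity (cint lebd (fun t : 'cV[R]_d => \prod_i F i (t i ord0))).
  by congr cint; apply/funext => t; exact: FE.
rewrite cint_leb_prod//.
have [i hi] : exists i, p i ord0 != 0.
  apply: contrapT => /forallNP h; move/eqP: p0; apply; apply/colP => i; rewrite mxE.
  by have /negP := h i; rewrite negbK => /eqP.
suff [j hj] : exists j, cint mu (F j) = 0 by rewrite (bigD1 j)//= hj mul0r.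
have shifted j : p (lshift d j) ord0 != 0 -> cint mu (F j) = 0.
  move=> hj; rewrite (_ : F j = fun=> 0) ?cint_real0 //; last first.
    have z0 : (false%:R : R)%:C = 0 :> R[i] by [].
    apply/funext => s; rewrite /F /ucell !indicE.
    case h1 : (s \in _); last by rewrite z0 mul0r mulr0.
    case h2 : (_ \in _); last by rewrite z0 !mulr0.
    move: (set_mem h1) (set_mem h2) hj; rewrite /= !in_itv /= => /andP[a1 a2] /andP[b1 b2].
    have : (-1 < p (lshift d j) ord0)%R by rewrite -(ltr_int R); move: a1 a2 b1 b2; lra.
    have : (p (lshift d j) ord0 < 1)%R by rewrite -(ltr_int R); move: a1 a2 b1 b2; lra.
    by move: (p _ _) => x; lia.
  rewrite (_ : (fun=> 0) = (fun=> (0 : R)%:C))// cint_real (_ : integral _ _ _ = 0%E)//.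
  exact: integral0_eq.
case: (split_ordP i) hi => j -> hj; exists j; first exact: shifted.
have [e|] := eqVneq (p (lshift d j) ord0) 0; last exact: shifted.
rewrite -[RHS](@cint_cis_unit (- p (rshift d j) ord0)) ?oppr_eq0//.
congr cint; apply/funext => s; rewrite /F e subr0; congr (_ * _).
by rewrite /ucell -rmorphM /= indicE; case: (_ \in _); rewrite ?mulr1 ?mulr0.
Qed.

Lemma unit_vector_orthonormal (p q : 'cV[int]_(d + d)) :
  ip (tf (iv p) unit_vector) (tf (iv q) unit_vector) = (p == q)%:R.
Proof.
have [->|pq] := eqVneq p q; first by rewrite tf_iso ipff nsq_unit_vector.
change (ip (tf (iv p) unit_vector) (tf (iv q) unit_vector) = 0).
apply: eq0_normc; rewrite tf_normc_shift -intvB unit_vector_ip0 ?normc0//.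
by rewrite subr_eq0 eq_sym.
Qed.

End unit_cube_vector.

(** * Matrix norms *)

Section matrix_norms.
Variables (R : realType) (m n : nat).
Implicit Types A : 'M[R]_(m, n).

Lemma ler_mx_norm A (r : R) : 0 <= r -> (forall i j, `|A i j| <= r) -> `|A| <= r.
Proof.
move=> r0 h; rewrite [`|A|]mx_normrE; apply/bigmax_leP; by split=> //= -[i j] _; exact: h.
Qed.

Lemma ltr_mx_norm A (r : R) : 0 < r -> (forall i j, `|A i j| < r) -> `|A| < r.
Proof.
move=> r0 h; rewrite [`|A|]mx_normrE; apply/bigmax_ltP; by split=> //= -[i j] _; exact: h.
Qed.

End matrix_norms.

(** Each entry is a coordinate of the image of a unit vector. Since [sup] has a default value on
    unbounded sets, the image of the unit ball is first shown to be bounded. *)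
Lemma entry_le_opnorm (R : realType) (n : nat) (A : 'M[R]_n) : `|A| <= opnorm A.
Proof.
have en0 k (y : 'cV[R]_k) : 0 <= enorm y by exact: sqrtr_ge0.
have ub : has_ubound [set enorm (A *m x) | x in [set x | enorm x <= 1]].
  exists (Num.sqrt (n%:R * ((n%:R * `|A|) * (n%:R * `|A|)))) => _ [x /= x1 <-].
  rewrite /enorm; apply: ler_wsqrtr; apply: (le_trans (ler_norm _)).
  apply: (le_trans (dotv_le _ _)); apply: ler_wpM2l => //.
  have xn : `|x| <= 1.
    by apply: cv_norm_le => // i; apply: le_trans x1; exact: coord_le_enorm.
  have h : `|A *m x| <= n%:R * `|A|.
    apply: (le_trans (mulmx_norm _ _)); rewrite -[leRHS]mulr1; apply: ler_wpM2l => //.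
  by apply: ler_pM.
have ej j : enorm (delta_mx j ord0 : 'cV[R]_n) <= 1.
  rewrite /enorm /dotv (bigD1 j)//= big1 ?addr0 => [|i ij]; last by rewrite !mxE (negPf ij) mul0r.
  by rewrite !mxE !eqxx mulr1 sqrtr1.
have le_op x : enorm x <= 1 -> enorm (A *m x) <= opnorm A.
  by move=> x1; apply: sup_ubound => //; exists x.
have op0 : 0 <= opnorm A.
  apply: le_trans (le_op 0 _); first exact: en0.
  by rewrite /enorm /dotv big1 ?sqrtr0// => i _; rewrite mxE mul0r.
apply: ler_mx_norm => // i j.
apply: le_trans (le_op _ (ej j)); apply: le_trans (coord_le_enorm _ i).
by rewrite -colE mxE.
Qed.

(** * Gabor frames and the finite lower inequality *)

Section frames.
Variables (R : realType) (d : nat).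
Local Notation n := (d + d)%N.
Local Notation S := (L2sys R d).
Local Notation iv := (@intv R n).
Variables (g : L2 R d) (m : 'cV[int]_n -> R) (M : R).
Hypothesis gm : majorized (g : S) m M.

Lemma esum_lattice (A : 'M[R]_n) (a : 'cV[R]_n -> \bar R) : A \in unitmx ->
  (\esum_(z in lattice A) a z = \esum_(k in [set: 'cV[int]_n]) a (A *m iv k))%E.
Proof.
move=> uA; apply: (reindex_esum setT (lattice A) (fun k => A *m iv k)); split.
- by move=> k _; exists k.
- move=> k l _ _ /(congr1 (mulmx (invmx A))); rewrite !mulKmx//; exact: intv_inj.
- by move=> _ [k _ <-]; exists k.
Qed.

Lemma esum_le_finite (T : choiceType) (a : T -> R) (c : R) :
  (forall s, uniq s -> \sum_(k <- s) a k <= c) ->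
  (\esum_(k in [set: T]) (a k)%:E <= c%:E)%E.
Proof.
move=> h; rewrite /esum; apply: ge_ereal_sup => _ [X [finX _] <-].
rewrite fsbig_finite//= sumEFin lee_fin; apply: h; exact: finmap.fset_uniq.
Qed.

Lemma finite_le_esum (T : choiceType) (a : T -> R) s : uniq s ->
  ((\sum_(k <- s) a k)%:E <= \esum_(k in [set: T]) (a k)%:E)%E.
Proof.
move=> us; apply: esum_ge; exists [set` s]; first by split=> //; exact: finite_seq.
by rewrite -fsbig_seq// sumEFin.
Qed.

Lemma sqL2_in (f : 'cV[R]_d -> R[i]) (fL : in_L2 f) :
  (L2norm f ^+ 2 = (nsq (toL2 fL : S))%:E)%E.
Proof. by rewrite sqr_L2norm nsq_L2. Qed.

(** Half of a lower frame bound is exceeded by some finite partial sum, except at norm 0, where the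
    empty sum does. Conversely the upper bound comes from [lattice_bessel], increased by 1 to be
    positive. *)
Lemma gabor_frameP (A : 'M[R]_n) : A \in unitmx ->
  gabor_frame g (lattice A) <-> exists2 a : R, 0 < a & lower_frame (g : S) A a.
Proof.
move=> uA; split=> [[a [B [a0 B0 h]]]|[a a0 h]].
  exists (a / 2); first by rewrite divr_gt0.
  move=> f; have /andP[+ _] := h f (L2P f).
  rewrite (sqL2_in (L2P f)) (_ : toL2 (L2P f) = f); last exact: L2_ext.
  rewrite esum_lattice// => hf.
  have n0 : 0 <= nsq f by exact: ip_ge0.
  have [nf|nf] := eqVneq (nsq f) 0.
    by exists [::] => //; rewrite nf mulr0 big_nil.
  have np : 0 < nsq f by rewrite lt_def nf.
  apply: contrapT => H.
  have : (\esum_(k in [set: 'cV[int]_n]) (normc (inner f (tfshift (A *m iv k) g)) ^+ 2)%:E <=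
      (a / 2 * nsq f)%:E)%E.
    apply: esum_le_finite => s us; rewrite leNgt; apply/negP => hs; apply: H.
    by exists s => //; exact: ltW.
  move=> /(le_trans hf); rewrite -EFinM lee_fin ler_pM2r//.
  by move: a0; lra.
have [N N0 sA] := unit_spaced uA.
exists a, ((N.*2.+1 ^ n)%:R * M + 1); split=> //.
  by rewrite ltr_wpDl// mulr_ge0//; exact: (majorant_ge0 gm).
move=> f fL; rewrite (sqL2_in fL) esum_lattice//; set fS := toL2 fL.
have n0 : 0 <= nsq (fS : S) by exact: ip_ge0.
apply/andP; split.
  have [s us hs] := h fS; apply: le_trans (finite_le_esum _ us); rewrite -EFinM lee_fin; exact: hs.
rewrite -EFinM; apply: esum_le_finite => s us.
apply: (le_trans (lattice_bessel gm (fS : S) sA us)).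
by apply: ler_wpM2r => //; rewrite lerDl.
Qed.

End frames.

(** * Separable lattices as block-diagonal matrices *)

Section separable.
Variables (R : realType) (d : nat).
Implicit Types alpha beta : R.

Definition sep_mx alpha beta : 'M[R]_(d + d) := block_mx alpha%:M 0 0 beta%:M.

Lemma separable_latticeE alpha beta : separable_lattice alpha beta = lattice (sep_mx alpha beta).
Proof.
have E (k l : 'cV[int]_d) : sep_mx alpha beta *m map_mx intr (col_mx k l) =
    col_mx (alpha *: map_mx intr k) (beta *: map_mx intr l).
  by rewrite map_col_mx /sep_mx mul_block_col !mul0mx addr0 add0r !mul_scalar_mx.
apply/seteqP; split => z.
  by move=> [k [l ->]]; exists (col_mx k l) => //; rewrite E.
by move=> [k _ <-]; exists (usubmx k), (dsubmx k); rewrite -E vsubmxK.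
Qed.

Lemma det_sep_mx alpha beta : \det (sep_mx alpha beta) = (alpha * beta) ^+ d.
Proof. by rewrite det_ublock !det_scalar exprMn. Qed.

Lemma sep_mx_unit alpha beta : 0 < alpha -> 0 < beta -> sep_mx alpha beta \in unitmx.
Proof. by move=> a0 b0; rewrite unitmxE det_sep_mx unitfE expf_neq0// mulf_neq0// gt_eqF. Qed.

Lemma sep_mx_norm (r a b : R) : 0 < r -> `|a| < r -> `|b| < r -> `|sep_mx a b| < r.
Proof.
move=> r0 ar br; apply: ltr_mx_norm => // i j.
case: (split_ordP i) => i' ->; case: (split_ordP j) => j' ->;
  rewrite ?(block_mxEul, block_mxEur, block_mxEdl, block_mxEdr) ?mxE ?normr0//.
- by case: (_ == _); rewrite ?mulr1n ?mulr0n ?normr0.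
- by case: (_ == _); rewrite ?mulr1n ?mulr0n ?normr0.
Qed.

Lemma sep_mxB a b a' b' : sep_mx a b - sep_mx a' b' = sep_mx (a - a') (b - b').
Proof.
by rewrite /sep_mx opp_block_mx add_block_mx !oppr0 !addr0 !raddfB.
Qed.

End separable.

(** * The frame sets *)

Section frame_sets.
Variables (R : realType) (d : nat).
Local Notation n := (d + d)%N.
Local Notation S := (L2sys R d).
Variables (g : L2 R d) (m : 'cV[int]_n -> R) (M : R).
Hypothesis d0 : (0 < d)%N.
Hypothesis gm : majorized (g : S) m M.
Hypothesis gt : near_tight (g : S).

Let gc : tf_continuous (g : S). Proof. exact: L2_tf_continuous. Qed.

Let n0 : (0 < n)%N. Proof. by rewrite addn_gt0 d0. Qed.

Lemma gabor_frame_open (A : 'M[R]_n) : A \in unitmx -> gabor_frame g (lattice A) ->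
  exists2 dl : R, 0 < dl & forall A', `|A' - A| < dl -> A' \in unitmx /\ gabor_frame g (lattice A').
Proof.
move=> uA /(gabor_frameP gm uA)[a a0 fA].
have [dl dl0 h] := lower_frame_open gm gc gt uA a0 fA.
exists dl => // A' /h[uA' fA']; split=> //.
by apply/(gabor_frameP gm uA'); have [a' a'0 fa'] := fA'; exists a'.
Qed.

Lemma gabor_frame_det (A : 'M[R]_n) : A \in unitmx -> gabor_frame g (lattice A) -> `|\det A| < 1.
Proof.
move=> uA /(gabor_frameP gm uA)[a a0 fA].
exact: (lower_frame_det gm gc (@unit_vector_orthonormal R d) gt n0 uA a0 fA).
Qed.

Lemma gabor_frame_small : exists2 dl : R, 0 < dl &
  forall A : 'M[R]_n, A \in unitmx -> `|A| < dl -> gabor_frame g (lattice A).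
Proof.
have [dl dl0 h] := lower_frame_small gm gc gt.
by exists dl => // A uA Al; apply/(gabor_frameP gm uA); have [a a0 fa] := h A uA Al; exists a.
Qed.

Lemma frame_set_full_open : open_lattices (frame_set_full g).
Proof.
rewrite /open_lattices openE => A [uA [_ fA]]; rewrite /interior.
have [dl dl0 h] := gabor_frame_open uA fA.
rewrite -nbhs_ballE; exists dl => //= A' AA'.
have [uA' fA'] : A' \in unitmx /\ gabor_frame g (lattice A').
  apply: h; apply: ltr_mx_norm => // i j; rewrite !mxE distrC.
  by have [_ AA''] := AA'; exact: (AA'' i j).
by split=> //; split=> //; exists A'.
Qed.

Lemma frame_set_full_vol : frame_set_full g `<=` [set L | is_lattice L /\ vol L < 1].
Proof.
move=> L [[A uA ->] fA]; split; first by exists A.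
by rewrite vol_lattice//; exact: gabor_frame_det.
Qed.

(** [sep_mx] depends on its parameters without increasing distances, so openness among matrices
    pulls back; a radius of at most [a] and [b] keeps both parameters positive. *)
Lemma frame_set_open : open (frame_set g).
Proof.
rewrite openE => -[a b] [/= a0 b0]; rewrite separable_latticeE => fA; rewrite /interior.
have [dl dl0 h] := gabor_frame_open (sep_mx_unit d a0 b0) fA.
pose r := Num.min dl (Num.min a b).
have r0 : 0 < r by rewrite !lt_min dl0 a0.
rewrite -nbhs_ballE; exists r => //= -[a' b'] [/= ha hb].
have {}ha : `|a - a'| < r by exact: ha.
have {}hb : `|b - b'| < r by exact: hb.
move: (ha) (hb); rewrite /r !lt_min => /and3P[ha1 ha2 _] /and3P[hb1 _ hb2].
have a'0 : 0 < a' by move: (ler_norm (a - a')) ha2; lra.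
have b'0 : 0 < b' by move: (ler_norm (b - b')) hb2; lra.
split=> //=; rewrite separable_latticeE.
have [] // := h (sep_mx d a' b').
by rewrite sep_mxB; apply: sep_mx_norm => //; rewrite distrC.
Qed.

Lemma frame_set_lt1 : frame_set g `<=` [set p | [/\ 0 < p.1, 0 < p.2 & p.1 * p.2 < 1]].
Proof.
move=> [a b] [/= a0 b0]; rewrite separable_latticeE => /(gabor_frame_det (sep_mx_unit d a0 b0)).
rewrite det_sep_mx ger0_norm ?exprn_ge0 ?mulr_ge0 ?ltW// => h; split=> //.
rewrite ltNge; apply/negP => ab; move: h; rewrite ltNge => /negP; apply.
exact: exprn_ege1.
Qed.

End frame_sets.

(** If the integral of the square vanishes, the function vanishes almost everywhere; this is where
    [g] is non-zero as a class. *)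
Lemma nsq_gt0 (R : realType) (d : nat) (g : L2 R d) :
  ~ {ae leb R d, forall t, g t = 0} -> 0 < nsq (g : L2sys R d).
Proof.
move=> gne; rewrite lt_def; apply/andP; split; last exact: ip_ge0.
apply/eqP => g0; apply: gne.
have mg : measurable_fun setT (fun t => (normc (g t) ^+ 2)%:E : \bar R).
  by apply: measurable_sqr_normc; apply: cmeas_L2; exact: L2P.
have := nsq_L2 g; rewrite g0 /sqL2 => i0.
have [+ _] := @ae_eq_integral_abs _ _ R (leb R d) setT measurableT _ mg.
have -> : (\int[leb R d]_t `|(normc (g t) ^+ 2)%:E| = 0)%E.
  rewrite -[RHS]/(0%:E) i0; apply: eq_integral => t _; by rewrite gee0_abs// lee_fin sqr_ge0.
move=> /(_ erefl); apply: filterS => t /(_ I)[] /eqP; rewrite sqrf_eq0 => /eqP.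
exact: eq0_normc.
Qed.

Theorem theorem5p6 (R : realType) (d : nat) (d_gt0 : (0 < d)%N)
  (g : 'cV[R]_d -> R[i]) (g_L2 : in_L2 g)
  (g_neq0 : ~ {ae leb R d, forall t, g t = 0})
  (g_class : (exists2 s : R, (2 * d)%:R < s & in_Minfty s g) \/ in_M1 g) :
  [/\ open_lattices (frame_set_full g),
      frame_set_full g `<=` [set L | is_lattice L /\ vol L < 1] &
      exists2 delta0 : R, 0 < delta0 &
        forall A : 'M[R]_(d + d), A \in unitmx -> opnorm A < delta0 ->
          frame_set_full g (lattice A)] /\
  [/\ open (frame_set g),
      frame_set g `<=` [set p | [/\ 0 < p.1, 0 < p.2 & p.1 * p.2 < 1]] &
      exists2 delta0 : R, 0 < delta0 &
        forall alpha beta : R, 0 < alpha < delta0 -> 0 < beta < delta0 ->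
          frame_set g (alpha, beta)].
Proof.
pose gL : L2 R d := toL2 g_L2.
have gp : 0 < nsq (gL : L2sys R d) by exact: nsq_gt0.
(* Both window classes are reduced to the integrable one. *)
have gM1 : in_M1 gL by case: g_class => // -[s sd gs]; exact: (Minfty_M1 (g := gL) d_gt0 sd gs).
have [m [M gm]] := M1_majorized gp gM1.
have gt := L2_near_tight gm gp.
have [dl dl0 small] := gabor_frame_small gm gt.
split; split.
- exact: (frame_set_full_open gm gt).
- by move=> L /(frame_set_full_vol d_gt0 gm gt)[].
- exists dl => // A uA Al; split; first by exists A.
  by apply: small => //; apply: le_lt_trans Al; exact: entry_le_opnorm.
- exact: (frame_set_open gm gt).
- exact: (frame_set_lt1 d_gt0 gm gt).
- exists dl => // a b /andP[a0 al] /andP[b0 bl]; split=> //=; rewrite separable_latticeE.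
  apply: small; first exact: sep_mx_unit.
  by apply: sep_mx_norm => //; rewrite ger0_norm// ltW.
Qed.
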